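(* Let $k\ge2$ be an integer and, for $\varepsilon>0$, let $$F_\varepsilon(u)=\int_{(0,1)}\big(f_\varepsilon(u')+\varepsilon^{2k-1}(u^{(k)})^2\big)\,dt,\qquad u\in H^k(0,1),\qquad f_\varepsilon(z)=\min\Big\{z^2,\frac1\varepsilon\Big\}.$$ Then, as $\varepsilon\to0$, the functionals $F_\varepsilon$ $\Gamma$-converge, both with respect to the convergence in measure and with respect to the $L^1(0,1)$-convergence, to the functional $$F(u)=\int_{(0,1)}(u')^2\,dt+m_k\sum_{t\in S(u)}|u(t+)-u(t-)|^{\frac1k}$$ with domain $SBV_2(0,1)$, where the constant $m_k$ is strictly positive and is defined by $$m_k=\inf_{T>0}\min\Big\{T+\int_{-T/2}^{T/2}(v^{(k)})^2\,dt:\ v\in H^k\big(-\tfrac T2,\tfrac T2\big),\ v\big(\pm\tfrac T2\big)=\pm\tfrac12,\ v^{(\ell)}\big(\pm\tfrac T2\big)=0\text{ for all }\ell\in\{1,\dots,k-1\}\Big\}.$$ Furthermore, the functionals are equicoercive, in the sense that if $\sup_\varepsilon F_\varepsilon(u_\varepsilon)<+\infty$ then, up to addition of constants (possibly depending on $\varepsilon$) and up to subsequences, there exists $u\in SBV_2(0,1)$ such that $u_\varepsilon$ tends to $u$ in measure as $\varepsilon\to0$.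
   Context: $SBV_2(0,1)$ is the space of functions $u\in BV(0,1)$ whose distributional derivative is a measure of the form $Du=u'\mathcal L^1+\sum_{t\in S(u)}(u(t+)-u(t-))\delta_t$ with $u'\in L^2(0,1)$; here $u'$ is the approximate gradient of $u$, $S(u)$ the set of jump points of $u$, and $u(t\pm)$ the right-hand and left-hand limits at $t$. Functionals are understood to take the value $+\infty$ outside their stated domain ($H^k(0,1)$ for $F_\varepsilon$, $SBV_2(0,1)$ for $F$; $F$ may also be $+\infty$ at some points of $SBV_2(0,1)$). *)

(* Defs.v *)
(* A function on an interval ]a, b[ is represented by a
   total function R -> R of which only the values on ]a, b[ matter, and these
   only up to null sets.  Measurable means Borel measurable, which loses
   nothing up to almost everywhere equality. *)
From mathcomp Require Import all_boot all_order all_algebra.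
From mathcomp Require Import all_classical all_reals all_analysis.

Set Implicit Arguments.
Unset Strict Implicit.
Unset Printing Implicit Defensive.

Import Order.TTheory GRing.Theory Num.Theory.
Import numFieldNormedType.Exports.

Local Open Scope classical_set_scope.
Local Open Scope ring_scope.

Local Notation mu := lebesgue_measure.
Local Notation I01 := (`]0%R, 1%R[%classic).

Definition L1 (R : realType) (a b : R) (u : R -> R) : Prop :=
  mu.-integrable `]a, b[ (EFin \o u).

Definition L2 (R : realType) (a b : R) (u : R -> R) : Prop :=
  measurable_fun `]a, b[ u /\
  mu.-integrable `]a, b[ (EFin \o (fun x => u x ^+ 2)).

(* The space C^1_c(]a, b[). *)
Definition test_function (R : realType) (a b : R) (phi : R -> R) : Prop :=
  [/\ forall x, derivable phi x 1,
      continuous (derive1 phi) &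
      exists c d : R, [/\ a < c, d < b &
        forall x, x \notin `[c, d] -> phi x = 0]].

Definition weak_derivative (R : realType) (a b : R) (u g : R -> R) : Prop :=
  locally_integrable `]a, b[ g /\
  forall phi, test_function a b phi ->
    \int[mu]_(x in `]a, b[) (u x * derive1 phi x) =
    - \int[mu]_(x in `]a, b[) (g x * phi x).

(* H^k(a, b), by induction: u is in H^k.+1 when u is in L^2 and has a weak
   derivative in H^k. *)
Fixpoint Hk (R : realType) (a b : R) (k : nat) (u : R -> R) : Prop :=
  match k with
  | 0 => L2 a b u
  | k'.+1 => L2 a b u /\ exists2 g, weak_derivative a b u g & Hk a b k' g
  end.

Definition wderiv (R : realType) (a b : R) (u : R -> R) : R -> R :=
  xget (fun=> 0) [set g | weak_derivative a b u g].

Definition wderivn (R : realType) (a b : R) (l : nat) (u : R -> R) : R -> R :=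
  iter l (wderiv a b) u.

(* The continuous representative of f takes the value y at x, where x may be
   one of the endpoints a and b. *)
Definition has_value (R : realType) (a b : R) (f : R -> R) (x y : R) : Prop :=
  exists w : R -> R,
    [/\ {within `[a, b], continuous w},
        {ae mu, forall t, t \in `]a, b[ -> w t = f t} &
        w x = y].

Definition cell_admissible (R : realType) (k : nat) (T : R) (v : R -> R)
    : Prop :=
  let a := - (T / 2) in let b := T / 2 in
  [/\ Hk a b k v,
      has_value a b v a (- (1 / 2)), has_value a b v b (1 / 2) &
      forall l, (1 <= l <= k.-1)%N ->
        has_value a b (wderivn a b l v) a 0 /\
        has_value a b (wderivn a b l v) b 0].

Definition cell_energy (R : realType) (k : nat) (T : R) (v : R -> R) : R :=
  T + \int[mu]_(t in `]- (T / 2), T / 2[)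
        (wderivn (- (T / 2)) (T / 2) k v t ^+ 2).

(* The minimum over v, written as an infimum; that it is attained is to be
   asserted separately. *)
Definition cell_min (R : realType) (k : nat) (T : R) : R :=
  inf [set cell_energy k T v | v in [set v | cell_admissible k T v]].

Definition m_ (R : realType) (k : nat) : R :=
  inf [set cell_min k T | T in [set T : R | 0 < T]].

Definition f_eps (R : realType) (eps z : R) : R := Num.min (z ^+ 2) (1 / eps).

Definition F_eps (R : realType) (k : nat) (eps : R) (u : R -> R) : \bar R :=
  if `[< Hk 0 1 k u >] then
    (\int[mu]_(t in I01)
       (f_eps eps (wderiv 0 1 u t)
        + eps ^+ (2 * k - 1) * wderivn 0 1 k u t ^+ 2)%:E)%E
  else +oo%E.

(* The one-sided limits are essential limits, so that they depend only on the
   almost everywhere class of u. *)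
Definition is_right_limit (R : realType) (u : R -> R) (t l : R) : Prop :=
  forall e : R, 0 < e -> exists2 d : R, 0 < d &
    {ae mu, forall x, x \in `]t, t + d[ -> `|u x - l| < e}.

Definition is_left_limit (R : realType) (u : R -> R) (t l : R) : Prop :=
  forall e : R, 0 < e -> exists2 d : R, 0 < d &
    {ae mu, forall x, x \in `]t - d, t[ -> `|u x - l| < e}.

Definition right_limit (R : realType) (u : R -> R) (t : R) : R :=
  xget 0 [set l | is_right_limit u t l].

Definition left_limit (R : realType) (u : R -> R) (t : R) : R :=
  xget 0 [set l | is_left_limit u t l].

Definition jump_set (R : realType) (u : R -> R) : set R :=
  [set t | I01 t /\
           exists l r, [/\ is_left_limit u t l, is_right_limit u t r & l != r]].

Definition jump (R : realType) (u : R -> R) (t : R) : R :=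
  right_limit u t - left_limit u t.

(* z is the approximate limit of (u s - u t) / (s - t) as s tends to t. *)
Definition is_approx_derivative (R : realType) (u : R -> R) (t z : R) : Prop :=
  forall e : R, 0 < e ->
    (fine (mu (`]t - r, t + r[ `&`
       [set s | e * `|s - t| < `|u s - u t - z * (s - t)|])) / (2 * r))
    @[r --> 0^'+] --> (0 : R).

Definition is_approx_gradient (R : realType) (u g : R -> R) : Prop :=
  measurable_fun (I01 : set R) g /\
  {ae mu, forall t, I01 t -> is_approx_derivative u t (g t)}.

Definition approx_gradient (R : realType) (u : R -> R) : R -> R :=
  xget (fun=> 0) [set g | is_approx_gradient u g].

(* Du = nu on ]0, 1[.  The integral with respect to the finite signed measure
   nu is computed from a decomposition nu = nu_p - nu_n into finite measures, on
   which it does not depend. *)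
Definition distributional_derivative (R : realType) (u : R -> R)
    (nu : {charge set (measurableTypeR R) -> \bar R}) : Prop :=
  exists nu_p nu_n : {finite_measure set (measurableTypeR R) -> \bar R},
    (forall A, measurable A -> nu A = (nu_p A - nu_n A)%E) /\
    forall phi, test_function 0 1 phi ->
      \int[mu]_(x in I01) (u x * derive1 phi x) =
      - (\int[nu_p]_(x in I01) phi x - \int[nu_n]_(x in I01) phi x).

(* The conditions that u is in L^1(0, 1) and that Du is a finite signed measure
   express that u is in BV(0, 1). *)
Definition SBV2 (R : realType) (u : R -> R) : Prop :=
  L1 0 1 u /\
  exists nu : {charge set (measurableTypeR R) -> \bar R},
    [/\ distributional_derivative u nu,
        is_approx_gradient u (approx_gradient u),
        L2 0 1 (approx_gradient u),
        summable (jump_set u) (fun t => (jump u t)%:E) &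
        forall A : set (measurableTypeR R), measurable A -> A `<=` I01 ->
          nu A = (\int[mu]_(x in A) (approx_gradient u x)%:E
                  + (\esum_(t in jump_set u `&` A) (Num.max (jump u t) 0)%:E
                     - \esum_(t in jump_set u `&` A)
                         (Num.max (- jump u t) 0)%:E))%E].

Definition F_lim (R : realType) (k : nat) (u : R -> R) : \bar R :=
  if `[< SBV2 u >] then
    (\int[mu]_(t in I01) (approx_gradient u t ^+ 2)%:E
     + (m_ R k)%:E * \esum_(t in jump_set u) (`|jump u t| `^ (1 / k%:R))%:E)%E
  else +oo%E.

Definition cvg_in_measure (R : realType) (v : nat -> R -> R) (u : R -> R)
    : Prop :=
  forall d : R, 0 < d ->
    mu (I01 `&` [set x | d < `|v n x - u x|]) @[n --> \oo] --> (0 : \bar R)%E.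

Definition cvg_in_L1 (R : realType) (v : nat -> R -> R) (u : R -> R) : Prop :=
  (\int[mu]_(x in I01) (`|v n x - u x|)%:E)%E @[n --> \oo]
    --> (0 : \bar R)%E.

(* Both convergences are metrizable, hence the sequential definition.  The limit
   eps -> 0 is along arbitrary positive sequences converging to 0. *)
Definition gamma_converges (R : realType) (X : set (R -> R))
    (cv : (nat -> R -> R) -> (R -> R) -> Prop)
    (Fe : R -> (R -> R) -> \bar R) (F : (R -> R) -> \bar R) : Prop :=
  forall eps : nat -> R, (forall n, 0 < eps n) -> eps n @[n --> \oo] --> (0 : R) ->
  forall u, X u ->
    (forall v : nat -> R -> R, (forall n, X (v n)) -> cv v u ->
       (F u <= limn_einf (fun n => Fe (eps n) (v n)))%E) /\
    (exists v : nat -> R -> R, [/\ forall n, X (v n), cv v u &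
       (limn_esup (fun n => Fe (eps n) (v n)) <= F u)%E]).

Definition equicoercive (R : realType) (Fe : R -> (R -> R) -> \bar R) : Prop :=
  forall u : R -> R -> R,
    (ereal_sup [set Fe eps (u eps) | eps in [set e : R | (0 < e)%R]] < +oo)%E ->
  exists c : R -> R,
  forall eps : nat -> R, (forall n, 0 < eps n) -> eps n @[n --> \oo] --> (0 : R) ->
  exists phi : nat -> nat, {homo phi : m n / (m < n)%N} /\
  exists u0 : R -> R, SBV2 u0 /\
    cvg_in_measure (fun n x => u (eps (phi n)) x + c (eps (phi n))) u0.

(* Main.v *)
(* Write s for the square root of epsilon, and call a point steep for u when |u'| > 1/s,
   that is where the truncation is active; the steep set has measure at most s^2 times
   the energy. Cut ]0, 1[ into cells of length of order s^2. In a cell that is not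
   almost entirely steep, Rolle's theorem and interpolation bound u', ..., u^(k-1), so
   that a maximal run of steep cells starts and ends with almost vanishing derivatives
   and is a competitor for the cell problem. Integration by parts against the k-th
   derivative of the optimal profile bounds the jump across the run: it is at most l^k
   for some l whose cost m_k l is paid by the energy of the run.
   Along an ultrafilter the flat part of u' converges weakly in L^2 to some f, and the
   steep energy of ]0, x] to a monotone function V. What remains of the limit of u after
   subtracting the primitive of f has increments bounded by the k-th powers of those of
   V / m_k, hence is a sum of jumps z with m_k sum |z|^(1/k) <= V 1 - V 0. Such a sum
   has vanishing derivative almost everywhere, so the limit is in SBV_2.
   For the upper bound, replace finitely many jumps of the limit by scaled optimal
   profiles and the density of the remaining part by a smooth one. *)
Require Import Defs.
From HB Require Import structures.
From mathcomp Require Import all_boot all_order all_algebra finmap.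
From mathcomp Require Import all_classical all_reals all_analysis.
From mathcomp Require Import measurable_realfun ring lra zify.

Import Order.TTheory GRing.Theory Num.Theory.
Import numFieldNormedType.Exports.

Local Open Scope classical_set_scope.
Local Open Scope ring_scope.

Local Notation mu := lebesgue_measure.
Set Implicit Arguments.
Unset Strict Implicit.
Unset Printing Implicit Defensive.

(** * Exchange of integration over a half-plane *)

Section Fubini_parts.
Context {R : realType}.

(** The end derivatives of a steep run are small but not zero, and turning the run into an exact
    competitor would need a gluing argument. Duality avoids it: [transition_parts] is an identity
    for all functions of class H^k, in which the end derivatives enter linearly and become an error
    term. The same identity computes the cell minimum, [T + alpha T^(1-2k)], so that only the
    infimum over [T] stays implicit and the cost [m_k |z|^(1/k)] of a jump [z] follows by scaling.
    The cells have length about [d s^2], with a second parameter [d]. On good cells the derivatives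
    are controlled up to an error of order [sqrt d], which does not vanish with [s]; hence [s] tends
    to 0 first, at fixed [d], and [d] afterwards. Jumps are measured by their [k]-th root [l],
    because [l ^ k] is superadditive: estimates on adjacent intervals add up without loss, although
    the number of cells grows like [1 / (d s^2)]. The additive constants are normalised by the value
    at one point outside a small exceptional set, since the functions are controlled only there. *)

Lemma measurable_le_diag : measurable [set z : measurableTypeR R * measurableTypeR R | z.1 <= z.2].
Proof.
rewrite -[X in measurable X]setTI.
have h : measurable_fun setT (fun z : measurableTypeR R * measurableTypeR R => z.1 <= z.2 :> R).
  by apply: measurable_fun_ler; [exact: measurable_fst|exact: measurable_snd].
exact: (h measurableT [set true]).
Qed.

(** Needed for two measures: Lebesgue measure, which gives integration by parts for absolutely
    continuous functions, and a finite measure, which gives the distributional derivative of its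
    cumulative function in [dist_deriv]. *)
Lemma fubini_le (nu : {sigma_finite_measure set (measurableTypeR R) -> \bar R}) (f h : R -> R) :
  nu.-integrable setT (EFin \o f) -> mu.-integrable setT (EFin \o h) ->
  [/\ mu.-integrable setT (EFin \o (fun x => h x * \int[nu]_(s in `]-oo, x]) f s)) ,
      nu.-integrable setT (EFin \o (fun s => f s * \int[mu]_(x in `[s, +oo[) h x)) &
  \int[mu]_x (h x * \int[nu]_(s in `]-oo, x]) f s) =
  \int[nu]_s (f s * \int[mu]_(x in `[s, +oo[) h x)].
Proof.
move=> intf inth.
have mf : measurable_fun setT f by apply/measurable_EFinP; exact: (measurable_int nu).
have mh : measurable_fun setT h by apply/measurable_EFinP; exact: (measurable_int mu).
pose D := [set z : measurableTypeR R * measurableTypeR R | z.1 <= z.2].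
pose k (z : measurableTypeR R * measurableTypeR R) : \bar R := (f z.1 * h z.2 * \1_D z)%:E.
have mk : measurable_fun setT k.
  apply/measurable_EFinP; apply: measurable_funM; first apply: measurable_funM.
  - by apply: measurableT_comp => //; exact: measurable_fst.
  - by apply: measurableT_comp => //; exact: measurable_snd.
  - by apply: measurable_indic; exact: measurable_le_diag.
pose m2 : {sigma_finite_measure set (measurableTypeR R) -> \bar R} := mu.
have ik : (nu \x m2)%E.-integrable setT k.
  apply/integrable12ltyP => //.
  apply: (@le_lt_trans _ _ (\int[nu]_x (`|(f x)%:E| * \int[mu]_y `|(h y)%:E|))%E).
    apply: ge0_le_integral => //=.
    - by move=> x _; exact: integral_ge0.
    - apply: (measurable_fun_fubini_tonelli_F (m2 := m2) (abse \o k)) => //=.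
      exact: measurableT_comp.
    - apply: emeasurable_funM => //; apply/measurable_EFinP. by apply: measurableT_comp.
    - move=> x _; rewrite -ge0_integralZl//=.
      + apply: ge0_le_integral => //=.
        * apply/measurable_EFinP; apply: measurableT_comp => //.
          apply: measurable_funM; first exact: measurable_funM.
          apply: (@measurable_comp _ _ _ _ _ _ setT) => //.
          by apply: measurable_indic; exact: measurable_le_diag.
        * apply/measurable_EFinP; apply: measurable_funM => //.
          by apply: measurableT_comp.
        * move=> y _; rewrite lee_fin !normrM -[leRHS]mulr1 ler_wpM2l ?mulr_ge0//.
          by rewrite indicE; case: (_ \in _); rewrite ?normr1 ?normr0.
      + by apply/measurable_EFinP; apply: measurableT_comp.
  case/integrableP : inth => _ ioo.
  rewrite ge0_integralZr//=; last 2 first.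
    by apply/measurable_EFinP; apply: measurableT_comp.
    exact: integral_ge0.
  case/integrableP : intf => _ ioo'.
  by rewrite lte_mul_pinfty// ?integral_ge0// ge0_fin_numE// integral_ge0.
have E1 x : (\int[m2]_y k (x, y) = (f x * \int[mu]_(y in `[x, +oo[) h y)%:E)%E.
  have ih : mu.-integrable `[x, +oo[ (EFin \o h).
    by apply: integrableS inth.
  rewrite EFinM /Rintegral fineK; last exact: integrable_fin_num.
  rewrite -integralZl//= [RHS]integral_mkcond/=.
  apply: eq_integral => y _; rewrite /k patchE/=.
  rewrite indicE /D; case: ifPn.
    by rewrite !inE/= in_itv/= andbT => xy; rewrite mem_set//= mulr1.
  by rewrite notin_setE/= in_itv/= andbT => xy; rewrite memNset ?mulr0.
have E2 y : (\int[nu]_x k (x, y) = (h y * \int[nu]_(x in `]-oo, y]) f x)%:E)%E.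
  have ih : nu.-integrable `]-oo, y] (EFin \o f).
    by apply: integrableS intf.
  rewrite EFinM /Rintegral fineK; last exact: integrable_fin_num.
  rewrite -integralZl//= [RHS]integral_mkcond/=.
  apply: eq_integral => x _; rewrite /k patchE/=.
  rewrite indicE /D; case: ifPn.
    by rewrite !inE/= in_itv/= => xy; rewrite mem_set//= mulr1 mulrC.
  by rewrite notin_setE/= in_itv/= => xy; rewrite memNset ?mulr0.
have I1 := integrable_fubini_F ik.
have I2 : m2.-integrable setT (fubini_G nu k).
  apply/integrableP; split; first exact: (measurable_fubini_G ik).
  apply: le_lt_trans ((integrable21ltyP nu m2 mk).1 ik).
  apply: ge0_le_integral => //=.
  - by apply: measurableT_comp => //; exact: (measurable_fubini_G ik).
  - apply: (measurable_fun_fubini_tonelli_G (m1 := nu) (abse \o k)) => //=.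
    exact: measurableT_comp.
  - move=> y _; apply: le_abse_integral => //.
    exact: measurableT_comp.
rewrite /fubini_F (funext E1) in I1.
rewrite /fubini_G (funext E2) in I2.
split => //.
have := Fubini ik.
under eq_integral do rewrite E1.
under [X in _ = X -> _]eq_integral do rewrite E2.
by rewrite /Rintegral => ->.
Qed.
End Fubini_parts.


(** * Integrals over intervals and primitives *)

Section Prim.
Context {R : realType}.
Implicit Types (a b x y z : R) (f g F G : R -> R).

(* For [y < x] the interval is empty, so [oint f x y = 0]: there is no orientation. *)
Definition oint f x y : R := \int[mu]_(t in `]x, y]) f t.
Definition cint a b f := mu.-integrable `[a, b] (EFin \o f).
(** Absolute continuity in integrated form: [f] is the density of [F], and no pointwise derivative
    of [F] is involved. *)
Definition prim a b F f :=
  forall x y, a <= x -> x <= y -> y <= b -> F y - F x = oint f x y.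

Lemma cintS a b x y f : cint a b f -> a <= x -> y <= b -> cint x y f.
Proof.
move=> h ax yb; apply: integrableS h => //.
by apply: subset_itvScc.
Qed.

Lemma cint_oc a b x y f : cint a b f -> a <= x -> y <= b ->
  mu.-integrable `]x, y] (EFin \o f).
Proof.
move=> h ax yb; apply: integrableS h => //.
by apply: subset_itv => //; rewrite bnd_simp.
Qed.

Lemma cint_oo a b f : mu.-integrable `]a, b[ (EFin \o f) <-> cint a b f.
Proof.
split=> [/integrableP[mf foo]|h]; last first.
  by apply: integrableS h => //; exact: subset_itv_oo_cc.
have mf' : measurable_fun `[a, b] (EFin \o f).
  exact: (emeasurable_fun_itv_cc (b0 := false) (b1 := true)).
apply/integrableP; split => //.
by rewrite integral_itv_bndoo//; exact: measurableT_comp.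
Qed.

Lemma cint_le a b f g : measurable_fun `[a, b] f -> (forall x, a <= x -> x <= b -> `|f x| <= `|g x|) ->
  cint a b g -> cint a b f.
Proof.
move=> mf fg ig; apply: le_integrable ig => //; first exact/measurable_EFinP.
by move=> x /=; rewrite in_itv/= => /andP[ax xb]; rewrite lee_fin fg.
Qed.

Lemma cint_meas a b f : cint a b f -> measurable_fun `[a, b] f.
Proof. by move=> /integrableP[/measurable_EFinP]. Qed.

Lemma cint_cst a b c : cint a b (fun=> c).
Proof.
apply: continuous_compact_integrable; first exact: segment_compact.
exact: cst_continuous.
Qed.

Lemma cint_bounded a b f M : measurable_fun `[a, b] f ->
  (forall x, a <= x -> x <= b -> `|f x| <= M) -> cint a b f.
Proof.
move=> mf fM; apply: (@cint_le _ _ _ (fun=> M)) => //; last exact: cint_cst.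
by move=> x ax xb; rewrite (le_trans (fM _ ax xb))// ler_norm.
Qed.

Lemma cintD a b f g : cint a b f -> cint a b g -> cint a b (fun x => f x + g x).
Proof. by move=> h1 h2; apply: (integrableD _ h1 h2). Qed.

Lemma cintB a b f g : cint a b f -> cint a b g -> cint a b (fun x => f x - g x).
Proof. by move=> h1 h2; apply: (integrableB _ h1 h2). Qed.

Lemma cintZ a b c f : cint a b f -> cint a b (fun x => c * f x).
Proof. by move=> h1; apply: (integrableZl _ c h1). Qed.

Lemma cint_norm a b f : cint a b f -> cint a b (fun x => `|f x|).
Proof. exact: integrable_norm. Qed.

Lemma cint_bM a b f g M : measurable_fun `[a, b] g -> (forall x, a <= x -> x <= b -> `|g x| <= M) ->
  cint a b f -> cint a b (fun x => f x * g x).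
Proof.
move=> mg gM fi; apply: (@cint_le _ _ _ (fun x => M * f x)); last exact: cintZ.
- by apply: measurable_funM => //; exact: cint_meas fi.
- move=> x ax xb; rewrite !normrM mulrC ler_wpM2r//.
  by rewrite (le_trans (gM _ ax xb))// ler_norm.
Qed.

Lemma cint_cM a b f g : {within `[a, b], continuous g} ->
  cint a b f -> cint a b (fun x => f x * g x).
Proof.
move=> cg fi.
have cK : compact (g @` `[a, b]).
  by apply: continuous_compact => //; exact: segment_compact.
have [M [_ MP]] := compact_bounded cK.
apply: (@cint_bM _ _ _ _ (M + 1)) => //.
- exact: subspace_continuous_measurable_fun.
- move=> x ax xb; apply: MP; first by rewrite ltrDl.
  by exists x => //=; rewrite in_itv/= ax xb.
Qed.

Lemma oint_cat a b f x y z : cint a b f -> a <= x -> x <= y -> y <= z -> z <= b ->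
  oint f x z = oint f x y + oint f y z.
Proof.
move=> h ax xy yz zb; rewrite /oint -Rintegral_setU//.
- by rewrite -itv_bndbnd_setU// bnd_simp.
- by rewrite -itv_bndbnd_setU ?bnd_simp//; apply: cint_oc h _ _.
- apply/disj_setPS => t [/=]; rewrite !in_itv/= => /andP[_ ty] /andP[].
  by rewrite ltNge ty.
Qed.


Section ointlin.
Variables (a b x y : R).
Hypotheses (ax : a <= x) (yb : y <= b).

Lemma ointD f g : cint a b f -> cint a b g ->
  oint (fun t => f t + g t) x y = oint f x y + oint g x y.
Proof. by move=> h1 h2; rewrite /oint RintegralD//; [exact: cint_oc h1 _ _|exact: cint_oc h2 _ _]. Qed.

Lemma ointB f g : cint a b f -> cint a b g ->
  oint (fun t => f t - g t) x y = oint f x y - oint g x y.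
Proof. by move=> h1 h2; rewrite /oint RintegralB//; [exact: cint_oc h1 _ _|exact: cint_oc h2 _ _]. Qed.

Lemma ointZ c f : cint a b f -> oint (fun t => c * f t) x y = c * oint f x y.
Proof. by move=> h1; rewrite /oint RintegralZl//; exact: cint_oc h1 _ _. Qed.

Lemma le_oint f g : cint a b f -> cint a b g ->
  (forall t, x < t -> t <= y -> f t <= g t) -> oint f x y <= oint g x y.
Proof.
move=> h1 h2 h; apply: le_Rintegral => //; [exact: cint_oc h1 _ _|exact: cint_oc h2 _ _|].
by move=> t /=; rewrite in_itv/= => /andP[xt ty]; exact: h.
Qed.

Lemma norm_oint f : cint a b f -> `|oint f x y| <= oint (fun t => `|f t|) x y.
Proof. by move=> h1; apply: le_normr_Rintegral => //; exact: cint_oc h1 _ _. Qed.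
End ointlin.

Lemma oint_ge0 x y f : (forall t, x < t -> t <= y -> 0 <= f t) -> 0 <= oint f x y.
Proof.
move=> h; apply: Rintegral_ge0 => t /=; rewrite in_itv/= => /andP[xt ty]; exact: h.
Qed.

Lemma eq_oint x y f g : (forall t, x < t -> t <= y -> f t = g t) -> oint f x y = oint g x y.
Proof.
move=> h; apply: eq_Rintegral => t; rewrite inE/= in_itv/= => /andP[xt ty]; exact: h.
Qed.

Lemma oint_cst x y c : x <= y -> oint (fun=> c) x y = c * (y - x).
Proof.
move=> xy; rewrite /oint Rintegral_cst//= lebesgue_measure_itv/= lte_fin.
by case: ltP => [//|yx]; rewrite (@le_anti _ _ x y) ?xy// subrr.
Qed.

Lemma oint_nil x f : oint f x x = 0.
Proof. by rewrite /oint set_itvoc0 Rintegral_set0. Qed.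

Lemma prim_cont a b F f : cint a b f -> prim a b F f -> {within `[a, b], continuous F}.
Proof.
move=> fi Ff; have [ab|ba] := leP a b; last first.
  rewrite set_itv_ge ?bnd_simp -?ltNge//; exact: continuous_subspace0.
have := parameterized_integral_continuous ab fi.
move=> h; have : {within `[a, b], continuous (fun x => F a + \int[mu]_(t in `[a, x]) f t)}.
  by move=> x; apply: cvgD; [exact: cvg_cst|exact: h].
apply: subspace_eq_continuous => x; rewrite inE/= in_itv/= => /andP[ax xb].
have := Ff _ _ (lexx a) ax xb; rewrite /oint Rintegral_itv_obnd_cbnd//.
  by move=> e; rewrite /from_subspace -e addrC subrK.
exact: cint_oc fi _ _.
Qed.

(** One double integral of [f s * g x] over [s <= x] is computed in both orders: the inner integral
    is [F x - F a] in one of them and [G b - G s] in the other. *)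
Lemma by_parts a b F G f g : a <= b -> cint a b f -> cint a b g -> prim a b F f -> prim a b G g ->
  oint (fun x => f x * G x) a b = F b * G b - F a * G a - oint (fun x => g x * F x) a b.
Proof.
move=> ab fi gi Ff Gg.
pose f' := f \_ `]a, b]; pose g' := g \_ `]a, b].
have fi' : mu.-integrable setT (EFin \o f').
  rewrite /f' -restrict_EFin; apply/integrable_restrict => //=.
  rewrite setTI; exact: cint_oc fi _ _.
have gi' : mu.-integrable setT (EFin \o g').
  rewrite /g' -restrict_EFin; apply/integrable_restrict => //=.
  rewrite setTI; exact: cint_oc gi _ _.
have [_ _] := fubini_le fi' gi'.
have -> : \int[mu]_x (g' x * \int[mu]_(s in `]-oo, x]) f' s) = oint (fun x => g x * F x - F a * g x) a b.
  rewrite /oint [RHS]Rintegral_mkcond; apply: eq_Rintegral => x _.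
  rewrite /g' !patchE; case: ifPn; last by rewrite mul0r.
  rewrite inE/= in_itv/= => /andP[ax xb]; rewrite [F a * _]mulrC -mulrBr; congr (_ * _).
  rewrite (Ff _ _ (lexx a) (ltW ax) xb) /oint.
  rewrite /f' -Rintegral_mkcondr; congr Rintegral; apply/seteqP; split => t /=; rewrite !in_itv/=.
    by move=> [-> /andP[->]].
  by move=> /andP[-> tx]; rewrite tx (le_trans tx).
have -> : \int[mu]_s (f' s * \int[mu]_(x in `[s, +oo[) g' x) = oint (fun x => G b * f x - f x * G x) a b.
  rewrite /oint [RHS]Rintegral_mkcond; apply: eq_Rintegral => x _.
  rewrite /f' !patchE; case: ifPn; last by rewrite mul0r.
  rewrite inE/= in_itv/= => /andP[ax xb]; rewrite [G b * _]mulrC -mulrBr; congr (_ * _).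
  rewrite (Gg _ _ (ltW ax) xb (lexx _)) /oint.
  rewrite /g' -Rintegral_mkcondr [RHS]Rintegral_itv_obnd_cbnd; last by apply: cint_oc gi _ _ => //; exact: ltW.
  congr Rintegral; apply/seteqP; split => t /=; rewrite !in_itv/= ?andbT.
    by move=> [-> /andP[_ ->]].
  by move=> /andP[xt ->]; rewrite xt (lt_le_trans ax).
have cF := prim_cont fi Ff; have cG := prim_cont gi Gg.
rewrite (@ointB a b)//; [|exact: cint_cM|exact: cintZ].
rewrite (@ointB a b)//; [|exact: cintZ|exact: cint_cM].
rewrite !(@ointZ a b)// -(Ff a b)// -(Gg a b)// => h.
lra.
Qed.

End Prim.


(** * Lebesgue points and the du Bois-Reymond lemma *)

Section DBR.
Context {R : realType}.
Implicit Types (a b c d e h p q r s t x y z : R) (f g F G : R -> R).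

Lemma aeS (P Q : R -> Prop) : (forall x, P x -> Q x) ->
  {ae mu, forall x, P x} -> {ae mu, forall x, Q x}.
Proof.
move=> PQ; apply: filterS PQ; exact: (ae_filter_ringOfSetsType (@lebesgue_measure R)).
Qed.

Lemma aeS2 (P P' Q : R -> Prop) : (forall x, P x -> P' x -> Q x) ->
  {ae mu, forall x, P x} -> {ae mu, forall x, P' x} -> {ae mu, forall x, Q x}.
Proof.
move=> PQ; apply: filterS2 PQ; exact: (ae_filter_ringOfSetsType (@lebesgue_measure R)).
Qed.

Lemma restr_int a b f : cint a b f -> mu.-integrable setT (EFin \o (f \_ `[a, b])).
Proof.
by move=> fi; rewrite -restrict_EFin; apply/integrable_restrict => //=; rewrite setTI.
Qed.

(** Almost every point is a Lebesgue point. There is one estimate for each side because [oint]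
    carries no orientation. *)
Lemma oint_derive a b f : cint a b f ->
  {ae mu, forall x, x \in `]a, b[ -> forall e, 0 < e -> exists2 d, 0 < d &
    forall y, `|y - x| < d -> (x <= y -> `|oint f x y - f x * (y - x)| <= e * (y - x)) /\
      (y <= x -> `|oint f y x - f x * (x - y)| <= e * (x - y))}.
Proof.
move=> fi; have fi' := restr_int fi.
set f' := f \_ `[a, b] in fi'.
have li : locally_integrable [set: R] f'.
  by apply: open_integrable_locally => //; exact: openT.
have iy y : mu.-integrable `]-oo, y] (EFin \o f') by apply: integrableS fi'.
have := FTC1Ny iy li.
apply: aeS => x [dF F'x]; rewrite in_itv/= => /andP[ax xb] e e0.
set F := fun x : R => \int[mu]_(t in `]-oo, x]) f' t in dF F'x.
have oE y z : a <= y -> y <= z -> z <= b -> F z - F y = oint f y z.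
  move=> ay yz zb; rewrite /F Rintegral_itvB//.
  apply: eq_Rintegral => t; rewrite inE/= in_itv/= => /andP[yt tz].
  by rewrite /f' patchE mem_set//= in_itv/= (le_trans ay (ltW yt)) (le_trans tz zb).
have hx : f' x = f x by rewrite /f' patchE mem_set//= in_itv/= !ltW.
move: F'x; rewrite derive1E hx => F'x.
have : (h^-1 *: (F (h *: 1 + x) - F x)) @[h --> 0^'] --> f x by rewrite -F'x; exact: dF.
move=> /cvgrPdist_lt/(_ e e0).
rewrite near_withinE => /nbhs_ballP[d /= d0 hd].
exists (Num.min d (Num.min (x - a) (b - x))); first by rewrite !lt_min d0 !subr_gt0 ax.
move=> y; rewrite !lt_min => /andP[yd /andP[y1 y2]].
have [->|yx] := eqVneq y x; first by rewrite oint_nil !subrr !mulr0 subr0 normr0.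
have /hd : ball 0 d (y - x) by rewrite /ball/= sub0r normrN.
rewrite subr_eq0 => /(_ yx).
rewrite scaler1 subrK => h.
have key : `|F y - F x - f x * (y - x)| <= e * `|y - x|.
  rewrite -[F y - F x](@mulVKf _ (y - x)) ?subr_eq0//.
  rewrite [f x * _]mulrC -mulrBr normrM mulrC ler_wpM2r// ltW// distrC.
  exact: h.
move: y1 y2; rewrite !ltr_norml !opprB => /andP[y1 y1'] /andP[y2 y2']; split=> xy.
  rewrite -oE//; [|lra|lra]; by rewrite (le_trans key)// ger0_norm// subr_ge0.
rewrite -oE//; [|lra|lra].
have -> : F x - F y - f x * (x - y) = - (F y - F x - f x * (y - x)) by ring.
by rewrite normrN (le_trans key)// ler0_norm ?subr_le0// opprB.
Qed.

Lemma ae_eq0_oint a b f : cint a b f ->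
  (forall x y, a < x -> x < y -> y < b -> oint f x y = 0) ->
  {ae mu, forall x, x \in `]a, b[ -> f x = 0}.
Proof.
move=> fi h; have := oint_derive fi; apply: aeS => x hx xab.
have xab' := xab; move: xab; rewrite in_itv/= => /andP[ax xb].
apply/eqP/negPn/negP => fx0.
have e0 : 0 < `|f x| / 2 by rewrite divr_gt0// normr_gt0.
have [d d0 H] := hx xab' _ e0.
pose r := Num.min (d / 2) ((b - x) / 2).
have r0 : 0 < r by rewrite lt_min !divr_gt0// subr_gt0.
have rd : r <= d / 2 by rewrite ge_min lexx.
have rb : r <= (b - x) / 2 by rewrite ge_min lexx orbT.
have xr : x + r - x = r by ring.
have [|+ _] := H (x + r).
  by rewrite xr gtr0_norm//; lra.
rewrite xr lerDl (ltW r0) => /(_ isT).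
rewrite h//; [|lra|lra].
rewrite sub0r normrN normrM (gtr0_norm r0) ler_pM2r//.
have := normr_gt0 (f x); rewrite fx0; lra.
Qed.

(** A trapezoid with slopes [n] and [- n]; as [n] grows it tends to the indicator of []0, r[]. *)
Definition bump (n r x : R) := Num.max 0 (Num.min 1 (Num.min (n * x) (n * (r - x)))).

Lemma bump_cont n r : continuous (bump n r).
Proof.
move=> x; rewrite /bump.
have c1 : n * y @[y --> x] --> n * x by apply: cvgMr; exact: cvg_id.
have c2 : n * (r - y) @[y --> x] --> n * (r - x).
  by apply: cvgMr; apply: cvgB; [exact: cvg_cst|exact: cvg_id].
have c3 := continuous_min c1 c2.
have c4 : {for x, continuous (cst (1 : R^o) : R -> R^o)} by exact: cst_continuous.
have c5 : {for x, continuous (cst (0 : R^o) : R -> R^o)} by exact: cst_continuous.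
exact: continuous_max c5 (continuous_min c4 c3).
Qed.

Lemma bump_ge0 n r x : 0 <= bump n r x.
Proof. by rewrite /bump le_max lexx. Qed.

Lemma bump_le1 n r x : bump n r x <= 1.
Proof. by rewrite /bump ge_max ler01 ge_min lexx. Qed.

Lemma bump_out n r x : 0 <= n -> (x <= 0) || (r <= x) -> bump n r x = 0.
Proof.
move=> n0 h; rewrite /bump max_l// !ge_min; apply/orP; right.
by case/orP: h => h; apply/orP; [left|right]; rewrite mulr_ge0_le0// subr_le0.
Qed.

Lemma bump_in (n r x : R) : 1 <= n * x -> 1 <= n * (r - x) -> bump n r x = 1.
Proof. by move=> h1 h2; rewrite /bump min_l ?max_r// le_min h1. Qed.

Lemma bump_prim n r : 0 <= n -> 0 <= r -> exists P : R -> R,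
  [/\ forall x, derivable P x 1, forall x, derive1 P x = bump n r x,
      forall x, x <= 0 -> P x = 0 & forall x, r <= x -> P x = P r].
Proof.
move=> n0 r0.
have bi : mu.-integrable setT (EFin \o bump n r).
  suff -> : bump n r = bump n r \_ `[0, r].
    apply: restr_int; apply: continuous_compact_integrable; first exact: segment_compact.
    by apply: continuous_subspaceT; exact: bump_cont.
  apply/funext => x; rewrite patchE; case: ifPn => //; rewrite notin_setE/= in_itv/= => h.
  rewrite bump_out//; move/negP: h; rewrite negb_and -!ltNge => /orP[/ltW->//|/ltW->].
  by rewrite orbT.
pose P x := \int[mu]_(t in `]-oo, x]) bump n r t.
have hP x : derivable P x 1 /\ P^`()%classic x = bump n r x.
  apply: (@continuous_FTC1 _ _ _ _ (x + 1)); [by rewrite ltrDl|by apply: integrableS bi|by rewrite ltNyr|].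
  exact: bump_cont.
exists P; split=> [x|x|x x0|x rx]; [exact: (hP x).1|exact: (hP x).2| |].
  rewrite /P; under eq_Rintegral => t.
    rewrite inE/= in_itv/= => tx; rewrite bump_out// ?(le_trans tx)//; over.
  by rewrite Rintegral_cst// mul0r.
apply/eqP; rewrite -subr_eq0 /P Rintegral_itvB//; last by apply: integrableS bi.
under eq_Rintegral => t.
  rewrite inE/= in_itv/= => /andP[tx _]; rewrite bump_out// ?(ltW tx) ?orbT//; over.
by rewrite Rintegral_cst// mul0r.
Qed.

(** Primitives of the two translated bumps reach the same constant, so their difference vanishes to
    the right of [q + r] as well as to the left of [p]. *)
Lemma bump_test a b p q r n : a < p -> p < q -> 0 <= r -> q + r < b -> 0 <= n ->
  exists2 phi, test_function a b phi & derive1 phi = (fun x => bump n r (x - p) - bump n r (x - q)).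
Proof.
move=> ap pq r0 qb n0; have [P [dP P' P0 Pr]] := bump_prim n0 r0.
have ids (c x : R) : is_derive x 1 (fun y : R => y - c) 1.
  exact: is_derive_shift.
have dPs c x : is_derive x 1 (fun y => P (y - c)) (bump n r (x - c)).
  rewrite -[bump _ _ _]mulr1; apply: (@is_derive1_comp _ P (fun y => y - c)).
  by rewrite -P' derive1E; apply: DeriveDef.
pose phi : R -> R := (fun x => P (x - p)) - (fun x => P (x - q)).
have idp x : is_derive x 1 phi (bump n r (x - p) - bump n r (x - q)).
  by apply: is_deriveB.
have dphi : derive1 phi = (fun x => bump n r (x - p) - bump n r (x - q)).
  by apply/funext => x; rewrite derive1E; apply: derive_val.
exists phi; last exact: dphi.
split.
- by move=> x; have := idp x; case.
- rewrite dphi => x; apply: cvgB.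
    apply: (continuous_comp (f := fun y => y - p) (g := bump n r)); last exact: bump_cont.
    by apply: cvgB; [exact: cvg_id|exact: cvg_cst].
  apply: (continuous_comp (f := fun y => y - q) (g := bump n r)); last exact: bump_cont.
  by apply: cvgB; [exact: cvg_id|exact: cvg_cst].
- exists p, (q + r); split => // x; rewrite in_itv/= negb_and -!ltNge => /orP[xp|qx].
    have h1 : x - p <= 0 by lra.
    have h2 : x - q <= 0 by lra.
    by rewrite (_ : phi x = P (x - p) - P (x - q))// (P0 _ h1) (P0 _ h2) subrr.
  have h1 : r <= x - p by lra.
  have h2 : r <= x - q by lra.
  by rewrite (_ : phi x = P (x - p) - P (x - q))// (Pr _ h1) (Pr _ h2) subrr.
Qed.

Lemma bump_lim a b f p r : cint a b f -> a <= p -> 0 <= r -> p + r <= b ->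
  \int[mu]_(x in `]a, b[) (f x * bump n%:R r (x - p)) @[n --> \oo] --> oint f p (p + r).
Proof.
move=> fi ap r0 prb.
have fi' := fi; move/cint_oo : fi' => fi'.
have mf : measurable_fun `]a, b[ f by apply/measurable_EFinP; exact: (measurable_int mu).
have mb n : measurable_fun setT (fun x => bump n%:R r (x - p)).
  apply: continuous_measurable_fun => x.
  apply: (continuous_comp (f := fun y => y - p) (g := bump n%:R r)); last exact: bump_cont.
  by apply: cvgB; [exact: cvg_id|exact: cvg_cst].
pose lim x := f x * \1_(`]p, p + r[%classic : set R) x.
have := @dominated_convergence _ _ _ (@lebesgue_measure R) `]a, b[%classic (measurable_itv _)
  (fun n => EFin \o (fun x => f x * bump n%:R r (x - p))) (EFin \o lim) (fun x => `|(f x)%:E|)%E.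
case.
- move=> n; apply/measurable_EFinP; apply: measurable_funM => //.
  apply: measurable_funTS; exact: mb.
- apply/measurable_EFinP; apply: measurable_funM => //; exact: measurable_indic.
- apply: aeW => x _; apply/cvg_EFin; first exact: nearW.
  rewrite /=; apply: cvgMr; rewrite indicE; case: (boolP (x \in _)) => hx.
    move: hx; rewrite inE/= in_itv/= => /andP[px xr].
    apply: cvg_near_cst; near=> n; rewrite bump_in//.
      rewrite -ler_pdivrMr ?subr_gt0// div1r; near: n; exact: nbhs_infty_ger.
    rewrite -ler_pdivrMr; last lra.
    by rewrite div1r; near: n; exact: nbhs_infty_ger.
  apply: cvg_near_cst; near=> n; rewrite bump_out//.
  move: hx; rewrite notin_setE/= in_itv/= => /negP; rewrite negb_and -!leNgt => /orP[h|h].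
    by rewrite subr_le0 h.
  apply/orP; right; lra.
- exact: integrable_abse.
- apply: aeW => x n _; rewrite lee_fin normrM ler_piMr//.
  by rewrite ger0_norm ?bump_ge0// bump_le1.
move=> il _ H.
have E : oint f p (p + r) = \int[mu]_(x in `]a, b[) lim x.
  have -> : lim = f \_ `]p, p + r[.
    apply/funext => x; rewrite /lim patchE indicE; case: ifPn => _; by rewrite ?mulr1 ?mulr0.
  rewrite -Rintegral_mkcondr /oint.
  have -> : `]a, b[ `&` `]p, p + r[ = `]p, p + r[%classic :> set R.
    apply/seteqP; split=> x /=; rewrite !in_itv/=; first by move=> [].
    move=> /andP[px xr]; split; apply/andP; split => //; lra.
  rewrite Rintegral_itv_bndo_bndc//.
  by apply: integrableS fi' => //; apply: subset_itv; rewrite bnd_simp.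
have il' := integrable_fin_num _ il.
move: H; rewrite -(fineK (il' (measurable_itv _))) => /fine_cvg.
by rewrite E; exact.
Unshelve. all: by end_near.
Qed.

(** Testing with differences of translated bumps shows that the integral of [f] over an interval
    depends only on its length. At two Lebesgue points this forces equal values. *)
Lemma du_bois_reymond a b f : a < b -> cint a b f ->
  (forall phi, test_function a b phi -> \int[mu]_(x in `]a, b[) (f x * derive1 phi x) = 0) ->
  exists c, {ae mu, forall x, x \in `]a, b[ -> f x = c}.
Proof.
move=> ab fi h.
have key p q r : a < p -> p < q -> 0 <= r -> q + r < b -> oint f p (p + r) = oint f q (q + r).
  move=> ap pq r0 qb.
  have lp := @bump_lim a b f p r fi (ltW ap) r0 ltac:(lra).
  have lq := @bump_lim a b f q r fi ltac:(lra) r0 ltac:(lra).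
  apply: (cvg_unique _ lp); rewrite //=.
  suff -> : (fun n : nat => \int[mu]_(x in `]a, b[) (f x * bump n%:R r (x - p))) =
    (fun n : nat => \int[mu]_(x in `]a, b[) (f x * bump n%:R r (x - q))) by exact: lq.
  apply/funext => n; have n0 : (0 : R) <= n%:R by [].
  have [phi /h + dphi] := bump_test ap pq r0 qb n0.
  rewrite dphi; under eq_Rintegral do rewrite mulrBr.
  have ib s : mu.-integrable `]a, b[ (EFin \o (fun x => f x * bump n%:R r (x - s))).
    apply/cint_oo; apply: cint_cM fi.
    apply: continuous_subspaceT => x.
    apply: (continuous_comp (f := fun y => y - s) (g := bump n%:R r)); last exact: bump_cont.
    by apply: cvgB; [exact: cvg_id|exact: cvg_cst].
  by rewrite RintegralB// => /eqP; rewrite subr_eq0 => /eqP.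
have hd := oint_derive fi.
pose G x := forall e : R, 0 < e -> exists2 d, 0 < d &
    forall y, `|y - x| < d -> (x <= y -> `|oint f x y - f x * (y - x)| <= e * (y - x)) /\
      (y <= x -> `|oint f y x - f x * (x - y)| <= e * (x - y)).
have eqG x y : a < x -> x < y -> y < b -> G x -> G y -> f x = f y.
  move=> ax xy yb Gx Gy; apply/eqP/negPn/negP => nxy.
  have e0 : 0 < `|f x - f y| / 4 by rewrite divr_gt0// normr_gt0 subr_eq0.
  have [d1 d10 H1] := Gx _ e0; have [d2 d20 H2] := Gy _ e0.
  pose r := Num.min (Num.min (d1 / 2) (d2 / 2)) ((b - y) / 2).
  have r0 : 0 < r by rewrite !lt_min !divr_gt0// subr_gt0.
  have rd1 : r <= d1 / 2 by rewrite !ge_min lexx.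
  have rd2 : r <= d2 / 2 by rewrite !ge_min lexx ?orbT.
  have rb : r <= (b - y) / 2 by rewrite !ge_min lexx ?orbT.
  have yr z : z + r - z = r by ring.
  have [|+ _] := H1 (x + r); first by rewrite yr gtr0_norm//; lra.
  have [|+ _] := H2 (y + r); first by rewrite yr gtr0_norm//; lra.
  rewrite !yr !lerDl (ltW r0) => /(_ isT) h2 /(_ isT) h1.
  have k := key x y r ax xy (ltW r0) ltac:(lra).
  have : `|(f x - f y) * r| <= `|f x - f y| / 2 * r.
    have -> : (f x - f y) * r = - (oint f x (x + r) - f x * r) + (oint f y (y + r) - f y * r).
      by rewrite k; ring.
    by rewrite (le_trans (ler_normD _ _))// normrN; lra.
  rewrite normrM (gtr0_norm r0) ler_pM2r//; lra.
have [x0 [x0ab Gx0]] : exists x0, (x0 \in `]a, b[) /\ G x0.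
  apply: contrapT => /forallNP hn.
  have : {ae mu, forall x, x \notin `]a, b[}.
    apply: aeS hd => x hx; apply/negP => xab; apply: (hn x); split => //; exact: hx.
  move=> [N [mN N0 sN]].
  have : (mu `]a, b[ <= mu N)%E.
    apply: le_measure; rewrite ?inE//.
    by apply: subset_trans sN => x /= xab; rewrite xab.
  by rewrite N0 lebesgue_measure_itv/= lte_fin ab -EFinD lee_fin; lra.
exists (f x0); apply: aeS hd => x hx xab; have Gx : G x by exact: hx.
move: xab x0ab; rewrite !in_itv/= => /andP[ax xb] /andP[ax0 x0b].
case: (ltgtP x x0) => [h1|h1|->//]; first exact: eqG.
by apply/esym/eqG.
Qed.

(** A weak derivative is only locally integrable, so that its uniqueness is obtained on compact
    subintervals first. *)
Lemma ae_open_cover a b (P : R -> Prop) :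
  (forall c d : R, a < c -> c < d -> d < b -> {ae mu, forall x, x \in `]c, d[ -> P x}) ->
  {ae mu, forall x, x \in `]a, b[ -> P x}.
Proof.
move=> h.
have : {ae mu, forall x, forall n : nat, x \in `]a + n.+1%:R^-1, b - n.+1%:R^-1[ -> P x}.
  apply: ae_foralln => n.
  have n0 : 0 < (n.+1%:R^-1 : R) by rewrite invr_gt0.
  move: (n.+1%:R^-1 : R) n0 => e n0.
  have [cd|dc] := ltP (a + e) (b - e); first by apply: h; lra.
  apply: aeW => x; rewrite in_itv/= => /andP[h1 h2].
  by have := lt_trans h1 h2; rewrite ltNge dc.
apply: aeS => x H; rewrite in_itv/= => /andP[ax xb].
have [n nn] : exists n : nat, n.+1%:R^-1 < Num.min (x - a) (b - x).
  have m0 : 0 < Num.min (x - a) (b - x) by rewrite lt_min !subr_gt0 ax.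
  exists (Num.truncn (Num.min (x - a) (b - x))^-1).
  by rewrite invf_plt ?posrE// truncnS_gt.
apply: (H n); rewrite in_itv/=; move: nn; rewrite lt_min => /andP[].
move: (n.+1%:R^-1 : R) => e h1 h2.
by apply/andP; split; lra.
Qed.

Lemma locally_integrable_cint a b c d f : locally_integrable `]a, b[ f -> a < c -> d < b -> cint c d f.
Proof.
move=> [mf _ lf] ac db.
have sub : (`[c, d] : set R) `<=` `]a, b[.
  by move=> x /=; rewrite !in_itv/= => /andP[cx xd]; apply/andP; split; lra.
apply/integrableP; split; first by apply/measurable_EFinP; apply: measurable_funS mf.
by apply: lf => //; exact: segment_compact.
Qed.

Lemma test_prim a b phi : test_function a b phi -> cint a b (derive1 phi) /\ prim a b phi (derive1 phi).
Proof.
move=> [dphi cphi _].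
have ci x y : cint x y (derive1 phi).
  apply: continuous_compact_integrable; first exact: segment_compact.
  exact: continuous_subspaceT.
split => // x y _ xy _; case: (ltgtP x y) xy => // [xy _|-> _]; last by rewrite subrr oint_nil.
have := @continuous_FTC2 R (derive1 phi) phi x y xy.
rewrite /oint Rintegral_itv_obnd_cbnd; last exact: cint_oc (ci x y) _ _.
rewrite /Rintegral => ->; [by [] | | | by []].
- exact: continuous_subspaceT.
- have c z : {for z, continuous phi} by apply: differentiable_continuous; apply/derivable1_diffP; exact: dphi.
  split => [z _| |]; [exact: dphi| |].
  + by apply: cvg_at_right_filter; exact: c.
  + by apply: cvg_at_left_filter; exact: c.
Qed.

End DBR.


(** * Representatives of Sobolev functions *)

Section Hk.
Context {R : realType}.
Implicit Types (a b c d e h p q r s t x y z : R) (f g u F G : R -> R) (w : nat -> R -> R).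

Definition aeq a b f g := {ae mu, forall x, x \in `]a, b[ -> f x = g x}.

Lemma aeq_refl a b f : aeq a b f f. Proof. exact: aeW. Qed.

Lemma aeq_sym a b f g : aeq a b f g -> aeq a b g f.
Proof. by apply: aeS => x h /h. Qed.

Lemma aeq_trans a b f g F : aeq a b f g -> aeq a b g F -> aeq a b f F.
Proof. by apply: aeS2 => x h1 h2 xab; rewrite h1// h2. Qed.

Lemma ae_exists a b (P : R -> Prop) : a < b -> {ae mu, forall x, P x} ->
  exists2 x, x \in `]a, b[ & P x.
Proof.
move=> ab hP; apply: contrapT => hn.
have : {ae mu, forall x, x \notin `]a, b[}.
  by apply: aeS hP => x hx; apply/negP => xab; apply: hn; exists x.
move=> [N [mN N0 sN]].
have : (mu `]a, b[ <= mu N)%E.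
  apply: le_measure; rewrite ?inE//.
  by apply: subset_trans sN => x /= xab; rewrite xab.
by rewrite N0 lebesgue_measure_itv/= lte_fin ab -EFinD lee_fin; lra.
Qed.

Lemma cont_aeq a b F G : a < b -> {within `[a, b], continuous F} -> {within `[a, b], continuous G} ->
  aeq a b F G -> forall x, a <= x -> x <= b -> F x = G x.
Proof.
move=> ab cF cG FG x ax xb; apply/eqP/negPn/negP => nxy.
have e0 : 0 < `|F x - G x| by rewrite normr_gt0 subr_eq0.
have xab : `[a, b]%classic x by rewrite /= in_itv/= ax xb.
have : {within `[a, b], continuous (fun y => F y - G y)}.
  by move=> y; apply: cvgB; [exact: cF|exact: cG].
move=> /subspace_continuousP/(_ x xab)/cvgrPdist_lt/(_ _ e0).
rewrite near_withinE => /nbhs_ballP[r /= r0 hr].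
pose l := Num.max a (x - r); pose m := Num.min b (x + r).
have lm : l < m by rewrite /l /m gt_max !lt_min; apply/andP; split; apply/andP; split; lra.
have [y] := ae_exists lm FG.
rewrite in_itv/= /l /m gt_max lt_min => /andP[/andP[ay xy] /andP[yb yx]] hy.
have /hr/(_ _) : ball x r y by rewrite /ball/= ltr_norml; apply/andP; split; lra.
have yab : y \in `]a, b[ by rewrite in_itv/= ay yb.
rewrite /= in_itv/= !ltW// /from_subspace (hy yab) subrr subr0 ltxx => /(_ isT).
by [].
Qed.

Lemma Rint_aeq a b f g : measurable_fun `]a, b[ f -> measurable_fun `]a, b[ g -> aeq a b f g ->
  \int[mu]_(x in `]a, b[) f x = \int[mu]_(x in `]a, b[) g x.
Proof.
move=> mf mg fg; congr fine; apply: ae_eq_integral => //; try exact/measurable_EFinP.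
by apply: aeS fg => x h xab; rewrite h.
Qed.

Lemma cint_moo a b f : cint a b f -> measurable_fun `]a, b[ f.
Proof. by move/cint_oo => /integrableP[/measurable_EFinP]. Qed.

Lemma moo_cc a b f : measurable_fun `]a, b[ f -> measurable_fun `[a, b] f.
Proof. exact: (measurable_fun_itv_cc (b0 := false) (b1 := true)). Qed.

Lemma cint_aeq a b f g : measurable_fun `]a, b[ g -> aeq a b f g -> cint a b f -> cint a b g.
Proof.
move=> mg fg /cint_oo fi; apply/cint_oo; move: (fi) => /integrableP[mf foo].
apply/integrableP; split; first exact/measurable_EFinP.
rewrite (_ : (\int[mu]_(x in `]a, b[) `|(EFin \o g) x| = \int[mu]_(x in `]a, b[) `|(EFin \o f) x|)%E)//.
apply: ae_eq_integral => //; [by do 2 apply: measurableT_comp => //|exact: measurableT_comp|].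
by apply: aeS fg => x h xab; rewrite /= h.
Qed.

Lemma oint_oo a b f : cint a b f -> oint f a b = \int[mu]_(x in `]a, b[) f x.
Proof.
move=> fi; rewrite /oint Rintegral_itv_bndo_bndc//.
by apply/cint_oo.
Qed.

Lemma oint_aeq a b x y f g : cint a b f -> cint a b g -> aeq a b f g -> a <= x -> y <= b ->
  oint f x y = oint g x y.
Proof.
move=> fi gi fg ax yb.
have fi' := cintS fi ax yb; have gi' := cintS gi ax yb.
rewrite !oint_oo//; apply: Rint_aeq; try exact: cint_moo.
apply: aeS fg => t + txy; apply; move: txy; rewrite !in_itv/= => /andP[xt ty].
by rewrite (le_lt_trans ax)// (lt_le_trans ty).
Qed.

Lemma oint_prim a b f c : cint a b f -> prim a b (fun x => c + oint f a x) f.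
Proof.
move=> fi x y ax xy yb; rewrite (@oint_cat _ a b f a x y)//; ring.
Qed.

Lemma test0 a b phi x : test_function a b phi -> x \notin `]a, b[ -> phi x = 0.
Proof.
move=> [_ _ [c [d [ac db h]]]] hx; apply: h; apply: contra hx.
by rewrite !in_itv/= => /andP[cx xd]; rewrite (lt_le_trans ac cx) (le_lt_trans xd db).
Qed.

Lemma test_cont a b phi : test_function a b phi -> continuous phi.
Proof.
by move=> [dphi _ _] x; apply: differentiable_continuous; apply/derivable1_diffP; exact: dphi.
Qed.

Lemma test_parts a b F f phi : a < b -> cint a b f -> prim a b F f -> test_function a b phi ->
  \int[mu]_(x in `]a, b[) (F x * derive1 phi x) = - \int[mu]_(x in `]a, b[) (f x * phi x).
Proof.
move=> ab fi Ff tphi; have [ci pp] := test_prim tphi.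
have cF := prim_cont fi Ff.
have cphi : {within `[a, b], continuous phi} by apply: continuous_subspaceT; exact: test_cont tphi.
have := by_parts (ltW ab) fi ci Ff pp.
rewrite !(test0 tphi) ?in_itv/= ?ltxx ?andbF// !mulr0 subrr sub0r.
rewrite !oint_oo; [|exact: cint_cM|exact: cint_cM].
under [X in _ = - X]eq_Rintegral do rewrite mulrC.
by move=> ->; rewrite opprK.
Qed.

Lemma prim_weak a b u F f : a < b -> measurable_fun `]a, b[ u -> aeq a b u F ->
  cint a b f -> prim a b F f -> weak_derivative a b u f.
Proof.
move=> ab mu_ uF fi Ff; split.
  by apply: open_integrable_locally; [exact: interval_open|exact/cint_oo].
move=> phi tphi; rewrite -(test_parts ab fi Ff tphi).
have cF := prim_cont fi Ff.
have mphi : measurable_fun `]a, b[ (derive1 phi).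
  by apply: measurable_funTS; apply: continuous_measurable_fun; case: tphi.
apply: Rint_aeq; [exact: measurable_funM| |].
  apply: measurable_funM => //; apply: cint_moo.
  apply: continuous_compact_integrable => //; exact: segment_compact.
by apply: aeS uF => x h xab; rewrite h.
Qed.

Lemma test_sub a b c d phi : a <= c -> d <= b -> test_function c d phi -> test_function a b phi.
Proof.
move=> ac db [h1 h2 [p [q [cp qd h3]]]]; split => //; exists p, q; split => //; lra.
Qed.

Lemma test_int a b c d phi g : a <= c -> d <= b -> test_function c d phi ->
  \int[mu]_(x in `]a, b[) (g x * phi x) = \int[mu]_(x in `]c, d[) (g x * phi x).
Proof.
move=> ac db tphi; rewrite Rintegral_mkcond [RHS]Rintegral_mkcond; apply: eq_Rintegral => x _.
rewrite !patchE; case: (boolP (x \in `]c, d[)) => hx.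
  rewrite [in RHS]mem_set// mem_set//= in_itv/=; move: hx; rewrite in_itv/= => /andP[cx xd].
  by apply/andP; split; lra.
rewrite [in RHS]memNset//; last by apply/negP.
by case: ifP => // _; rewrite (test0 tphi)// mulr0.
Qed.

(** On a smaller interval a primitive of [g1 - g2] is orthogonal to all derivatives of test
    functions, hence constant by [du_bois_reymond]; then [g1 - g2] has zero integral over every
    subinterval. *)
Lemma weak_unique a b u g1 g2 : weak_derivative a b u g1 -> weak_derivative a b u g2 ->
  aeq a b g1 g2.
Proof.
move=> [l1 h1] [l2 h2]; apply: (@ae_open_cover _ a b (fun x => g1 x = g2 x)) => c d ac cd db.
have i1 := locally_integrable_cint l1 ac db; have i2 := locally_integrable_cint l2 ac db.
have i12 := cintB i1 i2; set h := (fun x => g1 x - g2 x) in i12.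
have ph := oint_prim 0 i12; set G := (fun x => _) in ph.
have cG := prim_cont i12 ph.
have ciG : cint c d G by apply: continuous_compact_integrable => //; exact: segment_compact.
have H phi : test_function c d phi -> \int[mu]_(x in `]c, d[) (G x * derive1 phi x) = 0.
  move=> tphi; rewrite (test_parts cd i12 ph tphi) /h.
  have cphi : {within `[c, d], continuous phi}.
    by apply: continuous_subspaceT; exact: test_cont tphi.
  under eq_Rintegral do rewrite mulrBl.
  rewrite RintegralB//; [|by apply/cint_oo; exact: cint_cM|by apply/cint_oo; exact: cint_cM].
  have tphi' := test_sub (ltW ac) (ltW db) tphi.
  have := h1 _ tphi'; rewrite (h2 _ tphi') !(@test_int a b c d)//; [|exact: ltW..].
  by move=> /oppr_inj ->; rewrite subrr oppr0.
have [k hk] := du_bois_reymond cd ciG H.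
have Gk x : c <= x -> x <= d -> G x = k.
  move=> cx xd; apply: (@cont_aeq c d G (cst k)) => //.
  by apply: continuous_subspaceT => y; exact: cvg_cst.
have /(ae_eq0_oint i12) : forall x y, c < x -> x < y -> y < d -> oint h x y = 0.
  move=> x y cx xy yd; rewrite -ph ?ltW// !Gk ?subrr//; lra.
by apply: aeS => x hx xcd; apply/eqP; rewrite -subr_eq0; apply/eqP; exact: hx.
Qed.

Lemma weak_prim a b u g : a < b -> cint a b u -> cint a b g -> weak_derivative a b u g ->
  exists c, aeq a b u (fun x => c + oint g a x).
Proof.
move=> ab ui gi [_ h].
have pg := oint_prim 0 gi; have cg := prim_cont gi pg.
have ciG : cint a b (fun x => 0 + oint g a x).
  apply: continuous_compact_integrable => //; exact: segment_compact.
have [phi tphi|c hc] := du_bois_reymond ab (cintB ui ciG).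
  have [ci _] := test_prim tphi.
  have cd : {within `[a, b], continuous (derive1 phi)}.
    by apply: continuous_subspaceT; case: tphi.
  under eq_Rintegral do rewrite mulrBl.
  rewrite RintegralB//; [|by apply/cint_oo; exact: cint_cM..].
  by rewrite h// (test_parts ab gi pg tphi) subrr.
exists c; apply: aeS hc => x h' xab; have := h' xab; rewrite add0r => /eqP; rewrite subr_eq => /eqP.
by [].
Qed.

Lemma L2_cint a b u : L2 a b u -> cint a b u /\ cint a b (fun x => u x ^+ 2).
Proof.
move=> [mu_ /cint_oo u2]; split => //.
apply: (@cint_le _ _ _ _ (fun x => 1 + u x ^+ 2)).
- exact: moo_cc.
- move=> x _ _; rewrite [leRHS]ger0_norm; last by rewrite addr_ge0// sqr_ge0.
  rewrite -[u x ^+ 2]real_normK ?num_real//.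
  have := sqr_ge0 (`|u x| - 1); have := normr_ge0 (u x); nra.
- by apply: cintD => //; exact: cint_cst.
Qed.

Lemma cint_L2 a b u : measurable_fun `]a, b[ u -> cint a b (fun x => u x ^+ 2) -> L2 a b u.
Proof. by move=> mu_ u2; split => //; apply/cint_oo. Qed.

Lemma L2_aeq a b u v : measurable_fun `]a, b[ v -> aeq a b u v -> L2 a b u -> L2 a b v.
Proof.
move=> mv uv /L2_cint[_ u2]; apply: cint_L2 => //.
apply: cint_aeq u2; first exact: measurable_funX.
by apply: aeS uv => x h xab; rewrite h.
Qed.

Lemma L2_cont a b F : {within `[a, b], continuous F} -> L2 a b F.
Proof.
move=> cF.
have ci : cint a b F by apply: continuous_compact_integrable => //; exact: segment_compact.
apply: cint_L2; first exact: cint_moo.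
by under eq_fun do rewrite expr2; exact: cint_cM.
Qed.

(* [w l] is the [l]-th derivative of an H^k function: absolutely continuous for
   [l < k], and merely square integrable for [l = k]. *)
Definition rep a b k w :=
  [/\ forall l, (l < k)%N -> prim a b (w l) (w l.+1),
      forall l, (l <= k)%N -> cint a b (w l) & cint a b (fun x => w k x ^+ 2)].

Lemma rep_cont a b k w l : rep a b k w -> (l < k)%N -> {within `[a, b], continuous (w l)}.
Proof. by move=> [h1 h2 _] lk; apply: (prim_cont (f := w l.+1)); [exact: h2|exact: h1]. Qed.

Lemma rep_L2 a b k w l : rep a b k w -> (l <= k)%N -> L2 a b (w l).
Proof.
move=> rw; rewrite leq_eqVlt => /predU1P[->|lk]; last by apply: L2_cont; exact: rep_cont rw lk.
by case: rw => _ h1 h2; apply: cint_L2 => //; apply: cint_moo; exact: h1.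
Qed.

Lemma repS a b k w : rep a b k.+1 w -> rep a b k (fun l => w l.+1).
Proof. by move=> [h1 h2 h3]; split=> // l lk; [exact: h1|exact: h2]. Qed.

(** [wderiv] picks some weak derivative. Uniqueness makes the choice immaterial up to null sets, and
    the induction carries this through the iteration. *)
Lemma rep_wderivn a b k w u : a < b -> rep a b k w -> measurable_fun `]a, b[ u -> aeq a b u (w 0) ->
  forall l, (l <= k)%N -> measurable_fun `]a, b[ (wderivn a b l u) /\ aeq a b (wderivn a b l u) (w l).
Proof.
move=> ab [h1 h2 h3] mu_ u0; elim=> [//|l IH lk].
have [ml el] := IH (ltnW lk).
have wd := prim_weak ab ml el (h2 _ lk) (h1 _ lk).
have wd' : weak_derivative a b (wderivn a b l u) (wderiv a b (wderivn a b l u)).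
  exact: (xgetPex (fun=> 0) (ex_intro _ _ wd)).
split; last exact: weak_unique wd' wd.
by case: wd' => -[].
Qed.

Lemma Hk_L2 a b k u : Hk a b k u -> L2 a b u.
Proof. by case: k => [//|k] []. Qed.

Lemma rep_Hk a b k w u : a < b -> rep a b k w -> measurable_fun `]a, b[ u -> aeq a b u (w 0) -> Hk a b k u.
Proof.
move=> ab; elim: k w u => [|k IH] w u rw mu_ uw.
  by apply: (L2_aeq mu_ (aeq_sym uw)); exact: rep_L2 rw _.
split; first by apply: (L2_aeq mu_ (aeq_sym uw)); exact: rep_L2 rw _.
exists (w 1%N).
  by case: (rw) => h1 h2 _; apply: (prim_weak (F := w 0)) => //; [exact: h2|exact: h1].
apply: IH (repS rw) _ _; last exact: aeq_refl.
by apply: cint_moo; case: rw => _ h2 _; exact: h2.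
Qed.

Lemma Hk_rep a b k u : a < b -> Hk a b k u -> exists w, rep a b k w /\ aeq a b u (w 0).
Proof.
move=> ab; elim: k u => [|k IH] u /=.
  move=> /L2_cint[u1 u2]; exists (fun=> u); split; last exact: aeq_refl.
  by split.
move=> [L2u [g wg Hg]].
have [w [rw gw]] := IH _ Hg.
have [ui _] := L2_cint L2u; have [gi _] := L2_cint (Hk_L2 Hg).
have [c uc] := weak_prim ab ui gi wg.
have w0i : cint a b (w 0) by case: rw => _ h _; exact: h.
have pw := oint_prim c w0i.
exists (fun l => if l is l'.+1 then w l' else (fun x => c + oint (w 0) a x)); split.
  case: rw => h1 h2 h3; split => //.
    by case=> [|l] lk //; exact: h1.
  case=> [|l] lk; last exact: h2.
  apply: continuous_compact_integrable; first exact: segment_compact.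
  exact: prim_cont pw.
apply: aeS uc => x hx xab; rewrite hx//; congr (_ + _).
apply: oint_aeq gi w0i gw _ _ => //.
by move: xab; rewrite in_itv/= => /andP[_ /ltW].
Qed.

End Hk.


(** * Transition polynomials *)

Section Cauchy_Schwarz.
Context {R : realType}.
Implicit Types (a b c d e h x y t : R) (f g : R -> R).

Lemma cint_mul2 a b f g : measurable_fun `[a, b] f -> measurable_fun `[a, b] g ->
  cint a b (fun x => f x ^+ 2) -> cint a b (fun x => g x ^+ 2) -> cint a b (fun x => f x * g x).
Proof.
move=> mf mg f2 g2; apply: (@cint_le _ _ _ _ (fun x => f x ^+ 2 + g x ^+ 2)).
- exact: measurable_funM.
- move=> x _ _; rewrite [leRHS]ger0_norm ?addr_ge0 ?sqr_ge0// normrM.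
  rewrite -[f x ^+ 2]real_normK ?num_real// -[g x ^+ 2]real_normK ?num_real//.
  have := sqr_ge0 (`|f x| - `|g x|); have := normr_ge0 (f x); have := normr_ge0 (g x); nra.
- exact: cintD.
Qed.

Lemma oint_CS a b f g : a <= b -> measurable_fun `[a, b] f -> measurable_fun `[a, b] g ->
  cint a b (fun x => f x ^+ 2) -> cint a b (fun x => g x ^+ 2) ->
  (oint (fun x => f x * g x) a b) ^+ 2 <= oint (fun x => f x ^+ 2) a b * oint (fun x => g x ^+ 2) a b.
Proof.
move=> ab mf mg f2 g2; have fg := cint_mul2 mf mg f2 g2.
set A := oint (fun x => f x ^+ 2) a b; set B := oint _ a b; set C := oint (fun x => g x ^+ 2) a b.
have A0 : 0 <= A by apply: oint_ge0 => t _ _; exact: sqr_ge0.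
have H t : 0 <= t ^+ 2 * A + 2 * t * B + C.
  have -> : t ^+ 2 * A + 2 * t * B + C = oint (fun x => (t * f x + g x) ^+ 2) a b.
    rewrite -(@ointZ _ a b)// -(@ointZ _ a b)// -(@ointD _ a b)//; [|exact: cintZ..].
    rewrite -(@ointD _ a b)//; last by apply: cintD; exact: cintZ.
    by apply: eq_oint => x _ _; ring.
  by apply: oint_ge0 => x _ _; exact: sqr_ge0.
have [A0'|A0'] := eqVneq A 0.
  have [B0|nB] := eqVneq B 0; first by rewrite B0 A0' mul0r expr0n.
  (* For [A = 0] the quadratic in [t] is affine, and this value of [t] makes it equal to -1. *)
  have := H (- (C + 1) / (2 * B)).
  rewrite A0' mulr0 add0r.
  have -> : 2 * (- (C + 1) / (2 * B)) * B + C = -1 by field.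
  by rewrite ler0N1.
have Ap : 0 < A by rewrite lt_neqAle eq_sym A0'.
(* The minimiser of the quadratic in [t]. *)
have := H (- B / A).
have -> : (- B / A) ^+ 2 * A + 2 * (- B / A) * B + C = (A * C - B ^+ 2) / A by field.
by rewrite pmulr_lge0 ?invr_gt0// subr_ge0.
Qed.

Lemma oint_CS1 a b f : a <= b -> measurable_fun `[a, b] f -> cint a b (fun x => f x ^+ 2) ->
  (oint f a b) ^+ 2 <= (b - a) * oint (fun x => f x ^+ 2) a b.
Proof.
move=> ab mf f2; have := @oint_CS a b f (cst 1) ab mf.
rewrite (_ : (fun x => f x * cst 1 x) = f); last by apply/funext => x; rewrite mulr1.
rewrite (_ : (fun x => cst 1 x ^+ 2) = (fun=> 1)); last by apply/funext => x; rewrite expr1n.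
by rewrite oint_cst// mul1r mulrC; apply => //; exact: cint_cst.
Qed.

End Cauchy_Schwarz.

(** * The optimal profile and the duality identity *)

Section CellPoly.
Context {R : realType}.
Implicit Types (a b c x y : R) (p q r : {poly R}).

Lemma horner_within p a b : {within `[a, b], continuous (horner p)}.
Proof. by apply: continuous_subspaceT; exact: continuous_horner. Qed.

Lemma horner_cint p a b : cint a b (horner p).
Proof.
by apply: continuous_compact_integrable; [exact: segment_compact|exact: horner_within].
Qed.

Lemma horner_prim p a b : prim a b (horner p) (horner p^`()).
Proof.
move=> x y _ xy _; case: (ltgtP x y) xy => // [xy _|-> _]; last by rewrite subrr oint_nil.
have := @continuous_FTC2 R (horner p^`()) (horner p) x y xy (@horner_within _ _ _).
rewrite /oint Rintegral_itv_obnd_cbnd; last exact: cint_oc (horner_cint _ x y) _ _.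
rewrite /Rintegral => ->; [by []| |].
- split => [z _| |].
  + exact: derivable_horner.
  + by apply: cvg_at_right_filter; exact: continuous_horner.
  + by apply: cvg_at_left_filter; exact: continuous_horner.
- by move=> z _; rewrite derive1E; apply: derive_val.
Qed.

Lemma derivn_scale p c a l : (p \Po (c *: ('X - a%:P)))^`(l) = c ^+ l *: (p^`(l) \Po (c *: ('X - a%:P))).
Proof.
elim: l => [|l IH]; first by rewrite expr0 scale1r.
rewrite derivnS IH derivZ deriv_comp derivZ derivB derivX derivC subr0 -derivnS.
by rewrite -scalerAr mulr1 scalerA exprSr.
Qed.

Lemma derivn_root m c q r j : q = r * ('X - c%:P) ^+ m -> (j < m)%N -> q^`(j).[c] = 0.
Proof.
elim: j m q r => [|j IH] [|m] // q r -> jm.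
  by rewrite derivn0 hornerM horner_exp !hornerE subrr expr0n mulr0.
rewrite derivSn; apply: (IH m _ (r^`() * ('X - c%:P) + (r *+ m.+1))) => //.
rewrite derivM deriv_exp derivB derivX derivC subr0 mul1r /= exprS.
ring.
Qed.

(** At index 0 the division by zero yields 0: this is the primitive that vanishes at 0. *)
Definition antideriv p := \poly_(i < (size p).+1) (p`_i.-1 / i%:R).

Lemma deriv_antideriv p : (antideriv p)^`() = p.
Proof.
apply/polyP => i; rewrite coef_deriv coef_poly ltnS /=.
case: ltnP => h; last by rewrite mul0rn nth_default.
by rewrite -[RHS](@mulfVK _ i.+1%:R) ?pnatr_eq0// mulr_natr.
Qed.

Lemma size_antideriv p : (size (antideriv p) <= (size p).+1)%N.
Proof. exact: size_poly. Qed.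

(* The optimal profile is the normalized primitive of [x ^ (k - 1) (1 - x) ^ (k - 1)]. *)
Definition transition (k : nat) p :=
  [/\ p.[0] = 0, p.[1] = 1, (size p <= 2 * k)%N &
    forall l, (1 <= l < k)%N -> p^`(l).[0] = 0 /\ p^`(l).[1] = 0].

(** The bound [2 * k] on the size says that the derivative of order [2k] vanishes, which is the
    Euler-Lagrange equation of the cell problem. The zeros of order [k - 1] of [q] at 0 and 1 give
    the vanishing end derivatives of its primitive. *)
Lemma transition_exists k : (0 < k)%N -> exists p, transition k p /\
   forall x, 0 <= x -> x <= 1 -> 0 <= p.[x] <= 1.
Proof.
case: k => // m _.
pose q : {poly R} := 'X ^+ m * (1 - 'X) ^+ m.
have q0 x : 0 <= x -> x <= 1 -> 0 <= q.[x].
  move=> x0 x1; rewrite /q hornerM !horner_exp !hornerE; apply: mulr_ge0; apply: exprn_ge0 => //.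
  by rewrite subr_ge0.
pose Q := antideriv q.
have pQ := @horner_prim Q 0 1; rewrite deriv_antideriv in pQ.
have mono x y : 0 <= x -> x <= y -> y <= 1 -> Q.[x] <= Q.[y].
  move=> x0 xy y1; rewrite -subr_ge0 pQ//; apply: oint_ge0 => t xt ty; apply: q0; lra.
(* Only [[1/4, 1/2]] is kept, where [x] is at least 1/4 and [1 - x] at least 1/2. *)
have Qp : 0 < Q.[1] - Q.[0].
  rewrite pQ ?lexx ?ler01//.
  have ci := horner_cint q 0 1.
  rewrite (@oint_cat _ 0 1 _ _ (4^-1))//; [|lra..].
  rewrite (@oint_cat _ 0 1 _ _ (2^-1) 1)//; [|lra..].
  rewrite ltr_wpDl//; first by apply: oint_ge0 => t *; apply: q0; lra.
  rewrite ltr_pwDl//; last by apply: oint_ge0 => t *; apply: q0; lra.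
  apply: (@lt_le_trans _ _ (oint (fun=> 4^-1 ^+ m * 2^-1 ^+ m) (4^-1) (2^-1))).
    rewrite oint_cst; last lra.
    apply: mulr_gt0; last lra.
    by apply: mulr_gt0; apply: exprn_gt0; lra.
  apply: (@le_oint _ 0 1); [lra|lra|exact: cint_cst|exact: ci|].
  move=> t t1 t2; rewrite /q hornerM !horner_exp !hornerE.
  by apply: ler_pM; rewrite ?exprn_ge0//; apply: lerXn2r; rewrite ?nnegrE; lra.
set N := Q.[1] - Q.[0] in Qp.
exists (N^-1 *: (Q - Q.[0]%:P)); split; [split|].
- by rewrite !hornerE subrr mulr0.
- by rewrite !hornerE mulVf// gt_eqF.
- apply: (leq_trans (size_scale_leq _ _)).
  apply: (leq_trans (size_polyD _ _)); rewrite geq_max size_polyN; apply/andP; split; last first.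
    by apply: (leq_trans (size_polyC_leq1 _)).
  apply: (leq_trans (size_antideriv _)); rewrite mulnS ltnS.
  apply: (leq_trans (size_polyMleq _ _)).
  rewrite size_polyXn addSn /= addnC.
  apply: (leq_trans (leq_add (size_poly_exp_leq _ _) (leqnn _))).
  rewrite -opprB size_polyN size_XsubC /=; lia.
- case=> // l lm.
  have E : (N^-1 *: (Q - Q.[0]%:P))^`(l.+1) = N^-1 *: q^`(l).
    by rewrite derivSn derivZ derivB deriv_antideriv derivC subr0 derivnZ.
  rewrite E !hornerZ (@derivn_root m 0 q ((1 - 'X) ^+ m)) ?(@derivn_root m 1 q ((-1) ^+ m * 'X ^+ m)) ?mulr0//.
    have X1 : 1 - 'X = (-1) * ('X - 1%:P) :> {poly R} by rewrite mulN1r opprB.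
    by rewrite /q X1 exprMn mulrCA mulrA.
  by rewrite /q subr0 mulrC.
- move=> x x0 x1; rewrite !hornerE.
  have h1 := mono _ _ (lexx 0) x0 x1; have h2 := mono _ _ x0 x1 (lexx 1).
  rewrite mulr_ge0 ?invr_ge0 ?(ltW Qp) ?subr_ge0//=.
  by rewrite mulrC ler_pdivrMr// mul1r /N lerD2r.
Qed.

(* [p] carried from [0, 1] to [a, b] *)
Definition stretch a b p := p \Po ((b - a)^-1 *: ('X - a%:P)).

Lemma stretch_derivn a b p l x : (stretch a b p)^`(l).[x] = (b - a)^-1 ^+ l * p^`(l).[(b - a)^-1 * (x - a)].
Proof. by rewrite /stretch derivn_scale hornerZ horner_comp !hornerE. Qed.

Lemma stretch_l a b p l : (stretch a b p)^`(l).[a] = (b - a)^-1 ^+ l * p^`(l).[0].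
Proof. by rewrite stretch_derivn subrr mulr0. Qed.

Lemma stretch_r a b p l : a < b -> (stretch a b p)^`(l).[b] = (b - a)^-1 ^+ l * p^`(l).[1].
Proof. by move=> ab; rewrite stretch_derivn mulVf// gt_eqF// subr_gt0. Qed.

(** For a transition [p] this is the least [k]-th order energy of a unit transition on [[0, 1]]; on
    an interval of length [L] it is divided by [L^(2k-1)]. *)
Definition alpha k p := oint (fun x => p^`(k).[x] ^+ 2) 0 1.

(** The change of variables is read off the end values of the stretched primitive of the squared
    [k]-th derivative. *)
Lemma stretch_energy a b p k : a < b ->
  oint (fun x => (stretch a b p)^`(k).[x] ^+ 2) a b = (b - a)^-1 ^+ (2 * k) * (b - a) * alpha k p.
Proof.
move=> ab; pose r := p^`(k) ^+ 2; pose S := antideriv r.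
have -> : alpha k p = S.[1] - S.[0].
  have := @horner_prim S 0 1; rewrite deriv_antideriv => -> //.
  by apply: eq_oint => x _ _; rewrite /r horner_exp.
have ba : b - a != 0 by rewrite gt_eqF// subr_gt0.
have := @horner_prim (stretch a b S) a b a b (lexx _) (ltW ab) (lexx _).
have e0 := stretch_l a b S 0; have e1 := stretch_r S 0 ab.
rewrite !expr0 !mul1r !derivn0 in e0 e1; rewrite e0 e1 => ->.
rewrite -(@ointZ _ a b)//; last exact: horner_cint.
apply: eq_oint => x _ _; rewrite stretch_derivn.
rewrite -[(stretch a b S)^`()]derivn1 stretch_derivn derivn1 deriv_antideriv /r horner_exp expr1.
rewrite mulrA mulfK// exprMn -exprM mulnC//.
Qed.

Lemma stretch_rep a b p k : rep a b k (fun l x => (stretch a b p)^`(l).[x]).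
Proof.
split=> [l _|l _|]; [|exact: horner_cint|].
  by rewrite derivnS; exact: horner_prim.
have -> : (fun x => (stretch a b p)^`(k).[x] ^+ 2) = horner ((stretch a b p)^`(k) ^+ 2).
  by apply/funext => x; rewrite horner_exp.
exact: horner_cint.
Qed.

Lemma iter_parts a b k w q n : a <= b -> rep a b k w -> (n <= k)%N ->
  oint (fun x => w k x * q.[x]) a b =
  \sum_(j < n) (-1) ^+ j * (w (k - j.+1)%N b * q^`(j).[b] - w (k - j.+1)%N a * q^`(j).[a]) +
  (-1) ^+ n * oint (fun x => w (k - n)%N x * q^`(n).[x]) a b.
Proof.
move=> ab [h1 h2 h3]; elim: n => [|n IH] nk.
  by rewrite big_ord0 add0r expr0 mul1r subn0 derivn0.
rewrite IH; last exact: ltnW.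
rewrite big_ord_recr/= -addrA; congr (_ + _).
have E : (k - n = (k - n.+1).+1)%N by lia.
have pw : prim a b (w (k - n.+1)%N) (w (k - n)%N) by rewrite E; apply: h1; lia.
have pq := @horner_prim q^`(n) a b.
rewrite (by_parts ab _ _ pw pq); [|by apply: h2; lia|exact: horner_cint].
rewrite -derivnS (@eq_oint _ _ _ _ (fun x => w (k - n.+1)%N x * q^`(n.+1).[x])); last first.
  by move=> x _ _; rewrite mulrC.
by rewrite exprS; ring.
Qed.

Lemma poly_const (q : {poly R}) m x : (size q <= m.+1)%N -> q^`(m).[x] = q^`(m).[0].
Proof.
move=> sq; have : (size q^`(m) <= 1)%N.
  apply/leq_sizeP => j j1; rewrite coef_derivn nth_default ?mul0rn//.
  by apply: (leq_trans sq); lia.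
by move=> /size1_polyC ->; rewrite !hornerC.
Qed.

Lemma size_stretch a b p : (size (stretch a b p) <= size p)%N.
Proof.
rewrite /stretch; have [->|p0] := eqVneq p 0; first by rewrite comp_poly0 size_poly0.
have := size_comp_poly_leq p ((b - a)^-1 *: ('X - a%:P)).
have h : ((size ((b - a)^-1 *: ('X - a%:P))).-1 <= 1)%N.
  have := size_scale_leq (b - a)^-1 ('X - a%:P); rewrite size_XsubC.
  by case: (size _) => [|[|[|n]]].
have s0 : (0 < size p)%N by rewrite size_poly_gt0.
move=> /leq_trans; apply; rewrite -[leqRHS](prednK s0) ltnS -[leqRHS]muln1.
by rewrite leq_mul.
Qed.

(* The duality behind the cell problem: integrating [w_k] against the [k]-th
   derivative of the optimal profile only sees the increment of [w_0] and the
   boundary values of the intermediate derivatives. *)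
Lemma transition_parts a b k p w : (0 < k)%N -> a < b -> transition k p -> rep a b k w ->
  (b - a)^-1 ^+ (2 * k) * (b - a) * alpha k p * (w 0%N b - w 0%N a) =
  oint (fun x => w k x * (stretch a b p)^`(k).[x]) a b -
  \sum_(j < k.-1) (-1) ^+ j * (w (k - j.+1)%N b * (stretch a b p)^`(k + j).[b] -
                              w (k - j.+1)%N a * (stretch a b p)^`(k + j).[a]).
Proof.
case: k => // m _ ab [p0 p1 sp pl] rw; set P := stretch a b p.
have dd n j : P^`(n)^`(j) = P^`(n + j) by rewrite addnC /derivn iterD.
(* After [k - 1] integrations by parts the derivative of order [2k - 1] of [P] appears, a constant.
   The formula is used twice: with [v] the profile itself it expresses that constant by the energy
   of the profile, and with [v := w] it gives the claim. *)
have kap v : rep a b m.+1 v ->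
   oint (fun x => v m.+1 x * P^`(m.+1).[x]) a b =
   \sum_(j < m) (-1) ^+ j * (v (m.+1 - j.+1)%N b * P^`(m.+1 + j).[b] - v (m.+1 - j.+1)%N a * P^`(m.+1 + j).[a])
   + (-1) ^+ m * P^`(m.+1 + m).[0] * (v 0%N b - v 0%N a).
  move=> rv; rewrite (@iter_parts a b m.+1 v _ m (ltW ab) rv) ?leqnSn//.
  under eq_bigr do rewrite !dd.
  congr (_ + _); rewrite dd subSnn -mulrA; congr (_ * _).
  case: rv => h1 h2 _; rewrite (h1 0%N)// ?(ltW ab)// -(@ointZ _ a b)//; last exact: h2.
  apply: eq_oint => x _ _; rewrite mulrC; congr (_ * _); apply: poly_const.
  by apply: (leq_trans (size_stretch _ _ _)); apply: (leq_trans sp); lia.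
have := kap _ (@stretch_rep a b p m.+1).
rewrite (@eq_oint _ _ _ _ (fun x => P^`(m.+1).[x] ^+ 2)); last by move=> x _ _; rewrite expr2.
rewrite (stretch_energy p m.+1 ab) big1; last first.
  move=> j _; rewrite stretch_l (stretch_r _ _ ab).
  have [|-> ->] := pl (m.+1 - j.+1)%N; first by (case: j => j /= jm; lia).
  by rewrite !mulr0 !mul0r subrr mulr0.
have e0 := stretch_l a b p 0; have e1 := stretch_r p 0 ab.
rewrite !expr0 !mul1r !derivn0 p0 in e0; rewrite !expr0 !mul1r !derivn0 p1 in e1.
rewrite !derivn0 e0 e1 add0r subr0 mulr1 => ->.
by rewrite (kap _ rw) /=; ring.
Qed.

Lemma alpha_ge0 k p : 0 <= alpha k p.
Proof. by apply: oint_ge0 => t _ _; exact: sqr_ge0. Qed.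

(** If the energy vanished, the derivative of order [k - 1] would be constant; the end conditions
    then kill the derivatives one order after the other down to [p] itself, which would be constant
    although [p] goes from 0 to 1. *)
Lemma alpha_gt0 k p : (0 < k)%N -> transition k p -> 0 < alpha k p.
Proof.
move=> k0 tp; rewrite lt_neqAle alpha_ge0 andbT eq_sym; apply/eqP => a0.
have [p0 p1 _ pl] := tp.
have claim n : (n < k)%N -> forall x, 0 <= x -> x <= 1 -> p^`(k - n.+1).[x] = p^`(k - n.+1).[0].
  elim: n => [|n IH] nk x x0 x1.
    have E : k = (k - 1).+1 by lia.
    apply/eqP; rewrite -subr_eq0; apply/eqP.
    have pp := @horner_prim p^`(k - 1) 0 1.
    rewrite -derivnS -E in pp; rewrite (pp 0 x)//.
    have mq : measurable_fun `[0, x] (horner p^`(k)) by apply: cint_meas; exact: horner_cint.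
    have iq y z : cint y z (fun t => p^`(k).[t] ^+ 2).
      have := horner_cint (p^`(k) ^+ 2) y z; congr (cint _ _ _).
      by apply/funext => t; rewrite horner_exp.
    have := oint_CS1 x0 mq (iq _ _).
    have : oint (fun t => p^`(k).[t] ^+ 2) 0 x = 0.
      have h0 := a0; rewrite /alpha (@oint_cat _ 0 1 _ 0 x 1)// in h0.
      have h1 : 0 <= oint (fun t => p^`(k).[t] ^+ 2) 0 x by apply: oint_ge0 => t _ _; exact: sqr_ge0.
      have h2 : 0 <= oint (fun t => p^`(k).[t] ^+ 2) x 1 by apply: oint_ge0 => t _ _; exact: sqr_ge0.
      lra.
    move=> ->; rewrite mulr0 => h; apply/eqP; rewrite -sqrf_eq0 eq_le h; exact: sqr_ge0.
  have E : (k - n.+1 = (k - n.+2).+1)%N by lia.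
  apply/eqP; rewrite -subr_eq0; apply/eqP.
  have pp := @horner_prim p^`(k - n.+2) 0 1.
  rewrite -derivnS -E in pp; rewrite (pp 0 x)//.
  rewrite (@eq_oint _ _ _ _ (fun=> 0)) ?oint_cst ?mul0r// => t t0 tx.
  rewrite IH; [|by lia|lra|lra].
  by have [|-> _] := pl (k - n.+1)%N; first lia.
have := claim k.-1; rewrite prednK// subnn derivn0 leqnn => /(_ isT 1 ler01 (lexx _)).
by rewrite p0 p1 => /eqP; rewrite oner_eq0.
Qed.

End CellPoly.


(** * The cell problem *)

Section Cell.
Context {R : realType}.
Implicit Types (a b c x y T e : R) (p q r : {poly R}) (w : nat -> R -> R).

Lemma has_value_cont a b f G x : {within `[a, b], continuous G} -> aeq a b f G -> has_value a b f x (G x).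
Proof. by move=> cG fG; exists G; split => //; exact: aeq_sym. Qed.

Lemma has_value_unique a b f G x y : a < b -> {within `[a, b], continuous G} -> aeq a b f G ->
  a <= x -> x <= b -> has_value a b f x y -> G x = y.
Proof.
move=> ab cG fG ax xb [w [cw wf <-]]; apply: (cont_aeq ab cG cw) => //.
exact: aeq_trans (aeq_sym fG) (aeq_sym wf).
Qed.

Lemma rep_energy a b k w u : a < b -> rep a b k w -> measurable_fun `]a, b[ u -> aeq a b u (w 0%N) ->
  \int[mu]_(t in `]a, b[) (wderivn a b k u t ^+ 2) = oint (fun t => w k t ^+ 2) a b.
Proof.
move=> ab rw mu_ uw; have [mk ek] := rep_wderivn ab rw mu_ uw (leqnn k).
case: (rw) => _ h2 h3; rewrite oint_oo//; apply: Rint_aeq.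
- exact: measurable_funX.
- by apply: measurable_funX; apply: cint_moo; exact: h2.
- by apply: aeS ek => x h xab; rewrite h.
Qed.

(** The value of the cell problem of length [T], as [cell_minE] shows; thus [m_k] is the infimum of
    an explicit function of [T]. *)
Definition cost k p T := T + T^-1 ^+ (2 * k) * T * alpha k p.

Definition profile T p := stretch (- (T / 2)) (T / 2) p - (2^-1)%:P.

Lemma profile_derivn T p l : (0 < l)%N -> (profile T p)^`(l) = (stretch (- (T / 2)) (T / 2) p)^`(l).
Proof. by case: l => // l _; rewrite /profile !derivSn derivB derivC subr0. Qed.

Lemma poly_rep q a b k : rep a b k (fun l x => q^`(l).[x]).
Proof.
split=> [l _|l _|]; [|exact: horner_cint|].
  by rewrite derivnS; exact: horner_prim.
have -> : (fun x => q^`(k).[x] ^+ 2) = horner (q^`(k) ^+ 2) by apply/funext => x; rewrite horner_exp.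
exact: horner_cint.
Qed.

Lemma poly_meas q (D : set R) : measurable_fun D (horner q).
Proof. by apply: measurable_funTS; apply: continuous_measurable_fun; exact: continuous_horner. Qed.

Lemma profile_admissible k p T : (1 < k)%N -> transition k p -> 0 < T ->
  cell_admissible k T (horner (profile T p)) /\ cell_energy k T (horner (profile T p)) = cost k p T.
Proof.
move=> k1 [p0 p1 sp pl] T0.
have ab : - (T / 2) < T / 2 by lra.
have TT : T / 2 - - (T / 2) = T by lra.
have rw := poly_rep (profile T p) (- (T / 2)) (T / 2) k.
have mp := @poly_meas (profile T p) `]- (T / 2), T / 2[%classic.
have e0 : aeq (- (T / 2)) (T / 2) (horner (profile T p)) (horner (profile T p)^`(0)) by exact: aeq_refl.
have va : (profile T p).[- (T / 2)] = - (1 / 2).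
  have := stretch_l (- (T / 2)) (T / 2) p 0; rewrite !derivn0 expr0 mul1r p0 => h.
  by rewrite /profile hornerD h !hornerE; lra.
have vb : (profile T p).[T / 2] = 1 / 2.
  have := stretch_r p 0 ab; rewrite !derivn0 expr0 mul1r p1 => h.
  by rewrite /profile hornerD h !hornerE; lra.
split; last first.
  rewrite /cell_energy (rep_energy ab rw mp e0) /cost profile_derivn; last exact: ltnW.
  by rewrite stretch_energy// TT.
split.
- exact: rep_Hk ab rw mp e0.
- by rewrite -va; apply: has_value_cont; [exact: horner_within|exact: aeq_refl].
- by rewrite -vb; apply: has_value_cont; [exact: horner_within|exact: aeq_refl].
- move=> l /andP[l1 lk].
  have lk' : (l <= k)%N by lia.
  have [ml el] := rep_wderivn ab rw mp e0 lk'.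
  have [] := pl l; first lia.
  move=> d0 d1.
  have za : (profile T p)^`(l).[- (T / 2)] = 0 by rewrite profile_derivn// stretch_l d0 mulr0.
  have zb : (profile T p)^`(l).[T / 2] = 0 by rewrite profile_derivn// stretch_r// d1 mulr0.
  by split; [rewrite -za|rewrite -zb]; apply: has_value_cont => //; exact: horner_within.
Qed.

(** For an admissible [v] the boundary terms of [transition_parts] vanish and the increment is 1.
    With [A] the energy of the profile and [E] that of [v], Cauchy-Schwarz becomes [A^2 <= E A]. *)
Lemma cell_lower k p T v : (1 < k)%N -> transition k p -> 0 < T -> cell_admissible k T v ->
  cost k p T <= cell_energy k T v.
Proof.
move=> k1 tp T0 [Hv va vb vl].
have ab : - (T / 2) < T / 2 by lra.
have TT : T / 2 - - (T / 2) = T by lra.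
have [w [rw vw]] := Hk_rep ab Hv.
have mv : measurable_fun `]- (T / 2), T / 2[ v by case: (Hk_L2 Hv).
rewrite /cell_energy (rep_energy ab rw mv vw) /cost lerD2l.
have cw l : (l < k)%N -> {within `[- (T / 2), T / 2], continuous (w l)} by exact: rep_cont rw.
have k0 : (0 < k)%N by lia.
have w0a : w 0%N (- (T / 2)) = - (1 / 2).
  by apply: has_value_unique va => //; [exact: cw|exact: ltW].
have w0b : w 0%N (T / 2) = 1 / 2.
  by apply: has_value_unique vb => //; [exact: cw|exact: ltW].
have wl l : (1 <= l <= k.-1)%N -> w l (- (T / 2)) = 0 /\ w l (T / 2) = 0.
  move=> hl; have [ha hb] := vl l hl.
  have [_ el] := rep_wderivn ab rw mv vw (l := l) ltac:(lia).
  split; [apply: has_value_unique ha => //|apply: has_value_unique hb => //]; try exact: ltW.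
    apply: cw; lia.
  apply: cw; lia.
have := transition_parts k0 ab tp rw.
rewrite big1 ?subr0; last first.
  move=> [j jk] _ /=; have [|-> ->] := wl (k - j.+1)%N; first lia.
  by rewrite !mul0r subrr mulr0.
rewrite w0a w0b TT (_ : 1 / 2 - - (1 / 2) = 1); last lra.
rewrite mulr1; set A := _ * alpha k p => hA.
have A0 : 0 < A.
  by rewrite /A !mulr_gt0// ?exprn_gt0 ?invr_gt0//; exact: alpha_gt0.
case: rw => _ h2 h3.
have := @oint_CS _ _ _ (w k) (horner (stretch (- (T / 2)) (T / 2) p)^`(k)) (ltW ab).
rewrite -hA stretch_energy// TT -/A; set E := oint _ _ _ => H.
have : A ^+ 2 <= E * A.
  apply: H => //.
  - exact: cint_meas (h2 _ (leqnn k)).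
  - by apply: cint_meas; exact: horner_cint.
  - have := horner_cint ((stretch (- (T / 2)) (T / 2) p)^`(k) ^+ 2) (- (T / 2)) (T / 2).
    by congr (cint _ _ _); apply/funext => t; rewrite horner_exp.
by rewrite expr2 ler_pM2r.
Qed.

Lemma inf_min (S : set R) x : S x -> lbound S x -> inf S = x.
Proof.
move=> Sx lx; apply/eqP; rewrite eq_le; apply/andP; split.
  by apply: ge_inf => //; exists x.
by apply: lb_le_inf => //; exists x.
Qed.

Lemma cell_minE k p T : (1 < k)%N -> transition k p -> 0 < T -> cell_min k T = cost k p T.
Proof.
move=> k1 tp T0; have [ha he] := profile_admissible k1 tp T0.
apply: inf_min; first by exists (horner (profile T p)).
by move=> _ [v hv <-]; exact: cell_lower.
Qed.

(** For [T >= 1] the first term is at least 1. For [T < 1] the second is at least [alpha], its power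
    [1 - 2k] of [T] being negative. *)
Lemma cost_lb k p T : (1 < k)%N -> transition k p -> 0 < T -> Num.min 1 (alpha k p) <= cost k p T.
Proof.
move=> k1 tp T0; have a0 := @alpha_ge0 R k p.
have [T1|T1] := lerP 1 T.
  rewrite ge_min (le_trans T1)//.
  by rewrite lerDl !mulr_ge0// ?exprn_ge0// ?invr_ge0 ltW.
rewrite ge_min; apply/orP; right; rewrite /cost.
apply: (@le_trans _ _ (T^-1 ^+ (2 * k) * T * alpha k p)); last by rewrite lerDr ltW.
rewrite ler_peMl//.
have -> : (2 * k = (2 * k).-1.+1)%N by lia.
rewrite exprSr mulfVK ?gt_eqF//.
by rewrite exprn_ege1// -[leLHS]invr1 lef_pV2 ?posrE// ltW.
Qed.

Lemma m_has_inf k p : (1 < k)%N -> transition k p ->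
  lbound [set cell_min k T | T in [set T : R | 0 < T]] (Num.min 1 (alpha k p)).
Proof. by move=> k1 tp _ [T T0 <-]; rewrite (cell_minE k1 tp T0); exact: cost_lb. Qed.

Lemma m_gt0 k : (1 < k)%N -> 0 < m_ R k.
Proof.
move=> k1; have [p [tp _]] := @transition_exists R k ltac:(lia).
apply: (@lt_le_trans _ _ (Num.min 1 (alpha k p))).
  by rewrite lt_min ltr01 alpha_gt0//; lia.
apply: lb_le_inf; first by exists (cell_min k 1); exists 1 => //=.
exact: m_has_inf.
Qed.

Lemma m_le k p T : (1 < k)%N -> transition k p -> 0 < T -> m_ R k <= cost k p T.
Proof.
move=> k1 tp T0; rewrite -(cell_minE k1 tp T0); apply: ge_inf; last by exists T.
by exists (Num.min 1 (alpha k p)); exact: m_has_inf.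
Qed.

Lemma m_approx k p e : (1 < k)%N -> transition k p -> 0 < e -> exists2 T, 0 < T & cost k p T < m_ R k + e.
Proof.
move=> k1 tp e0.
have hi : has_inf [set cell_min k T | T in [set T : R | 0 < T]].
  split; first by exists (cell_min k 1); exists 1 => //=.
  by exists (Num.min 1 (alpha k p)); exact: m_has_inf.
have [_ [T T0 <-]] := inf_adherent e0 hi.
by rewrite (cell_minE k1 tp T0) => h; exists T.
Qed.

Lemma cell_attained k T : (1 < k)%N -> 0 < T ->
  exists2 v, cell_admissible k T v & cell_energy k T v = cell_min k T.
Proof.
move=> k1 T0; have [p [tp _]] := @transition_exists R k ltac:(lia).
have [ha he] := profile_admissible k1 tp T0.
by exists (horner (profile T p)) => //; rewrite he (cell_minE k1 tp T0).
Qed.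

(* Homogeneity: the cheapest way to produce a jump [l ^ k] costs [m_ k * l]. *)
Lemma m_scaled k p T l : (1 < k)%N -> transition k p -> 0 < T -> 0 <= l ->
  m_ R k * l <= T + T^-1 ^+ (2 * k) * T * alpha k p * (l ^+ k) ^+ 2.
Proof.
move=> k1 tp T0; rewrite le_eqVlt => /predU1P[<-|l0].
  rewrite mulr0 addr_ge0 ?(ltW T0)// !mulr_ge0 ?exprn_ge0 ?invr_ge0 ?(ltW T0)//; exact: alpha_ge0.
(* At the length [T / l], multiplication by [l] restores the term [T] and produces the factor
   [l^(2k)]. *)
have := m_le k1 tp (divr_gt0 T0 l0); rewrite -(ler_pM2r l0) => /le_trans; apply.
rewrite /cost mulrDl divfK ?gt_eqF// lerD2l le_eqVlt; apply/orP; left; apply/eqP.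
rewrite invf_div exprMn -exprM (mulnC k); field.
by rewrite gt_eqF.
Qed.

End Cell.


(** * Interpolation of derivatives *)

Section Interpolation.
Context {R : realType}.
Implicit Types (a b c h q s t x y M : R) (f g F G : R -> R) (w u : nat -> R -> R).

Lemma mean_value a b F f x y : cint a b f -> {within `[a, b], continuous f} -> prim a b F f ->
  a <= x -> x < y -> y <= b -> exists c, [/\ x <= c, c <= y & f c * (y - x) = F y - F x].
Proof.
move=> fi cf Ff ax xy yb.
have cf' : {within `[x, y], continuous f}.
  by apply: continuous_subspaceW cf; apply: subset_itvScc.
have [c cxy hc] := EVT_max (ltW xy) cf'.
have [d dxy hd] := EVT_min (ltW xy) cf'.
have yx0 : 0 < y - x by rewrite subr_gt0.
pose v := (F y - F x) / (y - x).
have vE : v * (y - x) = F y - F x by rewrite /v mulfVK// gt_eqF.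
have fi' := cintS fi ax yb.
have h1 : f d <= v.
  rewrite /v ler_pdivlMr// (Ff x y)//; last exact: ltW.
  rewrite -oint_cst; last exact: ltW.
  apply: (@le_oint _ x y) => //; first exact: cint_cst.
  by move=> t xt ty; apply: hd; rewrite in_itv/= (ltW xt).
have h2 : v <= f c.
  rewrite /v ler_pdivrMr// (Ff x y)//; last exact: ltW.
  rewrite -oint_cst; last exact: ltW.
  apply: (@le_oint _ x y) => //; first exact: cint_cst.
  by move=> t xt ty; apply: hc; rewrite in_itv/= (ltW xt).
move: cxy dxy; rewrite !in_itv/= => /andP[xc cy] /andP[xd dy].
have [cd|/ltW dc] := leP c d.
  have cf2 : {within `[c, d], continuous f}.
    by apply: continuous_subspaceW cf'; apply: subset_itvScc.
  have [|z zcd zv] := IVT cd cf2 (v := v).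
    by rewrite ge_min le_max h1 h2 orbT.
  exists z; move: zcd; rewrite in_itv/= => /andP[cz zd].
  by rewrite zv; split => //; [exact: le_trans cz|exact: le_trans zd dy].
have cf2 : {within `[d, c], continuous f}.
  by apply: continuous_subspaceW cf'; apply: subset_itvScc.
have [|z zcd zv] := IVT dc cf2 (v := v).
  by rewrite ge_min le_max h1 h2 orbT.
exists z; move: zcd; rewrite in_itv/= => /andP[cz zd].
by rewrite zv; split => //; [exact: le_trans cz|exact: le_trans zd cy].
Qed.

Definition separated s (m : nat) (p : nat -> R) := forall i, (i.+1 < m)%N -> p i + s <= p i.+1.

(* Rolle: each derivative is small somewhere; halving the points keeps them separated. *)
Lemma small_somewhere n a b u p s M : 0 < s -> 0 <= M ->
  (forall l, (l < n)%N -> prim a b (u l) (u l.+1)) ->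
  (forall l, (l <= n)%N -> cint a b (u l)) ->
  (forall l, (l <= n)%N -> {within `[a, b], continuous (u l)}) ->
  (forall i, (i < 2 ^ n)%N -> [/\ a <= p i, p i <= b & `|u 0%N (p i)| <= M]) ->
  separated s (2 ^ n) p ->
  forall l, (l <= n)%N -> exists y, [/\ a <= y, y <= b & `|u l y| <= (2 / s) ^+ l * M].
Proof.
move=> s0; elim: n u p M => [|n IH] u p M M0 pu iu cu hp sp [|l] ln //.
- by exists (p 0%N); rewrite expr0 mul1r; apply: hp; rewrite expn_gt0.
- by exists (p 0%N); rewrite expr0 mul1r; apply: hp; rewrite expn_gt0.
have e2 : (2 ^ n.+1 = (2 ^ n).*2)%N by rewrite expnS mul2n.
have /choice[p' hp'] : forall i, exists y, (i < 2 ^ n)%N ->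
    [/\ p i.*2 <= y, y <= p i.*2.+1 & `|u 1%N y| <= 2 / s * M].
  move=> i; case: (ltnP i (2 ^ n)) => hi; last by exists 0.
  have [h1 h2 h3] := hp i.*2 ltac:(lia).
  have [h4 h5 h6] := hp i.*2.+1 ltac:(lia).
  have gap := sp i.*2 ltac:(lia).
  have lt12 : p i.*2 < p i.*2.+1 by lra.
  have [y [y1 y2 yE]] := mean_value (iu 1%N isT) (cu 1%N isT) (pu 0%N isT) h1 lt12 h5.
  exists y => _; split => //.
  have : `|u 1%N y| * s <= 2 * M.
    apply: (@le_trans _ _ (`|u 1%N y| * (p i.*2.+1 - p i.*2))).
      by apply: ler_wpM2l => //; lra.
    rewrite -[X in _ * X]gtr0_norm ?subr_gt0// -normrM yE.
    by apply: (le_trans (ler_normB _ _)); lra.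
  by rewrite -ler_pdivlMr// mulrAC.
have [||||||y [y1 y2 y3]] := IH (fun l => u l.+1) p' (2 / s * M) _ _ _ _ _ _ l ln.
- by rewrite mulr_ge0// divr_ge0// ltW.
- by move=> j jn; exact: pu.
- by move=> j jn; exact: iu.
- by move=> j jn; exact: cu.
- move=> i hi; have [h1 h2 h3] := hp' i hi; split => //.
    by apply: le_trans h1; case: (hp i.*2) => //; lia.
  by apply: (le_trans h2); case: (hp i.*2.+1) => //; lia.
- move=> i hi; have [_ h2 _] := hp' i (ltnW hi); have [h1 _ _] := hp' _ hi.
  apply: le_trans h1; rewrite doubleS.
  have := sp i.*2.+1 ltac:(lia); lra.
by exists y; rewrite exprSr -mulrA.
Qed.

Lemma cancel_pow (A B S d : R) : A != 0 -> B != 0 -> A * (S / (B * A) * d) = S * (d / B).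
Proof. by move=> A0 B0; field; rewrite ?A0 ?B0. Qed.

(** All terms are weighted by powers of the length, which makes the estimate scale invariant. By
    Cauchy-Schwarz [u n] oscillates by at most the square root on the right; each lower derivative
    differs from its small value given by [small_somewhere] by an integral of the next one. Every
    descent adds one more term [(2 (b - a) / s)^n M], whence the factor [n.+1]. *)
Lemma interpolation n a b u p s M x l : 0 < s -> s <= b - a -> 0 <= M ->
  (forall l, (l <= n)%N -> prim a b (u l) (u l.+1)) ->
  (forall l, (l <= n.+1)%N -> cint a b (u l)) ->
  (forall l, (l <= n)%N -> {within `[a, b], continuous (u l)}) ->
  cint a b (fun t => u n.+1 t ^+ 2) ->
  (forall i, (i < 2 ^ n)%N -> [/\ a <= p i, p i <= b & `|u 0%N (p i)| <= M]) ->
  separated s (2 ^ n) p ->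
  a <= x -> x <= b -> (l <= n)%N ->
  (b - a) ^+ l * `|u l x| <= (n.+1)%:R * (2 * (b - a) / s) ^+ n * M +
     (b - a) ^+ n * Num.sqrt ((b - a) * oint (fun t => u n.+1 t ^+ 2) a b).
Proof.
move=> s0 sba M0 pu iu cu u2 hp sp ax xb ln.
have hs := small_somewhere s0 M0 (fun l hl => pu l (ltnW hl)) (fun l hl => iu l (leqW hl)) cu hp sp.
set h := b - a in sba *; set c := 2 * h / s; set D := Num.sqrt _.
have h0 : 0 < h by exact: lt_le_trans sba.
have c1 : 1 <= c by rewrite /c ler_pdivlMr// mul1r; lra.
have D0 : 0 <= D by exact: sqrtr_ge0.
have oscil y z : a <= y -> y <= z -> z <= b -> `|u n z - u n y| <= D.
  move=> ay yz zb; rewrite (pu n _ y z)// -ler_sqr ?nnegrE// sqr_sqrtr; last first.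
    by rewrite mulr_ge0 ?(ltW h0)//; apply: oint_ge0 => t _ _; exact: sqr_ge0.
  rewrite real_normK ?num_real//.
  have mu_ : measurable_fun `[y, z] (u n.+1).
    by apply: cint_meas; exact: cintS (iu _ (leqnn _)) ay zb.
  apply: (le_trans (oint_CS1 yz mu_ (cintS u2 ay zb))).
  apply: ler_pM; rewrite ?subr_ge0//; first by apply: oint_ge0 => t _ _; exact: sqr_ge0.
    by rewrite /h; lra.
  rewrite (@oint_cat _ a b _ a y b)//; [|lra].
  rewrite (@oint_cat _ a b _ y z b)//.
  have p1 : 0 <= oint (fun t => u n.+1 t ^+ 2) a y by apply: oint_ge0 => t _ _; exact: sqr_ge0.
  have p2 : 0 <= oint (fun t => u n.+1 t ^+ 2) z b by apply: oint_ge0 => t _ _; exact: sqr_ge0.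
  lra.
have osc' y z : a <= y -> y <= b -> a <= z -> z <= b -> `|u n z - u n y| <= D.
  move=> ay yb az zb; case: (leP y z) => [yz|/ltW zy]; first exact: oscil.
  by rewrite distrC; exact: oscil.
have claim j : (j <= n)%N -> forall x, a <= x -> x <= b ->
    h ^+ (n - j) * `|u (n - j)%N x| <= j.+1%:R * c ^+ n * M + h ^+ n * D.
  elim: j => [|j IH] jn y ay yb.
    have [z [az zb hz]] := hs n (leqnn n).
    rewrite subn0 mul1r.
    apply: (@le_trans _ _ (h ^+ n * (`|u n z| + D))).
      rewrite ler_wpM2l ?exprn_ge0 ?(ltW h0)//.
      rewrite -{1}[u n y](subrK (u n z)) addrC; apply: (le_trans (ler_normD _ _)).
      by rewrite lerD2l; exact: osc'.
    rewrite mulrDr lerD2r.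
    have -> : c ^+ n * M = h ^+ n * ((2 / s) ^+ n * M).
      by rewrite /c mulrAC [_ * h]mulrC exprMn mulrA.
    by rewrite ler_wpM2l// exprn_ge0// ltW.
  have E : (n - j = (n - j.+1).+1)%N by rewrite subnSK.
  have [z [az zb hz]] := hs (n - j.+1)%N (leq_subr _ _).
  set l' := (n - j.+1)%N in E hz *.
  have l'n : (l' <= n)%N by exact: leq_subr.
  pose S := j.+1%:R * c ^+ n * M + h ^+ n * D.
  have bnd t : a <= t -> t <= b -> h ^+ l'.+1 * `|u l'.+1 t| <= S by rewrite -E; apply: IH; exact: ltnW.
  have step : h ^+ l' * `|u l' y - u l' z| <= S.
    have aux y' z' : a <= z' -> z' <= y' -> y' <= b -> h ^+ l' * `|u l' y' - u l' z'| <= S.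
      move=> az' zy' yb'; rewrite (pu l' l'n z' y')//.
      have ui := iu l'.+1 ltac:(by rewrite ltnS).
      apply: (@le_trans _ _ (h ^+ l' * oint (fun=> S / h ^+ l'.+1) z' y')).
        rewrite ler_wpM2l ?exprn_ge0 ?(ltW h0)//.
        apply: (le_trans (norm_oint az' yb' ui)).
        apply: (@le_oint _ a b) => //; [exact: cint_norm|exact: cint_cst|].
        move=> t t1 t2; rewrite ler_pdivlMr ?exprn_gt0// mulrC; apply: bnd; lra.
      rewrite oint_cst//.
      have hl0 : h ^+ l' != 0 by rewrite expf_neq0// gt_eqF.
      have hn0 : h != 0 by rewrite gt_eqF.
      have -> : h ^+ l' * (S / h ^+ l'.+1 * (y' - z')) = S * ((y' - z') / h).
        by rewrite exprS; exact: cancel_pow.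
      have S0 : 0 <= S.
        rewrite /S addr_ge0// ?mulr_ge0 ?exprn_ge0 ?(ltW h0)//; exact: le_trans c1.
      by rewrite ler_piMr// ler_pdivrMr// mul1r /h; lra.
    case: (leP z y) => [zy|/ltW yz]; first exact: aux.
    by rewrite distrC; exact: aux.
  apply: (@le_trans _ _ (h ^+ l' * (`|u l' z| + `|u l' y - u l' z|))).
    rewrite ler_wpM2l ?exprn_ge0 ?(ltW h0)//.
    by rewrite -{1}[u l' y](subrK (u l' z)) addrC; exact: ler_normD.
  rewrite mulrDr.
  have : h ^+ l' * `|u l' z| <= c ^+ n * M.
    apply: (@le_trans _ _ (h ^+ l' * ((2 / s) ^+ l' * M))).
      by rewrite ler_wpM2l// exprn_ge0// ltW.
    rewrite mulrA -exprMn (_ : h * (2 / s) = c); last by rewrite /c; ring.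
    rewrite ler_wpM2r//; exact: ler_weXn2l.
  move=> h1; apply: (le_trans (lerD h1 step)).
  by rewrite /S -[j.+2]addn1 natrD; lra.
have := claim (n - l)%N (leq_subr _ _) x ax xb.
rewrite subKn// => /le_trans; apply; rewrite lerD2r.
have c0 : 0 <= c by exact: le_trans c1.
rewrite -!mulrA; apply: ler_wpM2r; first by rewrite mulr_ge0 ?exprn_ge0.
by rewrite ler_nat ltnS leq_subr.
Qed.

End Interpolation.


(** * The steep set *)

Section Steep.
Context {R : realType}.
Implicit Types (a b c h q s t x y M d L : R) (f g F G : R -> R) (w u : nat -> R -> R).

(* [s] stands for the square root of [eps]: the steep set is where the truncation
   [1 / eps] is active, that is where [|u'| > 1 / s]. *)
Definition steep f s x : R := if s^-1 < `|f x| then 1 else 0.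

Definition steep_size f s x y := oint (steep f s) x y.
Definition steep_jump f s x y := oint (fun t => f t * steep f s t) x y.
(** With [eps = s^2]: what the truncated points contribute to the first term of [F_eps], together
    with the whole higher order term. *)
Definition steep_energy k w s x y :=
  steep_size (w 1%N) s x y / s ^+ 2 + (s ^+ 2) ^+ (2 * k).-1 * oint (fun t => w k t ^+ 2) x y.

Lemma steep01 f s x : 0 <= steep f s x <= 1.
Proof. by rewrite /steep; case: ifP => _; rewrite ?lexx ?ler01. Qed.

Lemma steep_meas f s a b : measurable_fun `[a, b] f -> measurable_fun `[a, b] (steep f s).
Proof.
move=> mf; apply: measurable_fun_if => //.
by apply: measurable_fun_ltr => //; apply: measurableT_comp.
Qed.

Lemma steep_cint f s a b : measurable_fun `[a, b] f -> cint a b (steep f s).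
Proof.
move=> mf; apply: (@cint_bounded _ _ _ _ 1); first exact: steep_meas.
by move=> x _ _; have /andP[h1 h2] := steep01 f s x; rewrite ger0_norm.
Qed.

Lemma steepM_cint f s a b : cint a b f -> cint a b (fun x => f x * steep f s x).
Proof.
move=> fi; apply: (@cint_bM _ _ _ _ _ 1) => //; first by apply: steep_meas; exact: cint_meas.
by move=> x _ _; have /andP[h1 h2] := steep01 f s x; rewrite ger0_norm.
Qed.

Lemma steep_size_ge0 f s x y : 0 <= steep_size f s x y.
Proof. by apply: oint_ge0 => t _ _; case/andP: (steep01 f s t). Qed.

(** This is [transition_parts] divided by the coefficient of the increment, which is of order
    [(b - a)^(1-2k)]. Cauchy-Schwarz turns the integral into the first term, the jump that the
    energy can pay for; the sum over the end derivatives is an error, weighted by the powers of the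
    length that survive the division. *)
Lemma increment_bound k p w a b M : (0 < k)%N -> a < b -> transition k p -> rep a b k w ->
  (forall i, `|p^`(i).[0]| <= M) -> (forall i, `|p^`(i).[1]| <= M) ->
  `|w 0%N b - w 0%N a| <=
    Num.sqrt (oint (fun t => w k t ^+ 2) a b * (b - a) ^+ (2 * k).-1 / alpha k p) +
    M / alpha k p * \sum_(j < k.-1) (b - a) ^+ (k - j.+1) * (`|w (k - j.+1)%N a| + `|w (k - j.+1)%N b|).
Proof.
move=> k0 ab tp rw M0 M1.
have := transition_parts k0 ab tp rw.
have a0 := alpha_gt0 k0 tp.
set A := alpha k p in a0 *; set E := oint (fun t => w k t ^+ 2) a b; set L := b - a.
have L0 : 0 < L by rewrite subr_gt0.
set S := \sum_(j < k.-1) _; set Y := oint _ _ _; set T := \sum_(j < _) _.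
move=> H.
have c0 : 0 < L^-1 ^+ (2 * k) * L * A by rewrite !mulr_gt0// exprn_gt0// invr_gt0.
set c := L^-1 ^+ (2 * k) * L * A in H c0.
have E0 : 0 <= E by apply: oint_ge0 => t _ _; exact: sqr_ge0.
have k2 : (2 * k = (2 * k).-1.+1)%N by rewrite prednK// muln_gt0.
have cE : c = L^-1 ^+ (2 * k).-1 * A by rewrite /c k2 exprSr mulfVK ?gt_eqF.
rewrite -(ler_pM2l c0) -[c in X in X <= _]gtr0_norm// -normrM H.
apply: (le_trans (ler_normB _ _)); rewrite mulrDr lerD//.
- have q0 : 0 <= c * Num.sqrt (E * L ^+ (2 * k).-1 / A) by rewrite mulr_ge0 ?sqrtr_ge0// ltW.
  rewrite -ler_sqr ?nnegrE// real_normK ?num_real//.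
  rewrite exprMn sqr_sqrtr; last first.
    by apply: divr_ge0; [apply: mulr_ge0 => //; rewrite exprn_ge0// ltW|exact: ltW].
  have -> : c ^+ 2 * (E * L ^+ (2 * k).-1 / A) = E * c.
    rewrite cE exprVn; have : L ^+ (2 * k).-1 != 0 by rewrite expf_neq0// gt_eqF.
    by move: (L ^+ _) => l l0; field; rewrite l0 gt_eqF.
  case: (rw) => _ h2 h3; have := @oint_CS _ _ _ (w k) (horner (stretch a b p)^`(k)) (ltW ab).
  rewrite stretch_energy// -/L -/A -/c -/E -/Y; apply => //.
  + exact: cint_meas (h2 _ (leqnn k)).
  + by apply: cint_meas; exact: horner_cint.
  + have := horner_cint ((stretch a b p)^`(k) ^+ 2) a b.
    by congr (cint _ _ _); apply/funext => t; rewrite horner_exp.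
- apply: (le_trans (ler_norm_sum _ _ _)); rewrite mulrA mulr_sumr; apply: ler_sum => j _.
  rewrite normrM normrX normrN1 expr1n mul1r.
  set l := (k - j.+1)%N.
  have Mge : 0 <= M by apply: le_trans (M0 0%N).
  have bnd x : x = a \/ x = b -> `|(stretch a b p)^`(k + j).[x]| <= L^-1 ^+ (k + j) * M.
    case=> ->; [rewrite stretch_l|rewrite stretch_r//]; rewrite normrM ger0_norm ?exprn_ge0 ?invr_ge0 ?(ltW L0)//;
    by rewrite ler_wpM2l// exprn_ge0// invr_ge0 ltW.
  have -> : c * (M / A) * (L ^+ l * (`|w l a| + `|w l b|)) =
      `|w l b| * (L^-1 ^+ (k + j) * M) + `|w l a| * (L^-1 ^+ (k + j) * M).
    have e : ((2 * k).-1 = (k + j) + l)%N by have := ltn_ord j; rewrite /l; clear; lia.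
    rewrite cE e exprD !exprVn.
    have l1 : L ^+ l != 0 by rewrite expf_neq0// gt_eqF.
    have l2 : L ^+ (k + j) != 0 by rewrite expf_neq0// gt_eqF.
    move: (L ^+ l) (L ^+ (k + j)) l1 l2 => X1 X2 l1 l2.
    by field; rewrite l1 l2 gt_eqF.
  apply: (le_trans (ler_normB _ _)); rewrite !normrM.
  by apply: lerD; apply: ler_wpM2l => //; apply: bnd; [right|left].
Qed.

(* Greedy choice: a large set contains many separated points. *)
Lemma find_points f s d N x y : 0 < d -> measurable_fun `[x, y] f -> x <= y ->
  2 * d * N%:R < oint (fun t => 1 - steep f s t) x y ->
  exists p, (forall i, (i < N)%N -> [/\ x <= p i, p i <= y & `|f (p i)| <= s^-1]) /\ separated d N p.
Proof.
move=> d0; elim: N x y => [|N IH] x y mf xy h.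
  by exists (fun=> 0); split.
have gi a b : x <= a -> b <= y -> cint a b (fun t => 1 - steep f s t).
  move=> xa bY; apply: cintB; first exact: cint_cst.
  apply: steep_cint; apply: measurable_funS mf => //; exact: subset_itvScc.
have g01 t : 0 <= 1 - steep f s t <= 1 by have /andP[h1 h2] := steep01 f s t; apply/andP; split; lra.
pose A := [set t | x <= t <= y /\ `|f t| <= s^-1].
have g1 t : ~ A t -> x <= t -> t <= y -> 1 - steep f s t = 0.
  move=> nA xt ty; rewrite /steep; case: ltP => [_|ft]; first by rewrite subrr.
  by exfalso; apply: nA; split => //; rewrite xt ty.
have A0 : A !=set0.
  apply/set0P/negP => /eqP A0; move: h; apply/negP; rewrite -leNgt.
  rewrite (@eq_oint _ _ _ _ (fun=> 0)); first by rewrite oint_cst// mul0r !mulr_ge0// ltW.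
  by move=> t xt ty; apply: g1 => //; [rewrite A0|exact: ltW].
have Alb : has_lbound A by exists x => t [/andP[]].
have [p0 [/andP[xp py] fp] pi] := inf_adherent (divr_gt0 d0 (ltr0n _ 2)) (conj A0 Alb).
set i0 := inf A in pi.
have xi0 : x <= i0 by apply: lb_le_inf => // t [/andP[]].
(* The infimum [i0] may or may not belong to [A]; stepping back by [d / 2] makes everything in []x,
   i1]] steep in either case. As [p0] is within [d / 2] of [i0], the interval [[i1, p0 + d]] has
   length at most [2 * d], the share of the hypothesis spent on one point. *)
pose i1 := Num.max x (i0 - d / 2).
have i1p : x <= i1 by rewrite le_max lexx.
have i0p : i0 <= p0 by apply: ge_inf => //; split => //; rewrite xp py.
have i1le : i1 <= p0 by rewrite /i1 ge_max xp /=; lra.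
have i1y : i1 <= y by exact: le_trans py.
have z0 : oint (fun t => 1 - steep f s t) x i1 = 0.
  rewrite (@eq_oint _ _ _ _ (fun=> 0)) ?oint_cst ?mul0r// => t xt ti.
  apply: g1 => [At| |]; [|exact: ltW|exact: le_trans i1y].
  have := ge_inf Alb At; rewrite -/i0; move: ti; rewrite le_max.
  by rewrite (ltNge x t) in xt; rewrite (negbTE xt)/=; lra.
have oc a b c : x <= a -> a <= b -> b <= c -> c <= y ->
   oint (fun t => 1 - steep f s t) a c = oint (fun t => 1 - steep f s t) a b + oint (fun t => 1 - steep f s t) b c.
  by move=> h1 h2 h3 h4; apply: (@oint_cat _ x y) => //; exact: gi.
have ole a b : x <= a -> a <= b -> b <= y -> oint (fun t => 1 - steep f s t) a b <= b - a.
  move=> h1 h2 h3; rewrite -[leRHS]mul1r -oint_cst//.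
  apply: (@le_oint _ x y) => //; [exact: gi|exact: cint_cst|].
  by move=> t _ _; case/andP: (g01 t).
have i1d : i0 - d / 2 <= i1 by rewrite le_max lexx orbT.
move: h; rewrite (oc x i1 y)// z0 add0r -[N.+1]addn1 natrD mulrDr mulr1 => h.
have zy : p0 + d <= y.
  rewrite leNgt; apply/negP => yz; have := ole i1 y i1p i1y (lexx _).
  have : 0 <= 2 * d * N%:R by rewrite !mulr_ge0// ltW.
  lra.
move: h; rewrite (oc i1 (p0 + d) y)//; [|lra]; move=> h.
have := ole i1 (p0 + d) i1p ltac:(lra) zy => h1.
have [|||p [hp sp]] := IH (p0 + d) y.
- by apply: measurable_funS mf => //; apply: subset_itv; rewrite bnd_simp; lra.
- by [].
- lra.
exists (fun i => if i is j.+1 then p j else p0); rewrite addn1; split.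
  case=> [|i] hi; first by [].
  by have [h2 h3 h4] := hp i hi; split => //; lra.
case=> [|i] hi /=; last exact: sp.
by case: (hp 0%N hi).
Qed.

End Steep.


(** * Control of jumps by energy *)

Section Key.
Context {R : realType}.
Implicit Types (a b q t x y z L : R).

Lemma root_exists (k : nat) (X : R) : (0 < k)%N -> 0 <= X -> exists2 l : R, 0 <= l & l ^+ k = X.
Proof.
move=> k0 X0; exists (X `^ (k%:R^-1)); first exact: powR_ge0.
by rewrite -powR_mulrn ?powR_ge0// -powRrM mulVf ?powRr1// pnatr_eq0 -lt0n.
Qed.

Variables (n : nat) (w : nat -> R -> R) (s C d h M : R) (p : {poly R}).
Let k := n.+2.
Hypotheses (rw : rep 0 1 k w) (s0 : 0 < s) (C1 : 1 <= C) (d0 : 0 < d) (d12 : d <= 1 / 2).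
Hypotheses (h1 : s ^+ 2 * d / 2 <= h) (h2 : h <= s ^+ 2 * d).
Hypotheses (tp : transition k p) (M0 : forall i, `|p^`(i).[0]| <= M) (M1 : forall i, `|p^`(i).[1]| <= M).
Hypothesis enC : steep_energy k w s 0 1 <= C.

Hypotheses (C0 : 0 <= C) (s2 : 0 < s ^+ 2) (h0 : 0 < h) (M_ge0 : 0 <= M) (al0 : 0 < alpha k p).

Lemma w1i x y : 0 <= x -> y <= 1 -> cint x y (w 1%N).
Proof. by move=> x0 y1; case: rw => _ hi _; apply: cintS (hi 1%N isT) x0 y1. Qed.

Lemma wki x y : 0 <= x -> y <= 1 -> cint x y (fun t => w k t ^+ 2).
Proof. by move=> x0 y1; case: rw => _ _ hi; apply: cintS hi x0 y1. Qed.

Lemma w1m x y : 0 <= x -> y <= 1 -> measurable_fun `[x, y] (w 1%N).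
Proof. by move=> x0 y1; apply: cint_meas; exact: w1i. Qed.

Lemma oint_sq_ge0 x y : 0 <= oint (fun t => w k t ^+ 2) x y.
Proof. by apply: oint_ge0 => t _ _; exact: sqr_ge0. Qed.

Lemma size_cat x y z : 0 <= x -> x <= y -> y <= z -> z <= 1 ->
  steep_size (w 1%N) s x z = steep_size (w 1%N) s x y + steep_size (w 1%N) s y z.
Proof. by move=> *; apply: (@oint_cat _ 0 1) => //; apply: steep_cint; exact: w1m. Qed.

Lemma jump_cat x y z : 0 <= x -> x <= y -> y <= z -> z <= 1 ->
  steep_jump (w 1%N) s x z = steep_jump (w 1%N) s x y + steep_jump (w 1%N) s y z.
Proof. by move=> *; apply: (@oint_cat _ 0 1) => //; apply: steepM_cint; exact: w1i. Qed.

Lemma energy_cat x y z : 0 <= x -> x <= y -> y <= z -> z <= 1 ->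
  steep_energy k w s x z = steep_energy k w s x y + steep_energy k w s y z.
Proof.
move=> x0 xy yz z1; rewrite /steep_energy (size_cat x0 xy yz z1).
rewrite (@oint_cat _ 0 1 _ x y z)//; last exact: wki.
by rewrite mulrDl mulrDr; ring.
Qed.

Lemma energy_ge0 x y : 0 <= steep_energy k w s x y.
Proof.
rewrite /steep_energy addr_ge0//; first by rewrite divr_ge0 ?steep_size_ge0// ltW.
by apply: mulr_ge0; [rewrite exprn_ge0// ltW|exact: oint_sq_ge0].
Qed.

Lemma size_leC x y : 0 <= x -> x <= y -> y <= 1 -> steep_size (w 1%N) s x y <= C * s ^+ 2.
Proof.
move=> x0 xy y1; rewrite -ler_pdivrMr//; apply: le_trans enC; rewrite /steep_energy.
have : 0 <= (s ^+ 2) ^+ (2 * k).-1 * oint (fun t => w k t ^+ 2) 0 1.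
  by apply: mulr_ge0; [rewrite exprn_ge0// ltW|exact: oint_sq_ge0].
have : steep_size (w 1%N) s x y / s ^+ 2 <= steep_size (w 1%N) s 0 1 / s ^+ 2.
  rewrite ler_pM2r ?invr_gt0//.
  rewrite (@size_cat 0 x 1)// ?(le_trans xy)// (@size_cat x y 1)//.
  have := steep_size_ge0 (w 1%N) s 0 x; have := steep_size_ge0 (w 1%N) s y 1; lra.
lra.
Qed.

Lemma sq_leC x y : 0 <= x -> x <= y -> y <= 1 ->
  (s ^+ 2) ^+ (2 * k).-1 * oint (fun t => w k t ^+ 2) x y <= C.
Proof.
move=> x0 xy y1; apply: le_trans enC; rewrite /steep_energy.
apply: (@le_trans _ _ ((s ^+ 2) ^+ (2 * k).-1 * oint (fun t => w k t ^+ 2) 0 1)).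
  apply: ler_wpM2l; first by rewrite exprn_ge0// ltW.
  rewrite (@oint_cat _ 0 1 _ 0 x 1)// ?(le_trans xy)//; last exact: wki.
  rewrite (@oint_cat _ 0 1 _ x y 1)//; last exact: wki.
  have := oint_sq_ge0 0 x; have := oint_sq_ge0 y 1; lra.
by rewrite lerDr divr_ge0 ?steep_size_ge0// ltW.
Qed.

(** The first term tends to 0 with [s] at fixed [d]. The second comes from the oscillation of the
    derivative of order [k - 1] inside one cell; it is of order [sqrt d] and independent of [s]. *)
Definition rate : R := (4 * C / d) ^+ n * (n.+1%:R * (2 ^+ n.+2 / d) ^+ n * s) +
  (2 * C) ^+ n * Num.sqrt (d * C).

Lemma rate_ge0 : 0 <= rate.
Proof.
have a1 : 0 <= 4 * C / d by rewrite divr_ge0 ?mulr_ge0// ltW.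
have a2 : 0 <= 2 ^+ n.+2 / d by rewrite divr_ge0 ?(ltW d0)// exprn_ge0.
have a3 : 0 <= n.+1%:R * (2 ^+ n.+2 / d) ^+ n * s.
  by apply: mulr_ge0; [apply: mulr_ge0; [exact: ler0n|exact: exprn_ge0]|exact: ltW].
have a4 : 0 <= 2 * C by rewrite mulr_ge0.
apply: addr_ge0; apply: mulr_ge0 => //; rewrite ?sqrtr_ge0//; exact: exprn_ge0.
Qed.

(** Chosen so that [2 * sep * 2 ^ n = d * h]: when [find_points] does not apply, the part of the
    cell that is not steep has measure at most [d * h]. *)
Definition sep := d * h / 2 ^+ n.+1.

(* A cell [[q, q + h]] is good when it contains enough separated points that are
   not steep for Rolle's theorem to bound every derivative on it; a cell that is
   not good is almost entirely steep. *)
Definition good_cell q := exists u, (forall i, (i < 2 ^ n)%N ->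
   [/\ q <= u i, u i <= q + h & `|w 1%N (u i)| <= s^-1]) /\ separated sep (2 ^ n) u.

Lemma sep_gt0 : 0 < sep.
Proof. by rewrite /sep divr_gt0 ?mulr_gt0// exprn_gt0. Qed.

(** [L] stands for the length of a run next to the cell, at most [2 * C * s ^+ 2] because a run is
    steep on at least half of its length. Interpolation holds at the scale [h]; passing to [L]
    multiplies only the first term of the bound, by [(L / h)^n <= (4 C / d)^n], since
    [h >= s^2 d / 2]. *)
Lemma good_cell_bound q x l L : 0 <= q -> q + h <= 1 -> good_cell q -> q <= x -> x <= q + h ->
  (l <= n)%N -> h <= L -> L <= 2 * C * s ^+ 2 -> L ^+ l * `|w l.+1 x| <= rate / s ^+ 2.
Proof.
have hd0 := d0; have hd12 := d12; have hs0 := s0; have hh0 := h0.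
have hC0 := C0; have hC1 := C1; have hh1 := h1; have hh2 := h2.
have hs2 := s2.
move=> q0 q1 [u [hu su]] qx xq ln hL LC.
have hh : q + h - q = h by ring.
have sh : sep <= q + h - q.
  rewrite hh /sep ler_pdivrMr ?exprn_gt0// mulrC ler_pM2l//.
  apply: (@le_trans _ _ 1); first lra.
  by rewrite exprn_ege1// ler1n.
case: (rw) => r1 r2 r3.
have sub (f : R -> R) : cint 0 1 f -> cint q (q + h) f by move=> ai; apply: cintS ai _ _.
have := @interpolation R n q (q + h) (fun l => w l.+1) u sep s^-1 x l sep_gt0 sh.
rewrite hh invr_ge0 (ltW s0) => /(_ isT) H.
have {}H := H (fun l hl x y xa xy yb => r1 l.+1 hl x y (le_trans q0 xa) xy (le_trans yb q1)).
have {}H := H (fun l hl => sub _ (r2 l.+1 hl)).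
have {H} H : h ^+ l * `|w l.+1 x| <= n.+1%:R * (2 * h / sep) ^+ n * s^-1 + h ^+ n *
    Num.sqrt (h * oint (fun t => w n.+2 t ^+ 2) q (q + h)).
  apply: H => //; last exact: sub.
  move=> j jn; apply: (prim_cont (f := w j.+2)); first by apply: sub; exact: r2.
  by move=> a b qa ab bq; apply: r1 => //; [exact: le_trans qa|exact: le_trans q1].
have e1 : 2 * h / sep = 2 ^+ n.+2 / d.
  rewrite /sep [2 ^+ n.+2]exprS; have : 2 ^+ n.+1 != 0 :> R by rewrite expf_neq0.
  by move: (2 ^+ n.+1 : R) => z z0; field; rewrite z0 !gt_eqF.
rewrite e1 in H; set D1 := n.+1%:R * _ * _ in H; set E := oint _ _ _ in H.
have Lh1 : 1 <= L / h by rewrite ler_pdivlMr// mul1r.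
have D10 : 0 <= D1.
  by rewrite /D1 !mulr_ge0 ?exprn_ge0 ?divr_ge0 ?exprn_ge0 ?invr_ge0// ltW.
have E0 : 0 <= E by exact: oint_sq_ge0.
apply: (@le_trans _ _ ((L / h) ^+ n * (D1 + h ^+ n * Num.sqrt (h * E)))).
  have -> : L ^+ l * `|w l.+1 x| = (L / h) ^+ l * (h ^+ l * `|w l.+1 x|).
    by rewrite exprMn exprVn -mulrA mulKf// expf_neq0// gt_eqF.
  apply: ler_pM => //.
  - by rewrite exprn_ge0// (le_trans _ Lh1).
  - by apply: mulr_ge0; [rewrite exprn_ge0// ltW|].
  - exact: ler_weXn2l.
have -> : (L / h) ^+ n * (D1 + h ^+ n * Num.sqrt (h * E)) = (L / h) ^+ n * D1 + L ^+ n * Num.sqrt (h * E).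
  rewrite mulrDr; congr (_ + _).
  by rewrite exprMn exprVn -mulrA mulKf// expf_neq0// gt_eqF.
have L0 : 0 <= L by exact: le_trans (ltW h0) hL.
rewrite /rate mulrDl lerD//.
- have -> : (4 * C / d) ^+ n * (n.+1%:R * (2 ^+ n.+2 / d) ^+ n * s) / s ^+ 2 = (4 * C / d) ^+ n * D1.
    by rewrite /D1; field; rewrite gt_eqF.
  rewrite ler_wpM2r//; apply: lerXn2r; rewrite ?nnegrE ?divr_ge0 ?mulr_ge0 ?(ltW h0) ?(ltW d0)//.
  rewrite ler_pdivrMr// (le_trans LC)//.
  have -> : 2 * C * s ^+ 2 = 4 * C / d * (s ^+ 2 * d / 2) by field; rewrite gt_eqF.
  by rewrite ler_wpM2l// divr_ge0 ?mulr_ge0// ltW.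
- have hq : q <= q + h by rewrite lerDl ltW.
  have EC := sq_leC q0 hq q1; rewrite -/E in EC.
  have k2 : ((2 * k).-1 = (n.+1 + n.+1).+1)%N by rewrite /k; clear; lia.
  have q1' : Num.sqrt (h * E) <= Num.sqrt (d * C) / (s ^+ 2) ^+ n.+1.
    have y0 : 0 <= Num.sqrt (d * C) / (s ^+ 2) ^+ n.+1.
      by apply: divr_ge0; [exact: sqrtr_ge0|exact: exprn_ge0 (ltW s2)].
    rewrite -ler_sqr ?nnegrE ?sqrtr_ge0//.
    rewrite expr_div_n !sqr_sqrtr ?mulr_ge0 ?(ltW h0) ?(ltW d0)//.
    rewrite ler_pdivlMr ?exprn_gt0// -[(_ ^+ n.+1) ^+ 2]exprM muln2 -addnn.
    apply: (@le_trans _ _ (s ^+ 2 * d * E * (s ^+ 2) ^+ (n.+1 + n.+1))).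
      by apply: ler_wpM2r; [exact: exprn_ge0 (ltW s2)|exact: ler_wpM2r].
    rewrite k2 exprS in EC.
    have -> : s ^+ 2 * d * E * (s ^+ 2) ^+ (n.+1 + n.+1) = d * (s ^+ 2 * (s ^+ 2) ^+ (n.+1 + n.+1) * E) by ring.
    by rewrite ler_wpM2l// ltW.
  apply: (@le_trans _ _ ((2 * C * s ^+ 2) ^+ n * (Num.sqrt (d * C) / (s ^+ 2) ^+ n.+1))).
    apply: ler_pM => //; first exact: exprn_ge0.
    by apply: lerXn2r; rewrite ?nnegrE// !mulr_ge0// ltW.
  rewrite exprMn [X in _ / X]exprS.
  have : (s ^+ 2) ^+ n != 0 by rewrite expf_neq0// gt_eqF.
  have : s ^+ 2 != 0 by rewrite gt_eqF.
  move: (s ^+ 2) ((s ^+ 2) ^+ n) => X Y X0 Y0; rewrite le_eqVlt; apply/orP; left; apply/eqP.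
  by field; rewrite X0 Y0.
Qed.

Lemma bad_cell q : 0 <= q -> q + h <= 1 -> ~ good_cell q ->
  (1 - d) * h <= steep_size (w 1%N) s q (q + h).
Proof.
have hd0 := d0; have hd12 := d12; have hs0 := s0; have hh0 := h0.
have hC0 := C0; have hC1 := C1; have hh1 := h1; have hh2 := h2.
have hs2 := s2.
move=> q0 q1 nG; rewrite leNgt; apply/negP => H; apply: nG.
have qh : q <= q + h by rewrite lerDl ltW.
apply: (find_points sep_gt0) => //; first exact: w1m.
have si : cint q (q + h) (steep (w 1%N) s) by apply: steep_cint; exact: w1m.
rewrite (@ointB _ q (q + h))//; last exact: cint_cst.
rewrite oint_cst// -/(steep_size _ _ _ _).
have -> : 2 * sep * (2 ^ n)%:R = d * h.
  rewrite /sep exprS natrX; have : 2 ^+ n != 0 :> R by rewrite expf_neq0.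
  by move: (2 ^+ n : R) => z z0; field.
lra.
Qed.

Definition Kconst : R := 4 * n.+1%:R * (M / alpha k p) + 1.
(** The error per unit of [steep_size / s^2]. In [Kconst] the first summand pays for the end
    derivatives of a run and the summand 1 for good cells; the term [2 * s] pays for the increment
    over the part of a run that is not steep. *)
Definition rho : R := Kconst * rate + 2 * s.

(* The jump accumulated between [x] and [y] is at most [l ^ k] for some [l] that the
   energy pays for at the rate [m_ k]. Since [l1 ^ k + l2 ^ k <= (l1 + l2) ^ k], the
   property is stable under concatenation. *)
Definition controlled x y := exists2 l : R, 0 <= l &
  `|steep_jump (w 1%N) s x y| <= l ^+ k + rho * (steep_size (w 1%N) s x y / s ^+ 2) /\
  m_ R k * l <= (1 + 2 * d) * steep_energy k w s x y.

Lemma controlled_cat x y z : 0 <= x -> x <= y -> y <= z -> z <= 1 ->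
  controlled x y -> controlled y z -> controlled x z.
Proof.
have hd0 := d0; have hd12 := d12; have hs0 := s0; have hh0 := h0.
have hC0 := C0; have hC1 := C1; have hh1 := h1; have hh2 := h2.
have hs2 := s2.
move=> x0 xy yz z1 [l1 l10 [a1 b1]] [l2 l20 [a2 b2]]; exists (l1 + l2); first exact: addr_ge0.
split; last by rewrite (energy_cat x0 xy yz z1) mulrDr [leRHS]mulrDr lerD.
rewrite (jump_cat x0 xy yz z1) (size_cat x0 xy yz z1).
apply: (le_trans (ler_normD _ _)).
have hp : l1 ^+ k + l2 ^+ k <= (l1 + l2) ^+ k.
  rewrite /k [l1 ^+ _]exprS [l2 ^+ _]exprS [leRHS]exprS mulrDl.
  by apply: lerD; rewrite ler_wpM2l// lerXn2r ?nnegrE ?addr_ge0//; lra.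
set S1 := steep_size _ _ x y in a1 *; set S2 := steep_size _ _ y z in a2 *.
have -> : rho * ((S1 + S2) / s ^+ 2) = rho * (S1 / s ^+ 2) + rho * (S2 / s ^+ 2) by ring.
lra.
Qed.

Lemma Kconst_ge1 : 1 <= Kconst.
Proof. by rewrite /Kconst lerDr mulr_ge0// divr_ge0// ltW. Qed.

(** Here [l = 0] suffices: on a good cell the derivative is at most [rate / s^2], so that the steep
    jump is pure error. *)
Lemma controlled_cell q x y : 0 <= q -> q + h <= 1 -> good_cell q -> q <= x -> x <= y -> y <= q + h ->
  controlled x y.
Proof.
have hd0 := d0; have hd12 := d12; have hs0 := s0; have hh0 := h0.
have hC0 := C0; have hC1 := C1; have hh1 := h1; have hh2 := h2.
have hs2 := s2.
move=> q0 q1 gq qx xy yq.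
have x0 : 0 <= x by exact: le_trans qx.
have y1 : y <= 1 by exact: le_trans q1.
exists 0 => //; split; last by rewrite mulr0 mulr_ge0 ?energy_ge0//; lra.
rewrite expr0n add0r.
have si : cint x y (steep (w 1%N) s) by apply: steep_cint; exact: w1m.
apply: (le_trans (norm_oint (lexx x) (lexx y) (steepM_cint s (w1i x0 y1)))).
apply: (@le_trans _ _ (rate / s ^+ 2 * steep_size (w 1%N) s x y)).
  rewrite /steep_size -(@ointZ _ x y)//; apply: (@le_oint _ x y) => //.
  - by apply: cint_norm; apply: steepM_cint; exact: w1i.
  - exact: cintZ.
  - move=> t xt ty; have /andP[t0 t1] := steep01 (w 1%N) s t.
    rewrite normrM (ger0_norm t0) ler_wpM2r//.
    have := @good_cell_bound q t 0 h q0 q1 gq; rewrite expr0 mul1r; apply => //.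
    + exact: le_trans (ltW xt).
    + exact: le_trans yq.
    + apply: (le_trans h2); rewrite [leLHS]mulrC ler_wpM2r ?(ltW s2)//; lra.
rewrite mulrAC -mulrA ler_wpM2r ?divr_ge0 ?steep_size_ge0 ?(ltW s2)//.
rewrite /rho; have := rate_ge0; have := Kconst_ge1; have := s0; nra.
Qed.

(** The number [l] is the [k]-th root of the square root in [increment_bound], and [m_scaled] at the
    length [L / s^2] bounds its cost by length plus higher order energy. The length is replaced by
    the steep size at the price of [1 / (1 - d) <= 1 + 2 * d], valid for [d <= 1/2]; this is the
    source of the factor in [controlled]. *)
Lemma controlled_run a b : 0 <= a -> b <= 1 -> h <= b - a -> (1 - d) * (b - a) <= steep_size (w 1%N) s a b ->
  (forall l L, (l <= n)%N -> h <= L -> L <= 2 * C * s ^+ 2 -> L ^+ l * `|w l.+1 a| <= rate / s ^+ 2) ->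
  (forall l L, (l <= n)%N -> h <= L -> L <= 2 * C * s ^+ 2 -> L ^+ l * `|w l.+1 b| <= rate / s ^+ 2) ->
  controlled a b.
Proof.
have hd0 := d0; have hd12 := d12; have hs0 := s0; have hh0 := h0.
have hC0 := C0; have hC1 := C1; have hh1 := h1; have hh2 := h2.
have hs2 := s2.
move=> a0 b1 hL Ls Ha Hb.
set L := b - a in hL Ls.
have L0 : 0 < L by exact: lt_le_trans hL.
have ab : a < b by rewrite -subr_gt0.
have Sz := size_leC a0 (ltW ab) b1.
have S0 := steep_size_ge0 (w 1%N) s a b.
set S := steep_size _ _ _ _ in Ls Sz S0.
have LS : L <= 2 * S by nra.
have LC : L <= 2 * C * s ^+ 2 by apply: (le_trans LS); lra.
have LS' : L <= (1 + 2 * d) * S by nra.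
have rw' : rep a b k w.
  case: rw => r1 r2 r3; split.
  - by move=> l lk x y ax xy yb; apply: r1 => //; [exact: le_trans ax|exact: le_trans b1].
  - by move=> l lk; apply: cintS (r2 l lk) _ _.
  - exact: cintS r3 _ _.
have k0 : (0 < k)%N by [].
have := increment_bound k0 ab tp rw' M0 M1.
rewrite -/L; set E := oint _ _ _; set X := Num.sqrt _; set T := \sum_(j < _) _ => HI.
have E0 : 0 <= E by exact: oint_sq_ge0.
have X0 : 0 <= X by exact: sqrtr_ge0.
have [l l0 lX] := root_exists k0 X0.
have TT : T <= 2 * n.+1%:R * (L * (rate / s ^+ 2)).
  apply: (@le_trans _ _ (\sum_(j < n.+1) (2 * (L * (rate / s ^+ 2))))); last first.
    by rewrite sumr_const card_ord -mulr_natl; lra.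
  apply: ler_sum => j _.
  have -> : (k - j.+1 = (n - j).+1)%N by rewrite /k subSS -subSn// -ltnS.
  rewrite exprS -mulrA [2 * _]mulrC -mulrA ler_wpM2l ?(ltW L0)// mulrDr.
  have := Ha (n - j)%N L (leq_subr _ _) hL LC; have := Hb (n - j)%N L (leq_subr _ _) hL LC; lra.
exists l => //; split.
- have -> : steep_jump (w 1%N) s a b = (w 0%N b - w 0%N a) - oint (fun t => w 1%N t * (1 - steep (w 1%N) s t)) a b.
    case: rw' => r1 r2 _; rewrite (r1 0%N isT a b)// ?ltW//.
    rewrite -(@ointB _ a b)//.
    + by apply: eq_oint => t _ _; ring.
    + exact: r2.
    + rewrite (_ : (fun t => _) = (fun t => w 1%N t - w 1%N t * steep (w 1%N) s t)); last by apply/funext => t; ring.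
      by apply: cintB; [exact: r2|apply: steepM_cint; exact: r2].
  apply: (le_trans (ler_normB _ _)).
  have small : `|oint (fun t => w 1%N t * (1 - steep (w 1%N) s t)) a b| <= s^-1 * L.
    have ci : cint a b (fun t => w 1%N t * (1 - steep (w 1%N) s t)).
      case: rw' => _ r2 _.
      rewrite (_ : (fun t => _) = (fun t => w 1%N t - w 1%N t * steep (w 1%N) s t)); last by apply/funext => t; ring.
      by apply: cintB; [exact: r2|apply: steepM_cint; exact: r2].
    apply: (le_trans (norm_oint (lexx a) (lexx b) ci)).
    rewrite -oint_cst ?(ltW ab)//; apply: (@le_oint _ a b) => //; [exact: cint_norm|exact: cint_cst|].
    move=> t _ _; rewrite /steep; case: ltP => [_|ft]; first by rewrite subrr mulr0 normr0 invr_ge0 ltW.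
    by rewrite subr0 mulr1.
  rewrite -/S.
  have e1 : s^-1 * L <= 2 * s * (S / s ^+ 2).
    have -> : 2 * s * (S / s ^+ 2) = s^-1 * (2 * S) by field; rewrite gt_eqF.
    by rewrite ler_wpM2l// invr_ge0 ltW.
  have e2 : M / alpha k p * T <= 4 * n.+1%:R * (M / alpha k p) * rate * (S / s ^+ 2).
    have M' : 0 <= M / alpha k p by rewrite divr_ge0// ltW.
    apply: (@le_trans _ _ (M / alpha k p * (2 * n.+1%:R * (2 * S * (rate / s ^+ 2))))).
      rewrite ler_wpM2l// (le_trans TT)//.
      by rewrite ler_wpM2l ?mulr_ge0// ler_wpM2r// divr_ge0 ?rate_ge0// ltW.
    by rewrite le_eqVlt; apply/orP; left; apply/eqP; ring.
  have e3 : 0 <= rate * (S / s ^+ 2) by rewrite mulr_ge0 ?rate_ge0// divr_ge0// ltW.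
  rewrite lX /rho /Kconst.
  have -> : ((4 * n.+1%:R * (M / alpha k p) + 1) * rate + 2 * s) * (S / s ^+ 2) =
    4 * n.+1%:R * (M / alpha k p) * rate * (S / s ^+ 2) + rate * (S / s ^+ 2) + 2 * s * (S / s ^+ 2) by ring.
  lra.
- have T0 : 0 < L / s ^+ 2 by rewrite divr_gt0.
  apply: (le_trans (m_scaled _ tp T0 l0)) => //.
  rewrite lX sqr_sqrtr; last first.
    by apply: divr_ge0; [rewrite mulr_ge0// exprn_ge0// ltW|exact: ltW].
  have -> : (L / s ^+ 2)^-1 ^+ (2 * k) * (L / s ^+ 2) * alpha k p * (E * L ^+ (2 * k).-1 / alpha k p) =
     (s ^+ 2) ^+ (2 * k).-1 * E.
    have -> : (2 * k = (2 * k).-1.+1)%N by rewrite /k; clear; lia.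
    rewrite exprSr mulfVK ?gt_eqF// succnK invf_div exprMn exprVn.
    have : L ^+ (2 * k).-1 != 0 by rewrite expf_neq0// gt_eqF.
    move: (L ^+ _) ((s ^+ 2) ^+ _) => Y Z Y0.
    by field; rewrite Y0 gt_eqF.
  rewrite /steep_energy -/S -/E mulrDr; apply: lerD.
    by rewrite mulrA ler_wpM2r// invr_ge0 ltW.
  by rewrite ler_peMl ?mulr_ge0 ?exprn_ge0 ?(ltW s2)//; lra.
Qed.

Variable N : nat.
Hypothesis hN : h * N%:R = 1.

Definition cell (j : nat) : R := h * j%:R.
Lemma cellS j : cell j.+1 = cell j + h. Proof. by rewrite /cell -[j.+1]addn1 natrD mulrDr mulr1. Qed.
Lemma cell_ge0 j : 0 <= cell j. Proof. by rewrite /cell mulr_ge0// ltW. Qed.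
Lemma cell_le1 j : (j <= N)%N -> cell j <= 1.
Proof. by move=> jN; rewrite -hN /cell ler_wpM2l ?(ltW h0)// ler_nat. Qed.
Lemma cell_mono i j : (i <= j)%N -> cell i <= cell j.
Proof. by move=> ij; rewrite /cell ler_wpM2l ?(ltW h0)// ler_nat. Qed.

Lemma bad_run i j : (i <= j)%N -> (j <= N)%N -> (forall m, (i <= m < j)%N -> ~ good_cell (cell m)) ->
  (1 - d) * (cell j - cell i) <= steep_size (w 1%N) s (cell i) (cell j).
Proof.
have hd0 := d0; have hd12 := d12; have hs0 := s0; have hh0 := h0.
have hC0 := C0; have hC1 := C1; have hh1 := h1; have hh2 := h2.
have hs2 := s2.
elim: j => [|j IH].
  by rewrite leqn0 => /eqP -> _ _; rewrite subrr mulr0 steep_size_ge0.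
rewrite leq_eqVlt => /predU1P[<- _ _|]; first by rewrite subrr mulr0 steep_size_ge0.
rewrite ltnS => ij jN hb.
have jN' := ltnW jN.
have H := IH ij jN' (fun m hm => hb m ltac:(move: hm => /andP[-> /ltnW]; by [])).
rewrite (@size_cat (cell i) (cell j) (cell j.+1))//; last exact: cell_le1.
- have := @bad_cell (cell j) (cell_ge0 _); rewrite -cellS => /(_ (cell_le1 jN) (hb j _)) B.
  have {}B : (1 - d) * h <= steep_size (w 1%N) s (cell j) (cell j.+1) by apply: B; rewrite ij ltnSn.
  rewrite [in leLHS]cellS; lra.
- exact: cell_ge0.
- exact: cell_mono.
- exact: cell_mono.
Qed.

(* Between two good cells, either some cell in between is good and the interval is cut
   there, or all of them are bad and the cell problem applies to the whole run. *)
Lemma chain m : forall i x y, (i + m < N)%N -> good_cell (cell i) -> good_cell (cell (i + m)) ->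
  cell i <= x -> x <= cell i.+1 -> cell (i + m) <= y -> y <= cell (i + m).+1 -> x <= y ->
  controlled x y.
Proof.
have hd0 := d0; have hd12 := d12; have hs0 := s0; have hh0 := h0.
have hC0 := C0; have hC1 := C1; have hh1 := h1; have hh2 := h2.
have hs2 := s2.
elim/ltn_ind: m => m IH i x y imN gi gj ix xi jy yj xy.
have iN : (i < N)%N by apply: leq_ltn_trans imN; exact: leq_addr.
have i1 : cell i + h <= 1 by rewrite -cellS; exact: cell_le1.
case: m => [|m] in IH imN gj jy yj *.
  by apply: (@controlled_cell (cell i)) => //; rewrite ?cell_ge0 -?cellS//; rewrite addn0 in yj.
have ex : exists j, [&& (i < j)%N, (j <= i + m.+1)%N & `[< good_cell (cell j) >]].
  by exists (i + m.+1)%N; rewrite leqnn addnS ltnS leq_addr; apply/asboolP; rewrite -addnS.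
have [j /and3P[ij jm /asboolP gj'] jmin] := ex_minnP ex.
have x0 : 0 <= x by exact: le_trans (cell_ge0 _) ix.
have y1 : y <= 1 by apply: (le_trans yj); exact: cell_le1.
have jN : (j < N)%N by exact: leq_ltn_trans imN.
have cj : cell j <= y by apply: le_trans jy; exact: cell_mono.
have cij : cell i.+1 <= cell j by exact: cell_mono.
apply: (@controlled_cat x (cell i.+1) y) => //; first exact: le_trans cj.
  by apply: (@controlled_cell (cell i)) => //; rewrite ?cell_ge0 -?cellS.
apply: (@controlled_cat (cell i.+1) (cell j) y) => //; first exact: cell_ge0.
  have [e|nij] := eqVneq j i.+1.
    rewrite e; apply: (@controlled_cell (cell j)) => //; rewrite ?cell_ge0 -?e -?cellS //.
      by apply: cell_le1.
    by rewrite cellS lerDl ltW.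
  have ij' : (i.+1 < j)%N by rewrite ltn_neqAle eq_sym nij.
  apply: controlled_run => //.
  - exact: cell_ge0.
  - exact: cell_le1 (ltnW jN).
  - apply: (@le_trans _ _ (cell i.+2 - cell i.+1)); first by rewrite (cellS i.+1); lra.
    by rewrite lerD2r; exact: cell_mono.
  - apply: bad_run => //; first exact: ltnW.
    move=> a /andP[ia aj] ga; have : (j <= a)%N.
      by apply: jmin; rewrite ia (leq_trans (ltnW aj) jm); exact/asboolP.
    by rewrite leqNgt aj.
  - move=> l L ln hL LC; apply: (@good_cell_bound (cell i)) => //; rewrite ?cell_ge0 -?cellS//.
    exact: cell_mono.
  - move=> l L ln hL LC; apply: (@good_cell_bound (cell j)) => //; rewrite ?cell_ge0 -?cellS//.
      exact: cell_le1.
    exact: cell_mono.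
have [m' e] : exists m', (i + m.+1 = j + m')%N by exists (i + m.+1 - j)%N; rewrite subnKC.
rewrite e in imN gj jy yj.
apply: (IH m' _ j (cell j) y) => //.
- by move: e ij; clear; lia.
- exact: cell_mono.
Qed.

End Key.


(** * The jump estimate outside a small exceptional set *)

Section KeyThm.
Context {R : realType}.
Implicit Types (a b q s t x y z d h C L : R).

(** The exceptional set collects the closed bad cells; each is steep on at least half of its length,
    whence the factor 2. The null set [[set 0]] starts the induction, when no cell is available yet
    for the point 0. *)
Lemma bad_set n (w : nat -> R -> R) s C d h N :
  rep 0 1 n.+2 w -> 0 < s -> 1 <= C -> 0 < d -> d <= 1 / 2 ->
  s ^+ 2 * d / 2 <= h -> h <= s ^+ 2 * d -> 0 < h -> h * N%:R = 1 ->
  forall j, (j <= N)%N -> exists B : set R, [/\ measurable B,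
    (mu B <= (2 * steep_size (w 1%N) s 0 (cell h j))%:E)%E &
    forall x, 0 <= x -> x <= cell h j -> ~ B x ->
      exists2 i, (i < j)%N & good_cell n w s d h (cell h i) /\ cell h i <= x <= cell h i.+1].
Proof.
move=> rw s0 C1 d0 d12 h1 h2 h0 hN; elim=> [|j IH] jN.
  exists [set 0]; split; first exact: measurable_set1.
    by rewrite lebesgue_measure_set1 lee_fin mulr_ge0// steep_size_ge0.
  by move=> x x0; rewrite /cell mulr0 => x0' /=; case; apply/eqP; rewrite eq_le x0 x0'.
have [B [mB muB hB]] := IH (ltnW jN).
have cj0 : 0 <= cell h j by exact: cell_ge0.
have cS := cellS h j.
have cj1 : cell h j.+1 <= 1 by exact: (cell_le1 h0 hN).
have csz : steep_size (w 1%N) s 0 (cell h j.+1) =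
    steep_size (w 1%N) s 0 (cell h j) + steep_size (w 1%N) s (cell h j) (cell h j.+1).
  by apply: (size_cat s rw) => //; rewrite cS lerDl ltW.
have [gj|bj] := pselect (good_cell n w s d h (cell h j)).
  exists B; split => //.
    apply: (le_trans muB); rewrite lee_fin ler_pM2l// csz lerDl; exact: steep_size_ge0.
  move=> x x0 xj Bx; have [xj'|jx] := leP x (cell h j).
    by have [i ij hi] := hB x x0 xj' Bx; exists i => //; exact: ltnW.
  by exists j => //; split => //; rewrite (ltW jx) xj.
exists (B `|` `[cell h j, cell h j.+1]); split; first by apply: measurableU.
  apply: (le_trans (measureU2 _ _ _)) => //.
  apply: (@le_trans _ _ ((2 * steep_size (w 1%N) s 0 (cell h j))%:E + h%:E)%E).
    have e : (mu `[cell h j, cell h j.+1] <= h%:E)%E.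
      by rewrite lebesgue_measure_itv/= lte_fin cS ltrDl h0 -EFinB lee_fin addrC addKr.
    exact: leeD muB e.
  rewrite -EFinD lee_fin csz mulrDr lerD2l.
  have := bad_cell rw s0 C1 d0 d12 h1 h2 (le_trans ler01 C1) (exprn_gt0 2 s0) h0 cj0; rewrite -cS => /(_ cj1 bj).
  nra.
move=> x x0 xj nB; have [xj'|jx] := leP x (cell h j).
  have [|i ij hi] := hB x x0 xj'; first by move=> Bx; apply: nB; left.
  by exists i => //; exact: ltnW.
by exfalso; apply: nB; right; rewrite /= in_itv/= (ltW jx).
Qed.

(** The order of the quantifiers fixes the order of the limits: [K1] does not depend on [d], while
    [K2] does, so [s] must tend to 0 before [d]. *)
Theorem key n C : 1 <= C -> exists2 K1 : R, 0 <= K1 & forall d, 0 < d -> d <= 1 / 2 ->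
  exists2 K2 : R, 0 <= K2 & forall s (w : nat -> R -> R), 0 < s -> s <= 1 -> rep 0 1 n.+2 w ->
    steep_energy n.+2 w s 0 1 <= C ->
    exists B : set R, [/\ measurable B, (mu B <= (2 * C * s ^+ 2)%:E)%E &
      forall x y, 0 <= x -> x <= y -> y <= 1 -> ~ B x -> ~ B y ->
        exists2 l : R, 0 <= l &
          `|steep_jump (w 1%N) s x y| <= l ^+ n.+2 + K1 * Num.sqrt d + K2 * s /\
          m_ R n.+2 * l <= (1 + 2 * d) * steep_energy n.+2 w s x y].
Proof.
move=> C1; have C0 : 0 <= C by exact: le_trans C1.
have [p tp] : exists p : {poly R}, transition n.+2 p.
  by have [p [tp _]] := @transition_exists R n.+2 isT; exists p.
(* Only finitely many derivatives of [p] are nonzero, so a finite sum bounds all their end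
   values. *)
have [M [M_ge0 [M0 M1]]] : exists M : R, 0 <= M /\
    ((forall i, `|p^`(i).[0]| <= M) /\ (forall i, `|p^`(i).[1]| <= M)).
  exists (\sum_(i < size p) (`|p^`(i).[0]| + `|p^`(i).[1]|)); split.
    by apply: sumr_ge0 => i _; exact: addr_ge0.
  have H i : `|p^`(i).[0]| + `|p^`(i).[1]| <= \sum_(i < size p) (`|p^`(i).[0]| + `|p^`(i).[1]|).
    have [ip|pi] := ltnP i (size p).
      by rewrite (bigD1 (Ordinal ip))//= lerDl; apply: sumr_ge0 => j _; exact: addr_ge0.
    have -> : p^`(i) = 0 by apply/derivn_poly0.
    by rewrite !horner0 normr0 addr0; apply: sumr_ge0 => j _; exact: addr_ge0.
  by split=> i; apply: le_trans (H i); rewrite ?lerDl ?lerDr.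
have al0 := alpha_gt0 (isT : (0 < n.+2)%N) tp.
pose K := Kconst n M p.
have K0 : 0 <= K by apply: le_trans (Kconst_ge1 M_ge0 al0).
pose K1 := C * (K * ((2 * C) ^+ n * Num.sqrt C)).
exists K1; first by rewrite /K1 !mulr_ge0 ?exprn_ge0 ?mulr_ge0 ?sqrtr_ge0.
move=> d d0 d12.
pose K2 := C * (K * ((4 * C / d) ^+ n * (n.+1%:R * (2 ^+ n.+2 / d) ^+ n)) + 2).
have a1 : 0 <= 4 * C / d by rewrite divr_ge0 ?mulr_ge0// ltW.
have a2 : 0 <= 2 ^+ n.+2 / d by rewrite divr_ge0 ?(ltW d0)// exprn_ge0.
have a3 : 0 <= (4 * C / d) ^+ n * (n.+1%:R * (2 ^+ n.+2 / d) ^+ n).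
  by apply: mulr_ge0; [exact: exprn_ge0|apply: mulr_ge0; [exact: ler0n|exact: exprn_ge0]].
exists K2; first by rewrite /K2 mulr_ge0// addr_ge0// mulr_ge0.
move=> s w s0 s1 rw enC.
have s2 : 0 < s ^+ 2 by rewrite exprn_gt0.
(* A whole number of cells has to fill [[0, 1]]. Since [s^2 d <= 1], the length [1 / N] can be taken
   between half of [s^2 d] and [s^2 d]. *)
have [N [N1 N2]] : exists N, (s ^+ 2 * d)^-1 <= N%:R /\ N%:R <= 2 * (s ^+ 2 * d)^-1 :> R.
  pose X := (s ^+ 2 * d)^-1.
  have X1 : 1 <= X.
    rewrite -[1]invr1 lef_pV2 ?posrE ?mulr_gt0//.
    by rewrite mulr_ile1 ?exprn_ile1 ?(ltW s0) ?(ltW d0) ?exprn_ge0 ?(ltW s2)//; lra.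
  have X0 := le_trans ler01 X1.
  have /andP[t1 t2] := truncn_itv X0.
  exists (Num.truncn X).+1; split; first exact: ltW.
  rewrite -/X -[(Num.truncn X).+1]addn1 natrD; lra.
set X := (s ^+ 2 * d)^-1 in N1 N2.
have X0 : 0 < X by rewrite invr_gt0 mulr_gt0.
have N0 : 0 < N%:R :> R by exact: lt_le_trans N1.
have XE : X^-1 = s ^+ 2 * d by rewrite /X invrK.
pose h : R := N%:R^-1.
have h0 : 0 < h by rewrite invr_gt0.
have hN : h * N%:R = 1 by rewrite mulVf ?gt_eqF.
have h2 : h <= s ^+ 2 * d by rewrite -XE lef_pV2 ?posrE.
have h1 : s ^+ 2 * d / 2 <= h.
  by rewrite -XE -invfM mulrC lef_pV2 ?posrE// mulr_gt0.
have [B [mB muB hB]] := bad_set rw s0 C1 d0 d12 h1 h2 h0 hN (leqnn N).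
have cN : cell h N = 1 by exact: hN.
have sC : steep_size (w 1%N) s 0 1 <= C * s ^+ 2.
  by apply: (size_leC rw enC s2).
exists B; split => //.
  by apply: (le_trans muB); rewrite lee_fin cN -mulrA ler_pM2l.
move=> x y x0 xy y1 Bx By.
rewrite cN in hB.
have [i iN [gi /andP[ix xi]]] := hB x x0 (le_trans xy y1) Bx.
have [j jN [gj /andP[jy yj]]] := hB y (le_trans x0 xy) y1 By.
have [l l0 [H1 H2]] : controlled n w s C d M p x y.
  have ctl i' m : (i' + m < N)%N -> good_cell n w s d h (cell h i') -> good_cell n w s d h (cell h (i' + m)) ->
    cell h i' <= x -> x <= cell h i'.+1 -> cell h (i' + m) <= y -> y <= cell h (i' + m).+1 -> controlled n w s C d M p x y.
    by move=> *; apply: (chain rw s0 C1 d0 d12 h1 h2 tp M0 M1 enC C0 s2 h0 M_ge0 al0 hN (i := i') (m := m)).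
  have [ij|ji] := leqP i j.
    by apply: (ctl i (j - i)%N) => //; rewrite subnKC.
  (* If the cell found for [y] precedes the one found for [x], both points sit at the left end of
     cell [i], which then serves for both. *)
  have cij : cell h j.+1 <= cell h i by exact: cell_mono.
  have e : y = cell h i by apply/eqP; rewrite eq_le (le_trans yj cij) (le_trans ix xy).
  apply: (ctl i 0%N) => //; rewrite ?addn0// e//.
  by rewrite cellS lerDl ltW.
exists l => //; split => //; apply: (le_trans H1).
rewrite -addrA lerD2l.
have S1 : steep_size (w 1%N) s x y / s ^+ 2 <= C.
  by rewrite ler_pdivrMr//; exact: (size_leC rw enC s2).
have r0 : 0 <= rho n s C d M p.
  rewrite /rho addr_ge0 ?mulr_ge0 ?(ltW s0)//.
  exact: (rate_ge0 n s0 d0 C0).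
apply: (le_trans (ler_wpM2l r0 S1)).
rewrite /rho -/K /rate /K1 /K2 sqrtrM ?(ltW d0)//.
by rewrite le_eqVlt; apply/orP; left; apply/eqP; ring.
Qed.
End KeyThm.


(** * Limits along an ultrafilter *)

Section Ultra.
Context {R : realType} (U : set_system nat).
Hypothesis UU : UltraFilter U.
Implicit Types (a b : nat -> R) (f h : R -> R) (M C e l : R).

(** Every bounded sequence converges along an ultrafilter. Limits at all points [x], and of all
    integrals against test functions, thus exist at once, and subsequences are extracted only at the
    very end. *)
Definition ulim a : R := lim (a @ U).

Lemma ulim_cvg a M : U [set n | `|a n| <= M] -> a @ U --> ulim a.
Proof.
move=> aM; have := @segment_compact R (- M) M => /(_ (a @ U)).
have PF : ProperFilter (a @ U) by apply: fmap_proper_filter.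
case=> //.
  change (U (a @^-1` `[- M, M])); apply: filterS aM => n h.
  by rewrite /preimage/= in_itv/= -ler_norml.
move=> l [_ cl]; suff : a @ U --> l by move/cvgP.
move=> V Vl.
have [//|nV] := in_ultra_setVsetC (a @^-1` V) UU.
by have [x [nVx Vx]] := cl (~` V) V nV Vl; have := nVx Vx.
Qed.

Lemma ulim_bounded a M : (forall n, `|a n| <= M) -> a @ U --> ulim a.
Proof. by move=> aM; apply: (@ulim_cvg _ M); apply: filterE => n; exact: aM. Qed.

Lemma ulimE a l : a @ U --> l -> ulim a = l.
Proof. by move=> h; apply: cvg_lim. Qed.

Lemma ulim_le a b (x y : R) : U [set n | a n <= b n] -> a @ U --> x -> b @ U --> y -> x <= y.
Proof. by move=> ab ax bY; apply: ler_cvg_to ax bY ab. Qed.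

Lemma ulim_ler a (x c : R) : U [set n | a n <= c] -> a @ U --> x -> x <= c.
Proof. by move=> ac ax; apply: ulim_le ac ax _; exact: cvg_cst. Qed.

Lemma sum_tail (y x : nat -> R) : (forall n, x n = y n + x n.+1) ->
  forall n, x 0%N = \sum_(0 <= i < n) y i + x n.
Proof.
move=> h; elim=> [|n IH]; first by rewrite big_geq// add0r.
by rewrite big_nat_recr//= -addrA -h.
Qed.

Section weak_limit.
Variables (g : nat -> R -> R) (C : R).
Hypotheses (mg : forall n, measurable_fun (`[0, 1] : set R) (g n)) (g2 : forall n, cint 0 1 (fun t => g n t ^+ 2))
  (gC : forall n, oint (fun t => g n t ^+ 2) 0 1 <= C).

Let Ig f n := oint (fun t => g n t * f t) 0 1.

Lemma C_ge0 : 0 <= C.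
Proof. by apply: le_trans (gC 0%N); apply: oint_ge0 => t _ _; exact: sqr_ge0. Qed.

Let bounded f := measurable_fun (`[0, 1] : set R) f /\ exists M, forall x, 0 <= x -> x <= 1 -> `|f x| <= M.

Let bsq f : bounded f -> cint 0 1 (fun t => f t ^+ 2).
Proof.
move=> [mf [M fM]]; apply: (@cint_bounded _ _ _ _ (M ^+ 2)).
  exact: measurable_funX.
by move=> x x0 x1; rewrite normrX lerXn2r ?nnegrE// ?fM// (le_trans _ (fM 0 _ _)).
Qed.

Let gfi n f : bounded f -> cint 0 1 (fun t => g n t * f t).
Proof. by move=> bf; case: (bf) => mf _; apply: cint_mul2 => //; exact: bsq. Qed.

Let Ig_le n f : bounded f -> `|Ig f n| <= Num.sqrt (C * oint (fun t => f t ^+ 2) 0 1).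
Proof.
move=> bf; case: (bf) => mf _; have f0 : 0 <= oint (fun t => f t ^+ 2) 0 1 by apply: oint_ge0 => t _ _; exact: sqr_ge0.
rewrite -ler_sqr ?nnegrE ?sqrtr_ge0// real_normK ?num_real// sqr_sqrtr ?mulr_ge0 ?C_ge0//.
apply: (le_trans (oint_CS ler01 (mg n) mf (g2 n) (bsq bf))).
by rewrite ler_wpM2r.
Qed.

Let Ig_cvg f : bounded f -> Ig f @ U --> ulim (Ig f).
Proof. by move=> bf; apply: ulim_bounded => n; exact: Ig_le. Qed.

Let J f := ulim (Ig f).

Let J_le f : bounded f -> `|J f| <= Num.sqrt (C * oint (fun t => f t ^+ 2) 0 1).
Proof.
move=> bf; apply: (@ulim_ler (fun n => `|Ig f n|)); first by apply: filterE => n; exact: Ig_le.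
by apply: cvg_norm; exact: Ig_cvg.
Qed.

Let J_D f h : bounded f -> bounded h -> J (fun t => f t + h t) = J f + J h.
Proof.
move=> bf bh; apply: ulimE.
rewrite (_ : Ig _ = fun n => Ig f n + Ig h n); first by apply: cvgD; exact: Ig_cvg.
apply/funext => n; rewrite /Ig -(@ointD _ 0 1)//; [|exact: gfi..].
by apply: eq_oint => t _ _; rewrite mulrDr.
Qed.

Let J_Z f c : bounded f -> J (fun t => c * f t) = c * J f.
Proof.
move=> bf; apply: ulimE.
rewrite (_ : Ig _ = fun n => c * Ig f n); first by apply: cvgMr; exact: Ig_cvg.
apply/funext => n; rewrite /Ig -(@ointZ _ 0 1)//; [|exact: gfi..].
by apply: eq_oint => t _ _; ring.
Qed.

Let b_indic (E : set R) : measurable E -> bounded (\1_E : R -> R).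
Proof.
move=> mE; split; first exact: measurable_indic.
by exists 1 => x _ _; rewrite indicE; case: (_ \in _); rewrite ?normr1 ?normr0.
Qed.

Let sq_indic (E : set R) : measurable E -> (oint (fun t => (\1_E t) ^+ 2) 0 1 : R) = fine (mu (E `&` `]0, 1])).
Proof.
move=> mE; rewrite (@eq_oint _ _ _ _ (\1_E : R -> R)); last first.
  by move=> t _ _; rewrite indicE; case: (_ \in _); rewrite ?expr1n ?expr0n.
by rewrite /oint /Rintegral integral_indic.
Qed.

Let nu0 (E : set (measurableTypeR R)) : \bar R := (J (\1_E : R -> R))%:E.

Let nu00 : nu0 set0 = 0%E.
Proof.
rewrite /nu0; congr EFin; apply/eqP; rewrite -normr_le0.
apply: (le_trans (J_le (b_indic measurable0))).
by rewrite sq_indic// set0I measure0 mulr0 sqrtr0.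
Qed.

Let nu0fin E : measurable E -> nu0 E \is a fin_num. Proof. by []. Qed.

(** Finite additivity together with continuity at the empty set: [J] of the tail union [T N] is at
    most the square root of [C] times the measure of that tail in []0, 1]], which tends to 0. *)
Let nu0s : semi_sigma_additive nu0.
Proof.
move=> F mF tF mUF.
pose T N : set R := \bigcup_(k >= N) F k.
have mT N : measurable (T N) by apply: bigcup_measurable => k _; exact: mF.
have step N : J (\1_(T N) : R -> R) = J (\1_(F N) : R -> R) + J (\1_(T N.+1) : R -> R).
  rewrite -(J_D (b_indic (mF N)) (b_indic (mT N.+1))).
  congr J; apply/funext => x; rewrite !indicE.
  have -> : (x \in T N) = (x \in F N) || (x \in T N.+1).
    apply/idP/orP; rewrite !inE.
      move=> [k /= Nk Fk]; have [e|nk] := eqVneq N k; first by left; rewrite e.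
      by right; exists k => //=; rewrite ltn_neqAle nk.
    by case=> [FN|[k /= Nk Fk]]; [exists N => //=|exists k => //=; exact: ltnW].
  have : ~~ ((x \in F N) && (x \in T N.+1)).
    apply/negP => /andP[]; rewrite !inE => FN [k /= Nk Fk].
    by have := tF N k I I (ex_intro _ x (conj FN Fk)); move=> e; rewrite e ltnn in Nk.
  by case: (x \in F N) => //= h; rewrite ?(negbTE h) ?addr0 ?add0r.
have sums N : J (\1_(T 0%N) : R -> R) = \sum_(0 <= i < N) J (\1_(F i) : R -> R) + J (\1_(T N) : R -> R).
  exact: (@sum_tail (fun N => J (\1_(F N) : R -> R)) (fun N => J (\1_(T N) : R -> R)) step).
pose D : set R := [set` `]0, 1]].
have mD : measurable D by exact: measurable_itv.
have tailmu : (mu (\bigcup_(k >= N) (F k `&` D)) @[N --> \oo] --> 0)%E.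
  have mF' k : measurable (F k `&` D) by apply: measurableI => //; exact: mF.
  rewrite -(_ : mu (lim_sup_set (fun k => F k `&` D)) = 0%E); last first.
    rewrite (_ : lim_sup_set _ = set0) ?measure0//.
    apply/seteqP; split => // x hx.
    have [k /= _ [Fk _]] := hx 0%N I; have [j /= kj [Fj _]] := hx k.+1 I.
    by have := tF k j I I (ex_intro _ x (conj Fk Fj)); move=> e; rewrite e ltnn in kj.
  apply: lim_sup_set_cvg => //.
  apply: (@le_lt_trans _ _ (mu D)).
    apply: le_measure; rewrite ?inE//; first by apply: bigcup_measurable => k _.
    by move=> x [k _ []].
  by rewrite /D lebesgue_measure_itv/= lte_fin ltr01 -EFinB ltry.
have tail0 : (fun N => fine (mu (T N `&` D))) @ \oo --> (0 : R).
  rewrite (_ : (fun N => _) = fine \o (fun N => mu (\bigcup_(k >= N) (F k `&` D)))); last first.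
    by apply/funext => N /=; rewrite /T setI_bigcupl.
  exact: fine_cvg tailmu.
have JT : (fun N => J (\1_(T N) : R -> R)) @ \oo --> (0 : R).
  apply/norm_cvg0P.
  apply: (@squeeze_cvgr _ _ _ _ (fun=> 0) (fun N => Num.sqrt (C * fine (mu (T N `&` D))))).
  - apply: nearW => N /=; rewrite normr_ge0/= -sq_indic//; exact: J_le (b_indic (mT N)).
  - exact: cvg_cst.
  - rewrite -[X in _ --> X](_ : Num.sqrt (C * 0) = 0); last by rewrite mulr0 sqrtr0.
    by apply: continuous_cvg; [exact: sqrt_continuous|apply: cvgMr; exact: tail0].
have -> : nu0 (\bigcup_n F n) = (J (\1_(T 0%N) : R -> R))%:E.
  by congr (EFin (J (\1_ _))); apply/seteqP; split => x [k _ Fk]; exists k.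
rewrite (_ : (fun n => _) = EFin \o (fun N => J (\1_(T 0%N) : R -> R) - J (\1_(T N) : R -> R))); last first.
  by apply/funext => N /=; rewrite (sums N) addrK sumEFin.
apply: cvg_EFin; first exact: nearW.
rewrite -[X in _ --> X]subr0; apply: cvgB JT; exact: cvg_cst.
Qed.

(* The limits of the integrals over measurable sets are absolutely continuous with
   respect to Lebesgue measure, because the [g n] are bounded in L^2. *)
Lemma weak_density : exists f, [/\ mu.-integrable setT (EFin \o f) &
   forall E : set R, measurable E -> J (\1_E : R -> R) = oint (fun t => f t * \1_E t) 0 1].
Proof.
pose nu : {charge set (measurableTypeR R) -> \bar R} := HB.pack nu0 (isCharge.Build _ _ _ nu0 nu00 nu0fin nu0s).
have numu : nu `<< mu.
  apply/null_content_dominatesP => A mA A0; rewrite /nu/= /nu0; congr EFin; apply/eqP; rewrite -normr_le0.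
  apply: (le_trans (J_le (b_indic mA))).
  rewrite sq_indic// (_ : mu _ = 0%E) ?mulr0 ?sqrtr0//.
  by apply/eqP; rewrite eq_le measure_ge0 andbT -A0 le_measure// inE//; exact: measurableI.
have rf := Radon_Nikodym_fin_num _ numu.
have ri := Radon_Nikodym_integrable numu.
pose f := Radon_Nikodym nu mu; exists (fine \o f).
have fE : EFin \o (fine \o f) = f by apply/funext => x /=; rewrite fineK//; exact: rf.
split; first by rewrite fE.
move=> E mE.
pose D : set R := [set` `]0, 1]].
have mD : measurable D by exact: measurable_itv.
have mED : measurable (E `&` D) by exact: measurableI.
have -> : J (\1_E : R -> R) = J (\1_(E `&` D) : R -> R).
  congr (lim (_ @ U)); apply/funext => n; apply: eq_oint => t t0 t1; rewrite indicI /= .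
  have Dt : D t by rewrite /D/= in_itv/= t0.
  by rewrite [\1_D t]indicE mem_set ?mulr1.
have e1 : (\int[mu]_(x in E `&` D) f x = \int[mu]_(x in D) (fine (f x) * \1_E x)%:E)%E.
  rewrite integral_mkcondl; apply: eq_integral => x _; rewrite patchE indicE.
  by case: (x \in E); rewrite ?mulr1 ?mulr0// fineK//; exact: rf.
apply: EFin_inj; rewrite -[LHS]/(nu (E `&` D)) (Radon_Nikodym_integral numu mED) e1.
rewrite /oint /Rintegral -/D fineK// -e1 -(Radon_Nikodym_integral numu mED)//.
Qed.

Lemma oint_indic f x y : 0 <= x -> y <= 1 -> oint (fun t => f t * \1_(`]x, y]) t) 0 1 = oint f x y.
Proof.
move=> x0 y1; rewrite /oint /Rintegral; congr fine.
have -> : (`]x, y]%classic : set R) = `]0, 1] `&` `]x, y].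
  apply/seteqP; split => [t|t [_ //]] /= h; split => //; move: h; rewrite !in_itv/= => /andP[xt ty].
  by rewrite (le_lt_trans x0 xt) (le_trans ty y1).
rewrite integral_mkcondr; apply: eq_integral => t tD; rewrite patchE indicE in_setI tD/=.
by case: (t \in _); rewrite ?mulr1 ?mulr0.
Qed.

(** The sum is the integer part of [X] capped at [K]; it writes a step approximation as a sum of
    indicators of level sets. *)
Lemma layer_cake (X : R) K : 0 <= X ->
  (X < K%:R -> (\sum_(i < K) ((i.+1%:R <= X)%R)%:R <= X < \sum_(i < K) ((i.+1%:R <= X)%R)%:R + 1)) /\
  (K%:R <= X -> \sum_(i < K) ((i.+1%:R <= X)%R)%:R = K%:R :> R).
Proof.
move=> X0; elim: K => [|K [h1 h2]].
  by split; rewrite ?big_ord0// ltNge X0.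
rewrite big_ord_recr/=; split => h.
- have -> : (K.+1%:R <= X) = false by apply/negbTE; rewrite -ltNge.
  rewrite addr0; have [/h1//|KX] := ltP X K%:R.
  by rewrite (h2 KX) KX natr1.
- rewrite h h2 ?natr1// (le_trans _ h)// ler_nat; exact: leqnSn.
Qed.

Lemma cancel_all (a c : R) : (forall n, `|a| <= c / n.+1%:R) -> a = 0.
Proof.
move=> h; apply/eqP; rewrite -normr_le0 leNgt; apply/negP => a0.
have := h (Num.truncn (c / `|a|)); rewrite leNgt => /negP; apply.
by rewrite ltr_pdivrMr// mulrC -ltr_pdivrMr// truncnS_gt.
Qed.

Section density.
Variable f : R -> R.
Hypotheses (fi : cint 0 1 f)
  (fJ : forall E : set R, measurable E -> J (\1_E : R -> R) = oint (fun t => f t * \1_E t) 0 1).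

Let ffi h : bounded h -> cint 0 1 (fun t => f t * h t).
Proof. by move=> [mh [M hM]]; apply: cint_bM hM fi. Qed.

Let bD h1 h2 : bounded h1 -> bounded h2 -> bounded (fun t => h1 t + h2 t).
Proof.
move=> [m1 [M1 b1]] [m2 [M2 b2]]; split; first exact: measurable_funD.
exists (M1 + M2) => x x0 x1; rewrite (le_trans (ler_normD _ _))// lerD ?b1 ?b2//.
Qed.

Let bZ c h : bounded h -> bounded (fun t => c * h t).
Proof.
move=> [m1 [M1 b1]]; split; first exact: measurable_funM.
by exists (`|c| * M1) => x x0 x1; rewrite normrM ler_wpM2l ?b1.
Qed.

Let ok h := bounded h /\ J h = oint (fun t => f t * h t) 0 1.

Let okD h1 h2 : ok h1 -> ok h2 -> ok (fun t => h1 t + h2 t).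
Proof.
move=> [b1 e1] [b2 e2]; split; first exact: bD.
rewrite J_D// e1 e2 -(@ointD _ 0 1)//; [|exact: ffi..].
by apply: eq_oint => t _ _; rewrite mulrDr.
Qed.

Let okZ c h : ok h -> ok (fun t => c * h t).
Proof.
move=> [b1 e1]; split; first exact: bZ.
rewrite J_Z// e1 -(@ointZ _ 0 1)//; [|exact: ffi..].
by apply: eq_oint => t _ _; ring.
Qed.

Let ok_indic (E : set R) : measurable E -> ok (\1_E : R -> R).
Proof. by move=> mE; split; [exact: b_indic|exact: fJ]. Qed.

(** The identity is known for indicators, hence for step functions. Both sides are continuous for
    uniform convergence, and the level sets of [h] at multiples of [1 / (N + 1)] give a step
    function that close to [h]. *)
Lemma density_bounded h : bounded h -> J h = oint (fun t => f t * h t) 0 1.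
Proof.
move=> bh; case: (bh) => mh [M hM]; apply/eqP; rewrite -subr_eq0; apply/eqP.
apply: (@cancel_all _ (Num.sqrt C + oint (fun t => `|f t|) 0 1)) => N.
have M0 : 0 <= M by apply: le_trans (hM 0 (lexx _) ler01).
pose K := (Num.truncn (2 * M * N.+1%:R)).+1.
pose E i : set R := `[0, 1] `&` [set t | i.+1%:R <= N.+1%:R * (h t + M)].
have mE i : measurable (E i).
  apply: measurable_fun_le => //.
  by apply: measurable_funM => //; apply: measurable_funD.
pose hN t : R := - M + N.+1%:R^-1 * \sum_(i < K) \1_(E i) t.
have okN : ok hN.
  apply: okD.
    have := okZ (- M) (ok_indic measurableT); congr ok.
    by apply/funext => t; rewrite indicT mulr1.
  apply: okZ; move: (K) => m; elim: m => [|K' IH].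
    have := okZ 0 (ok_indic measurableT); congr ok.
    by apply/funext => t; rewrite mul0r big_ord0.
  have := okD IH (ok_indic (mE K')); congr ok.
  by apply/funext => t; rewrite big_ord_recr.
have bN := okN.1.
have bB : bounded (fun t => h t + -1 * hN t) by apply: bD => //; exact: bZ.
have close t : 0 <= t -> t <= 1 -> `|h t + -1 * hN t| <= N.+1%:R^-1.
  move=> t0 t1; have /ler_normlP[hM1 hM2] := hM t t0 t1.
  pose X := N.+1%:R * (h t + M).
  have X0 : 0 <= X by rewrite mulr_ge0//; lra.
  have XK : X < K%:R.
    apply: (@le_lt_trans _ _ (2 * M * N.+1%:R)); last exact: truncnS_gt.
    by rewrite /X mulrC ler_wpM2r//; lra.
  have [/(_ XK)/andP[l1 l2] _] := layer_cake K X0.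
  have e : \sum_(i < K) \1_(E i) t = \sum_(i < K) ((i.+1%:R <= X)%R)%:R :> R.
    apply: eq_bigr => i _; rewrite indicE; congr (nat_of_bool _)%:R.
    by apply/idP/idP; rewrite inE /E/= in_itv/= t0 t1; [case|split].
  rewrite /hN e; set S := \sum_(i < K) _ in l1 l2 *.
  have N0 : 0 < N.+1%:R :> R by rewrite ltr0n.
  have -> : h t + -1 * (- M + N.+1%:R^-1 * S) = N.+1%:R^-1 * (X - S).
    by rewrite /X; field; rewrite nat1r gt_eqF.
  rewrite normrM gtr0_norm ?invr_gt0// -[leRHS]mulr1 ler_wpM2l ?invr_ge0 ?(ltW N0)//.
  by rewrite ger0_norm; lra.
have -> : J h - oint (fun t => f t * h t) 0 1 =
    J (fun t => h t + -1 * hN t) - oint (fun t => f t * (h t + -1 * hN t)) 0 1.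
  rewrite J_D//; last exact: bZ.
  rewrite J_Z// okN.2 (@eq_oint _ _ _ (fun t => f t * (h t + -1 * hN t)) (fun t => f t * h t - f t * hN t)).
    by rewrite (@ointB _ 0 1)//; [ring|exact: ffi..].
  by move=> t _ _; ring.
have N0 : 0 <= N.+1%:R^-1 :> R by rewrite invr_ge0.
apply: (le_trans (ler_normB _ _)); rewrite mulrDl lerD//.
- apply: (le_trans (J_le bB)).
  have -> : Num.sqrt C / N.+1%:R = Num.sqrt (C * N.+1%:R^-1 ^+ 2).
    by rewrite sqrtrM ?C_ge0// sqrtr_sqr ger0_norm.
  rewrite ler_sqrt ?mulr_ge0 ?C_ge0 ?sqr_ge0// ler_wpM2l ?C_ge0//.
  rewrite -[leRHS]mulr1 -[X in _ * X]subr0 -oint_cst//.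
  apply: (@le_oint _ 0 1) => //; [exact: bsq|exact: cint_cst|].
  by move=> t t0 t1; rewrite -[leLHS]real_normK ?num_real// lerXn2r ?nnegrE// close// ltW.
- have c1 : cint 0 1 (fun t => f t * (h t + -1 * hN t)) by exact: ffi.
  apply: (le_trans (norm_oint (lexx _) (lexx _) c1)).
  rewrite mulrC -(@ointZ _ 0 1)//; last exact: cint_norm.
  apply: (@le_oint _ 0 1) => //; [exact: cint_norm|apply: cintZ; exact: cint_norm|].
  by move=> t t0 t1; rewrite normrM mulrC ler_wpM2r// close// ltW.
Qed.

(** Weak lower semicontinuity of the norm, from [2 g h - h^2 <= g^2]. Since [f] is not yet known to
    be square integrable, it is paired through its truncations [h N], which monotone convergence
    removes. *)
Lemma density_sq (l : R) : U [set n | oint (fun t => g n t ^+ 2) 0 1 <= l] ->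
  cint 0 1 (fun t => f t ^+ 2) /\ oint (fun t => f t ^+ 2) 0 1 <= l.
Proof.
move=> Ul.
pose h N t := f t * \1_([set t | `|f t| <= N%:R]) t.
have mf : measurable_fun (`[0, 1] : set R) f by exact: cint_meas.
have hE N t : h N t = if `|f t| <= N%:R then f t else 0.
  by rewrite /h indicE; case: ifPn => ft; [rewrite mem_set ?mulr1|rewrite memNset ?mulr0//; exact/negP].
have bh N : bounded (h N).
  split.
    rewrite (_ : h N = fun t => if `|f t| <= N%:R then f t else 0); last exact/funext.
    apply: measurable_fun_if => //.
      by apply: measurable_fun_ler => //; exact: measurableT_comp.
    by apply: measurable_funS mf => //; exact: subIsetl.
  by exists N%:R => x _ _; rewrite hE; case: ifPn => //; rewrite normr0.
have H N : oint (fun t => h N t ^+ 2) 0 1 <= l.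
  have e : oint (fun t => h N t ^+ 2) 0 1 = J (h N).
    rewrite density_bounded//; apply: eq_oint => t _ _; rewrite !hE; by case: ifP; rewrite expr2 ?mulr0.
  have cv : (fun n => 2 * Ig (h N) n - oint (fun t => h N t ^+ 2) 0 1) @ U --> oint (fun t => h N t ^+ 2) 0 1.
    rewrite {2}(_ : oint _ 0 1 = 2 * J (h N) - oint (fun t => h N t ^+ 2) 0 1); last by rewrite -e; ring.
    by apply: cvgB; [apply: cvgMr; exact: Ig_cvg|exact: cvg_cst].
  apply: ulim_ler cv; apply: filterS Ul => n; apply: le_trans.
  rewrite /Ig -(@ointZ _ 0 1)//; last exact: gfi.
  rewrite -(@ointB _ 0 1)//; [|apply: cintZ; exact: gfi|exact: bsq].
  apply: (@le_oint _ 0 1) => //; first by apply: cintB; [apply: cintZ; exact: gfi|exact: bsq].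
  by move=> t _ _; have := sqr_ge0 (g n t - h N t); lra.
pose D : set R := [set` `]0, 1]].
have mD : measurable D by exact: measurable_itv.
have mfD : measurable_fun D f by apply: measurable_funS mf => //; exact: subset_itv_oc_cc.
have mhD N : measurable_fun D (h N).
  by apply: measurable_funS (bh N).1 => //; exact: subset_itv_oc_cc.
have MC : ((\int[mu]_(t in D) (h N t ^+ 2)%:E)%E @[N --> \oo] --> \int[mu]_(t in D) (f t ^+ 2)%:E)%E.
  have := @cvg_monotone_convergence _ _ R mu D mD (fun N t => (h N t ^+ 2)%:E).
  rewrite (_ : (\int[mu]_(t in D) (f t ^+ 2)%:E)%E = (\int[mu]_(t in D) limn (fun N => (h N t ^+ 2)%:E))%E); last first.
    apply: eq_integral => t _; apply/esym/cvg_lim => //.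
    apply: cvg_near_cst; exists (Num.truncn `|f t|).+1 => // N /= tN; rewrite hE ifT//.
    by rewrite ltW// (lt_le_trans (truncnS_gt _))// ler_nat.
  apply.
  - by move=> N; apply/measurable_EFinP; apply: measurable_funX; exact: mhD.
  - by move=> N x _; rewrite lee_fin sqr_ge0.
  - move=> x _ N M NM; rewrite lee_fin !hE; case: ifPn => xN; last by rewrite expr0n/= sqr_ge0.
    by rewrite ifT// (le_trans xN)// ler_nat.
have L : (\int[mu]_(t in D) (f t ^+ 2)%:E <= l%:E)%E.
  apply: (cvge_to_le MC); apply: nearW => N; move: (H N); rewrite /oint /Rintegral -/D -lee_fin fineK//.
  exact: integrable_fin_num (cint_oc (bsq (bh N)) (lexx _) (lexx _)).
have f2 : cint 0 1 (fun t => f t ^+ 2).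
  apply/cint_oo/integrableP; split.
    by apply/measurable_EFinP; apply: measurable_funX; apply: measurable_funS mf => //; exact: subset_itv_oo_cc.
  apply: (@le_lt_trans _ _ l%:E); last exact: ltry.
  have L' : (\int[mu]_(t in D) `|(EFin \o (fun t => (f t ^+ 2)%R)) t| <= l%:E)%E.
    by under eq_integral do rewrite /= ger0_norm ?sqr_ge0//.
  apply: le_trans L'; apply: ge0_subset_integral => //; last exact: subset_itv_oo_oc.
  by apply: measurableT_comp => //; apply/measurable_EFinP; apply: measurable_funX.
split=> //; rewrite /oint /Rintegral -/D -lee_fin fineK//.
exact: integrable_fin_num (cint_oc f2 (lexx _) (lexx _)).
Qed.
End density.

Theorem weak_L2 : exists f, [/\ cint 0 1 f, cint 0 1 (fun t => f t ^+ 2),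
  forall x y : R, 0 <= x -> y <= 1 -> (fun n => oint (g n) x y) @ U --> oint f x y &
  forall l, U [set n | oint (fun t => g n t ^+ 2) 0 1 <= l] -> oint (fun t => f t ^+ 2) 0 1 <= l].
Proof.
have [f [fi fJ]] := weak_density.
have ci : cint 0 1 f by apply: integrableS fi.
exists f; split => //.
- have UC : U [set n | oint (fun t => g n t ^+ 2) 0 1 <= C] by apply: filterE => n; exact: gC.
  by have [] := density_sq ci fJ UC.
- move=> x y x0 y1; have mE : measurable (`]x, y] : set R) by exact: measurable_itv.
  have := Ig_cvg (b_indic mE); rewrite -/(J _) fJ// oint_indic//.
  by rewrite (_ : Ig _ = fun n => oint (g n) x y)//; apply/funext => n; rewrite /Ig oint_indic.
- by move=> l Ul; have [] := density_sq ci fJ Ul.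
Qed.
End weak_limit.
End Ultra.


(** * Compactness *)

Section Tools.
Context {R : realType}.
Implicit Types (a b c d e l s t x y C K M : R) (f g : R -> R).

Lemma extract (U : set_system nat) (P : nat -> set nat) : ProperFilter U ->
  (forall N, U [set n | (N <= n)%N]) -> (forall m, U (P m)) ->
  exists phi : nat -> nat, {homo phi : m n / (m < n)%N} /\ forall m, P m (phi m).
Proof.
move=> UF Uoo UP.
have H m N : {n | (N <= n)%N /\ P m n}.
  by apply: cid; have [x [h1 h2]] := @filter_ex _ U _ _ (filterI (Uoo N) (UP m)); exists x.
pose phi := fix phi m := match m with 0 => sval (H 0%N 0%N) | m'.+1 => sval (H m'.+1 (phi m').+1) end.
exists phi; split; last by case=> [|m]; [exact: (svalP (H _ _)).2|exact: (svalP (H _ _)).2].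
apply: homo_ltn => [y x z|m]; first exact: ltn_trans.
exact: (svalP (H _ _)).1.
Qed.

Lemma homo_ge_id (phi : nat -> nat) : {homo phi : m n / (m < n)%N} -> forall m, (m <= phi m)%N.
Proof.
move=> h; elim=> // m IH; apply: leq_ltn_trans IH _; exact: h.
Qed.

(** Countably many limits along the ultrafilter are realised by one subsequence: its [m]-th index
    makes the sequences [a 0] to [a m] closer than [1 / (m + 1)] to their limits. *)
Lemma extract_cvg (U : set_system nat) (a : nat -> nat -> R) (l : nat -> R) : ProperFilter U ->
  (forall N, U [set n | (N <= n)%N]) -> (forall q, a q @ U --> l q) ->
  exists phi : nat -> nat, {homo phi : m n / (m < n)%N} /\ forall q, a q \o phi @ \oo --> l q.
Proof.
move=> UF Uoo al.
pose P m := [set n | forall q, (q <= m)%N -> `|l q - a q n| < m.+1%:R^-1].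
have UP m : U (P m).
  have e0 : 0 < m.+1%:R^-1 :> R by rewrite invr_gt0.
  have H q : U [set n | `|l q - a q n| < m.+1%:R^-1] by exact: (@cvgr_dist_lt _ _ _ _ _ _ _ (al q) _ e0).
  suff : forall j, U [set n | forall q, (q <= j)%N -> `|l q - a q n| < m.+1%:R^-1] by exact.
  elim=> [|j IH].
    by apply: filterS (H 0%N) => n h q; rewrite leqn0 => /eqP ->.
  apply: filterS2 IH (H j.+1) => n h1 h2 q; rewrite leq_eqVlt => /predU1P[->//|]; exact: h1.
have [phi [h1 h2]] := extract UF Uoo UP.
exists phi; split => // q; apply/cvgrPdist_lt => e e0.
exists (maxn q (Num.truncn e^-1)) => // m /=; rewrite geq_max => /andP[qm em].
apply: lt_le_trans (h2 m q qm) _; rewrite invf_ple ?posrE//.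
by rewrite (le_trans (ltW (truncnS_gt _)))// ler_nat ltnS.
Qed.

(** The Borel-Cantelli lemma for a geometric series. *)
Lemma eventually_good (B : nat -> set R) c : (forall i, measurable (B i)) ->
  (forall i, mu (B i) <= (c * 2^-1 ^+ i)%:E)%E ->
  {ae mu, forall x, exists N, forall i, (N <= i)%N -> ~ B i x}.
Proof.
move=> mB cB.
have c0 : 0 <= c.
  by have h := cB 0%N; rewrite expr0 mulr1 in h; rewrite -lee_fin; apply: le_trans h; exact: measure_ge0.
have mu0 : mu (lim_sup_set B) = 0%E.
  apply: lim_sup_set_cvg0 => //.
  apply: (@le_lt_trans _ _ (\sum_(n <oo) (c * 2^-1 ^+ n)%:E)%E).
    by apply: lee_nneseries => [i _ _|i _]; [exact: measure_ge0|exact: cB].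
  apply: (@le_lt_trans _ _ (2 * c)%:E); last exact: ltry.
  apply: lime_le.
    by apply: is_cvg_nneseries => i _ _; rewrite lee_fin mulr_ge0// exprn_ge0.
  apply: nearW => N; rewrite sumEFin lee_fin.
  have -> : \sum_(0 <= i < N) c * 2^-1 ^+ i = 2 * c - 2 * c * 2^-1 ^+ N.
    elim: N => [|N IH]; first by rewrite big_geq// expr0; ring.
    by rewrite big_nat_recr//= IH exprS; field.
  by rewrite gerBl mulr_ge0 ?exprn_ge0 ?mulr_ge0.
exists (lim_sup_set B); split => //.
  by rewrite /lim_sup_set; apply: bigcap_measurable => // N _; apply: bigcup_measurable => i _; exact: mB.
move=> x /= nx N _.
apply: contrapT => h; apply: nx; exists N => i Ni Bi; apply: h; exists i => //.
Qed.

(** One point of [X] is picked in each subinterval of [[0, 1]] with rational end points, enumerated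
    by [pickle]; codes of other pairs receive the default point [x0]. *)
Lemma dense_seq (X : R -> Prop) : {ae mu, forall x, x \in `]0, 1[ -> X x} ->
  exists q : nat -> R, (forall j, (q j \in `]0, 1[) /\ X (q j)) /\
    forall a b, 0 <= a -> a < b -> b <= 1 -> exists j, a < q j < b.
Proof.
move=> aeX.
have pick (a b : R) : 0 <= a -> a < b -> b <= 1 -> exists x, a < x < b /\ ((x \in `]0, 1[) /\ X x).
  move=> a0 ab b1; have [x xab hx] := ae_exists ab aeX.
  exists x; move: xab; rewrite in_itv/= => /andP[ax xb]; rewrite ax xb; split => //.
  have x01 : x \in `]0, 1[ by rewrite in_itv/= (le_lt_trans a0 ax) (lt_le_trans xb b1).
  by split => //; exact: hx.
have [x0 [_ X0]] := pick 0 1 (lexx _) ltr01 (lexx _).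
have H (j : nat) : exists x : R, ((x \in `]0, 1[) /\ X x) /\ forall p : rat * rat, choice.unpickle j = Some p ->
    0 <= (ratr p.1 : R) -> (ratr p.1 : R) < ratr p.2 -> (ratr p.2 : R) <= 1 -> ratr p.1 < x < ratr p.2.
  case: (choice.unpickle j) => [[p q]|]; last by exists x0.
  have [h|h] := pselect [/\ 0 <= (ratr p : R), (ratr p : R) < ratr q & (ratr q : R) <= 1]; last first.
    by exists x0; split => // _ [<-] /= *; exfalso; apply: h.
  have [p0 pq q1] := h; have [x [xpq hx]] := pick _ _ p0 pq q1.
  by exists x; split => // _ [<-].
have /choice[q hq] := H; exists q; split; first by move=> j; case: (hq j).
move=> a b a0 ab b1.
have [r1] := rat_in_itvoo ab; rewrite in_itv/= => /andP[ar1 r1b].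
have [r2] := rat_in_itvoo r1b; rewrite in_itv/= => /andP[r12 r2b].
have [_ /(_ (r1, r2) (choice.pickleK _))] := hq (choice.pickle (r1, r2)).
move=> h; have /= {}h := h (le_trans a0 (ltW ar1)) r12 (le_trans (ltW r2b) b1).
exists (choice.pickle (r1, r2)); move: h => /andP[h1 h2].
by rewrite (lt_trans ar1 h1) (lt_trans h2 r2b).
Qed.

Lemma cvg_congr (T : Type) (F : set_system T) (a : T -> R) (l l' : R) : l = l' -> a @ F --> l -> a @ F --> l'.
Proof. by move=> ->. Qed.

Lemma cvg_exp (T : Type) (F : set_system T) (a : T -> R) (l : R) k : Filter F -> a @ F --> l ->
  (fun z : T => a z ^+ k) @ F --> l ^+ k.
Proof.
move=> FF al; elim: k => [|k IH].
  by rewrite (_ : (fun z : T => _) = fun=> 1); [exact: cvg_cst|apply/funext => z].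
rewrite (_ : (fun z : T => _) = fun z => a z * a z ^+ k); last by apply/funext => z; rewrite exprS.
by rewrite exprS; apply: cvgM.
Qed.

Lemma cvg_close (T : Type) (F : set_system T) {FF : Filter F} (a : T -> R) (l e : R) : a @ F --> l -> 0 < e ->
  F [set z | l - e < a z /\ a z < l + e].
Proof.
move=> al e0; have /(_ FF) := @cvgr_dist_lt _ _ _ _ _ _ _ al _ e0.
by apply: filterS => z; rewrite ltr_distlC => /andP[h1 h2]; split.
Qed.


Lemma four_twelfths (j o p a b e : R) : j <= p + a + b -> o <= e / 12 -> p <= e / 12 -> a <= e / 12 -> b <= e / 12 ->
  j + o <= e / 3.
Proof. lra. Qed.

Lemma three_thirds (a b x y e : R) : a - e / 3 < b -> b < a + e / 3 -> `|b - y| <= e / 3 -> `|a - x| <= e / 3 ->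
  `|x - y| < e.
Proof.
rewrite !ler_norml ltr_norml => b2 b2' /andP[c1 c2] /andP[c3 c4]; apply/andP; split; lra.
Qed.

Lemma lt_twice (a b h : R) : a < b + h -> b < h -> a < 2 * h.
Proof. lra. Qed.

Lemma small_pow (k : nat) (E h d e : R) : 0 <= E -> E <= 2 * h -> 0 < d -> d <= 1 / 2 -> h <= 1 / 8 ->
  h <= e / 48 -> ((1 + 2 * d) * E) ^+ k.+2 <= e / 12.
Proof.
move=> E0 Eh d0 d12 h8 he.
have b1 : (1 + 2 * d) * E <= 4 * h by nra.
have b0 : 0 <= (1 + 2 * d) * E by apply: mulr_ge0 => //; lra.
apply: (@le_trans _ _ ((4 * h) ^+ k.+2)); first by apply: lerXn2r => //; rewrite nnegrE; lra.
rewrite exprS; apply: (@le_trans _ _ (4 * h * 1)); last lra.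
by apply: ler_wpM2l; [lra|apply: exprn_ile1; lra].
Qed.

Lemma oint_small g C x y e : cint 0 1 g -> cint 0 1 (fun t => g t ^+ 2) ->
  oint (fun t => g t ^+ 2) 0 1 <= C -> 0 <= x -> x <= y -> y <= 1 -> 0 <= e -> (y - x) * C <= e ^+ 2 ->
  `|oint g x y| <= e.
Proof.
move=> gi g2 gC x0 xy y1 e0 h.
rewrite -ler_sqr ?nnegrE// real_normK ?num_real//.
apply: (le_trans (oint_CS1 xy (cint_meas (cintS gi x0 y1)) (cintS g2 x0 y1))).
apply: le_trans h; apply: ler_wpM2l; first by rewrite subr_ge0.
apply: le_trans gC.
rewrite (oint_cat g2 (lexx 0) x0 (le_trans xy y1) (lexx _)) (oint_cat g2 x0 xy y1 (lexx _)).
have o1 : 0 <= oint (fun t => g t ^+ 2) 0 x by apply: oint_ge0 => t _ _; exact: sqr_ge0.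
have o2 : 0 <= oint (fun t => g t ^+ 2) y 1 by apply: oint_ge0 => t _ _; exact: sqr_ge0.
lra.
Qed.

Lemma cvg_half : (fun m => 2^-1 ^+ m : R) @ \oo --> (0 : R).
Proof. by apply: cvg_expr; rewrite gtr0_norm ?invr_gt0// invf_lt1// ltr1n. Qed.

End Tools.

(** * Passage to the limit along the ultrafilter *)

Section Compactness.
Context {R : realType} (n : nat) (s : nat -> R) (w : nat -> nat -> R -> R) (C K : R) (c : nat -> R).
Implicit Types (d e l t x y M : R) (f g : R -> R).
Let k := n.+2.
Hypotheses (C1 : 1 <= C) (s0 : forall i, 0 < s i) (s1 : forall i, s i <= 1)
  (s2 : forall i, s i <= 2^-1 ^+ i) (rw : forall i, rep 0 1 k (w i)).

(* The part of [f] on which the truncation is not active. *)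
Definition flat f e t := f t * (1 - steep f e t).

Hypotheses (enC : forall i, steep_energy k (w i) (s i) 0 1 <= C)
  (flC : forall i, oint (fun t => flat (w i 1%N) (s i) t ^+ 2) 0 1 <= C)
  (cK : forall i, exists B : set R, [/\ measurable B, (mu B <= (2 * C * s i ^+ 2)%:E)%E &
     forall x, 0 <= x -> x <= 1 -> ~ B x -> `|w i 0%N x + c i| <= K]).

Variable U : set_system nat.
Hypotheses (UU : UltraFilter U) (Uoo : forall N, U [set i | (N <= i)%N]).

Let g i := flat (w i 1%N) (s i).
Let E i x y := steep_energy k (w i) (s i) x y.
Let J i x y := steep_jump (w i 1%N) (s i) x y.
Let S i x := w i 0%N x + c i.

Let cw i : cint 0 1 (w i 1%N). Proof. by case: (rw i) => _ h _; exact: h. Qed.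

Let gE i : g i = fun t => w i 1%N t - w i 1%N t * steep (w i 1%N) (s i) t.
Proof. by apply/funext => t; rewrite /g /flat; ring. Qed.

Let gi i : cint 0 1 (g i).
Proof. by rewrite gE; apply: cintB => //; apply: steepM_cint. Qed.

Let g2 i : cint 0 1 (fun t => g i t ^+ 2).
Proof.
apply: (@cint_bounded _ _ _ _ ((s i)^-1 ^+ 2)).
  by apply: measurable_funX; exact: cint_meas (gi i).
move=> t _ _; rewrite normrX lerXn2r ?nnegrE ?invr_ge0 ?(ltW (s0 i))//.
rewrite /g /flat /steep; case: ltP => [_|h]; first by rewrite subrr mulr0 normr0 invr_ge0 ltW.
by rewrite subr0 mulr1.
Qed.

Let incr i x y : 0 <= x -> x <= y -> y <= 1 -> S i y - S i x = J i x y + oint (g i) x y.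
Proof.
move=> x0 xy y1; have -> : S i y - S i x = w i 0%N y - w i 0%N x by rewrite /S; ring.
case: (rw i) => h _ _; rewrite (h 0%N isT x y)// /J /steep_jump -(@ointD _ 0 1)//; last exact: steepM_cint.
by apply: eq_oint => t _ _; rewrite gE; ring.
Qed.

Let E_cat i x y z : 0 <= x -> x <= y -> y <= z -> z <= 1 -> E i x z = E i x y + E i y z.
Proof. by move=> *; apply: (energy_cat (s i) (rw i)). Qed.

Let E_ge0 i x y : 0 <= E i x y. Proof. rewrite /E; apply: energy_ge0; exact: exprn_gt0. Qed.

Let E_C i x y : 0 <= x -> x <= y -> y <= 1 -> E i x y <= C.
Proof.
move=> x0 xy y1; apply: le_trans (enC i); rewrite -/(E i 0 1).
rewrite (E_cat i (lexx 0) x0 (le_trans xy y1) (lexx _)) (E_cat i x0 xy y1 (lexx _)).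
have := E_ge0 i 0 x; have := E_ge0 i y 1; lra.
Qed.

Let cvgU (a : nat -> R) l : a @ \oo --> l -> a @ U --> l.
Proof. by move=> h V Vl; have [N _ NV] := h V Vl; exact: filterS NV (Uoo N). Qed.

Let s_cvg : s @ \oo --> (0 : R).
Proof.
apply: (@squeeze_cvgr _ _ _ _ (fun=> 0) (fun i => 2^-1 ^+ i)); [|exact: cvg_cst|exact: cvg_half].
by apply: nearW => i; rewrite ltW//= s2.
Qed.

(** Extends the energy of [[0, t]] to a monotone function of [t] on the whole line, so that
    [V (x + d)] and [V (x - d)] need no side condition. *)
Let clamp t : R := Num.max 0 (Num.min t 1).

Let clamp01 t : 0 <= clamp t <= 1.
Proof. by rewrite /clamp le_max lexx ge_max ler01 ge_min lexx orbT. Qed.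

Let clamp_id t : 0 <= t -> t <= 1 -> clamp t = t.
Proof. by move=> t0 t1; rewrite /clamp min_l// max_r. Qed.

Let clamp_le x y : x <= y -> clamp x <= clamp y.
Proof. by move=> xy; rewrite /clamp le_max2// le_min2. Qed.

Let G t := ulim U (fun i => E i 0 (clamp t)).

Let G_cvg t : (fun i => E i 0 (clamp t)) @ U --> G t.
Proof.
apply: (@ulim_bounded _ _ _ _ C) => i; have /andP[c0 c1] := clamp01 t.
by rewrite ger0_norm ?E_ge0// E_C.
Qed.

Let M := m_ R k.
Let M0 : 0 < M. Proof. exact: m_gt0. Qed.

(* [f] is the weak limit of the flat parts of the derivatives, [S0] the limit of the
   functions and [V] the limit of the steep energy of [[0, x]], divided by [m_ k].
   Outside the discontinuities of [V] the convergence holds along one subsequence,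
   by density of a countable set on which it does. *)
Theorem compactness : exists f (S0 V : R -> R) (X : R -> Prop) (phi : nat -> nat),
  [/\ cint 0 1 f /\ cint 0 1 (fun t => f t ^+ 2),
      {homo V : x y / x <= y},
      {ae mu, forall x, x \in `]0, 1[ -> X x} /\
        (forall x y, 0 < x -> x <= y -> y < 1 -> X x -> X y ->
           `|S0 y - S0 x - oint f x y| <= (V y - V x) ^+ k),
      forall l, U [set i | oint (fun t => flat (w i 1%N) (s i) t ^+ 2) 0 1 +
                           steep_energy k (w i) (s i) 0 1 <= l] ->
        oint (fun t => f t ^+ 2) 0 1 + m_ R k * (V 1 - V 0) <= l &
      {homo phi : m n / (m < n)%N} /\
        (forall x, x \in `]0, 1[ -> X x -> (forall e, 0 < e -> exists2 d, 0 < d & V (x + d) - V (x - d) < e) ->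
          (fun i => w (phi i) 0%N x + c (phi i)) @ \oo --> S0 x)].
Proof.
have [K1 K10 hK1] := key n C1.
pose d (m : nat) : R := 2^-1 ^+ m.+1.
have d0 m : 0 < d m by rewrite exprn_gt0// invr_gt0.
have d12 m : d m <= 1 / 2.
  rewrite /d exprS mul1r ler_piMr ?invr_ge0// exprn_ile1 ?invr_ge0//.
  by rewrite invf_le1// ler1n.
have /choice[K2 hK2] : forall m, exists K2 : R, 0 <= K2 /\ forall i, exists B : set R,
   [/\ measurable B, (mu B <= (2 * C * s i ^+ 2)%:E)%E &
      forall x y, 0 <= x -> x <= y -> y <= 1 -> ~ B x -> ~ B y ->
      `|J i x y| <= ((1 + 2 * d m) * (E i x y / M)) ^+ k + K1 * Num.sqrt (d m) + K2 * s i].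
  move=> m; have [K2 K20 h] := hK1 (d m) (d0 m) (d12 m); exists K2; split => // i.
  have [B [mB muB hB]] := h (s i) (w i) (s0 i) (s1 i) (rw i) (enC i).
  exists B; split => // x y x0 xy y1 Bx By.
  have [l l0 [h1 h2]] := hB x y x0 xy y1 Bx By.
  apply: (le_trans h1); rewrite !lerD2r.
  have h3 : l <= (1 + 2 * d m) * (E i x y / M).
    by rewrite mulrA ler_pdivlMr// mulrC.
  by apply: lerXn2r => //; rewrite nnegrE (le_trans l0 h3).
have /choice[B hB] : forall mi : nat * nat, exists B : set R,
   [/\ measurable B, (mu B <= (2 * C * s mi.2 ^+ 2)%:E)%E &
      forall x y, 0 <= x -> x <= y -> y <= 1 -> ~ B x -> ~ B y ->
      `|J mi.2 x y| <= ((1 + 2 * d mi.1) * (E mi.2 x y / M)) ^+ k + K1 * Num.sqrt (d mi.1) + K2 mi.1 * s mi.2].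
  by move=> [m i]; have [_ /(_ i)] := hK2 m.
have /choice[Bc hBc] := cK.
(* The points that leave, from some index on, the exceptional sets of every [d m] and those of the
   bound [K]. Almost every point does, since these sets have measure at most [2 * C * 2^-i]. *)
pose X x := (forall m, exists N, forall i, (N <= i)%N -> ~ B (m, i) x) /\ exists N, forall i, (N <= i)%N -> ~ Bc i x.
have small i : ((2 * C * s i ^+ 2)%:E <= (2 * C * 2^-1 ^+ i)%:E)%E.
  rewrite lee_fin ler_wpM2l//; first by have := C1; lra.
  by apply: le_trans (s2 i); rewrite expr2 ger_pMl// s1.
have aeX : {ae mu, forall x, x \in `]0, 1[ -> X x}.
  have h1 : {ae mu, forall x m, exists N, forall i, (N <= i)%N -> ~ B (m, i) x}.
    apply/ae_foralln => m; apply: (@eventually_good _ _ (2 * C)) => i; first by case: (hB (m, i)).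
    by apply: le_trans (small i); case: (hB (m, i)).
  have h2 : {ae mu, forall x, exists N, forall i, (N <= i)%N -> ~ Bc i x}.
    apply: (@eventually_good _ _ (2 * C)) => i; first by case: (hBc i).
    by apply: le_trans (small i); case: (hBc i).
  by apply: aeS2 h1 h2 => x a1 a2 _; split.
have [f [fi f2 fw fl]] := weak_L2 UU (fun i => cint_meas (gi i)) g2 flC.
pose S0 x := ulim U (fun i => S i x).
have S_cvg x : 0 < x -> x < 1 -> X x -> (fun i => S i x) @ U --> S0 x.
  move=> x0 x1 [_ [N hN]]; apply: (@ulim_cvg _ _ _ _ K); apply: filterS (Uoo N) => i Ni.
  by have [_ _ h] := hBc i; apply: h (ltW x0) (ltW x1) (hN i Ni).
pose V t := G t / M.
have V_homo : {homo V : x y / x <= y}.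
  move=> x y xy; apply: ler_wpM2r; first by rewrite invr_ge0; exact: ltW M0.
  apply: (ulim_le UU _ (@G_cvg x) (@G_cvg y)); apply: filterE => i.
  have /andP[c0 _] := clamp01 x; have /andP[_ c1] := clamp01 y.
  change (is_true (E i 0 (clamp x) <= E i 0 (clamp y))).
  by rewrite (E_cat i (lexx 0) c0 (clamp_le xy) c1) lerDl E_ge0.
have E_cvg x y : 0 <= x -> x <= y -> y <= 1 -> (fun i => E i x y / M) @ U --> V y - V x.
  move=> x0 xy y1; rewrite /V -mulrBl; apply: cvgMl.
  rewrite (_ : (fun i => E i x y) = fun i => E i 0 (clamp y) - E i 0 (clamp x)).
    by apply: cvgB; exact: G_cvg.
  apply/funext => i; rewrite !clamp_id ?(le_trans x0)// ?(le_trans xy)//.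
  by rewrite (E_cat i (lexx 0) x0 xy y1); ring.
have d_cvg : d @ \oo --> (0 : R).
  rewrite /d (_ : (fun m => _) = (fun m => 2^-1 ^+ m * 2^-1)); last by apply/funext => m; rewrite exprSr.
  by apply: (cvg_congr (mul0r 2^-1)); apply: cvgMl; exact: cvg_half.
have K1d_cvg : (fun m => K1 * Num.sqrt (d m)) @ \oo --> (0 : R).
  apply: (@cvg_congr _ _ _ _ (K1 * Num.sqrt 0)); first by rewrite sqrtr0 mulr0.
  by apply: cvgMr; apply: continuous_cvg => //; exact: sqrt_continuous.
have Jle x y m : 0 < x -> x <= y -> y < 1 -> X x -> X y ->
   exists N, forall i, (N <= i)%N -> `|J i x y| <= ((1 + 2 * d m) * (E i x y / M)) ^+ k + K1 * Num.sqrt (d m) + K2 m * s i.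
  move=> x0 xy y1 [/(_ m)[N1 h1] _] [/(_ m)[N2 h2] _]; exists (maxn N1 N2) => i.
  rewrite geq_max => /andP[i1 i2]; have [_ _ h] := hB (m, i).
  by apply: (h x y (ltW x0) xy (ltW y1)); [exact: h1|exact: h2].
(* The limit in [i] at fixed [m] removes [K2 m * s i]; the limit in [m] then removes
   [K1 * sqrt (d m)] and the factor [1 + 2 * d m]. *)
have main x y : 0 < x -> x <= y -> y < 1 -> X x -> X y -> `|S0 y - S0 x - oint f x y| <= (V y - V x) ^+ k.
  move=> x0 xy y1 Xx Xy.
  have J_cvg : (fun i => `|J i x y|) @ U --> `|S0 y - S0 x - oint f x y|.
    apply: cvg_norm; rewrite (_ : (fun i => _) = fun i => S i y - S i x - oint (g i) x y).
      apply: cvgB; last exact: fw (ltW x0) (ltW y1).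
      by apply: cvgB; apply: S_cvg => //; [exact: lt_le_trans xy|exact: le_lt_trans y1].
    by apply/funext => i; rewrite incr ?(ltW x0) ?(ltW y1)//; ring.
  have E' := E_cvg x y (ltW x0) xy (ltW y1).
  have lem m : `|S0 y - S0 x - oint f x y| <= ((1 + 2 * d m) * (V y - V x)) ^+ k + K1 * Num.sqrt (d m).
    rewrite -[leRHS]addr0 -(mulr0 (K2 m)).
    have [N hN] := Jle x y m x0 xy y1 Xx Xy.
    apply: (@ulim_le _ _ UU _ (fun i => ((1 + 2 * d m) * (E i x y / M)) ^+ k + K1 * Num.sqrt (d m) + K2 m * s i) _ _ _ J_cvg).
      by apply: filterS (Uoo N) => i; exact: hN.
    apply: cvgD; last by apply: cvgMr; exact: cvgU s_cvg.
    by apply: cvgD; [apply: cvg_exp; apply: cvgMr|exact: cvg_cst].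
  have lim : (fun m => ((1 + 2 * d m) * (V y - V x)) ^+ k + K1 * Num.sqrt (d m)) @ \oo --> (V y - V x) ^+ k.
    apply: (@cvg_congr _ _ _ _ (((1 + 2 * 0) * (V y - V x)) ^+ k + 0)); first by rewrite mulr0 !addr0 mul1r.
    apply: cvgD => //.
    by apply: cvg_exp; apply: cvgMl; apply: cvgD; [exact: cvg_cst|apply: cvgMr].
  by apply: ler_cvg_to (cvg_cst _) lim _; apply: nearW => m; exact: lem.
have [q [qX q_dense]] := dense_seq aeX.
have q01 j : 0 < q j /\ q j < 1 by have [+ _] := qX j; rewrite in_itv/= => /andP.
(* The values of the functions (odd [j]) and of the energies (even [j]) at the dense points are
   interleaved, so that one extraction serves both. *)
pose a j i := if odd j then S i (q j./2) else E i 0 (clamp (q j./2)).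
pose l j := if odd j then S0 (q j./2) else G (q j./2).
have al j : a j @ U --> l j.
  rewrite /a /l; case: (odd j); last exact: G_cvg.
  have [h1 h2] := q01 j./2; exact: S_cvg h1 h2 (qX _).2.
have [phi [phi_inc phi_cvg]] := extract_cvg (@ultra_proper _ _ UU) Uoo al.
have Sq j : (fun i => S (phi i) (q j)) @ \oo --> S0 (q j).
  by have := phi_cvg (2 * j).+1; rewrite /a /l /= mul2n odd_double /= uphalf_double.
have Gq j : (fun i => E (phi i) 0 (clamp (q j))) @ \oo --> G (q j).
  by have := phi_cvg (2 * j)%N; rewrite /a /l /= mul2n odd_double /= doubleK.
exists f, S0, V, X, phi; split => //.
- move=> l' Ul'; pose F := ulim U (fun i => oint (fun t => g i t ^+ 2) 0 1).
  have F_cvg : (fun i => oint (fun t => g i t ^+ 2) 0 1) @ U --> F.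
    apply: (@ulim_bounded _ _ UU _ C) => i; rewrite ger0_norm ?flC//.
    by apply: oint_ge0 => t _ _; exact: sqr_ge0.
  have fF : oint (fun t => f t ^+ 2) 0 1 <= F.
    apply/ler_addgt0Pr => e e0; apply: fl.
    by apply: filterS (cvg_close F_cvg e0) => i [_ /ltW].
  apply: (@le_trans _ _ (F + M * (V 1 - V 0))); first by rewrite lerD2r.
  apply: (@ulim_ler _ _ UU (fun i => oint (fun t => g i t ^+ 2) 0 1 + M * (E i 0 1 / M))).
    by apply: filterS Ul' => i; rewrite /= mulrCA mulfV ?gt_eqF// mulr1.
  by apply: cvgD => //; apply: cvgMr; exact: E_cvg.
(* Dense points [y1 < x < y2] are chosen where [V] varies by less than [h]. Along [phi] the energy
   of [[y1, y2]] stays below [2 * h], which bounds the difference of the values at [x] and [y2] by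
   [e / 3]; at [y2] convergence is already known. *)
- split => // x; rewrite in_itv/= => /andP[x0 x1] Xx Vx.
  apply/cvgrPdist_lt => e e0.
  have e12 : 0 < e / 12 by rewrite divr_gt0.
  have [m Hm] : exists m, K1 * Num.sqrt (d m) <= e / 12.
    have [m _ /(_ m (leqnn _)) [_ h]] := cvg_close K1d_cvg e12.
    by exists m; rewrite -[leRHS]add0r; exact: ltW.
  pose h := Num.min (e / 48) (1 / 8).
  have h0 : 0 < h by rewrite lt_min !divr_gt0.
  have he : h <= e / 48 by rewrite /h ge_min lexx.
  have h8 : h <= 1 / 8 by rewrite /h ge_min lexx orbT.
  have [dd dd0 Vdd] := Vx h h0.
  have [j1 /andP[j1l j1r]] : exists j, Num.max 0 (x - dd) < q j < x.
    apply: q_dense; rewrite ?le_max ?lexx ?gt_max ?x0 ?(ltW x1)//=.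
    by rewrite gtrBl.
  have C0 : 0 < C by apply: lt_le_trans C1.
  pose r := (e / 12) ^+ 2 / C.
  have r0 : 0 < r by rewrite divr_gt0// exprn_gt0.
  have [j2 /andP[j2l j2r]] : exists j, x < q j < Num.min 1 (Num.min (x + dd) (x + r)).
    by apply: q_dense; rewrite ?(ltW x0)// ?ge_min ?lexx// !lt_min x1 !ltrDl dd0 r0.
  move: j2r; rewrite !lt_min => /and3P[j21 j2d j2r].
  move: j1l; rewrite gt_max => /andP[j10 j1d].
  set y1 := q j1 in j1r j10 j1d; set y2 := q j2 in j2l j21 j2d j2r.
  have Vy : V y2 - V y1 < h.
    apply: le_lt_trans Vdd; apply: lerB; apply: V_homo; exact: ltW.
  have [N hN] : exists N, forall i, (N <= i)%N -> E i y1 y2 / M < 2 * h -> `|S i y2 - S i x| <= e / 3.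
    have [N1 hN1] := Jle x y2 m x0 (ltW j2l) j21 Xx (qX j2).2.
    have K2s : (fun i => K2 m * s i) @ \oo --> (0 : R).
      by apply: (cvg_congr (mulr0 (K2 m))); apply: cvgMr.
    have [N2 _ hN2] := cvg_close K2s e12.
    exists (maxn N1 N2) => i; rewrite geq_max => /andP[i1 i2] Ei.
    rewrite (incr i (ltW x0) (ltW j2l) (ltW j21)).
    have a1 := hN1 i i1; have [_ a2'] := hN2 i i2.
    have {a2'}a2 : K2 m * s i <= e / 12 by rewrite -[leRHS]add0r; exact: ltW.
    have a3 : `|oint (g i) x y2| <= e / 12.
      apply: (oint_small (gi i) (g2 i) (flC i) (ltW x0) (ltW j2l) (ltW j21) (ltW e12)).
      have -> : (e / 12) ^+ 2 = r * C by rewrite /r divfK// gt_eqF.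
      by apply: ler_wpM2r; [exact: ltW|rewrite lerBlDl; exact: ltW].
    have a4 : ((1 + 2 * d m) * (E i x y2 / M)) ^+ k <= e / 12.
      have E0 : 0 <= E i x y2 / M by apply: mulr_ge0; rewrite ?E_ge0// invr_ge0 ltW.
      have EE : E i x y2 / M <= E i y1 y2 / M.
        apply: ler_wpM2r; first by rewrite invr_ge0 ltW.
        by rewrite (E_cat i (ltW j10) (ltW j1r) (ltW j2l) (ltW j21)) lerDr E_ge0.
      exact: (small_pow n E0 (le_trans EE (ltW Ei)) (d0 m) (d12 m) h8 he).
    apply: (le_trans (ler_normD _ _)).
    exact: four_twelfths a1 a3 a4 Hm a2.
  have EU : U [set i | E i y1 y2 / M < 2 * h].
    have Ey := E_cvg y1 y2 (ltW j10) (ltW (lt_trans j1r j2l)) (ltW j21).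
    by apply: filterS (cvg_close Ey h0) => i [_ b1]; exact: lt_twice b1 Vy.
  have SU : `|S0 y2 - S0 x| <= e / 3.
    apply: (@ulim_ler _ _ UU (fun i => `|S i y2 - S i x|)).
      by apply: filterS2 EU (Uoo N) => i e1 Ni; exact: hN.
    by apply: cvg_norm; apply: cvgB; apply: S_cvg => //; [exact: lt_trans j2l|exact: (qX j2).2].
  have Ephi : (fun i => E (phi i) y1 y2 / M) @ \oo --> V y2 - V y1.
    rewrite /V -mulrBl; apply: cvgMl.
    rewrite (_ : (fun i => E (phi i) y1 y2) = fun i => E (phi i) 0 (clamp y2) - E (phi i) 0 (clamp y1)).
      by apply: cvgB; exact: Gq.
    have y12 := lt_trans j1r j2l.
    apply/funext => i; rewrite !clamp_id ?(ltW j10) ?(ltW j21) ?(ltW (lt_trans j10 y12)) ?(ltW (lt_trans y12 j21))//.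
    by rewrite (E_cat (phi i) (lexx 0) (ltW j10) (ltW y12) (ltW j21)); ring.
  have e3 : 0 < e / 3 by rewrite divr_gt0.
  have n3 : \forall i \near \oo, (N <= phi i)%N.
    by exists N => // i /= Ni; exact: leq_trans Ni (homo_ge_id phi_inc i).
  apply: filterS3 (cvg_close Ephi h0) (cvg_close (Sq j2) e3) n3 => i [_ b1] [b2 b2'] b3.
  have {}b1 : E (phi i) y1 y2 / M < 2 * h by exact: lt_twice b1 Vy.
  have b4 := hN _ b3 b1; rewrite -/y2 in b2 b2'.
  change (is_true (`|S0 x - S (phi i) x| < e)).
  exact: three_thirds b2 b2' b4 SU.
Qed.
End Compactness.


(** * Jumps of the limit *)

Section Atoms.
Context {R : realType}.
Implicit Types (z : R -> R).

(** Only positive parts are summed, so that this is a measure; the signed sum of the jumps is the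
    difference of [atoms z] and [atoms] of the opposite function. *)
Definition atoms z (A : set (measurableTypeR R)) : \bar R := (\esum_(t in A) (Num.max (z t) 0)%:E)%E.

Let atoms0 z : atoms z set0 = 0%E. Proof. by rewrite /atoms esum_set0. Qed.

Let max_ge0 z (t : R) : (0 <= (Num.max (z t) 0)%:E)%E.
Proof. by rewrite lee_fin le_max lexx orbT. Qed.

Let atoms_ge0 z A : (0 <= atoms z A)%E.
Proof. by apply: esum_ge0 => t _. Qed.

Let atoms_sigma z : semi_sigma_additive (atoms z).
Proof.
move=> F mF tF mUF; rewrite /atoms nneseries_sum_bigcup//.
by apply: is_cvg_nneseries => i _ _; exact: atoms_ge0.
Qed.

HB.instance Definition _ z := isMeasure.Build _ _ _ (atoms z) (atoms0 z) (atoms_ge0 z) (@atoms_sigma z).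

End Atoms.

(** * One-sided limits and oscillation of a monotone function *)

Section Monotone.
Context {R : realType} (V : R -> R).
Hypothesis V_homo : {homo V : x y / x <= y}.
Implicit Types (a b e t x y c d : R).

Definition Vr t := inf (V @` [set y | t < y]).
Definition Vl t := sup (V @` [set y | y < t]).
Definition osc t := Vr t - Vl t.

Let Vr_inf t : has_inf (V @` [set y | t < y]).
Proof.
split; first by exists (V (t + 1)), (t + 1) => //=; rewrite ltrDl.
by exists (V t) => _ [y /= ty <-]; apply: V_homo; exact: ltW.
Qed.

Let Vl_sup t : has_sup (V @` [set y | y < t]).
Proof.
split; first by exists (V (t - 1)), (t - 1) => //=; rewrite gtrBl.
by exists (V t) => _ [y /= ty <-]; apply: V_homo; exact: ltW.
Qed.

Lemma Vr_le t y : t < y -> Vr t <= V y.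
Proof. by move=> ty; apply: ge_inf; [case: (Vr_inf t)|exists y]. Qed.

Lemma Vl_ge t y : y < t -> V y <= Vl t.
Proof. by move=> ty; apply: ub_le_sup; [case: (Vl_sup t)|exists y]. Qed.

Lemma Vr_ge t : V t <= Vr t.
Proof.
apply: lb_le_inf; first by case: (Vr_inf t).
by move=> _ [y /= ty <-]; apply: V_homo; exact: ltW.
Qed.

Lemma Vl_le t : Vl t <= V t.
Proof.
apply: ge_sup; first by case: (Vl_sup t).
by move=> _ [y /= ty <-]; apply: V_homo; exact: ltW.
Qed.

Lemma osc_ge0 t : 0 <= osc t.
Proof. by rewrite subr_ge0 (le_trans (Vl_le t))// Vr_ge. Qed.

Lemma Vr_close t e : 0 < e -> exists2 d : R, 0 < d & forall y, y < t + d -> V y <= Vr t + e.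
Proof.
move=> e0; have [_ [y /= ty <-] ye] := inf_adherent e0 (Vr_inf t).
exists (y - t); first by rewrite subr_gt0.
by move=> x; rewrite addrC subrK => xy; apply: le_trans (ltW ye); apply: V_homo; exact: ltW.
Qed.

Lemma Vl_close t e : 0 < e -> exists2 d : R, 0 < d & forall y, t - d < y -> Vl t - e <= V y.
Proof.
move=> e0; have [_ [y /= ty <-] ye] := sup_adherent e0 (Vl_sup t).
exists (t - y); first by rewrite subr_gt0.
by move=> x; rewrite opprB addrC subrK => xy; apply: (le_trans (ltW ye)); apply: V_homo; exact: ltW.
Qed.

Lemma Vr_le_Vl x y : x < y -> Vr x <= Vl y.
Proof.
move=> xy; apply: (@le_trans _ _ (V ((x + y) / 2))).
  by apply: Vr_le; rewrite midf_lt.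
by apply: Vl_ge; rewrite midf_lt.
Qed.

Lemma Vr_homo x y : x <= y -> Vr x <= Vr y.
Proof.
rewrite le_eqVlt => /predU1P[->//|xy].
by rewrite (le_trans (Vr_le xy))// Vr_ge.
Qed.

Lemma osc_sum (l : seq R) a b : path <%R a l -> all (fun t => t < b) l -> a < b ->
  \sum_(t <- l) osc t <= Vl b - Vr a.
Proof.
elim: l a => [|t l IH] a /=; first by move=> _ _ ab; rewrite big_nil subr_ge0 Vr_le_Vl.
move=> /andP[at_ pl] /andP[tb lb] ab; rewrite big_cons.
have := IH t pl lb tb; have := Vr_le_Vl at_; rewrite /osc; lra.
Qed.

Lemma osc_uniq (l : seq R) a b : a < b -> uniq l -> {in l, forall t, a < t < b} ->
  \sum_(t <- l) osc t <= Vl b - Vr a.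
Proof.
move=> ab ul hl; rewrite (perm_big (sort <=%R l))/=; last by rewrite perm_sym perm_sort.
apply: osc_sum => //.
- rewrite lt_path_sortedE; apply/andP; split; last by rewrite sort_lt_sorted.
  by apply/allP => t; rewrite mem_sort => /hl /andP[].
- by apply/allP => t; rewrite mem_sort => /hl /andP[].
Qed.

Lemma osc_esum (P : set R) (p : R -> R) a b c : a < b -> (forall t, P t -> a < t < b) -> 0 <= c ->
  (forall t, P t -> p t <= c * osc t) ->
  (\esum_(t in P) (p t)%:E <= (c * (Vl b - Vr a))%:E)%E.
Proof.
move=> ab Pab c0 hp; apply: ub_ereal_sup => _ [A [fA AP] <-].
rewrite fsbig_finite// sumEFin lee_fin.
have lA t : t \in enum_fset (fset_set A) -> A t.
  by move=> h; have : t \in fset_set A by []; rewrite in_fset_set// => /set_mem.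
apply: (@le_trans _ _ (\sum_(t <- enum_fset (fset_set A)) c * osc t)).
  by rewrite big_seq [leRHS]big_seq; apply: ler_sum => t /lA/AP; exact: hp.
rewrite -mulr_sumr ler_wpM2l// osc_uniq//; first exact: fset_uniq.
by move=> t /lA/AP; exact: Pab.
Qed.

Lemma osc_le t a b : a < t -> t < b -> osc t <= Vl b - Vr a.
Proof. by move=> at_ tb; have := Vr_le_Vl tb; have := Vr_le_Vl at_; rewrite /osc; lra. Qed.

Lemma osc_le_oc t a b : a < t -> t <= b -> osc t <= Vr b - Vr a.
Proof. by move=> at_ tb; have := Vr_homo tb; have := Vr_le_Vl at_; rewrite /osc; lra. Qed.

Lemma osc_esum_oc (P : set R) (p : R -> R) a b c : a < b -> (forall t, P t -> a < t <= b) -> 0 <= c ->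
  (forall t, P t -> p t <= c * osc t) ->
  (\esum_(t in P) (p t)%:E <= (c * (Vr b - Vr a))%:E)%E.
Proof.
move=> ab Pab c0 hp; apply/lee_addgt0Pr => e e0.
have e' : 0 < e / (c + 1) by rewrite divr_gt0//; lra.
have [d d0 hd] := Vr_close b e'.
have bb : b < b + d / 2 by rewrite ltrDl divr_gt0.
apply: (le_trans (@osc_esum P p a (b + d / 2) c _ _ c0 hp)); first exact: lt_trans bb.
  by move=> t /Pab /andP[-> tb]; exact: le_lt_trans bb.
rewrite -EFinD lee_fin.
have h1 : Vl (b + d / 2) <= Vr b + e / (c + 1).
  by apply: (le_trans (Vl_le _)); apply: hd; rewrite ltrD2l; lra.
have h2 : c * (e / (c + 1)) <= e.
  rewrite mulrA ler_pdivrMr; [nra|lra].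
apply: (@le_trans _ _ (c * (Vr b + e / (c + 1) - Vr a))); first by rewrite ler_wpM2l// lerD2r.
have -> : c * (Vr b + e / (c + 1) - Vr a) = c * (Vr b - Vr a) + c * (e / (c + 1)) by ring.
by rewrite lerD2l.
Qed.

Lemma size_sum (l : seq R) c : {in l, forall t, c <= osc t} -> (size l)%:R * c <= \sum_(t <- l) osc t.
Proof.
elim: l => [|t l IH] hl; first by rewrite big_nil mul0r.
rewrite big_cons /= -nat1r mulrDl mul1r lerD ?hl ?mem_head//.
by apply: IH => x xl; apply: hl; rewrite inE xl orbT.
Qed.

(** The oscillations at distinct points of []a, b[] add up to at most [Vl b - Vr a], so only
    finitely many of them exceed [1 / (m + 1)]. *)
Lemma osc_ae a b : a < b -> {ae mu, forall t, t \in `]a, b[ -> osc t = 0}.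
Proof.
move=> ab.
pose E m := [set t | (t \in `]a, b[) /\ m.+1%:R^-1 < osc t].
have fE m : finite_set (E m).
  apply: contrapT => /infinite_set_fset.
  move=> /(_ (Num.truncn (m.+1%:R * (Vl b - Vr a))).+1)[B BE cB].
  have hB t : t \in B -> E m t by move=> tB; exact: BE.
  have H : \sum_(t <- enum_fset B) osc t <= Vl b - Vr a.
    by apply: osc_uniq => //; [exact: fset_uniq|move=> t /hB[]; rewrite in_itv/=].
  have /le_trans/(_ H) := @size_sum (enum_fset B) m.+1%:R^-1 (fun t tB => ltW (hB t tB).2).
  rewrite ler_pdivrMr// mulrC leNgt => /negP; apply.
  by apply: (lt_le_trans (truncnS_gt _)); rewrite ler_nat.
have aeE m : {ae mu, forall t, ~ E m t}.
  exists (E m); split.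
  - exact: countable_measurable (finite_set_countable (fE m)).
  - exact: countable_lebesgue_measure0 (finite_set_countable (fE m)).
  - by move=> t /= /contrapT.
have := ae_foralln aeE; apply: aeS => t ht tab; apply/eqP; rewrite eq_le osc_ge0 andbT leNgt; apply/negP => t0.
apply: (ht (Num.truncn (osc t)^-1)); split => //.
by rewrite invf_plt ?posrE// truncnS_gt.
Qed.
End Monotone.

(** Any ultrafilter limit of [a] serves as [L], because the bounds pass to the limit; a one-sided
    limit is thus obtained together with its rate, without a Cauchy argument. *)
Lemma limit_value {R : realType} (T : Type) (P : T -> Prop) (j b : T -> R) (a : nat -> R) :
  (exists x, P x) -> (forall x, P x -> exists N, forall i, (N <= i)%N -> `|j x - a i| <= b x) ->
  exists L : R, forall x, P x -> `|j x - L| <= b x.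
Proof.
move=> [x0 Px0] h.
have [U [UU oU]] := @ultraFilterLemma nat \oo _.
have Uoo N : U [set i | (N <= i)%N] by apply: oU; exists N.
have [N hN] := h x0 Px0.
have ac : a @ U --> ulim U a.
  apply: (@ulim_cvg _ _ UU _ (`|j x0| + b x0)); apply: filterS (Uoo N) => i Ni.
  have := hN i Ni; change (`|j x0 - a i| <= b x0 -> `|a i| <= `|j x0| + b x0) => H.
  by rewrite -(subKr (j x0) (a i)) (le_trans (ler_normB _ _))// lerD2l.
exists (ulim U a) => x Px; have [N' hN'] := h x Px.
apply: (@ulim_ler _ _ UU (fun i => `|j x - a i|)).
  by apply: filterS (Uoo N') => i; exact: hN'.
by apply: cvg_norm; apply: cvgB => //; exact: cvg_cst.
Qed.

Lemma eps_pow {R : realType} (A B : R) k : (forall e, 0 < e -> e <= 1 -> A <= (B + 2 * e) ^+ k + 2 * e) ->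
  A <= B ^+ k.
Proof.
move=> h.
have c1 : (fun m => (B + 2 * 2^-1 ^+ m) ^+ k + 2 * 2^-1 ^+ m) @ \oo --> B ^+ k.
  have c2 : (fun m => 2 * 2^-1 ^+ m : R) @ \oo --> (0 : R).
    by apply: (cvg_congr (mulr0 2)); apply: cvgMr; exact: cvg_half.
  apply: (cvg_congr (addr0 _)); apply: cvgD => //; apply: cvg_exp.
  by apply: (cvg_congr (addr0 _)); apply: cvgD => //; exact: cvg_cst.
apply: ler_cvg_to (cvg_cst _) c1 _; apply: nearW => m; apply: h.
  by rewrite exprn_gt0// invr_gt0.
by rewrite exprn_ile1// ?invr_ge0// invf_le1// ler1n.
Qed.

Lemma xget_sat (T : choiceType) (P : T -> Prop) (x0 : T) : (exists x, P x) -> P (xget x0 [set x | P x]).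
Proof. by move=> h; case: h => x Px; case: xgetP => [y _ //|/(_ x)/(_ Px)]. Qed.

(** * Functions with increments bounded by a power of monotone increments *)

Section Jumps.
Context {R : realType} (n : nat) (X : R -> Prop) (J V : R -> R).
Implicit Types (a b e t x y c d : R).
Let k := n.+2.
Hypotheses (V_homo : {homo V : x y / x <= y})
  (aeX : {ae mu, forall x, x \in `]0, 1[ -> X x})
  (hJ : forall x y, 0 < x -> x <= y -> y < 1 -> X x -> X y -> `|J y - J x| <= (V y - V x) ^+ k).

Let Vr := Vr V. Let Vl := Vl V.

Let pick a b : 0 <= a -> a < b -> b <= 1 -> exists x, [/\ a < x, x < b, 0 < x, x < 1 & X x].
Proof.
move=> a0 ab b1; have [x + hx] := ae_exists ab aeX.
rewrite in_itv/= => /andP[ax xb]; have x0 := le_lt_trans a0 ax; have x1 := lt_le_trans xb b1.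
by exists x; split => //; apply: hx; rewrite in_itv/= x0 x1.
Qed.

Let step : forall (i : nat), 0 < i.+1%:R^-1 :> R. Proof. by move=> i; rewrite invr_gt0. Qed.

Let step_lt d : 0 < d -> exists N, forall i, (N <= i)%N -> i.+1%:R^-1 < d.
Proof.
move=> d0; exists (Num.truncn d^-1) => i Ni; rewrite invf_plt ?posrE//.
by apply: (lt_le_trans (truncnS_gt _)); rewrite ler_nat.
Qed.

Let Vpow x y x' y' : x' <= x -> y <= y' -> x <= y -> (y - x) ^+ k <= (y' - x') ^+ k.
Proof. by move=> h1 h2 h3; apply: lerXn2r; rewrite ?nnegrE; lra. Qed.

(** The bound involves [Vr t] rather than [V t] because the comparison points lie to the right of
    [t]; this keeps the jump of [V] at [t] out of the estimate. *)
Lemma right_value t : 0 <= t -> t < 1 -> exists L, forall x, X x /\ (t < x /\ x < 1) -> `|J x - L| <= (V x - Vr t) ^+ k.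
Proof.
move=> t0 t1.
have /choice[x hx] : forall i : nat, exists x, [/\ t < x, x < Num.min 1 (t + i.+1%:R^-1), 0 < x, x < 1 & X x].
  by move=> i; apply: pick => //; rewrite ?lt_min ?t1 ?ltrDl ?step// ge_min lexx.
apply: (@limit_value _ _ _ _ _ (fun i => J (x i))).
  by have [x0 [h1 h2 h3 h4 h5]] := pick t0 t1 (lexx 1); exists x0.
move=> y [Xy [ty y1]]; have [N hN] := step_lt (ltac:(by rewrite subr_gt0) : 0 < y - t).
exists N => i /hN Ni; have [tx + x0 x1 Xx] := hx i; rewrite lt_min => /andP[_ xt].
have xy : x i <= y by rewrite ltW// (lt_trans xt)// -ltrBrDl.
apply: (le_trans (hJ x0 xy y1 Xx Xy)); apply: Vpow => //; first exact: Vr_le.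
exact: V_homo.
Qed.

Lemma left_value t : 0 < t -> t <= 1 -> exists L, forall x, X x /\ (0 < x /\ x < t) -> `|J x - L| <= (Vl t - V x) ^+ k.
Proof.
move=> t0 t1.
have /choice[x hx] : forall i : nat, exists x, [/\ Num.max 0 (t - i.+1%:R^-1) < x, x < t, 0 < x, x < 1 & X x].
  by move=> i; apply: pick => //; rewrite ?gt_max ?t0 ?ltrBlDr ?ltrDl ?step// le_max lexx.
apply: (@limit_value _ _ _ _ _ (fun i => J (x i))).
  by have [x0 [h1 h2 h3 h4 h5]] := pick (lexx 0) t0 t1; exists x0.
move=> y [Xy [y0 yt]]; have [N hN] := step_lt (ltac:(by rewrite subr_gt0) : 0 < t - y).
exists N => i /hN Ni; have [+ tx x0 x1 Xx] := hx i; rewrite gt_max => /andP[_ xt].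
have xy : y <= x i by rewrite ltW// (lt_trans _ xt)// ltrBrDl -ltrBrDr.
rewrite distrC; apply: (le_trans (hJ y0 xy x1 Xy Xx)); apply: Vpow => //; first exact: Vl_ge.
exact: V_homo.
Qed.

Let Jr t : R := xget 0 [set L | forall x, X x /\ (t < x /\ x < 1) -> `|J x - L| <= (V x - Vr t) ^+ k].
Let Jl t : R := xget 0 [set L | forall x, X x /\ (0 < x /\ x < t) -> `|J x - L| <= (Vl t - V x) ^+ k].

Let JrP t x : 0 <= t -> t < 1 -> X x -> t < x -> x < 1 -> `|J x - Jr t| <= (V x - Vr t) ^+ k.
Proof.
move=> t0 t1 Xx tx x1; have [L hL] := right_value t0 t1.
by have H := @xget_sat _ (fun L => forall x, _) 0 (ex_intro _ L hL); exact: H.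
Qed.

Let JlP t x : 0 < t -> t <= 1 -> X x -> 0 < x -> x < t -> `|J x - Jl t| <= (Vl t - V x) ^+ k.
Proof.
move=> t0 t1 Xx tx x1; have [L hL] := left_value t0 t1.
by have H := @xget_sat _ (fun L => forall x, _) 0 (ex_intro _ L hL); exact: H.
Qed.

Let ek e : 0 < e -> e <= 1 -> e ^+ k <= e.
Proof. move=> e0 e1; have h : e ^+ n.+1 <= 1 by apply: exprn_ile1 => //; exact: ltW.
by rewrite exprS ler_piMr// ltW. Qed.

Let near_r t b e : 0 <= t -> t < 1 -> t < b -> 0 < e -> e <= 1 ->
  exists x, [/\ t < x, x < b, 0 < x, x < 1 & [/\ X x, `|J x - Jr t| <= e, Vr t <= V x & V x <= Vr t + e]].
Proof.
move=> t0 t1 tb e0 e1; have [d d0 hd] := Vr_close V_homo t e0.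
have [//|||x [tx + x0 x1 Xx]] := @pick t (Num.min 1 (Num.min b (t + d))) => //.
- by rewrite !lt_min t1 tb ltrDl.
- by rewrite ge_min lexx.
rewrite !lt_min => /and3P[_ xb xd].
have Vx := Vr_le V_homo tx; have Vx' := hd x xd.
exists x; split => //; split => //; apply: (le_trans (JrP t0 t1 Xx tx x1)).
by apply: le_trans (ek e0 e1); apply: lerXn2r; rewrite ?nnegrE ?subr_ge0//; [exact: ltW|rewrite lerBlDl].
Qed.

Let near_l t a e : 0 < t -> t <= 1 -> a < t -> 0 < e -> e <= 1 ->
  exists x, [/\ a < x, x < t, 0 < x, x < 1 & [/\ X x, `|J x - Jl t| <= e, V x <= Vl t & Vl t - e <= V x]].
Proof.
move=> t0 t1 tb e0 e1; have [d d0 hd] := Vl_close V_homo t e0.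
have [||//|x [+ xt x0 x1 Xx]] := @pick (Num.max 0 (Num.max a (t - d))) t => //.
- by rewrite le_max lexx.
- by rewrite !gt_max t0 tb ltrBlDr ltrDl.
rewrite !gt_max => /and3P[_ xb xd].
have Vx := Vl_ge V_homo xt; have Vx' := hd x xd; rewrite -/(Vl t) in Vx Vx'.
exists x; split => //; split => //; apply: (le_trans (JlP t0 t1 Xx x0 xt)).
by apply: le_trans (ek e0 e1); apply: lerXn2r; rewrite ?nnegrE ?subr_ge0//; [exact: ltW|lra].
Qed.

Definition jump_at t : R := if (0 < t) && (t < 1) then Jr t - Jl t else 0.

Let Vr_ler := Vr_le_Vl V_homo.

Let three (u v p q : R) (e B : R) : 0 < e -> e <= 1 -> 0 <= B -> `|p - u| <= e -> `|q - v| <= e -> `|q - p| <= (B + 2 * e) ^+ k ->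
  `|v - u| <= (B + 2 * e) ^+ k + 2 * e.
Proof.
move=> e0 e1 B0 h1 h2 h3; have -> : v - u = (q - p) + (p - u) - (q - v) by ring.
apply: (le_trans (ler_normB _ _)); apply: (@le_trans _ _ ((B + 2 * e) ^+ k + e + e)); last by lra.
by apply: lerD => //; apply: (le_trans (ler_normD _ _)); apply: lerD.
Qed.

Lemma jump_at_le t : 0 < t -> t < 1 -> `|jump_at t| <= osc V t ^+ k.
Proof.
move=> t0 t1; rewrite /jump_at t0 t1/=; apply: eps_pow => e e0 e1.
have [x [tx _ x0 x1 [Xx J1 V1 V1']]] := near_r (ltW t0) t1 t1 e0 e1.
have [y [_ yt y0 y1 [Xy J2 V2 V2']]] := near_l t0 (ltW t1) t0 e0 e1.
apply: (three (u := Jl t) (p := J y) (q := J x)) => //; first exact: osc_ge0.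
have yx : y <= x by apply: ltW; exact: lt_trans tx.
by apply: (le_trans (hJ y0 yx x1 Xy Xx)); apply: lerXn2r; rewrite ?nnegrE ?subr_ge0 ?V_homo//;
  move: (osc_ge0 V_homo t); rewrite /osc -/(Vr t) -/(Vl t); lra.
Qed.

Let JrJr x y : 0 <= x -> x < y -> y < 1 -> `|Jr y - Jr x| <= (Vr y - Vr x) ^+ k.
Proof.
move=> x0 xy y1; have x1 := lt_trans xy y1; have y0 := ltW (le_lt_trans x0 xy).
apply: eps_pow => e e0 e1.
have [p [_ px p0 p1 [Xp J1 V1 V1']]] := near_r x0 x1 xy e0 e1.
have [q [yq _ q0 q1 [Xq J2 V2 V2']]] := near_r y0 y1 y1 e0 e1.
have H := Vr_homo V_homo (ltW xy).
apply: (three (p := J p) (q := J q)) => //; first by rewrite subr_ge0.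
have pq : p <= q by apply: ltW; exact: lt_trans yq.
by apply: (le_trans (hJ p0 pq q1 Xp Xq)); apply: lerXn2r; rewrite ?nnegrE ?subr_ge0 ?V_homo//;
  move: H; rewrite -/(Vr x) -/(Vr y); lra.
Qed.

Let JlJr x y : 0 <= x -> x < y -> y < 1 -> `|Jl y - Jr x| <= (Vl y - Vr x) ^+ k.
Proof.
move=> x0 xy y1; have x1 := lt_trans xy y1; have y0 := le_lt_trans x0 xy.
apply: eps_pow => e e0 e1.
have mxy : x < (x + y) / 2 by rewrite midf_lt.
have mxy' : (x + y) / 2 < y by rewrite midf_lt.
have [p [_ pm p0 p1 [Xp J1 V1 V1']]] := near_r x0 x1 mxy e0 e1.
have [q [mq _ q0 q1 [Xq J2 V2 V2']]] := near_l y0 (ltW y1) mxy' e0 e1.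
have H := Vr_ler xy.
apply: (three (p := J p) (q := J q)) => //; first by rewrite subr_ge0.
have pq : p <= q by apply: ltW; exact: lt_trans mq.
by apply: (le_trans (hJ p0 pq q1 Xp Xq)); apply: lerXn2r; rewrite ?nnegrE ?subr_ge0 ?V_homo//;
  move: H; rewrite -/(Vr x) -/(Vl y); lra.
Qed.

Let J_cont x : 0 < x -> x < 1 -> X x -> osc V x = 0 -> J x = Jr x.
Proof.
move=> x0 x1 Xx ox; apply/eqP; rewrite -subr_eq0 -normr_le0 distrC.
have VV : V x = Vr x by move: ox (Vr_ge V_homo x) (Vl_le V_homo x); rewrite /osc -/(Vr x); lra.
rewrite -[leRHS](@expr0n R k); apply: eps_pow => e e0 e1.
have [p [xp _ p0 p1 [Xp J1 V1 V1']]] := near_r (ltW x0) x1 x1 e0 e1.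
apply: (three (p := J x) (q := J p)) => //; first by rewrite subrr normr0 ltW.
rewrite add0r; apply: (le_trans (hJ x0 (ltW xp) p1 Xx Xp)).
by apply: lerXn2r; rewrite ?nnegrE ?subr_ge0 ?V_homo 1?ltW// ; lra.
Qed.

Let z := jump_at.
Let sigma (A : set R) : R := fine (atoms z A) - fine (atoms (fun t => - z t) A).

(** By [jump_at_le] each jump is at most [osc^k <= (Vr b - Vr a)^(k-1) * osc], and the oscillations
    in []a, b]] add up to at most [Vr b - Vr a]. *)
Let atoms_le (z' : R -> R) a b : (forall t, z' t <= `|z t|) -> 0 <= a -> a < b -> b < 1 ->
  (atoms z' `]a, b] <= ((Vr b - Vr a) ^+ k)%:E)%E.
Proof.
move=> zz a0 ab b1; rewrite exprSr.
have H := Vr_homo V_homo (ltW ab).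
apply: (osc_esum_oc V_homo ab) => [t|| t]; first by rewrite /= in_itv.
  by rewrite exprn_ge0// subr_ge0.
rewrite /= in_itv/= => /andP[at_ tb].
have o1 := osc_le_oc V_homo at_ tb; have o0 := osc_ge0 V_homo t.
rewrite ge_max; apply/andP; split; last by rewrite mulr_ge0// exprn_ge0// subr_ge0.
apply: (le_trans (zz t)); apply: (le_trans (jump_at_le (le_lt_trans a0 at_) (le_lt_trans tb b1))).
rewrite /k [osc V t ^+ _]exprSr; apply: ler_wpM2r => //.
by apply: lerXn2r => //; rewrite nnegrE subr_ge0.
Qed.

Let atoms_le_oo (z' : R -> R) a b : (forall t, z' t <= `|z t|) -> 0 <= a -> a < b -> b <= 1 ->
  (atoms z' `]a, b[ <= ((Vl b - Vr a) ^+ k)%:E)%E.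
Proof.
move=> zz a0 ab b1; rewrite exprSr.
have H := Vr_ler ab.
apply: (osc_esum V_homo ab) => [t|| t]; first by rewrite /= in_itv.
  by rewrite exprn_ge0// subr_ge0.
rewrite /= in_itv/= => /andP[at_ tb].
have o1 := osc_le V_homo at_ tb; have o0 := osc_ge0 V_homo t.
rewrite ge_max; apply/andP; split; last by rewrite mulr_ge0// exprn_ge0// subr_ge0.
apply: (le_trans (zz t)); apply: (le_trans (jump_at_le (le_lt_trans a0 at_) (lt_le_trans tb b1))).
rewrite /k [osc V t ^+ _]exprSr; apply: ler_wpM2r => //.
by apply: lerXn2r => //; rewrite nnegrE subr_ge0.
Qed.

Let zz1 t : z t <= `|z t|. Proof. exact: ler_norm. Qed.
Let zz2 t : - z t <= `|z t|. Proof. by rewrite -normrN ler_norm. Qed.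

Let atoms_fin (z' : R -> R) (A : set R) : (forall t, z' t <= `|z t|) -> measurable A -> A `<=` `]0, 1[ -> atoms z' A \is a fin_num.
Proof.
move=> zz mA A01; rewrite ge0_fin_numE ?measure_ge0//.
have m01 : measurable (`]0, 1[ : set (measurableTypeR R)) by exact: measurable_itv.
apply: (@le_lt_trans _ _ (atoms z' `]0, 1[)); first by apply: le_measure; [exact: mem_set|exact: mem_set|exact: A01].
exact: le_lt_trans (atoms_le_oo zz (lexx _) ltr01 (lexx _)) (ltry _).
Qed.

Let sub01 x y : 0 <= x -> y < 1 -> (`]x, y] : set R) `<=` `]0, 1[.
Proof.
by move=> x0 y1 t; rewrite /= !in_itv/= => /andP[xt ty]; rewrite (le_lt_trans x0 xt) (le_lt_trans ty y1).
Qed.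

Let moc (x y : R) : measurable (`]x, y] : set (measurableTypeR R)). Proof. exact: measurable_itv. Qed.

Let sigma_le x y : 0 <= x -> x < y -> y < 1 -> `|sigma `]x, y]| <= (Vr y - Vr x) ^+ k.
Proof.
move=> x0 xy y1.
have h1 := atoms_le zz1 x0 xy y1; have h2 := atoms_le zz2 x0 xy y1.
have f1 := atoms_fin zz1 (moc x y) (sub01 x0 y1); have f2 := atoms_fin zz2 (moc x y) (sub01 x0 y1).
rewrite -(fineK f1) lee_fin in h1; rewrite -(fineK f2) lee_fin in h2.
have g1 : 0 <= fine (atoms z `]x, y]) by apply: fine_ge0; exact: measure_ge0.
have g2 : 0 <= fine (atoms (fun t => - z t) `]x, y]) by apply: fine_ge0; exact: measure_ge0.
rewrite ler_norml /sigma; apply/andP; split; lra.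
Qed.

Let sigma_le_oo x y : 0 <= x -> x < y -> y < 1 -> `|sigma (`]x, y[)| <= (Vl y - Vr x) ^+ k.
Proof.
move=> x0 xy y1.
have h1 := atoms_le_oo zz1 x0 xy (ltW y1); have h2 := atoms_le_oo zz2 x0 xy (ltW y1).
have m : measurable (`]x, y[ : set (measurableTypeR R)) by exact: measurable_itv.
have s01 : (`]x, y[ : set R) `<=` `]0, 1[.
  by apply: subset_trans (sub01 x0 y1) => //; exact: subset_itv_oo_oc.
have f1 := atoms_fin zz1 m s01; have f2 := atoms_fin zz2 m s01.
rewrite -(fineK f1) lee_fin in h1; rewrite -(fineK f2) lee_fin in h2.
have g1 : 0 <= fine (atoms z `]x, y[) by apply: fine_ge0; exact: measure_ge0.
have g2 : 0 <= fine (atoms (fun t => - z t) `]x, y[) by apply: fine_ge0; exact: measure_ge0.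
rewrite ler_norml /sigma; apply/andP; split; lra.
Qed.

Let sigmaU (A B : set (measurableTypeR R)) : measurable A -> measurable B -> A `<=` `]0, 1[ -> B `<=` `]0, 1[ -> A `&` B = set0 ->
  sigma (A `|` B) = sigma A + sigma B.
Proof.
move=> mA mB A0 B0 AB; rewrite /sigma !measureU//.
have f1 := atoms_fin zz1 mA A0; have f2 := atoms_fin zz2 mA A0.
have f3 := atoms_fin zz1 mB B0; have f4 := atoms_fin zz2 mB B0.
by rewrite !fineD//; ring.
Qed.

Let sigma_cat x y t : 0 <= x -> x <= y -> y <= t -> t < 1 -> sigma `]x, t] = sigma `]x, y] + sigma `]y, t].
Proof.
move=> x0 xy yt t1; rewrite -sigmaU//; last 3 first.
- by apply: sub01 => //; exact: le_lt_trans t1.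
- by apply: sub01 => //; exact: le_trans xy.
- by apply/seteqP; split => // u [] /=; rewrite !in_itv/= => /andP[_ uy] /andP[yu _]; lra.
by rewrite -itv_bndbnd_setU// bnd_simp.
Qed.

Let sigma1 t : 0 < t -> t < 1 -> sigma [set t] = z t.
Proof.
move=> t0 t1; rewrite /sigma /atoms !esum_set1 ?lee_fin ?le_max ?lexx ?orbT//=.
by have [h|h] := leP 0 (z t); [rewrite [X in _ - X]max_r ?oppr_le0// subr0|rewrite max_l ?oppr_ge0 ?(ltW h)// opprK add0r].
Qed.

Let sigma_split x t : 0 <= x -> x < t -> t < 1 -> sigma `]x, t] = sigma `]x, t[ + z t.
Proof.
move=> x0 xt t1; have t0 := le_lt_trans x0 xt; rewrite -sigma1// -sigmaU//.
- by rewrite setUitv1// bnd_simp.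
- by apply: subset_trans (sub01 x0 t1) => //; exact: subset_itv_oo_oc.
- by move=> _ ->; rewrite /= in_itv/= t0.
- by apply/seteqP; split => // u [] /=; rewrite in_itv/= => /andP[_ +] e; rewrite e ltxx.
Qed.

(** What the jumps do not explain of the increment of [Jr]. It is additive over adjacent intervals
    and will turn out to be 0. *)
Let D x y := Jr y - Jr x - sigma `]x, y].

Let Dcat x y t : 0 <= x -> x <= y -> y <= t -> t < 1 -> D x t = D x y + D y t.
Proof. by move=> x0 xy yt t1; rewrite /D (sigma_cat x0 xy yt t1); ring. Qed.

Let D_le x y : 0 <= x -> x < y -> y < 1 -> `|D x y| <= 2 * (Vr y - Vr x) ^+ k.
Proof.
move=> x0 xy y1; apply: (le_trans (ler_normB _ _)).
by have := JrJr x0 xy y1; have := sigma_le x0 xy y1; lra.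
Qed.

(** The jump of [Jr] at [y] cancels against the atom at [y]. What remains is controlled by [Vl y],
    so that it becomes small as [x] increases to [y] even where [V] jumps. *)
Let D_left x y : 0 <= x -> x < y -> y < 1 -> `|D x y| <= 2 * (Vl y - Vr x) ^+ k.
Proof.
move=> x0 xy y1; have y0 := le_lt_trans x0 xy.
have -> : D x y = Jl y - Jr x - sigma `]x, y[.
  by rewrite /D sigma_split// /z /jump_at y0 y1/=; ring.
apply: (le_trans (ler_normB _ _)).
by have := JlJr x0 xy y1; have := sigma_le_oo x0 xy y1; lra.
Qed.

Let D0 x : D x x = 0.
Proof. by rewrite /D subrr sub0r set_itvoc0 /sigma !measure0 subrr oppr0. Qed.

(** Continuous induction on the largest [t] up to which the linear bound holds. [D_left] carries the
    bound to [t] itself; to the right of [t], where the increment of [Vr] is small, twice its [k]-th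
    power is below [e] times it, because [k >= 2]. *)
Let D_small x y e : 0 <= x -> x <= y -> y < 1 -> 0 < e -> `|D x y| <= e * (Vr y - Vr x).
Proof.
move=> x0; rewrite le_eqVlt => /predU1P[<- _ _|xy y1 e0]; first by rewrite D0 normr0 subrr mulr0.
pose A := [set t | x <= t <= y /\ `|D x t| <= e * (Vr t - Vr x)].
have Ax : A x by split; [rewrite lexx ltW|rewrite D0 normr0 subrr mulr0].
have sA : has_sup A by split; [exists x|exists y => t [/andP[]]].
pose t := sup A.
have xt : x <= t by apply: ub_le_sup => //; case: sA.
have ty : t <= y by apply: ge_sup; [exists x|move=> u [/andP[]]].
have At : A t.
  split; first by rewrite xt ty.
  apply/ler_addgt0Pr => r r0.
  pose r' := Num.min 1 (r / 2).
  have r'0 : 0 < r' by rewrite lt_min ltr01 divr_gt0.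
  have r'1 : r' <= 1 by rewrite ge_min lexx.
  have r'2 : r' <= r / 2 by rewrite ge_min lexx orbT.
  have [d d0 hd] := Vl_close V_homo t r'0; rewrite -/(Vl t) in hd.
  have [a [axy hax] ad] := sup_adherent d0 sA; rewrite -/t in ad.
  have /andP[xa ay] := axy.
  have ta : a <= t by apply: ub_le_sup; [case: sA|split].
  move: ta; rewrite le_eqVlt => /predU1P[<-|ta]; first by rewrite (le_trans hax)// lerDl ltW.
  have t1 : t < 1 by exact: le_lt_trans y1.
  rewrite (Dcat x0 xa (ltW ta) t1); apply: (le_trans (ler_normD _ _)).
  have h1 := D_left (le_trans x0 xa) ta t1.
  have V1 := Vr_homo V_homo (ltW ta); have V2 := hd a ad; have V3 := Vr_ler ta; have V4 := Vr_ge V_homo a.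
  have h2 : (Vl t - Vr a) ^+ k <= r'.
    apply: le_trans (ek r'0 r'1); apply: lerXn2r; rewrite ?nnegrE ?subr_ge0//; first exact: ltW.
    by move: V2 V4; rewrite -/(Vr a); lra.
  apply: lerD; last by lra.
  by apply: (le_trans hax); rewrite ler_pM2l// lerD2r.
move: ty; rewrite le_eqVlt => /predU1P[e1|ty]; first by rewrite -e1; case: At.
exfalso.
pose r' := Num.min 1 (e / 2).
have r'0 : 0 < r' by rewrite lt_min ltr01 divr_gt0.
have r'1 : r' <= 1 by rewrite ge_min lexx.
have r'2 : r' <= e / 2 by rewrite ge_min lexx orbT.
have [d d0 hd] := Vr_close V_homo t r'0; rewrite -/(Vr t) in hd.
have [b /andP[tb bm]] : exists b, t < b < Num.min y (t + d).
  by exists ((t + Num.min y (t + d)) / 2); rewrite !midf_lt// lt_min ty ltrDl.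
move: bm; rewrite lt_min => /andP[by_ bd].
have b1 := lt_trans by_ y1.
have t0 := le_trans x0 xt.
suff Ab : A b by have := ub_le_sup sA.2 Ab; rewrite -/t leNgt tb.
split; first by rewrite (ltW (le_lt_trans xt tb)) ltW.
rewrite (Dcat x0 xt (ltW tb) b1); apply: (le_trans (ler_normD _ _)).
have -> : e * (Vr b - Vr x) = e * (Vr t - Vr x) + e * (Vr b - Vr t) by ring.
apply: lerD; first by case: At.
apply: (le_trans (D_le t0 tb b1)).
have V1 : Vr b <= Vr t + r'.
  have [b' /andP[bb' b'd]] : exists b', b < b' < t + d by exists ((b + (t + d)) / 2); rewrite !midf_lt.
  by apply: (le_trans (Vr_le V_homo bb')); exact: hd.
have V2 := Vr_homo V_homo (ltW tb); rewrite -/(Vr t) -/(Vr b) in V2.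
rewrite /k exprS; have h : (Vr b - Vr t) ^+ n.+1 <= r'.
  rewrite exprS; apply: (@le_trans _ _ ((Vr b - Vr t) * 1)); last lra.
  by apply: ler_wpM2l; [rewrite subr_ge0|apply: exprn_ile1; lra].
have : (Vr b - Vr t) * (Vr b - Vr t) ^+ n.+1 <= (Vr b - Vr t) * r' by apply: ler_wpM2l; rewrite ?subr_ge0.
nra.
Qed.

Lemma D_eq0 x y : 0 <= x -> x <= y -> y < 1 -> D x y = 0.
Proof.
move=> x0 xy y1; apply/eqP; rewrite -normr_le0; apply/ler_addgt0Pr => e e0; rewrite add0r.
have V0 : 0 <= Vr y - Vr x by rewrite subr_ge0; exact: Vr_homo.
have c0 : 0 < e / (Vr y - Vr x + 1) by rewrite divr_gt0//; lra.
apply: (le_trans (D_small x0 xy y1 c0)).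
rewrite mulrAC ler_pdivrMr; [nra|lra].
Qed.

(* Since [k > 1], an increment bounded by the [k]-th power of an increment of a monotone
   function is concentrated on the discontinuities of that function. *)
Theorem jump_decomposition : exists (z : R -> R) (c : R),
  [/\ forall t, ~~ ((0 < t) && (t < 1)) -> z t = 0,
      atoms z `]0, 1[ \is a fin_num /\ atoms (fun t => - z t) `]0, 1[ \is a fin_num,
      (\esum_(t in (`]0%R, 1%R[ : set R)) (`|z t| `^ (1 / k%:R))%:E <= (V 1 - V 0)%:E)%E &
      {ae mu, forall x, x \in `]0, 1[ -> J x = c + (fine (atoms z `]0, x]) - fine (atoms (fun t => - z t) `]0, x]))}].
Proof.
exists z, (Jr 0); split.
- by move=> t /negbTE h; rewrite /z /jump_at h.
- by split; apply: atoms_fin.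
- have := @osc_esum _ V V_homo `]0, 1[ (fun t => `|z t| `^ (1 / k%:R)) 0 1 1 ltr01.
  move=> /(_ _ _ _)/le_trans; apply => //.
  + move=> t /=; rewrite in_itv/= => /andP[t0 t1]; rewrite [leRHS]mul1r.
    apply: (@le_trans _ _ ((osc V t ^+ k) `^ (1 / k%:R))).
      have kk : 0 <= 1 / k%:R :> R by exact: divr_ge0.
      have o1 : osc V t ^+ k \is Num.nneg by rewrite nnegrE exprn_ge0// osc_ge0.
      have o2 : `|z t| \is Num.nneg by rewrite nnegrE.
      exact: (@ge0_ler_powR R _ kk _ _ o2 o1 (jump_at_le t0 t1)).
    by rewrite -powR_mulrn ?osc_ge0// -powRrM mul1r mulfV ?powRr1 ?osc_ge0// pnatr_eq0.
  + by rewrite lee_fin mul1r; have := Vl_le V_homo 1; have := Vr_ge V_homo 0; lra.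
- apply: aeS2 aeX (osc_ae V_homo ltr01) => x Xx ox x01.
  have := x01; rewrite in_itv/= => /andP[x0 x1].
  rewrite (J_cont x0 x1 (Xx x01) (ox x01)).
  by have := D_eq0 (lexx 0) (ltW x0) x1; rewrite /D /sigma; lra.
Qed.
End Jumps.


(** * Atoms and distributional derivatives *)

Section Radon.
Context {R : realType}.
Implicit Types (a b c d e r s t x y : R) (f g u z phi : R -> R) (A : set (measurableTypeR R)).

Lemma atoms_01 z A : (forall t, ~~ ((0 < t) && (t < 1)) -> z t = 0) ->
  atoms z A = atoms z (A `&` `]0, 1[).
Proof.
move=> z0; rewrite /atoms esum_mkcondr; apply: eq_esum => t _.
case: ifPn => // /negP h; rewrite z0 ?maxxx//.
by apply/negP => h'; apply: h; apply/mem_set; rewrite /= in_itv.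
Qed.

(** Applied to [(f, z)] and to the opposite pair, this yields the two finite measures whose
    difference is the derivative. *)
Lemma radon_measure f z : cint 0 1 f -> (forall t, ~~ ((0 < t) && (t < 1)) -> z t = 0) ->
  atoms z `]0, 1[ \is a fin_num ->
  exists nu : {finite_measure set (measurableTypeR R) -> \bar R}, forall A, measurable A ->
    nu A = (\int[mu]_(x in A `&` `]0%R, 1%R[) (Num.max (f x) 0)%:E + atoms z A)%E.
Proof.
move=> fi z0 zfin.
pose g := (fun x => Num.max (f x) 0) \_ (`]0, 1[ : set R).
have ci : mu.-integrable `]0, 1[ (EFin \o (fun x => Num.max (f x) 0)).
  apply/cint_oo; apply: (@cint_le _ _ _ _ f) => //.
    by apply: measurable_maxr => //; exact: cint_meas.
  by move=> x _ _; rewrite ger0_norm ?le_max ?lexx ?orbT// ge_max ler_norm normr_ge0.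
have gi : mu.-integrable setT (EFin \o g).
  by rewrite /g -restrict_EFin; apply/integrable_restrict => //=; rewrite setTI.
have mg : measurable_fun setT (EFin \o g) by exact: (measurable_int mu).
have g0 x : (0 <= (EFin \o g) x)%E.
  by rewrite /= lee_fin /g patchE; case: ifP => // _; rewrite le_max lexx orbT.
pose m1 : set (measurableTypeR R) -> \bar R := fun A => (\int[mu]_(t in A) (EFin \o g) t)%E.
have m10 : m1 set0 = 0%E by rewrite /m1 integral_set0.
have m1ge A : (0 <= m1 A)%E by exact: integral_ge0.
have m1s : semi_sigma_additive m1 by exact: semi_sigma_additive_nng_induced.
pose M1 : {measure set (measurableTypeR R) -> \bar R} := HB.pack m1 (isMeasure.Build _ _ _ m1 m10 m1ge m1s).
pose M2 : {measure set (measurableTypeR R) -> \bar R} := measure_add M1 (atoms z).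
have M2E A : M2 A = (M1 A + atoms z A)%E by exact: measure_addE.
have fin : fin_num_fun M2.
  move=> A mA; rewrite M2E fin_numD; apply/andP; split.
    by apply: integrable_fin_num => //; exact: integrableS gi.
  change (is_true (atoms z A \is a fin_num)); rewrite (atoms_01 A z0) ge0_fin_numE ?measure_ge0//.
  have m01 : measurable (`]0, 1[ : set (measurableTypeR R)) by exact: measurable_itv.
  apply: (@le_lt_trans _ _ (atoms z `]0, 1[)); last by rewrite -ge0_fin_numE.
  by apply: le_measure; [apply: mem_set; exact: measurableI|exact: mem_set|].
pose nu : {finite_measure set (measurableTypeR R) -> \bar R} :=
  HB.pack (M2 : set (measurableTypeR R) -> \bar R) M2 (Measure_isFinite.Build _ _ _ _ fin).
exists nu => A mA.
rewrite -[LHS]/(M2 A) M2E; congr (_ + _)%E.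
rewrite /M1/= /m1 integral_mkcondr; apply: eq_integral => x _.
by rewrite /= /g !patchE; case: ifP.
Qed.

Section finite_measure.
Variable nu : {finite_measure set (measurableTypeR R) -> \bar R}.

Lemma finite_fin A : measurable A -> nu A \is a fin_num.
Proof. exact: fin_num_measure. Qed.

Lemma small_set (F : nat -> set (measurableTypeR R)) e : (forall i, measurable (F i)) ->
  (forall i, F i.+1 `<=` F i) -> \bigcap_i F i = set0 -> 0 < e -> exists i, fine (nu (F i)) < e.
Proof.
move=> mF dF F0 e0.
have H : (nu \o F @ \oo --> nu (\bigcap_i F i))%E.
  apply: nonincreasing_cvg_mu => //.
  - by rewrite ltey_eq finite_fin.
  - by rewrite F0; exact: measurable0.
  - move=> m n mn; apply/subsetPset; elim: n mn => [|n IH]; first by rewrite leqn0 => /eqP ->.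
    by rewrite leq_eqVlt => /predU1P[->//|/IH]; apply: subset_trans.
rewrite F0 measure0 in H.
have {}H : (fine \o (nu \o F)) @ \oo --> (0 : R) by exact: fine_cvg H.
have [N _ /(_ N (leqnn _)) [_ h]] := cvg_close H e0.
by exists N; rewrite add0r in h.
Qed.

Lemma fine_le (A B : set (measurableTypeR R)) : measurable A -> measurable B -> A `<=` B -> fine (nu A) <= fine (nu B).
Proof.
by move=> mA mB AB; apply: fine_le; [exact: finite_fin|exact: finite_fin|apply: le_measure => //; exact: mem_set].
Qed.

Lemma small_right t e : 0 < e -> exists2 d : R, 0 < d & forall x, x < t + d -> fine (nu [set` `]t, x]]) < e.
Proof.
move=> e0; have m i : measurable ([set` `]t, t + i.+1%:R^-1]] : set (measurableTypeR R)) by exact: measurable_itv.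
have [] := @small_set (fun i : nat => [set` `]t, t + i.+1%:R^-1]]) e m _ _ e0.
- move=> i x; rewrite /= !in_itv/= => /andP[-> /le_trans]; apply.
  by rewrite lerD2l lef_pV2 ?posrE// ler_nat.
- apply/seteqP; split => // x h.
  have : t < x by have := h 0%N I; rewrite /= in_itv/= => /andP[].
  rewrite -subr_gt0 => tx; have := h (Num.truncn (x - t)^-1) I.
  rewrite /= in_itv/= => /andP[_]; rewrite -lerBlDl leNgt invf_plt ?posrE// ?truncnS_gt//.
move=> i hi; exists i.+1%:R^-1; first by rewrite invr_gt0.
move=> x xt; apply: le_lt_trans hi; apply: fine_le; [exact: measurable_itv|exact: m|].
by move=> y; rewrite /= !in_itv/= => /andP[-> /le_trans]; apply; exact: ltW.
Qed.

Lemma small_left t e : 0 < e -> exists2 d : R, 0 < d & forall x, t - d < x -> fine (nu [set` `]x, t[]) < e.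
Proof.
move=> e0; have m i : measurable ([set` `]t - i.+1%:R^-1, t[] : set (measurableTypeR R)) by exact: measurable_itv.
have [] := @small_set (fun i : nat => [set` `]t - i.+1%:R^-1, t[]) e m _ _ e0.
- move=> i x; rewrite /= !in_itv/= => /andP[+ ->]; rewrite andbT; apply: le_lt_trans.
  by rewrite lerD2l lerN2 lef_pV2 ?posrE// ler_nat.
- apply/seteqP; split => // x h.
  have : x < t by have := h 0%N I; rewrite /= in_itv/= => /andP[].
  rewrite -subr_gt0 => tx; have := h (Num.truncn (t - x)^-1) I.
  rewrite /= in_itv/= => /andP[+ _]; rewrite ltrBlDl -ltrBlDr ltNge => /negP; apply.
  by rewrite ltW// invf_plt ?posrE// truncnS_gt.
move=> i hi; exists i.+1%:R^-1; first by rewrite invr_gt0.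
move=> x xt; apply: le_lt_trans hi; apply: fine_le; [exact: measurable_itv|exact: m|].
by move=> y; rewrite /= !in_itv/= => /andP[/(lt_trans xt) -> ->].
Qed.

Lemma test_out phi x : test_function 0 1 phi -> ~~ ((0 < x) && (x < 1)) -> derive1 phi x = 0.
Proof.
move=> [_ _ [c [d [c0 d1 h]]]] x01.
have : \forall y \near x, phi y = cst 0 y.
  have [xc|cx] := ltP x c; last have [dx|xd] := ltP d x.
  - near=> y; apply: h; rewrite in_itv/= negb_and -ltNge; apply/orP; left.
    by near: y; exact: lt_nbhsl.
  - near=> y; apply: h; rewrite in_itv/= negb_and -!ltNge; apply/orP; right.
    by near: y; exact: lt_nbhsr.
  - by exfalso; move: x01; rewrite (lt_le_trans c0 cx) (le_lt_trans xd d1).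
move=> /near_eq_derive H; rewrite derive1E H ?derive_cst//.
Unshelve. all: by end_near.
Qed.

(** Fubini on [s <= x]: the integral of the derivative of [phi] over [x >= s] is [- phi s]. *)
Lemma dist_deriv phi : test_function 0 1 phi ->
  mu.-integrable `]0, 1[ (EFin \o (fun x => fine (nu [set` `]0, x]]) * derive1 phi x)) /\
  \int[mu]_(x in `]0, 1[) (fine (nu [set` `]0, x]]) * derive1 phi x) = - \int[nu]_(x in `]0, 1[) phi x.
Proof.
move=> tphi; have [ci pp] := test_prim tphi.
have m01 : measurable (`]0, 1[ : set (measurableTypeR R)) by exact: measurable_itv.
have i1 : nu.-integrable setT (EFin \o (\1_(`]0, 1[) : R -> R)).
  apply/integrableP; split; first by apply/measurable_EFinP; exact: measurable_indic.
  under eq_integral do rewrite /= ger0_norm//.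
  rewrite integral_indic// setIT; have := finite_fin m01; rewrite ge0_fin_numE//.
have dE : derive1 phi = (derive1 phi) \_ `[0, 1].
  apply/funext => x; rewrite patchE; case: ifPn => // /negP h; apply: test_out tphi _.
  by apply/negP => /andP[x0 x1]; apply: h; apply/mem_set; rewrite /= in_itv/= !ltW.
have i2 : mu.-integrable setT (EFin \o derive1 phi) by rewrite dE; exact: restr_int.
have [i4 _ H] := fubini_le i1 i2.
have E : (fun x => fine (nu [set` `]0, x]]) * derive1 phi x) \_ `]0, 1[ =
    (fun x => derive1 phi x * \int[nu]_(s in `]-oo, x]) (\1_(`]0, 1[) s : R)).
  apply/funext => x; rewrite patchE.
  case: ifPn => [/set_mem/=|/negP h].
    rewrite in_itv/= => /andP[x0 x1]; rewrite mulrC; congr (_ * _).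
    rewrite /Rintegral integral_indic//; congr (fine (nu _)).
    apply/seteqP; split => y; rewrite /= !in_itv/=; first by move=> /andP[y0 yx]; rewrite y0 (le_lt_trans yx x1) yx.
    by move=> [/andP[-> _] ->].
  rewrite (test_out tphi) ?mul0r//; apply/negP => h'; apply: h; apply/mem_set; by rewrite /= in_itv.
split.
  have := i4; rewrite -E -restrict_EFin => /integrable_restrict; rewrite setTI; apply => //.
rewrite Rintegral_mkcond E.
pose D : set (measurableTypeR R) := [set` `]0, 1[].
have e s : (\1_(`]0, 1[) s : R) * \int[mu]_(x in `[s, +oo[) derive1 phi x = ((fun s => - phi s) \_ D) s.
  rewrite patchE indicE; case: ifPn => [/set_mem/=|_]; last by rewrite mul0r.
  rewrite /D/= in_itv/= mul1r => /andP[s0 s1].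
  have -> : \int[mu]_(x in `[s, +oo[) derive1 phi x = oint (derive1 phi) s 1.
    rewrite -(@Rintegral_itv_obnd_cbnd R s +oo%O (derive1 phi)); last by apply: integrableS i2.
    rewrite /oint Rintegral_mkcond [RHS]Rintegral_mkcond; apply: eq_Rintegral => x _; rewrite !patchE.
    have [x1|x1] := ltP 1 x.
      rewrite [in RHS]memNset; last by rewrite /= in_itv/= [x <= 1]leNgt x1 andbF.
      by case: ifP => // _; rewrite (test_out tphi)// [x < 1]ltNge (ltW x1) andbF.
    congr (if _ then _ else _); apply/idP/idP => /set_mem h; apply/mem_set; move: h; rewrite /= !in_itv/= andbT.
      by move=> ->.
    by case/andP.
  rewrite -(pp s 1 (ltW s0) (ltW s1) (lexx 1)) (test0 tphi) ?sub0r//.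
  by rewrite in_itv/= ltxx andbF.
rewrite H; under eq_Rintegral do rewrite e.
rewrite -Rintegral_mkcond.
have i3 : nu.-integrable D (EFin \o (fun s => - phi s)).
  have [_ + _] := fubini_le i1 i2; rewrite (_ : (fun s => _) = (fun s => - phi s) \_ D); last exact/funext.
  by rewrite -restrict_EFin => /integrable_restrict; rewrite setTI; apply.
have -> : \int[nu]_(x in `]0, 1[) phi x = \int[nu]_(x in D) (-1 * - phi x).
  by apply: eq_Rintegral => s _; ring.
by rewrite RintegralZl//; ring.
Qed.
End finite_measure.

Lemma summable_support (p : R -> R) (A : set R) : (forall t, 0 <= p t) ->
  (\esum_(t in A) (p t)%:E < +oo)%E -> countable [set t | A t /\ 0 < p t].
Proof.
move=> p0 fin.
have S0 : (0 <= \esum_(t in A) (p t)%:E)%E by apply: esum_ge0 => t _; rewrite lee_fin.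
have [S hS] : exists S, (\esum_(t in A) (p t)%:E)%E = S%:E.
  by exists (fine (\esum_(t in A) (p t)%:E)%E); rewrite fineK// ge0_fin_numE.
pose E m := [set t | A t /\ m.+1%:R^-1 < p t].
have fE m : finite_set (E m).
  apply: contrapT => /infinite_set_fset.
  move=> /(_ (Num.truncn (m.+1%:R * S)).+1)[B BE cB].
  have hB t : t \in B -> E m t by move=> tB; exact: BE.
  have H : \sum_(t <- enum_fset B) p t <= S.
    rewrite -lee_fin -hS; apply: ereal_sup_ubound; exists [set` B].
      by split; [exact: finite_fset|move=> t /hB []].
    rewrite fsbig_finite//= sumEFin; congr EFin; apply: perm_big.
    by rewrite set_fsetK.
  have : (size (enum_fset B))%:R * m.+1%:R^-1 <= \sum_(t <- enum_fset B) p t.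
    have hl : {in enum_fset B, forall t, m.+1%:R^-1 <= p t} by move=> t tB; exact: ltW (hB t tB).2.
    elim: (enum_fset B) hl => [|t l IH] hl; first by rewrite big_nil mul0r.
    rewrite big_cons /= -nat1r mulrDl mul1r lerD ?hl ?mem_head//.
    by apply: IH => x xl; apply: hl; rewrite inE xl orbT.
  move=> /le_trans/(_ H).
  rewrite ler_pdivrMr// mulrC leNgt => /negP; apply.
  by apply: (lt_le_trans (truncnS_gt _)); rewrite ler_nat.
rewrite (_ : [set t | _] = \bigcup_m E m).
  by apply: bigcup_countable => // m _; exact: finite_set_countable.
apply/seteqP; split => [t [At pt]|t [m _ [At pt]]]; last by split => //; exact: lt_trans pt.
exists (Num.truncn (p t)^-1) => //; split => //.
by rewrite invf_plt ?posrE// truncnS_gt.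
Qed.

Lemma esum_sub (p : R -> R) (A B : set R) : (forall t, 0 <= p t) -> A `<=` B ->
  (\esum_(t in A) (p t)%:E <= \esum_(t in B) (p t)%:E)%E.
Proof.
move=> p0 AB; rewrite esum_mkcond [leRHS]esum_mkcond; apply: le_esum => t _.
case: ifPn => [/set_mem/AB/mem_set -> //|_]; case: ifP => // _; by rewrite lee_fin.
Qed.

Lemma esum_scale (p : R -> R) (A : set R) c : 0 <= c -> (\esum_(t in A) (p t)%:E < +oo)%E ->
  (\esum_(t in A) (c * p t)%:E < +oo)%E.
Proof.
move=> c0 fin; apply: (@le_lt_trans _ _ (c%:E * \esum_(t in A) (p t)%:E)%E).
  apply: ub_ereal_sup => _ [X [fX XA] <-].
  rewrite fsbig_finite// sumEFin -mulr_sumr EFinM; apply: lee_wpmul2l; rewrite ?lee_fin//.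
  by apply: ereal_sup_ubound; exists X => //; rewrite fsbig_finite// sumEFin.
by rewrite lte_mul_pinfty.
Qed.

(* Almost every point [t] lies in finitely many of the balls [B(s, p s / h)], so that the atoms
   [s] near [t] satisfy [p s <= h |s - t|]. *)
Lemma sparse_atoms (p : R -> R) h : 0 < h -> (forall t, 0 <= p t) -> (\esum_(t in setT) (p t)%:E < +oo)%E ->
  {ae mu, forall t, exists2 d : R, 0 < d & forall s, `|s - t| < d -> p s <= h * `|s - t|}.
Proof.
move=> h0 p0 fin.
pose S := [set t | [set: R] t /\ 0 < p t].
have cS : countable S := summable_support p0 fin.
have /countable_injP[f injf] := cS.
pose B (i : nat) : set R := \bigcup_(s in S `&` f @^-1` [set i]) ball s (p s / h).
have Bempty i : ~ (f @` S) i -> B i = set0.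
  move=> ni; apply/seteqP; split => // x [s [Ss fs] _]; apply: ni; exists s => //.
have Bone s : S s -> B (f s) = ball s (p s / h).
  move=> Ss; apply/seteqP; split => [x [s' [Ss' fs']]|x hx]; last by exists s.
  have -> // : s' = s by apply: injf => //; exact: mem_set.
have mB i : measurable (B i).
  have [[s Ss <-]|/Bempty ->] := pselect ((f @` S) i); last exact: measurable0.
  by rewrite Bone//; exact: measurable_ball.
have B0 : mu (lim_sup_set B) = 0%E.
  apply: lim_sup_set_cvg0 => //.
  rewrite nneseries_esumT// esum_mkcond (_ : (\esum_(i in setT) _)%E = (\esum_(i in f @` S) mu (B i))%E); last first.
    rewrite [RHS]esum_mkcond; apply: eq_esum => i _; rewrite in_setT.
    by case: ifPn => // /negP h1; rewrite Bempty ?measure0// => h2; apply: h1; exact: mem_set.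
  rewrite esum_image//.
  rewrite (@eq_esum _ _ _ _ (fun s => (2 / h * p s)%:E)); last first.
    move=> s Ss; rewrite Bone// lebesgue_measure_ball; last by rewrite divr_ge0// ltW.
    by congr EFin; rewrite -mulr_natl; ring.
  apply: esum_scale; first by rewrite divr_ge0// ltW.
  by apply: le_lt_trans fin; exact: esum_sub.
have aeB : {ae mu, forall t, exists N, forall i, (N <= i)%N -> ~ B i t}.
  exists (lim_sup_set B); split => //.
    by rewrite /lim_sup_set; apply: bigcap_measurable => // N _; apply: bigcup_measurable => i _; exact: mB.
  move=> x /= nx N _; apply: contrapT => hh; apply: nx; exists N => i Ni Bi; apply: hh; by exists i.
have aeS' : {ae mu, forall t, ~ S t}.
  exists S; split.
  - exact: countable_measurable.
  - exact: countable_lebesgue_measure0.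
  - by move=> t /= /contrapT.
apply: aeS2 aeB aeS' => t [N hN] nS.
(* The finitely many atoms of index below [N] differ from [t], hence keep a positive distance from
   it; atoms of larger index have balls that miss [t]. *)
have [d d0 hd] : exists2 d : R, 0 < d & forall s, S s -> (f s < N)%N -> d <= `|s - t|.
  elim: (N) => [|m [d d0 hd]]; first by exists 1.
  have [[s0 Ss0 fs0]|nm] := pselect ((f @` S) m); last first.
    exists d => // s Ss; rewrite ltnS leq_eqVlt => /predU1P[e|]; last exact: hd.
    by exfalso; apply: nm; exists s.
  exists (Num.min d `|s0 - t|).
    by rewrite lt_min d0 normr_gt0 subr_eq0; apply/eqP => e; apply: nS; rewrite -e.
  move=> s Ss; rewrite ltnS leq_eqVlt => /predU1P[e|sm].
    by rewrite (_ : s = s0) ?ge_min ?lexx ?orbT//; apply: injf; rewrite ?e//; exact: mem_set.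
  by rewrite ge_min hd.
exists d => // s sd.
have [ps|ps] := ltP 0 (p s); last by apply: (le_trans ps); rewrite mulr_ge0// ltW.
have Ss : S s by [].
have Ns : (N <= f s)%N by rewrite leqNgt; apply/negP => /(hd s Ss); rewrite leNgt sd.
have := hN _ Ns; rewrite Bone// /ball/= => /negP; rewrite -leNgt ler_pdivrMr//.
by rewrite mulrC.
Qed.
End Radon.


(** * One-sided limits and approximate derivatives *)

Section Limits.
Context {R : realType}.
Implicit Types (a b c d e r s t x y z l : R) (f g u : R -> R).

Lemma right_limit_unique u t l1 l2 : is_right_limit u t l1 -> is_right_limit u t l2 -> l1 = l2.
Proof.
move=> h1 h2; apply/eqP; rewrite -subr_eq0 -normr_le0; apply/ler_addgt0Pr => e e0; rewrite add0r.
have e2 : 0 < e / 2 by rewrite divr_gt0.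
have [d1 d10 H1] := h1 _ e2; have [d2 d20 H2] := h2 _ e2.
have td : t < t + Num.min d1 d2 by rewrite ltrDl lt_min d10.
have [x xt [a1 a2]] := ae_exists td (aeS2 (fun x (p : _ -> _) (q : _ -> _) => conj p q) H1 H2).
move: xt; rewrite in_itv/= => /andP[tx]; rewrite -ltrBlDl lt_min => /andP[x1 x2].
have {}a1 : `|u x - l1| < e / 2 by apply: a1; rewrite in_itv/= tx -ltrBlDl.
have {}a2 : `|u x - l2| < e / 2 by apply: a2; rewrite in_itv/= tx -ltrBlDl.
have -> : l1 - l2 = (u x - l2) - (u x - l1) by ring.
by apply: (le_trans (ler_normB _ _)); lra.
Qed.

Lemma left_limit_unique u t l1 l2 : is_left_limit u t l1 -> is_left_limit u t l2 -> l1 = l2.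
Proof.
move=> h1 h2; apply/eqP; rewrite -subr_eq0 -normr_le0; apply/ler_addgt0Pr => e e0; rewrite add0r.
have e2 : 0 < e / 2 by rewrite divr_gt0.
have [d1 d10 H1] := h1 _ e2; have [d2 d20 H2] := h2 _ e2.
have td : t - Num.min d1 d2 < t by rewrite ltrBlDr ltrDl lt_min d10.
have [x xt [a1 a2]] := ae_exists td (aeS2 (fun x (p : _ -> _) (q : _ -> _) => conj p q) H1 H2).
move: xt; rewrite in_itv/= => /andP[+ tx]; rewrite ltrBlDl -ltrBlDr lt_min => /andP[x1 x2].
have {}a1 : `|u x - l1| < e / 2 by apply: a1; rewrite in_itv/= tx andbT ltrBlDl -ltrBlDr.
have {}a2 : `|u x - l2| < e / 2 by apply: a2; rewrite in_itv/= tx andbT ltrBlDl -ltrBlDr.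
have -> : l1 - l2 = (u x - l2) - (u x - l1) by ring.
by apply: (le_trans (ler_normB _ _)); lra.
Qed.

Lemma right_limitE u t l : is_right_limit u t l -> right_limit u t = l.
Proof.
move=> h; have := @xget_sat _ (is_right_limit u t) 0 (ex_intro _ l h).
by move=> h'; exact: right_limit_unique h' h.
Qed.

Lemma left_limitE u t l : is_left_limit u t l -> left_limit u t = l.
Proof.
move=> h; have := @xget_sat _ (is_left_limit u t) 0 (ex_intro _ l h).
by move=> h'; exact: left_limit_unique h' h.
Qed.

Let bad u t z e r : set R := `]t - r, t + r[ `&` [set s | e * `|s - t| < `|u s - u t - z * (s - t)|].

Lemma bad_meas u t z e r : measurable_fun (`]0, 1[ : set R) u -> 0 <= t - r -> t + r <= 1 -> measurable (bad u t z e r).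
Proof.
move=> mu_ tr rt; rewrite /bad.
have sub : (`]t - r, t + r[ : set R) `<=` `]0, 1[.
  by move=> x; rewrite /= !in_itv/= => /andP[h1 h2]; rewrite (le_lt_trans tr h1) (lt_le_trans h2 rt).
have m1 : measurable_fun (`]t - r, t + r[ : set R) u by apply: measurable_funS mu_.
suff : measurable_fun (`]t - r, t + r[ : set R) (fun s => e * `|s - t| < `|u s - u t - z * (s - t)|).
  by move=> H; exact: (H (measurable_itv _) [set true] I).
apply: measurable_fun_ltr => //.
- by apply: measurable_funM => //; apply: measurableT_comp => //; exact: measurable_funB.
- apply: measurableT_comp => //; apply: measurable_funB; first exact: measurable_funB.
  by apply: measurable_funM => //; exact: measurable_funB.
Qed.

Let two_quarters r x y : 0 < r -> x < 1 / 4 * (2 * r) -> y < 1 / 4 * (2 * r) -> 2 * r <= x + y -> False.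
Proof. move=> *; lra. Qed.

(** With [e] a third of [|z1 - z2|], every [s] other than [t] violates one of the two expansions.
    The two exceptional sets then cover the window up to a point, although each fills less than a
    quarter of it. *)
Lemma approx_derivative_unique u t (z1 z2 : R) : measurable_fun (`]0, 1[ : set R) u -> t \in `]0, 1[ ->
  is_approx_derivative u t z1 -> is_approx_derivative u t z2 -> z1 = z2.
Proof.
rewrite in_itv/= => mu_ /andP[t0 t1] h1 h2; apply/eqP/negPn/negP => z12.
pose e := `|z1 - z2| / 3.
have e0 : 0 < e by rewrite divr_gt0// normr_gt0 subr_eq0.
have q : 0 < 1 / 4 :> R by rewrite divr_gt0.
have FF : Filter ((0 : R)^'+) by exact: _.
have n1 := cvg_close (FF := FF) (h1 e e0) q; have n2 := cvg_close (FF := FF) (h2 e e0) q.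
have n3 : \forall r \near (0 : R)^'+, 0 < r /\ r < Num.min t (1 - t).
  near=> r; split; near: r; first exact: nbhs_right_gt.
  by apply: nbhs_right_lt; rewrite lt_min t0 subr_gt0.
have [r [[_ a1] [[_ a2] [r0]]]] := filter_ex (filterI n1 (filterI n2 n3)).
rewrite lt_min => /andP[rt r1t].
have tr : 0 <= t - r by rewrite subr_ge0 ltW.
have tr1 : t + r <= 1 by rewrite -lerBrDl ltW.
have m1 := bad_meas z1 e mu_ tr tr1; have m2 := bad_meas z2 e mu_ tr tr1.
set B1 := bad u t z1 e r in m1; set B2 := bad u t z2 e r in m2.
rewrite -/(bad u t z1 e r) -/B1 ltr_pdivrMr ?mulr_gt0// in a1.
rewrite -/(bad u t z2 e r) -/B2 ltr_pdivrMr ?mulr_gt0// in a2.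
have muI : mu (`]t - r, t + r[ : set R) = (2 * r)%:E.
  rewrite lebesgue_measure_itv/= lte_fin ifT; last by lra.
  by rewrite -EFinB; congr EFin; ring.
have fin (B : set R) : measurable B -> B `<=` `]t - r, t + r[ -> mu B = (fine (mu B))%:E.
  move=> mB BI; rewrite fineK// ge0_fin_numE ?measure_ge0//.
  by apply: (@le_lt_trans _ _ (mu (`]t - r, t + r[ : set R))); [apply: le_measure => //; exact: mem_set|rewrite muI ltry].
have cover : (`]t - r, t + r[ : set R) `<=` (B1 `|` B2) `|` [set t].
  move=> s sI; have [->|st] := eqVneq s t; [by right|left].
  have [h|h] := ltP (e * `|s - t|) `|u s - u t - z1 * (s - t)|; first by left; split.
  right; split => //=; rewrite ltNge; apply/negP => h'.
  have : `|(z1 - z2) * (s - t)| <= 2 * (e * `|s - t|).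
    have -> : (z1 - z2) * (s - t) = (u s - u t - z2 * (s - t)) - (u s - u t - z1 * (s - t)) by ring.
    by apply: (le_trans (ler_normB _ _)); lra.
  have st0 : 0 < `|s - t| by rewrite normr_gt0 subr_eq0.
  rewrite normrM (_ : `|z1 - z2| = 3 * e); last by rewrite /e; field.
  nra.
have : ((2 * r)%:E <= mu B1 + mu B2)%E.
  rewrite -muI; apply: (@le_trans _ _ (mu (B1 `|` B2 `|` [set t]))).
    by apply: le_measure => //; apply: mem_set => //; apply: measurableU => //; exact: measurableU.
  apply: (le_trans (measureU2 _ _ _)) => //; first exact: measurableU.
  have e1 : mu [set t] = 0%E by exact: lebesgue_measure_set1.
  have e2 : (mu (B1 `|` B2) <= mu B1 + mu B2)%E by exact: measureU2.
  have e3 : (mu (B1 `|` B2) + mu [set t] <= mu B1 + mu B2 + 0)%E by apply: leeD => //; rewrite e1.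
  by rewrite adde0 in e3; exact: e3.
have f1 := fin B1 m1 (@subIsetl _ _ _); have f2 := fin B2 m2 (@subIsetl _ _ _).
rewrite f1 f2 -EFinD lee_fin.
rewrite !add0r in a1 a2; exact: two_quarters a1 a2.
Unshelve. all: by end_near.
Qed.

Lemma classical_approx u v t z : measurable_fun (`]0, 1[ : set R) u -> t \in `]0, 1[ ->
  {ae mu, forall s, s \in `]0, 1[ -> u s = v s} -> u t = v t ->
  (forall e, 0 < e -> exists2 d, 0 < d & forall s, `|s - t| < d -> `|v s - v t - z * (s - t)| <= e * `|s - t|) ->
  is_approx_derivative u t z.
Proof.
rewrite in_itv/= => mu_ /andP[t0 t1] uv utv hv e e0.
have [d d0 hd] := hv e e0.
apply: cvg_near_cst; near=> r.
have r0 : 0 < r by near: r; exact: nbhs_right_gt.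
have rm : r < Num.min d (Num.min t (1 - t)).
  by near: r; apply: nbhs_right_lt; rewrite !lt_min d0 t0 subr_gt0.
move: rm; rewrite !lt_min => /and3P[rd rt rt1].
have tr : 0 <= t - r by rewrite subr_ge0 ltW.
have tr1 : t + r <= 1 by rewrite -lerBrDl ltW.
have mB := bad_meas z e mu_ tr tr1.
rewrite -/(bad u t z e r).
suff -> : mu (bad u t z e r) = 0%E by rewrite mul0r.
apply: measure_negligible => //.
have : {ae mu, forall s, ~ bad u t z e r s}.
  apply: aeS uv => s hs [sI]; apply/negP; rewrite -leNgt.
  move: sI; rewrite /= in_itv/= => /andP[s1 s2].
  rewrite hs ?utv; last by rewrite in_itv/= (le_lt_trans tr s1) (lt_le_trans s2 tr1).
  by apply: hd; rewrite ltr_distl; lra.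
by move=> [N [mN N0 sN]]; exists N; split => // x hx; apply: sN => /=; apply.
Unshelve. all: by end_near.
Qed.

End Limits.



(** * From a jump decomposition to SBV2 *)

Section Representation.
Context {R : realType} (n : nat) (f z u : R -> R) (c : R).
Implicit Types (d e h r s t x y l : R).
Let k := n.+2.
Let p t := `|z t| `^ (1 / k%:R).
Hypotheses (fi : cint 0 1 f) (f2 : cint 0 1 (fun t => f t ^+ 2))
  (z0 : forall t, ~~ ((0 < t) && (t < 1)) -> z t = 0)
  (zp : atoms z [set` `]0, 1[] \is a fin_num) (zn : atoms (fun t => - z t) [set` `]0, 1[] \is a fin_num)
  (pfin : (\esum_(t in [set` `]0%R, 1%R[]) (p t)%:E < +oo)%E)
  (mu_ : measurable_fun (`]0, 1[ : set R) u)
  (uv : {ae mu, forall x, x \in `]0, 1[ ->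
     u x = c + oint f 0 x + (fine (atoms z [set` `]0, x]]) - fine (atoms (fun t => - z t) [set` `]0, x]]))}).

Variables nu_p nu_n : {finite_measure set (measurableTypeR R) -> \bar R}.
Hypotheses
  (nu_pE : forall A, measurable A -> nu_p A = (\int[mu]_(x in A `&` `]0%R, 1%R[) (Num.max (f x) 0)%:E + atoms z A)%E)
  (nu_nE : forall A, measurable A -> nu_n A = (\int[mu]_(x in A `&` `]0%R, 1%R[) (Num.max (- f x)%R 0)%:E + atoms (fun t => (- z t)%R) A)%E).

Let I01 : set (measurableTypeR R) := [set` `]0, 1[].
Let P (A : set (measurableTypeR R)) : R := fine (nu_p A).
Let N (A : set (measurableTypeR R)) : R := fine (nu_n A).
(** A representative of [u] defined at every point. It is written with finite measures, whose
    continuity along decreasing sets gives the one-sided limits. *)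
Let v x := c + P [set` `]0, x]] - N [set` `]0, x]].

Let m01 : measurable I01. Proof. exact: measurable_itv. Qed.
Let moc x y : measurable ([set` `]x, y]] : set (measurableTypeR R)). Proof. exact: measurable_itv. Qed.

Let zn0 t : ~~ ((0 < t) && (t < 1)) -> - z t = 0. Proof. by move=> /z0 ->; rewrite oppr0. Qed.

Let atoms_fin (w : R -> R) A : (forall t, ~~ ((0 < t) && (t < 1)) -> w t = 0) -> atoms w I01 \is a fin_num -> measurable A ->
  atoms w A \is a fin_num.
Proof.
move=> w0 wf mA; rewrite (atoms_01 A w0) ge0_fin_numE ?measure_ge0//.
apply: (@le_lt_trans _ _ (atoms w I01)); last by rewrite -ge0_fin_numE ?measure_ge0.
by apply: le_measure; [apply: mem_set; exact: measurableI|exact: mem_set|].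
Qed.

Let fmax_int (g : R -> R) : cint 0 1 g -> cint 0 1 (fun x => Num.max (g x) 0).
Proof.
move=> gi; apply: (@cint_le _ _ _ _ g) => //.
  by apply: measurable_maxr => //; exact: cint_meas.
by move=> x _ _; rewrite ger0_norm ?le_max ?lexx ?orbT// ge_max ler_norm normr_ge0.
Qed.

Let fni : cint 0 1 (fun x => - f x).
Proof. by rewrite (_ : (fun x => - f x) = fun x => -1 * f x); [exact: cintZ|apply/funext => x; rewrite mulN1r]. Qed.

Let mass (nu : {finite_measure set (measurableTypeR R) -> \bar R}) (g w : R -> R) A : cint 0 1 g ->
  (forall t, ~~ ((0 < t) && (t < 1)) -> w t = 0) -> atoms w I01 \is a fin_num ->
  (forall A, measurable A -> nu A = (\int[mu]_(x in A `&` `]0%R, 1%R[) (Num.max (g x) 0)%:E + atoms w A)%E) ->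
  measurable A -> fine (nu A) = \int[mu]_(x in A `&` `]0, 1[) Num.max (g x) 0 + fine (atoms w A).
Proof.
move=> gi w0 wf nuE mA; rewrite nuE// fineD//; last exact: atoms_fin.
apply: integrable_fin_num; first exact: measurableI.
by apply: integrableS (_ : mu.-integrable `]0, 1[ _) => //; [exact: measurableI|apply/cint_oo; exact: fmax_int].
Qed.

Let PN x y : 0 <= x -> x <= y -> y < 1 ->
  P [set` `]x, y]] - N [set` `]x, y]] = oint f x y + (fine (atoms z [set` `]x, y]]) - fine (atoms (fun t => - z t) [set` `]x, y]])).
Proof.
move=> x0 xy y1; rewrite /P /N (mass fi z0 zp nu_pE (moc x y)) (mass fni zn0 zn nu_nE (moc x y)).
have -> : ([set` `]x, y]] `&` [set` `]0, 1[] : set R) = [set` `]x, y]].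
  apply/seteqP; split => t /=; rewrite !in_itv/=; first by case.
  by move=> /andP[xt ty]; rewrite xt ty (le_lt_trans x0 xt) (le_lt_trans ty y1).
have -> : oint f x y = oint (fun t => Num.max (f t) 0) x y - oint (fun t => Num.max (- f t) 0) x y.
  rewrite -(@ointB _ 0 1)//; [|exact: ltW|exact: fmax_int|exact: fmax_int].
  apply: eq_oint => t _ _; have [h|h] := leP 0 (f t).
    by rewrite max_r ?oppr_le0// subr0.
  by rewrite max_l ?oppr_ge0 ?(ltW h)// opprK add0r.
rewrite /oint; ring.
Qed.

Let vE x : 0 <= x -> x < 1 -> v x = c + oint f 0 x + (fine (atoms z [set` `]0, x]]) - fine (atoms (fun t => - z t) [set` `]0, x]])).
Proof. by move=> x0 x1; rewrite /v -addrA PN// addrA. Qed.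

Let ocU x y : 0 <= x -> x <= y -> ([set` `]0, y]] : set (measurableTypeR R)) = [set` `]0, x]] `|` [set` `]x, y]].
Proof. by move=> x0 xy; rewrite -itv_bndbnd_setU// bnd_simp. Qed.

Let ocU_disj x y : ([set` `]0, x]] : set (measurableTypeR R)) `&` [set` `]x, y]] = set0.
Proof. by apply/seteqP; split => // t [] /=; rewrite !in_itv/= => /andP[_ tx] /andP[xt _]; lra. Qed.

Let v_diff x y : 0 <= x -> x <= y -> v y - v x = P [set` `]x, y]] - N [set` `]x, y]].
Proof.
move=> x0 xy; rewrite /v /P /N (ocU x0 xy) !measureU ?ocU_disj//.
by rewrite !fineD ?finite_fin//; ring.
Qed.

Let diff_lt (a b e : R) : 0 <= a -> 0 <= b -> a < e -> b < e -> `|a - b| < e.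
Proof. by move=> *; rewrite ltr_norml; apply/andP; split; lra. Qed.

Let diff_le (a b e : R) : 0 <= a -> 0 <= b -> a <= e -> b <= e -> `|a - b| <= e.
Proof. by move=> *; rewrite ler_norml; apply/andP; split; lra. Qed.

Let triangle (x a o y e B : R) : `|x - a| <= e / 2 * y -> `|o| <= B -> B <= e / 2 * y -> `|x + o - a| <= e * y.
Proof. by move=> h1 h2 h3; rewrite addrAC; apply: (le_trans (ler_normD _ _)); lra. Qed.

Let P0 A : 0 <= P A. Proof. by apply: fine_ge0; exact: measure_ge0. Qed.
Let N0 A : 0 <= N A. Proof. by apply: fine_ge0; exact: measure_ge0. Qed.

Let u_right t : 0 < t -> t < 1 -> is_right_limit u t (v t).
Proof.
move=> t0 t1 e e0.
have [d1 d10 h1] := small_right nu_p t e0; have [d2 d20 h2] := small_right nu_n t e0.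
exists (Num.min (1 - t) (Num.min d1 d2)); first by rewrite !lt_min subr_gt0 t1 d10.
apply: aeS uv => x ux; rewrite in_itv/= => /andP[tx]; rewrite -ltrBlDl !lt_min => /and3P[x1 xd1 xd2].
have {}x1 : x < 1 by lra.
have x0 := lt_trans t0 tx.
rewrite ux ?in_itv/= ?x0// -(vE (ltW x0) x1) v_diff ?(ltW t0) ?(ltW tx)//.
by apply: diff_lt => //; [apply: h1|apply: h2]; rewrite -ltrBlDl.
Qed.

Let mass1 t : 0 < t -> t < 1 -> P [set t] - N [set t] = z t.
Proof.
move=> t0 t1; have mt : measurable ([set t] : set (measurableTypeR R)) by exact: measurable_set1.
rewrite /P /N (mass fi z0 zp nu_pE mt) (mass fni zn0 zn nu_nE mt).
have e (g : R -> R) : \int[mu]_(x in [set t] `&` `]0, 1[) g x = 0.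
  rewrite (_ : [set t] `&` `]0, 1[ = [set t]); last by apply/seteqP; split => [x []//|x ->]; split => //=; rewrite in_itv/= t0.
  by rewrite Rintegral_set1.
rewrite !e !add0r /atoms !esum_set1 ?lee_fin ?le_max ?lexx ?orbT//=.
by have [h|h] := leP 0 (z t); [rewrite [X in _ - X]max_r ?oppr_le0// subr0|rewrite max_l ?oppr_ge0 ?(ltW h)// opprK add0r].
Qed.

Let u_left t : 0 < t -> t < 1 -> is_left_limit u t (v t - z t).
Proof.
move=> t0 t1 e e0.
have [d1 d10 h1] := small_left nu_p t e0; have [d2 d20 h2] := small_left nu_n t e0.
exists (Num.min t (Num.min d1 d2)); first by rewrite !lt_min t0 d10.
apply: aeS uv => x ux; rewrite in_itv/= => /andP[+ tx]; rewrite ltrBlDl -ltrBlDr !lt_min => /and3P[x0 xd1 xd2].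
have {}x0 : 0 < x by lra.
have x1 := lt_trans tx t1.
rewrite ux ?in_itv/= ?x0// -(vE (ltW x0) x1) distrC.
have -> : v t - z t - v x = P [set` `]x, t[] - N [set` `]x, t[].
  have := v_diff (ltW x0) (ltW tx).
  have -> : ([set` `]x, t]] : set (measurableTypeR R)) = [set` `]x, t[] `|` [set t] by rewrite setUitv1// bnd_simp.
  have dj : ([set` `]x, t[] : set (measurableTypeR R)) `&` [set t] = set0.
    by apply/seteqP; split => // y [] /=; rewrite in_itv/= => /andP[_ +] e1; rewrite e1 ltxx.
  have mt : measurable ([set t] : set (measurableTypeR R)) by exact: measurable_set1.
  rewrite {1}/P {1}/N !measureU// !fineD ?finite_fin//.
  have := mass1 t0 t1; rewrite /P /N; lra.
by apply: diff_lt => //; [apply: h1|apply: h2]; rewrite ltrBlDl -ltrBlDr.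
Qed.

Lemma rep_jump t : 0 < t -> t < 1 -> jump u t = z t.
Proof.
by move=> t0 t1; rewrite /jump (right_limitE (u_right t0 t1)) (left_limitE (u_left t0 t1)); ring.
Qed.

Lemma rep_jump_set : jump_set u = [set t | (0 < t) && (t < 1) /\ z t != 0].
Proof.
apply/seteqP; split => t.
  move=> [/= t01 [l [r [hl hr lr]]]]; move: t01; rewrite in_itv/= => t01; split => //.
  have /andP[t0 t1] := t01.
  rewrite (left_limit_unique hl (u_left t0 t1)) (right_limit_unique hr (u_right t0 t1)) in lr.
  by apply: contra lr => /eqP ->; rewrite subr0.
move=> [t01 zt]; split; first by rewrite /= in_itv.
have /andP[t0 t1] := t01.
exists (v t - z t), (v t); split; [exact: u_left|exact: u_right|].
by apply: contra zt => /eqP h; apply/eqP; lra.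
Qed.

Let pT : (\esum_(t in setT) (p t)%:E < +oo)%E.
Proof.
rewrite (_ : (\esum_(t in setT) (p t)%:E)%E = (\esum_(t in [set` `]0%R, 1%R[]) (p t)%:E)%E)//.
rewrite [RHS]esum_mkcond; apply: eq_esum => t _; case: ifPn => // /negP h.
rewrite /p z0 ?normr0 ?powR0//; last by apply/negP => h'; apply: h; apply/mem_set; rewrite /= in_itv.
by rewrite div1r invr_eq0 pnatr_eq0.
Qed.

Let G := fine (\esum_(t in setT) (p t)%:E)%E.

Let GE : (\esum_(t in setT) (p t)%:E)%E = G%:E.
Proof. by rewrite fineK// ge0_fin_numE// esum_ge0// => t _; rewrite lee_fin powR_ge0. Qed.

Let G0 : 0 <= G.
Proof. by rewrite fine_ge0// esum_ge0// => t _; rewrite lee_fin powR_ge0. Qed.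

Let pk t : `|z t| = p t ^+ k.
Proof. by rewrite /p -powR_mulrn ?powR_ge0// -powRrM div1r mulVf ?pnatr_eq0// powRr1. Qed.

Let atoms_le (w : R -> R) A q : 0 <= q -> (forall t, A t -> `|w t| <= q * p t) -> fine (atoms w A) <= q * G.
Proof.
move=> q0 h; have le : (atoms w A <= (q * G)%:E)%E.
  rewrite /atoms; apply: ub_ereal_sup => _ [X [fX XA] <-].
  apply: (@le_trans _ _ (\sum_(i \in X) (q * p i)%:E)%E).
    apply: lee_fsum => // t /XA At; rewrite lee_fin ge_max mulr_ge0 ?powR_ge0// andbT.
    by apply: (le_trans (ler_norm _)); exact: h.
  rewrite fsbig_finite// sumEFin -mulr_sumr lee_fin; apply: ler_wpM2l => //.
  by rewrite -lee_fin -GE -sumEFin -fsbig_finite//; apply: ereal_sup_ubound; exists X.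
have h0 : (0 <= atoms w A)%E by exact: measure_ge0.
by rewrite -lee_fin fineK// ge0_fin_numE//; exact: le_lt_trans le (ltry _).
Qed.

Let pk_le (y q : R) j : 0 <= y -> y <= q -> q <= 1 -> y ^+ j.+2 <= q * y.
Proof.
move=> y0 yq q1; rewrite exprS mulrC; apply: ler_wpM2r => //.
apply: (le_trans _ yq); rewrite exprS -[leRHS]mulr1; apply: ler_wpM2l => //.
by apply: exprn_ile1 => //; exact: le_trans yq q1.
Qed.

(** If [p y <= q |y - t|] for the atoms between [s] and [s'], then [|z y| = (p y)^k <= q d p y]
    because [k >= 2]. Summability of [p] makes the jumps near [t] contribute at most a small
    multiple of the distance. *)
Let atoms_small t s s' q d : 0 <= q -> q <= 1 -> q * d <= 1 -> s < s' -> (forall y, y \in `]s, s'] -> `|y - t| <= d /\ p y <= q * `|y - t|) ->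
  `|fine (atoms z [set` `]s, s']]) - fine (atoms (fun t => - z t) [set` `]s, s']])| <= q * d * G.
Proof.
move=> q0 q1 qd ss h.
have d0 : 0 <= d.
  have /h[+ _] : s' \in `]s, s'] by rewrite in_itv/= ss lexx.
  exact: le_trans.
have hh y : y \in `]s, s'] -> `|z y| <= q * d * p y.
  move=> /h[yd yq]; rewrite pk; apply: pk_le => //; first exact: powR_ge0.
  by apply: (le_trans yq); apply: ler_wpM2l.
have a1 : fine (atoms z [set` `]s, s']]) <= q * d * G by apply: atoms_le => //; exact: mulr_ge0.
have a2 : fine (atoms (fun t => - z t) [set` `]s, s']]) <= q * d * G.
  by apply: atoms_le => [|y /= hy]; [exact: mulr_ge0|rewrite normrN; exact: hh].
have b1 : 0 <= fine (atoms z [set` `]s, s']]) by apply: fine_ge0; exact: measure_ge0.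
have b2 : 0 <= fine (atoms (fun t => - z t) [set` `]s, s']]) by apply: fine_ge0; exact: measure_ge0.
exact: diff_le.
Qed.

(** Almost every [t] is a Lebesgue point of [f] and, by [sparse_atoms] applied to the summable roots
    [p], sees only small atoms nearby. At such [t] the representative [v] is differentiable in the
    classical sense, with derivative [f t]. *)
Lemma rep_gradient : is_approx_gradient u f.
Proof.
split; first exact: cint_moo fi.
have /ae_foralln H : forall m : nat, {ae mu, forall t, exists2 d : R, 0 < d & forall s, `|s - t| < d -> p s <= m.+1%:R^-1 * `|s - t|}.
  by move=> m; apply: sparse_atoms => // t; exact: powR_ge0.
have H2 := aeS2 (fun t (a : _ -> _) b => conj a b) uv (aeS2 (fun t (a : _ -> _) b => conj a b) (oint_derive fi) H).
apply: aeS H2 => t [ut [ot pt]] t01; have /andP[t0 t1] : (0 < t) && (t < 1) by move: t01; rewrite /= in_itv.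
have utv : u t = v t by rewrite vE ?(ltW t0)// ut.
apply: (@classical_approx _ u v) => //.
  by apply: aeS uv => x h x01; rewrite h// vE//; move: x01; rewrite in_itv/= => /andP[] // /ltW.
move=> e e0; have e2 : 0 < e / 2 by rewrite divr_gt0.
have [d1 d10 h1] := ot t01 _ e2.
pose q0 := e / (2 * (G + 1)).
have q00 : 0 < q0 by rewrite divr_gt0// mulr_gt0// ltr_wpDl.
have [m hm] : exists m : nat, m.+1%:R^-1 < q0.
  by exists (Num.truncn q0^-1); rewrite invf_plt ?posrE// truncnS_gt.
have [d2 d20 h2] := pt m.
set q := m.+1%:R^-1 in h2 hm.
have q_0 : 0 <= q by rewrite invr_ge0.
have q_1 : q <= 1 by rewrite invf_le1// ler1n.
have qG : q * G <= e / 2.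
  apply: (@le_trans _ _ (q0 * (G + 1))); first by apply: ler_pM => //; [exact: ltW|rewrite lerDl].
  by rewrite /q0 le_eqVlt; apply/orP; left; apply/eqP; field; rewrite gt_eqF// ltr_wpDl.
exists (Num.min (Num.min d1 d2) (Num.min 1 (Num.min t (1 - t)))); first by rewrite !lt_min d10 d20 ltr01 t0 subr_gt0.
move=> s; rewrite !lt_min => /and4P[/andP[sd1 sd2] s1 st s1t].
have qs : q * `|s - t| <= 1 by rewrite -[leRHS]mulr1; apply: ler_pM => //; exact: ltW.
have fin (x a o y : R) : `|x - a| <= e / 2 * y -> `|o| <= q * y * G -> 0 <= y -> `|x + o - a| <= e * y.
  move=> ha ho y0; apply: (triangle ha ho).
  by rewrite mulrAC; apply: ler_wpM2r.
case: (ltgtP s t) => [lt|lt|->]; last by rewrite !subrr mulr0 subrr normr0 mulr0.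
- have s0 : 0 < s by move: st; rewrite ltr0_norm ?subr_lt0// opprB ltrBlDr ltrDl.
  rewrite distrC (_ : `|s - t| = t - s); last by rewrite distrC gtr0_norm ?subr_gt0.
  rewrite (_ : f t * (s - t) - (v s - v t) = v t - v s - f t * (t - s)); last by ring.
  rewrite v_diff ?(ltW s0) ?(ltW lt)// PN ?(ltW s0) ?(ltW lt)//.
  apply: fin; [by apply: (h1 s sd1).2; exact: ltW| |by rewrite subr_ge0 ltW].
  apply: (@atoms_small t) => //; first by rewrite -[t - s]gtr0_norm ?subr_gt0// distrC.
  move=> y; rewrite in_itv/= => /andP[sy yt].
  have yd : `|y - t| <= t - s by rewrite distrC ger0_norm ?subr_ge0//; lra.
  split => //; apply: h2; apply: (le_lt_trans yd).
  by move: sd2; rewrite distrC gtr0_norm ?subr_gt0.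
- have s_1 : s < 1 by move: s1t; rewrite gtr0_norm ?subr_gt0//; lra.
  rewrite (_ : `|s - t| = s - t); last by rewrite gtr0_norm ?subr_gt0.
  rewrite v_diff ?(ltW t0) ?(ltW lt)// PN ?(ltW t0) ?(ltW lt)//.
  apply: fin; [by apply: (h1 s sd1).1; exact: ltW| |by rewrite subr_ge0 ltW].
  apply: (@atoms_small t) => //; first by rewrite -[s - t]gtr0_norm ?subr_gt0.
  move=> y; rewrite in_itv/= => /andP[ty ys].
  have yd : `|y - t| <= s - t by rewrite gtr0_norm ?subr_gt0//; lra.
  split => //; apply: h2; apply: (le_lt_trans yd).
  by move: sd2; rewrite gtr0_norm ?subr_gt0.
Qed.

Let agE : is_approx_gradient u (approx_gradient u) /\ aeq 0 1 f (approx_gradient u).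
Proof.
have h := @xget_sat _ (is_approx_gradient u) (fun=> 0) (ex_intro _ f rep_gradient).
split; first exact: h.
have [_ h1] := h; have [_ h2] := rep_gradient.
apply: aeS2 h2 h1 => t h2 h1 t01.
by apply: (approx_derivative_unique mu_ t01); [exact: h2|exact: h1].
Qed.

Let mag : measurable_fun (`]0, 1[ : set R) (approx_gradient u).
Proof. by have [[]] := agE. Qed.

Let uv' : {ae mu, forall x, x \in `]0, 1[ -> u x = v x}.
Proof. by apply: aeS uv => x h x01; rewrite h// vE//; move: x01; rewrite in_itv/= => /andP[] // /ltW. Qed.

(** [u] agrees almost everywhere with [v], which is bounded by the total masses; clipping [u] at
    that bound gives a measurable bounded function equal to [u] almost everywhere. *)
Let u_L1 : L1 0 1 u.
Proof.
pose M := `|c| + P setT + N setT.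
pose w x := Num.min M (Num.max (- M) (u x)).
have mw : measurable_fun (`]0, 1[ : set R) w.
  by apply: measurable_minr => //; exact: measurable_maxr.
have uw : aeq 0 1 w u.
  apply: aeS uv' => x h x01; rewrite /w h//.
  have a1 : P [set` `]0, x]] <= P setT by apply: fine_le.
  have a2 : N [set` `]0, x]] <= N setT by apply: fine_le.
  have b1 := P0 [set` `]0, x]]; have b2 := N0 [set` `]0, x]].
  have c1 := ler_norm c; have c2 := ler_norm (- c); rewrite normrN in c2.
  have h1 : v x <= M by rewrite /v /M; lra.
  have h2 : - M <= v x by rewrite /v /M; lra.
  by rewrite max_r// min_r.
apply/cint_oo; apply: (@cint_aeq _ _ _ w) => //.
apply: (@cint_bounded _ _ _ _ M); first exact: moo_cc.
have M0 : 0 <= M by rewrite !addr_ge0.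
move=> x _ _; rewrite /w ler_norml le_min ge_min lexx/= le_max lexx/= andbT.
by rewrite (le_trans _ M0)// oppr_le0.
Qed.

Let nu : {charge set (measurableTypeR R) -> \bar R} :=
  cadd (charge_of_finite_measure nu_p) (copp (charge_of_finite_measure nu_n)).

Let u_dist : distributional_derivative u nu.
Proof.
exists nu_p, nu_n; split => // phi tphi.
have [ip ep] := dist_deriv nu_p tphi; have [iN eN] := dist_deriv nu_n tphi.
have [ci pp] := test_prim tphi.
have mphi : measurable_fun (`]0, 1[ : set R) (derive1 phi) by exact: cint_moo ci.
have ic : mu.-integrable `]0, 1[ (EFin \o (fun x => c * derive1 phi x)).
  by apply/cint_oo; exact: cintZ.
have e : (fun x => v x * derive1 phi x) = (fun x => c * derive1 phi x + P [set` `]0, x]] * derive1 phi x - N [set` `]0, x]] * derive1 phi x).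
  by apply/funext => x; rewrite /v; ring.
have i1 : mu.-integrable `]0, 1[ (EFin \o (fun x => c * derive1 phi x + P [set` `]0, x]] * derive1 phi x)).
  rewrite (_ : EFin \o _ = (EFin \o (fun x => c * derive1 phi x)) \+ (EFin \o (fun x => P [set` `]0, x]] * derive1 phi x)))//.
  exact: integrableD.
have i2 : mu.-integrable `]0, 1[ (EFin \o (fun x => v x * derive1 phi x)).
  rewrite e; exact: (@integrableB _ _ _ mu _ (measurable_itv _) (fun x => (c * derive1 phi x + P [set` `]0, x]] * derive1 phi x)%:E) (fun x => (N [set` `]0, x]] * derive1 phi x)%:E) i1 iN).
rewrite (@Rint_aeq _ 0 1 _ (fun x => v x * derive1 phi x)); last first.
- by apply: aeS uv' => x h x01; rewrite h.
- by move: i2 => /integrableP[/measurable_EFinP].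
- by apply: measurable_funM => //.
rewrite e RintegralB// RintegralD// ep eN.
have -> : \int[mu]_(x in `]0, 1[) (c * derive1 phi x) = 0.
  rewrite RintegralZl//; last by apply/cint_oo.
  by rewrite -oint_oo// -pp ?ler01// !(test0 tphi) ?in_itv/= ?ltxx ?andbF// subrr mulr0.
ring.
Qed.

Let jump_z t : jump_set u t -> jump u t = z t.
Proof. by rewrite rep_jump_set => -[/andP[t0 t1] _]; exact: rep_jump. Qed.

Let esum_jump (F : R -> R) A : F 0 = 0 -> A `<=` I01 ->
  (\esum_(t in jump_set u `&` A) (F (jump u t))%:E = \esum_(t in A) (F (z t))%:E)%E.
Proof.
move=> F0 AI; rewrite esum_mkcond [RHS]esum_mkcond; apply: eq_esum => t _.
case: ifPn => [/set_mem[jt /mem_set ->]|/negP h]; first by rewrite jump_z.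
case: ifPn => // /set_mem At; suff -> : z t = 0 by rewrite F0.
apply/eqP/negPn/negP => zt; apply: h; apply/mem_set; split => //; rewrite rep_jump_set; split => //.
by have := AI _ At; rewrite /I01/= in_itv.
Qed.

Let jump_sub : jump_set u `<=` I01.
Proof. by move=> t; rewrite rep_jump_set => -[? _]; rewrite /I01/= in_itv. Qed.

Let esum_jumpT (F : R -> R) : F 0 = 0 ->
  (\esum_(t in jump_set u) (F (jump u t))%:E = \esum_(t in [set` `]0%R, 1%R[]) (F (z t))%:E)%E.
Proof. by move=> F0; rewrite -(esum_jump F0)// (setIidl jump_sub). Qed.

Lemma rep_SBV2 : SBV2 u.
Proof.
split; first exact: u_L1.
have [ag fg] := agE.
exists nu; split => //.

- by apply: (@L2_aeq _ _ _ f _ mag fg); apply: cint_L2 => //; exact: cint_moo fi.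
- rewrite /esum.summable (esum_jumpT (F := fun x => `|x|)) ?normr0//.
  rewrite (_ : (\esum_(t in _) _)%E = atoms z I01 + atoms (fun t => (- z t)%R) I01)%E; last first.
    rewrite /atoms -esumD; last 2 first.
    - by move=> t _; rewrite lee_fin le_max lexx orbT.
    - by move=> t _; rewrite lee_fin le_max lexx orbT.
    apply: eq_esum => t _; rewrite -EFinD; congr EFin.
    have [h|h] := leP 0 (z t); first by rewrite ger0_norm// [X in _ + X]max_r ?oppr_le0// addr0.
    by rewrite ltr0_norm// max_l ?oppr_ge0 ?(ltW h)// add0r.
  by rewrite -ge0_fin_numE ?adde_ge0 ?measure_ge0// fin_numD zp zn.
- move=> A mA AI; rewrite (esum_jump (F := fun x => Num.max x 0)) ?maxxx//.
  rewrite (esum_jump (F := fun x => Num.max (- x) 0)) ?oppr0 ?maxxx//.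
  have -> : nu A = (nu_p A - nu_n A)%E by [].
  rewrite nu_pE// nu_nE// (setIidl AI).
  rewrite -/(atoms z A) -/(atoms (fun t => (- z t)%R) A).
  have fA : mu.-integrable A (EFin \o f) by apply: integrableS (AI) _ => //; apply/cint_oo.
  have -> : (\int[mu]_(x in A) (approx_gradient u x)%:E = \int[mu]_(x in A) (f x)%:E)%E.
    apply: ae_eq_integral => //.
    - by apply/measurable_EFinP; exact: measurable_funS mag.
    - by move: fA => /integrableP[].
    - by apply: aeS fg => x h Ax; rewrite h//; exact: AI.
  rewrite [in RHS]integralE.
  have e1 : (\int[mu]_(x in A) (EFin \o f)^\+ x = \int[mu]_(x in A) (Num.max (f x) 0)%:E)%E.
    by apply: eq_integral => x _; rewrite funeposE EFin_max.
  have e2 : (\int[mu]_(x in A) (EFin \o f)^\- x = \int[mu]_(x in A) (Num.max (- f x)%R 0)%:E)%E.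
    by apply: eq_integral => x _; rewrite funenegE EFin_max.
  have f1 : (\int[mu]_(x in A) (Num.max (f x) 0)%:E)%E \is a fin_num.
    by rewrite -e1; apply: integrable_fin_num => //; exact: integrable_funepos.
  have f2' : (\int[mu]_(x in A) (Num.max (- f x)%R 0)%:E)%E \is a fin_num.
    by rewrite -e2; apply: integrable_fin_num => //; exact: integrable_funeneg.
  have g1 := atoms_fin z0 zp mA; have g2 := atoms_fin zn0 zn mA.
  rewrite -[X in (_ = X - _ + _)%E]/(\int[mu]_(x in A) (EFin \o f)^\+ x)%E.
  rewrite -[X in (_ = _ - X + _)%E]/(\int[mu]_(x in A) (EFin \o f)^\- x)%E e1 e2.
  rewrite -(fineK f1) -(fineK f2') -(fineK g1) -(fineK g2) -!EFinD; congr EFin; ring.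
Qed.

Lemma rep_F_lim : F_lim k u = ((oint (fun t => f t ^+ 2) 0 1)%:E + (m_ R k)%:E * \esum_(t in [set` `]0%R, 1%R[]) (p t)%:E)%E.
Proof.
have [ag fg] := agE.
rewrite /F_lim (asboolT rep_SBV2) (esum_jumpT (F := fun x => `|x| `^ (1 / k%:R))); last first.
  by rewrite normr0 powR0// div1r invr_eq0 pnatr_eq0.
congr (_ + _)%E; rewrite oint_oo// /Rintegral fineK; last first.
  by apply: integrable_fin_num => //; apply/cint_oo.
apply: ae_eq_integral => //.
- by apply/measurable_EFinP; exact: measurable_funX.
- by apply/measurable_EFinP; exact: cint_moo f2.
- by apply: aeS fg => x h x01; rewrite h.
Qed.

End Representation.


(** * Bounded energy *)

Section Energy.
Context {R : realType} (n : nat).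
Implicit Types (a b c d e l s t x y C K : R) (f g u : R -> R) (w : nat -> R -> R).
Let k := n.+2.

Definition total_energy w s := oint (fun t => flat (w 1%N) s t ^+ 2) 0 1 + steep_energy k w s 0 1.

Let f_epsE s z : 0 < s -> f_eps (s ^+ 2) z = (z * (1 - (if s^-1 < `|z| then 1 else 0))) ^+ 2 + (if s^-1 < `|z| then 1 else 0) / s ^+ 2.
Proof.
move=> s0; rewrite /f_eps -(real_normK (num_real z)) div1r -exprVn.
have si0 : 0 <= s^-1 by rewrite invr_ge0 ltW.
case: ltP => h.
  rewrite subrr mulr0 expr0n/= add0r mul1r exprVn min_r// -exprVn; apply: lerXn2r; rewrite ?nnegrE// ltW//.
rewrite subr0 mulr1 mul0r addr0 min_l ?real_normK ?num_real//.
by rewrite -(real_normK (num_real z)); apply: lerXn2r; rewrite ?nnegrE.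
Qed.

Lemma flat_sq_int w s : 0 < s -> cint 0 1 (w 1%N) -> cint 0 1 (fun t => flat (w 1%N) s t ^+ 2).
Proof.
move=> s0 cw; apply: (@cint_bounded _ _ _ _ (s^-1 ^+ 2)).
  apply: measurable_funX; apply: measurable_funM; first exact: cint_meas.
  by apply: measurable_funB => //; apply: steep_meas; exact: cint_meas.
move=> t _ _; rewrite normrX lerXn2r ?nnegrE ?invr_ge0 ?(ltW s0)//.
rewrite /flat /steep; case: ltP => [_|h]; first by rewrite subrr mulr0 normr0 invr_ge0 ltW.
by rewrite subr0 mulr1.
Qed.

Lemma F_eps_rep s w u : 0 < s -> rep 0 1 k w -> measurable_fun (`]0, 1[ : set R) u -> aeq 0 1 u (w 0%N) ->
  F_eps k (s ^+ 2) u = (total_energy w s)%:E.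
Proof.
move=> s0 rw mu_ uw; have hk : Hk 0 1 k u := rep_Hk ltr01 rw mu_ uw.
rewrite /F_eps asboolT//.
have [m1 e1] := rep_wderivn ltr01 rw mu_ uw (isT : (1 <= k)%N).
have [mk ek] := rep_wderivn ltr01 rw mu_ uw (leqnn k).
have [_ h2 h3] := rw.
have c1 := h2 1%N isT; have st := steep_cint s (cint_meas c1).
have i1 := flat_sq_int s0 c1.
pose F t := flat (w 1%N) s t ^+ 2 + ((s ^+ 2)^-1 * steep (w 1%N) s t + (s ^+ 2) ^+ (2 * k).-1 * w k t ^+ 2).
have i2 : cint 0 1 (fun t => (s ^+ 2)^-1 * steep (w 1%N) s t + (s ^+ 2) ^+ (2 * k).-1 * w k t ^+ 2).
  by apply: cintD; apply: cintZ.
have iF : cint 0 1 F by exact: cintD.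
have -> : total_energy w s = oint F 0 1.
  rewrite /total_energy /steep_energy /steep_size mulrC -(@ointZ _ 0 1)// -(@ointZ _ 0 1)// -(@ointD _ 0 1)//; try exact: cintZ.
  by rewrite -(@ointD _ 0 1).
have e : aeq 0 1 (fun t => f_eps (s ^+ 2) (wderiv 0 1 u t) + (s ^+ 2) ^+ (2 * k - 1) * wderivn 0 1 k u t ^+ 2) F.
  apply: aeS2 e1 ek => t e1 ek t01.
  have {e1} -> : wderiv 0 1 u t = w 1%N t by exact: e1.
  by rewrite ek// f_epsE// /F /flat /steep subn1 -addrA; congr (_ + (_ + _)); exact: mulrC.
have mf : measurable_fun (`]0, 1[ : set R) (fun t => f_eps (s ^+ 2) (wderiv 0 1 u t) + (s ^+ 2) ^+ (2 * k - 1) * wderivn 0 1 k u t ^+ 2).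
  apply: measurable_funD.
    by rewrite /f_eps; apply: measurable_minr => //; apply: measurable_funX.
  by apply: measurable_funM => //; apply: measurable_funX.
rewrite oint_oo// /Rintegral fineK; last by apply: integrable_fin_num => //; apply/cint_oo.
apply: ae_eq_integral => //.
- exact/measurable_EFinP.
- by apply/measurable_EFinP; exact: cint_moo iF.
- by apply: aeS e => x h x01; rewrite h.
Qed.

Lemma steep_energy_ge0 w s x y : 0 < s -> 0 <= steep_energy k w s x y.
Proof. by move=> s0; apply: energy_ge0; exact: exprn_gt0. Qed.

(** With the fixed value [d = 1/2], [key] bounds the oscillation outside the exceptional set in
    terms of [C] alone; the flat part adds at most [1 + C], by [|g| <= 1 + g^2]. The constant [c] is
    minus the value at one point outside that set, and it is arbitrary when the set contains all of
    [[0, 1]]. *)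
Lemma bounded_rep C : 1 <= C -> exists K : R, forall s u, 0 < s -> s <= 1 -> (F_eps k (s ^+ 2) u <= C%:E)%E ->
  exists w c, [/\ rep 0 1 k w, measurable_fun (`]0, 1[ : set R) u, aeq 0 1 u (w 0%N), F_eps k (s ^+ 2) u = (total_energy w s)%:E &
    exists B : set R, [/\ measurable B, (mu B <= (2 * C * s ^+ 2)%:E)%E &
     forall x, 0 <= x -> x <= 1 -> ~ B x -> `|w 0%N x + c| <= K]].
Proof.
move=> C1; have C0 : 0 <= C by exact: le_trans C1.
have [K1 K10 hK1] := key n C1.
have h0 : 0 < 1 / 2 :> R by rewrite divr_gt0.
have [K2 K20 hK2] := hK1 (1 / 2) h0 (lexx _).
have M0 : 0 < m_ R k by exact: m_gt0.
exists ((2 * C / m_ R k) ^+ k + K1 * Num.sqrt (1 / 2) + K2 + (1 + C)) => s u s0 s_1 FC.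
have hk : Hk 0 1 k u by move: FC; rewrite /F_eps; case: asboolP.
have [w [rw uw]] := Hk_rep ltr01 hk.
have mu_ : measurable_fun (`]0, 1[ : set R) u by have [] := Hk_L2 hk.
have FE := F_eps_rep s0 rw mu_ uw.
rewrite FE lee_fin in FC.
have [_ h2 _] := rw; have c1 := h2 1%N isT.
have i1 := flat_sq_int s0 c1.
have fl0 : 0 <= oint (fun t => flat (w 1%N) s t ^+ 2) 0 1 by apply: oint_ge0 => t _ _; exact: sqr_ge0.
have en0 x y := steep_energy_ge0 w x y s0.
have enC : steep_energy k w s 0 1 <= C by apply: le_trans FC; rewrite lerDr.
have flC : oint (fun t => flat (w 1%N) s t ^+ 2) 0 1 <= C by apply: le_trans FC; rewrite lerDl.
have [B [mB muB hB]] := hK2 s w s0 s_1 rw enC.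
have [[y [y0 y1 By]]|ny] := pselect (exists y, [/\ 0 <= y, y <= 1 & ~ B y]); last first.
  exists w, 0; split => //; exists B; split => // x x0 x1 Bx; exfalso; apply: ny; by exists x.
exists w, (- w 0%N y); split => //; exists B; split => //.
suff H a b : 0 <= a -> a <= b -> b <= 1 -> ~ B a -> ~ B b ->
    `|w 0%N b - w 0%N a| <= (2 * C / m_ R k) ^+ k + K1 * Num.sqrt (1 / 2) + K2 + (1 + C).
  move=> x x0 x1 Bx; have [xy|yx] := leP x y; last by apply: H => //; exact: ltW.
  by rewrite distrC; exact: H.
move=> a0 ab b1 Ba Bb.
have [l l0 [hl1 hl2]] := hB a b a0 ab b1 Ba Bb.
have gi : cint 0 1 (flat (w 1%N) s).
  rewrite (_ : flat (w 1%N) s = fun t => w 1%N t - w 1%N t * steep (w 1%N) s t); last by apply/funext => t; rewrite /flat; ring.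
  by apply: cintB => //; exact: steepM_cint.
have -> : w 0%N b - w 0%N a = steep_jump (w 1%N) s a b + oint (flat (w 1%N) s) a b.
  have [hp _ _] := rw; rewrite (hp 0%N isT a b)// /steep_jump -(@ointD _ 0 1)//; last exact: steepM_cint.
  by apply: eq_oint => t _ _; rewrite /flat; ring.
have o1 : `|oint (flat (w 1%N) s) a b| <= 1 + C.
  apply: (le_trans (norm_oint a0 b1 gi)).
  apply: (@le_trans _ _ (oint (fun t => 1 + flat (w 1%N) s t ^+ 2) 0 1)); last first.
    rewrite (@ointD _ 0 1)//; last exact: cint_cst.
    by rewrite oint_cst// subr0 mulr1 lerD2l.
  have ci : cint 0 1 (fun t => 1 + flat (w 1%N) s t ^+ 2) by apply: cintD => //; exact: cint_cst.
  apply: (@le_trans _ _ (oint (fun t => 1 + flat (w 1%N) s t ^+ 2) a b)).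
    apply: (@le_oint _ 0 1) => //; first exact: cint_norm.
    move=> t _ _; rewrite -(real_normK (num_real (flat _ _ _))); set q := `|_|; have q0 : 0 <= q by exact: normr_ge0.
    have := sqr_ge0 (q - 1); rewrite sqrrB1 -mulr_natr; nra.
  rewrite (oint_cat ci (lexx 0) a0 (le_trans ab b1) (lexx 1)) (oint_cat ci a0 ab b1 (lexx 1)).
  have p0 x x' : 0 <= oint (fun t => 1 + flat (w 1%N) s t ^+ 2) x x'.
    by apply: oint_ge0 => t _ _; rewrite addr_ge0// sqr_ge0.
  by rewrite addrCA lerDl addr_ge0.
have E1 : steep_energy k w s a b <= C.
  apply: le_trans enC.
  rewrite (energy_cat s rw (lexx 0) a0 (le_trans ab b1) (lexx 1)) (energy_cat s rw a0 ab b1 (lexx 1)).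
  by rewrite addrCA lerDl addr_ge0.
have l1 : l <= 2 * C / m_ R k.
  rewrite ler_pdivlMr// mulrC; apply: (le_trans hl2).
  rewrite (_ : 1 + 2 * (1 / 2) = 2 :> R); last by field.
  by rewrite ler_pM2l.
have l2 : l ^+ k <= (2 * C / m_ R k) ^+ k by apply: lerXn2r => //; rewrite nnegrE (le_trans l0).
have l3 : K2 * s <= K2 by rewrite ler_piMr.
apply: (le_trans (ler_normD _ _)); apply: lerD => //.
by apply: (le_trans hl1); rewrite lerD// lerD2r.
Qed.

End Energy.

(** * Convergence of a subsequence to a limit profile *)

Section Subsequence.
Context {R : realType} (n : nat) (s c : nat -> R) (w : nat -> nat -> R -> R) (C K : R).
Implicit Types (d e l t x y M : R) (f z u : R -> R).
Let k := n.+2.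
Hypotheses (C1 : 1 <= C) (s0 : forall i, 0 < s i) (s1 : forall i, s i <= 1)
  (s2 : forall i, s i <= 2^-1 ^+ i) (rw : forall i, rep 0 1 k (w i))
  (enC : forall i, total_energy n (w i) (s i) <= C)
  (cK : forall i, exists B : set R, [/\ measurable B, (mu B <= (2 * C * s i ^+ 2)%:E)%E &
     forall x, 0 <= x -> x <= 1 -> ~ B x -> `|w i 0%N x + c i| <= K]).

Definition profile_of f z x := oint f 0 x + (fine (atoms z [set` `]0, x]]) - fine (atoms (fun t => - z t) [set` `]0, x]])).

(** The common source of the lower bound and of equicoerciveness. The limiting inequality is stated
    for every upper bound [l] of the energies, so that it can be applied to a subsequence selected
    by its energy level. *)
Theorem limit_profile : exists f z (d : R) (phi : nat -> nat),
  [/\ cint 0 1 f /\ cint 0 1 (fun t => f t ^+ 2),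
    (forall t, ~~ ((0 < t) && (t < 1)) -> z t = 0) /\
      (atoms z [set` `]0, 1[] \is a fin_num /\ atoms (fun t => - z t) [set` `]0, 1[] \is a fin_num),
    (\esum_(t in [set` `]0%R, 1%R[]) (`|z t| `^ (1 / k%:R))%:E < +oo)%E /\
    (forall l, (forall i, total_energy n (w i) (s i) <= l) ->
       ((oint (fun t => f t ^+ 2) 0 1)%:E + (m_ R k)%:E * (\esum_(t in [set` `]0%R, 1%R[]) (`|z t| `^ (1 / k%:R))%:E) <= l%:E)%E),
    {homo phi : m n / (m < n)%N} &
    {ae mu, forall x, x \in `]0, 1[ -> (fun i => w (phi i) 0%N x + c (phi i)) @ \oo --> d + profile_of f z x}].
Proof.
have [U [UU oU]] := @ultraFilterLemma nat \oo _.
have Uoo N : U [set i | (N <= i)%N] by apply: oU; exists N.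
have fl0 i : 0 <= oint (fun t => flat (w i 1%N) (s i) t ^+ 2) 0 1 by apply: oint_ge0 => t _ _; exact: sqr_ge0.
have en0 i := steep_energy_ge0 n (w i) 0 1 (s0 i).
have enC' i : steep_energy k (w i) (s i) 0 1 <= C by apply: le_trans (enC i); rewrite lerDr.
have flC i : oint (fun t => flat (w i 1%N) (s i) t ^+ 2) 0 1 <= C by apply: le_trans (enC i); rewrite lerDl.
have [f [S0 [V [X [phi [[fi f2] Vh [aeX hS] lE [hphi hphi2]]]]]]] := compactness C1 s0 s1 s2 rw enC' flC cK UU Uoo.
have hJ x y : 0 < x -> x <= y -> y < 1 -> X x -> X y ->
    `|(S0 y - oint f 0 y) - (S0 x - oint f 0 x)| <= (V y - V x) ^+ k.
  move=> x0 xy y1 Xx Xy; have := hS x y x0 xy y1 Xx Xy.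
  rewrite (oint_cat fi (lexx 0) (ltW x0) xy (ltW y1)).
  by rewrite (_ : S0 y - S0 x - _ = S0 y - (oint f 0 x + oint f x y) - (S0 x - oint f 0 x)); last by ring.
have [z [d [z0 [zp zn] zs zJ]]] := @jump_decomposition _ n X _ V Vh aeX hJ.
exists f, z, d, phi; split => //.
- split; first by apply: le_lt_trans zs (ltry _).
  move=> l hl; have := lE l _ => /(_ (filterE _ hl)) h.
  apply: (@le_trans _ _ ((oint (fun t => f t ^+ 2) 0 1)%:E + (m_ R k)%:E * (V 1 - V 0)%:E)%E); last first.
    by rewrite -EFinM -EFinD lee_fin.
  rewrite leeD2l//; apply: lee_wpmul2l => //; by rewrite lee_fin ltW// m_gt0.
- have H := aeS2 (fun x (a : _ -> _) b => conj a b) aeX (aeS2 (fun x (a : _ -> _) (b : _ -> _) => conj a b) zJ (osc_ae Vh ltr01)).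
  apply: aeS H => x [Xx [Jx ox]] x01.
  have -> : d + profile_of f z x = S0 x by have := Jx x01; rewrite /profile_of => h; lra.
  apply: hphi2 => //; first exact: Xx.
  move=> e e0; have e2 : 0 < e / 3 by rewrite divr_gt0.
  have [d1 d10 h1] := Vr_close Vh x e2; have [d2 d20 h2] := Vl_close Vh x e2.
  pose dd := Num.min d1 d2 / 2.
  have m0 : 0 < Num.min d1 d2 by rewrite lt_min d10.
  have dd0 : 0 < dd by rewrite divr_gt0.
  have ddm : dd < Num.min d1 d2 by rewrite /dd; lra.
  move: (ddm); rewrite lt_min => /andP[dd1 dd2].
  exists dd => //.
  have a1 : V (x + dd) <= Vr V x + e / 3 by apply: h1; rewrite ltrD2l.
  have a2 : Vl V x - e / 3 <= V (x - dd) by apply: h2; rewrite ltrD2l ltrN2.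
  have := ox x01; rewrite /osc; lra.
Qed.

End Subsequence.


(** * Lower bound and equicoerciveness *)

Section Profiles.
Context {R : realType} (n : nat).
Implicit Types (c d e l t x y C K : R) (f z u : R -> R).
Let k := n.+2.

Lemma profile_SBV2 f z u c : cint 0 1 f -> cint 0 1 (fun t => f t ^+ 2) ->
  (forall t, ~~ ((0 < t) && (t < 1)) -> z t = 0) ->
  atoms z [set` `]0, 1[] \is a fin_num -> atoms (fun t => - z t) [set` `]0, 1[] \is a fin_num ->
  (\esum_(t in [set` `]0%R, 1%R[]) (`|z t| `^ (1 / k%:R))%:E < +oo)%E ->
  measurable_fun (`]0, 1[ : set R) u -> aeq 0 1 u (fun x => c + profile_of f z x) ->
  SBV2 u /\ F_lim k u = ((oint (fun t => f t ^+ 2) 0 1)%:E + (m_ R k)%:E * \esum_(t in [set` `]0%R, 1%R[]) (`|z t| `^ (1 / k%:R))%:E)%E.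
Proof.
move=> fi f2 z0 zp zn zs mu_ uv.
have zn0 t : ~~ ((0 < t) && (t < 1)) -> - z t = 0 by move=> /z0 ->; rewrite oppr0.
have fni : cint 0 1 (fun x => - f x).
  by rewrite (_ : (fun x => - f x) = fun x => -1 * f x); [exact: cintZ|apply/funext => x; rewrite mulN1r].
have [nu_p hp] := radon_measure fi z0 zp.
have [nu_n hn] := radon_measure fni zn0 zn.
have uv' : {ae mu, forall x, x \in `]0, 1[ ->
     u x = c + oint f 0 x + (fine (atoms z [set` `]0, x]]) - fine (atoms (fun t => - z t) [set` `]0, x]]))}.
  by apply: aeS uv => x h x01; rewrite h// /profile_of addrA.
by split; [exact: (rep_SBV2 fi f2 z0 zp zn zs mu_ uv' hp hn)|exact: (rep_F_lim fi f2 z0 zp zn zs mu_ uv' hp hn)].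
Qed.

Lemma profile_measurable f z : cint 0 1 f -> (forall t, ~~ ((0 < t) && (t < 1)) -> z t = 0) ->
  atoms z [set` `]0, 1[] \is a fin_num -> atoms (fun t => - z t) [set` `]0, 1[] \is a fin_num ->
  measurable_fun (`]0, 1[ : set R) (profile_of f z).
Proof.
move=> fi z0 zp zn.
have ma w : (forall t, ~~ ((0 < t) && (t < 1)) -> w t = 0) -> atoms w [set` `]0, 1[] \is a fin_num ->
    measurable_fun (`]0, 1[ : set R) (fun x => fine (atoms w [set` `]0, x]])).
  move=> w0 wf; apply: nondecreasing_measurable => // x y xy.
  have mI t : measurable ([set` `]0, t]] : set (measurableTypeR R)) by exact: measurable_itv.
  have m01 : measurable ([set` `]0, 1[] : set (measurableTypeR R)) by exact: measurable_itv.
  have fin t : atoms w [set` `]0, t]] \is a fin_num.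
    rewrite (atoms_01 _ w0) ge0_fin_numE ?measure_ge0//.
    apply: (@le_lt_trans _ _ (atoms w [set` `]0, 1[])); last by rewrite -ge0_fin_numE ?measure_ge0.
    by apply: le_measure; [apply: mem_set; exact: measurableI|exact: mem_set|].
  rewrite -lee_fin !fineK//; apply: le_measure; [exact: mem_set|exact: mem_set|].
  by move=> t /=; rewrite !in_itv/= => /andP[-> /le_trans->].
have mc : measurable_fun (`]0, 1[ : set R) (oint f 0).
  have pr : prim 0 1 (oint f 0) f by rewrite (_ : oint f 0 = fun x => 0 + oint f 0 x); [exact: oint_prim|apply/funext => x; rewrite add0r].
  have := L2_cont (prim_cont fi pr); by case.
apply: measurable_funD => //; apply: measurable_funB; apply: ma => //.
by move=> t /z0 ->; rewrite oppr0.
Qed.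

(** The rates [2^-i] turn convergence in measure into convergence almost everywhere, by
    Borel-Cantelli. One point [x0] where both the functions and their shifted copies converge
    determines the limit of the constants, hence [u] up to null sets. *)
Lemma F_lim_le (s : nat -> R) (v : nat -> R -> R) u l : (forall i, 0 < s i) -> (forall i, s i <= 2^-1 ^+ i) ->
  measurable_fun (`]0, 1[ : set R) u -> (forall i, (F_eps k (s i ^+ 2) (v i) <= l%:E)%E) ->
  (forall i, (mu (`]0%R, 1%R[ `&` [set x | (2^-1 ^+ i < `|v i x - u x|)%R]) <= (2^-1 ^+ i)%:E)%E) ->
  (F_lim k u <= l%:E)%E.
Proof.
move=> s0 s2 mu_ Fl vu.
have s1 i : s i <= 1 by apply: (le_trans (s2 i)); rewrite exprn_ile1// invf_le1// ler1n.
pose C := Num.max 1 l; have C1 : 1 <= C by rewrite le_max lexx.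
have lC : l <= C by rewrite le_max lexx orbT.
have [K hK] := bounded_rep n C1.
have /choice[w /choice[c hw]] : forall i, exists w : nat -> R -> R, exists c, [/\ rep 0 1 k w, measurable_fun (`]0, 1[ : set R) (v i),
    aeq 0 1 (v i) (w 0%N), F_eps k (s i ^+ 2) (v i) = (total_energy n w (s i))%:E &
    exists B : set R, [/\ measurable B, (mu B <= (2 * C * s i ^+ 2)%:E)%E &
     forall x, 0 <= x -> x <= 1 -> ~ B x -> `|w 0%N x + c| <= K]].
  by move=> i; apply: (hK (s i) (v i)) => //; apply: le_trans (Fl i) _; rewrite lee_fin.
have rw i : rep 0 1 k (w i) by case: (hw i).
have mv i : measurable_fun (`]0, 1[ : set R) (v i) by case: (hw i).
have te i : total_energy n (w i) (s i) <= l by have := Fl i; case: (hw i) => _ _ _ -> _; rewrite lee_fin.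
have teC i : total_energy n (w i) (s i) <= C by exact: le_trans (te i) lC.
have cK i : exists B : set R, [/\ measurable B, (mu B <= (2 * C * s i ^+ 2)%:E)%E &
     forall x, 0 <= x -> x <= 1 -> ~ B x -> `|w i 0%N x + c i| <= K] by case: (hw i).
have [f [z [d [phi [[fi f2] [z0 [zp zn]] [zs zl] hphi lim]]]]] := limit_profile C1 s0 s1 s2 rw teC cK.
have aev : {ae mu, forall x, forall i, x \in `]0, 1[ -> v i x = w i 0%N x}.
  by apply: ae_foralln => i; case: (hw i).
pose B i := `]0, 1[ `&` [set x | 2^-1 ^+ i < `|v i x - u x|].
have mB i : measurable (B i).
  have H : measurable_fun (`]0, 1[ : set R) (fun x => 2^-1 ^+ i < `|v i x - u x|).
    by apply: measurable_fun_ltr => //; apply: measurableT_comp => //; exact: measurable_funB.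
  exact: (H (measurable_itv _) [set true] I).
have evg : {ae mu, forall x, exists N, forall i, (N <= i)%N -> ~ B i x}.
  by apply: (@eventually_good _ _ 1) => // i; rewrite mul1r; exact: vu.
have evu x : x \in `]0, 1[ -> (exists N, forall i, (N <= i)%N -> ~ B i x) -> (fun i => v (phi i) x) @ \oo --> u x.
  move=> x01 [N hN]; apply/cvgrPdist_le => e e0.
  have /cvgrPdist_le/(_ e e0) : (fun m => 2^-1 ^+ m : R) @ \oo --> (0 : R) by exact: cvg_half.
  move=> [M _ hM]; exists (maxn N M) => // i /=; rewrite geq_max => /andP[Ni Mi].
  have ip := homo_ge_id hphi i.
  have : ~ B (phi i) x by apply: hN; exact: leq_trans Ni ip.
  move=> nB; have : `|v (phi i) x - u x| <= 2^-1 ^+ phi i by rewrite leNgt; apply/negP => h; apply: nB; split.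
  rewrite distrC => /le_trans; apply.
  by have := hM (phi i) (leq_trans Mi ip); rewrite sub0r normrN ger0_norm ?exprn_ge0 ?invr_ge0.
have H := aeS2 (fun x (a : _ -> _) b => conj a b) lim (aeS2 (fun x (a : _ ) (b : _) => conj a b) aev evg).
have [x0 x001 [l0 [v0 e0]]] := ae_exists ltr01 H.
have cc : (fun i => c (phi i)) @ \oo --> d + profile_of f z x0 - u x0.
  rewrite (_ : (fun i => c (phi i)) = (fun i => w (phi i) 0%N x0 + c (phi i) - v (phi i) x0)).
    exact: cvgB (l0 x001) (evu x0 x001 e0).
  by apply/funext => i; rewrite v0// addrC addKr.
have ua : aeq 0 1 u (fun x => (d - (d + profile_of f z x0 - u x0)) + profile_of f z x).
  apply: aeS H => x [lx [vx ex]] x01.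
  have h1 := cvgB (lx x01) cc.
  have h2 : (fun i => v (phi i) x) @ \oo --> d + profile_of f z x - (d + profile_of f z x0 - u x0).
    rewrite (_ : (fun i => v (phi i) x) = (fun i => w (phi i) 0%N x + c (phi i) - c (phi i))); first exact: h1.
    by apply/funext => i; rewrite vx// addrK.
  have := cvg_unique _ (evu x x01 ex) h2 => /(_ (@norm_hausdorff _ _)) ->; ring.
have [_ ->] := profile_SBV2 fi f2 z0 zp zn zs mu_ ua.
exact: zl.
Qed.

End Profiles.

(** * The lower bound for arbitrary sequences and compactness *)

Section Gamma_liminf.
Context {R : realType} (n : nat).
Implicit Types (c d e l t x y C K : R) (f z u : R -> R) (v : nat -> R -> R) (eps : nat -> R).
Let k := n.+2.

Lemma ereal_between (x y : \bar R) : (x < y)%E -> exists l, (x < l%:E)%E /\ (l%:E < y)%E.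
Proof.
case: x => [r| |]; case: y => [r'| |] //.
- by rewrite lte_fin => h; exists ((r + r') / 2); rewrite !lte_fin; split; lra.
- by move=> _; exists (r + 1); rewrite lte_fin ltry; split => //; lra.
- by move=> _; exists (r' - 1); rewrite lte_fin ltNyr; split => //; lra.
- by move=> _; exists 0; rewrite ltNyr ltry.
Qed.

Lemma near_small (eps : nat -> R) m : eps @ \oo --> (0 : R) -> \forall i \near \oo, Num.sqrt (eps i) <= 2^-1 ^+ m.
Proof.
move=> h; have p0 : 0 < (2^-1 ^+ m) ^+ 2 :> R by rewrite !exprn_gt0// invr_gt0.
have FF : Filter \oo by exact: _.
have := cvg_close (FF := FF) h p0; apply: filterS => i [_]; rewrite add0r => hi.
have q0 : 0 <= 2^-1 ^+ m :> R by rewrite exprn_ge0// invr_ge0.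
by rewrite -(ger0_norm q0) -sqrtr_sqr ler_wsqrtr// ltW.
Qed.

(** Only [N <= psi N] is asked, because the indices picked below a level of the inferior limit need
    not increase. *)
Lemma cvg_subseq (T : topologicalType) (a : nat -> T) (psi : nat -> nat) (l : T) : (forall N, (N <= psi N)%N) ->
  a @ \oo --> l -> (a \o psi) @ \oo --> l.
Proof.
move=> hp al V Vl; have [N _ hN] := al V Vl; exists N => // i /= Ni; apply: hN => /=.
exact: leq_trans Ni (hp i).
Qed.

(* The additive constants of the compactness theorem converge, because the sequence
   itself converges at almost every point along a subsequence. *)
Theorem liminf_measure eps u v : (forall i, 0 < eps i) -> eps @ \oo --> (0 : R) ->
  measurable_fun (`]0, 1[ : set R) u -> cvg_in_measure v u ->
  (F_lim k u <= limn_einf (fun i => F_eps k (eps i) (v i)))%E.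
Proof.
(* A real level [l] strictly between the two sides is exceeded from below by arbitrarily late
   energies, and [F_lim_le] along these indices contradicts the choice of [l]. *)
move=> e0 ec mu_ vu; rewrite leNgt; apply/negP => /ereal_between[l [h1 h2]].
pose F i := F_eps k (eps i) (v i).
have /choice[psi hpsi] : forall N : nat, exists j : nat, (N <= j)%N /\ (F j <= l%:E)%E.
  move=> N; have h3 : (einfs F N < l%:E)%E.
    apply: le_lt_trans h1; rewrite limn_einf_lim.
    rewrite (cvg_lim _ (@cvg_einfs_sup _ _))//; apply: ereal_sup_ubound; by exists N.
  have [_ [j /= Nj <-] hj] := ereal_inf_lt h3.
  by exists j; split => //; exact: ltW.
pose s' i := Num.sqrt (eps (psi i)).
pose P m := [set i : nat | s' i <= 2^-1 ^+ m /\ (mu (`]0%R, 1%R[ `&` [set x | (2^-1 ^+ m < `|v (psi i) x - u x|)%R]) <= (2^-1 ^+ m)%:E)%E].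
have ep : (eps \o psi) @ \oo --> (0 : R) by apply: cvg_subseq => // N; case: (hpsi N).
have PP m : \oo (P m).
  have p0 : 0 < 2^-1 ^+ m :> R by rewrite exprn_gt0// invr_gt0.
  have n1 := near_small m ep.
  have := cvg_subseq (fun N => (hpsi N).1) (vu _ p0) => /fine_cvgP[fin cf].
  have FF : Filter \oo by exact: _.
  have n2 := cvg_close (FF := FF) cf p0.
  apply: filterS (filterI n1 (filterI fin n2)) => i [a1 [a2 [_ a3]]]; split => //.
  by rewrite /= add0r in a2 a3; rewrite -(fineK a2) lee_fin ltW.
have [phi [hphi hP]] := extract (_ : ProperFilter \oo) (fun N => nbhs_infty_ge N) PP.
suff : (F_lim k u <= l%:E)%E by move=> /(lt_le_trans h2); rewrite ltxx.
apply: (@F_lim_le _ n (fun i => s' (phi i)) (fun i => v (psi (phi i)))) => //.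
- by move=> i; rewrite sqrtr_gt0.
- by move=> i; have [] := hP i.
- move=> i; have [_ h] := hpsi (phi i).
  by rewrite (_ : s' (phi i) ^+ 2 = eps (psi (phi i))) ?h// /s' sqr_sqrtr// ltW.
- by move=> i; have [] := hP i.
Qed.

(** The Markov inequality. *)
Lemma L1_measure u v : L1 0 1 u -> (forall i, L1 0 1 (v i)) -> cvg_in_L1 v u -> cvg_in_measure v u.
Proof.
move=> iu iv vu d d0.
have mk i : (d%:E * mu (`]0%R, 1%R[ `&` [set x | (d < `|v i x - u x|)%R]) <= \int[mu]_(x in `]0%R, 1%R[) (`|v i x - u x|)%:E)%E.
  have m1 : measurable_fun (`]0, 1[ : set R) (EFin \o (fun x => v i x - u x)).
    apply/measurable_EFinP; apply: measurable_funB; apply: cint_moo; apply/cint_oo; [exact: iv|exact: iu].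
  have mA : measurable (`]0%R, 1%R[ `&` [set x | (d < `|v i x - u x|)%R]).
    have H : measurable_fun (`]0, 1[ : set R) (fun x => d < `|v i x - u x|).
      by apply: measurable_fun_ltr => //; apply: measurableT_comp => //; exact/measurable_EFinP.
    exact: (H (measurable_itv _) [set true] I).
  rewrite -integral_cst//.
  apply: (@le_trans _ _ (\int[mu]_(x in `]0%R, 1%R[ `&` [set x | (d < `|v i x - u x|)%R]) (`|v i x - u x|)%:E)%E).
    apply: ge0_le_integral => //.
    - by move=> x _; rewrite lee_fin ltW.
    - apply/measurable_EFinP; apply: measurableT_comp => //.
      by apply: (@measurable_funS _ _ _ _ (`]0, 1[ : set R)) => //; exact/measurable_EFinP.
    - by move=> x [_ /= h]; rewrite lee_fin ltW.
  apply: ge0_subset_integral => //.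
  by apply/measurable_EFinP; apply: measurableT_comp => //; exact/measurable_EFinP.
apply: (squeeze_cvge (f := fun=> 0%E) (h := fun i => (d^-1)%:E * \int[mu]_(x in `]0%R, 1%R[) (`|v i x - u x|)%:E)%E).
- apply: nearW => i; rewrite measure_ge0/=.
  have := lee_wpmul2l (_ : 0 <= (d^-1)%:E)%E (mk i); rewrite lee_fin invr_ge0 ltW// => /(_ isT).
  by rewrite muleA -EFinM mulVf ?gt_eqF// mul1e.
- exact: cvg_cst.
- by rewrite -[X in _ --> X](mule0 (d^-1)%:E); apply: cvgeZl.
Qed.

Lemma ae_measure v u : (forall i, measurable_fun (`]0, 1[ : set R) (v i)) -> measurable_fun (`]0, 1[ : set R) u ->
  {ae mu, forall x, x \in `]0, 1[ -> (fun i => v i x) @ \oo --> u x} -> cvg_in_measure v u.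
Proof.
move=> mv mu_ vu d d0.
pose A i : set R := `]0, 1[ `&` [set x | d < `|v i x - u x|].
have mA i : measurable (A i).
  have H : measurable_fun (`]0, 1[ : set R) (fun x => d < `|v i x - u x|).
    by apply: measurable_fun_ltr => //; apply: measurableT_comp => //; exact: measurable_funB.
  exact: (H (measurable_itv _) [set true] I).
pose F N := \bigcup_(i in [set i | (N <= i)%N]) A i.
have mF N : measurable (F N) by apply: bigcup_measurable => i _.
have mcap : measurable (\bigcap_N F N) by apply: bigcap_measurable => // N _.
have F1 N : F N `<=` `]0, 1[ by move=> x [i _ []].
have FI : (mu (F 0%N) < +oo)%E.
  apply: (@le_lt_trans _ _ (mu (`]0, 1[ : set R))); first by apply: le_measure; [exact: mem_set (mF 0%N)|apply: mem_set; exact: measurable_itv|exact: F1].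
  by rewrite lebesgue_measure_itv/= lte_fin ltr01 -EFinB ltry.
have Fd : {homo F : n m / (n <= m)%N >-> (m <= n)%O}.
  by move=> N M NM; apply/subsetPset => x [i /= Mi Ai]; exists i => //=; exact: leq_trans Mi.
have cap0 : mu (\bigcap_N F N) = 0%E.
  apply: measure_negligible => //.
  have : {ae mu, forall x, ~ (\bigcap_N F N) x}.
    apply: aeS vu => x hx hF; have x01 : x \in `]0, 1[ by exact: F1 (hF 0%N I).
    have /cvgrPdist_le/(_ d d0)[N _ hN] := hx x01.
    have [i /= Ni [_ /=]] := hF N I; rewrite ltNge => /negP; apply.
    by rewrite distrC; exact: hN.
  by move=> [N [mN N0 sN]]; exists N; split => // x hx; apply: sN => /=; apply.
have Fc : mu \o F @ \oo --> 0%E by rewrite -cap0; exact: (nonincreasing_cvg_mu FI mF mcap Fd).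
apply: (squeeze_cvge (f := fun=> 0%E) (h := mu \o F)) => //; last exact: cvg_cst.
apply: nearW => i; rewrite measure_ge0/=; apply: le_measure; [exact: mem_set (mA i)|exact: mem_set (mF i)|].
by move=> x Ax; exists i => /=.
Qed.

Theorem F_eps_equicoercive : equicoercive (@F_eps R k).
Proof.
move=> u hsup.
have [C [C1 hC]] : exists C : R, 1 <= C /\ forall e, 0 < e -> (F_eps k e (u e) <= C%:E)%E.
  move: hsup; set S := ereal_sup _ => Soo.
  have hS e : 0 < e -> (F_eps k e (u e) <= S)%E by move=> e0; apply: ereal_sup_ubound; exists e.
  case: S Soo hS => [r _ hS|//|_ hS].
    by exists (Num.max 1 r); rewrite le_max lexx; split => // e /hS/le_trans; apply; rewrite lee_fin le_max lexx orbT.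
  by exists 1; split => // e /hS/le_trans; apply; rewrite leNye.
have [K hK] := bounded_rep n C1.
(* The constants must depend on [eps] alone, so they are fixed before any sequence is given; outside
   []0, 1]] their choice is arbitrary, because the extracted subsequence stays inside. *)
have /choice[w /choice[c hw]] : forall e, exists w : nat -> R -> R, exists c, 0 < e -> e <= 1 ->
   [/\ rep 0 1 k w, measurable_fun (`]0, 1[ : set R) (u e),
    aeq 0 1 (u e) (w 0%N), F_eps k e (u e) = (total_energy n w (Num.sqrt e))%:E &
    exists B : set R, [/\ measurable B, (mu B <= (2 * C * Num.sqrt e ^+ 2)%:E)%E &
     forall x, 0 <= x -> x <= 1 -> ~ B x -> `|w 0%N x + c| <= K]].
  move=> e; have [/andP[e0 e1]|h] := boolP ((0 < e) && (e <= 1)); last first.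
    by exists (fun _ _ => 0), 0 => e0 e1; move: h; rewrite e0 e1.
  have q0 : 0 < Num.sqrt e by rewrite sqrtr_gt0.
  have q1 : Num.sqrt e <= 1 by rewrite -sqrtr1 ler_wsqrtr.
  have qE : Num.sqrt e ^+ 2 = e by rewrite sqr_sqrtr// ltW.
  have [|w [c]] := hK _ (u e) q0 q1; first by rewrite qE; exact: hC.
  by rewrite qE => h; exists w, c.
exists c => eps e0 ec.
have PP m := near_small m ec.
have [psi [hpsi hP]] := extract (_ : ProperFilter \oo) (fun N => nbhs_infty_ge N) PP.
pose s i := Num.sqrt (eps (psi i)).
have s0 i : 0 < s i by rewrite sqrtr_gt0.
have s2 i : s i <= 2^-1 ^+ i by exact: hP.
have s1 i : s i <= 1 by apply: (le_trans (s2 i)); rewrite exprn_ile1// invf_le1// ler1n.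
have e1 i : eps (psi i) <= 1.
  by rewrite -(sqr_sqrtr (ltW (e0 (psi i)))) exprn_ile1 ?sqrtr_ge0//; exact: s1.
have hwi i := hw _ (e0 (psi i)) (e1 i).
have rw i : rep 0 1 k (w (eps (psi i))) by case: (hwi i).
have te i : total_energy n (w (eps (psi i))) (s i) <= C.
  by have := hC _ (e0 (psi i)); case: (hwi i) => _ _ _ -> _; rewrite lee_fin.
have cK i : exists B : set R, [/\ measurable B, (mu B <= (2 * C * s i ^+ 2)%:E)%E &
     forall x, 0 <= x -> x <= 1 -> ~ B x -> `|w (eps (psi i)) 0%N x + c (eps (psi i))| <= K] by case: (hwi i).
have [f [z [d [phi [[fi f2] [z0 [zp zn]] [zs _] hphi lim]]]]] :=
  limit_profile (w := fun i => w (eps (psi i))) (c := fun i => c (eps (psi i))) C1 s0 s1 s2 rw te cK.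
exists (psi \o phi); split; first by move=> i j ij; apply: hpsi; exact: hphi.
exists (fun x => d + profile_of f z x).
have mp : measurable_fun (`]0, 1[ : set R) (fun x => d + profile_of f z x).
  by apply: measurable_funD => //; exact: profile_measurable.
split; first by have [] := profile_SBV2 fi f2 z0 zp zn zs mp (aeq_refl _ _ _).
have mv i : measurable_fun (`]0, 1[ : set R) (u (eps (psi i))) by case: (hwi i).
have aev : {ae mu, forall x, forall i, x \in `]0, 1[ -> u (eps (psi i)) x = w (eps (psi i)) 0%N x}.
  by apply: ae_foralln => i; case: (hwi i).
apply: ae_measure => //; first by move=> i; apply: measurable_funD; [exact: (mv (phi i))|exact: measurable_cst].
apply: aeS2 lim aev => x hx vx x01.
rewrite (_ : (fun i => _) = (fun i => w (eps (psi (phi i))) 0%N x + c (eps (psi (phi i))))); first exact: hx.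
by apply/funext => i; rewrite /= vx.
Qed.

End Gamma_liminf.


(** * Density of smooth functions *)

Section Density.
Context {R : realType}.
Implicit Types (a b c d e h r s t x y M : R) (f g H G : R -> R).

Lemma oint_cvg0 (f : nat -> R -> R) g : (forall n, measurable_fun (`[0, 1] : set R) (f n)) -> cint 0 1 g ->
  (forall n x, 0 <= x -> x <= 1 -> `|f n x| <= g x) ->
  {ae mu, forall x, x \in `]0, 1[ -> (fun n => f n x) @ \oo --> (0 : R)} ->
  (fun n => oint (f n) 0 1) @ \oo --> (0 : R).
Proof.
move=> mf gi fg f0.
have fi n : cint 0 1 (f n).
  apply: (@cint_le _ _ _ _ g) => // x x0 x1; apply: (le_trans (fg n x x0 x1)); exact: ler_norm.
have m01 : measurable (`]0, 1[ : set (measurableTypeR R)) by exact: measurable_itv.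
have d1 n : measurable_fun (`]0, 1[ : set R) (EFin \o f n).
  by apply/measurable_EFinP; exact: cint_moo (fi n).
have d2 : {ae mu, forall x, [set` `]0%R, 1%R[] x -> (EFin \o f n) x @[n --> \oo] --> cst 0%E x}.
  by apply: aeS f0 => x h x01; apply: cvg_EFin; [exact: nearW|exact: h].
have d3 : mu.-integrable `]0, 1[ (EFin \o g) by apply/cint_oo.
have d4 : {ae mu, forall x, forall n, [set` `]0%R, 1%R[] x -> (`|(EFin \o f n) x| <= (EFin \o g) x)%E}.
  apply: aeW => x n; rewrite /= in_itv/= => /andP[x0 x1].
  by rewrite lee_fin fg ?ltW.
have [_ _] := dominated_convergence m01 d1 (@measurable_cst _ _ _ _ _ _) d2 d3 d4.
rewrite integral0 => /fine_cvgP[_]; apply: cvg_trans; apply: near_eq_cvg; apply: nearW => n /=.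
by rewrite oint_oo.
Qed.

Let clamp_dist a c : 0 <= c -> `|Num.max (- c) (Num.min a c) - a| <= `|a|.
Proof.
move=> c0; have a1 := ler_norm a; have a2 := ler_norm (- a); rewrite normrN in a2.
case: (leP a c) => h1.
  case: (leP (- c) a) => h2; first by rewrite subrr normr0.
  by rewrite ger0_norm; lra.
by rewrite max_r; [rewrite ler0_norm; lra|lra].
Qed.

Lemma truncation g e : cint 0 1 g -> cint 0 1 (fun x => g x ^+ 2) -> 0 < e ->
  exists M (h : R -> R), [/\ 0 <= M, measurable_fun setT h, forall x, `|h x| <= M & oint (fun x => (h x - g x) ^+ 2) 0 1 <= e].
Proof.
move=> gi g2 e0; pose g' := g \_ `[0, 1].
have mg' : measurable_fun setT g' by have /integrableP[/measurable_EFinP] := restr_int gi.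
pose h (n : nat) x := Num.max (- n%:R) (Num.min (g' x) n%:R).
have mh n : measurable_fun setT (h n).
  by apply: measurable_maxr => //; exact: measurable_minr.
have hb n x : `|h n x| <= n%:R.
  by rewrite ler_norml /h le_max lexx/= ge_max ge_min lexx orbT andbT ge0_cp.
have g'E x : 0 <= x -> x <= 1 -> g' x = g x.
  by move=> x0 x1; rewrite /g' patchE mem_set//= in_itv/= x0.
have hg n x : 0 <= x -> x <= 1 -> `|h n x - g x| <= `|g x|.
  by move=> x0 x1; rewrite /h g'E//; exact: clamp_dist.
have cv := @oint_cvg0 (fun n x => (h n x - g x) ^+ 2) (fun x => g x ^+ 2) _ g2 _ _.
have {cv} cv : (fun n => oint (fun x => (h n x - g x) ^+ 2) 0 1) @ \oo --> (0 : R).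
  apply: cv => [n|n x x0 x1|].
  - by apply: measurable_funX; apply: measurable_funB; [exact: measurable_funS (mh n)|exact: cint_meas].
  - by rewrite normrX -(real_normK (num_real (g x))) lerXn2r ?nnegrE ?hg.
  - apply: aeW => x; rewrite in_itv/= => /andP[x0 x1]; apply: cvg_near_cst.
    exists (Num.truncn `|g x|).+1 => // n /= hn.
    have gn : `|g x| <= n%:R by apply: (le_trans (ltW (truncnS_gt _))); rewrite ler_nat.
    rewrite /h g'E ?ltW//; move: gn; rewrite ler_norml => /andP[h1 h2].
    by rewrite (min_l h2) (max_r h1) subrr expr0n.
have FF : Filter \oo by exact: _.
have [n [_]] := @filter_ex _ \oo _ _ (cvg_close (FF := FF) cv e0).
by rewrite add0r => hn; exists n%:R, (h n); split => //; exact: ltW.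
Qed.

(** * Steklov averages *)

Section Average.
Variables (h : R -> R) (M : R).
Hypotheses (mh : measurable_fun setT h) (hM : forall x, `|h x| <= M).

Let M0 : 0 <= M. Proof. exact: le_trans (normr_ge0 _) (hM 0). Qed.

Let hi a b : cint a b h.
Proof. by apply: (@cint_bounded _ _ _ _ M) => //; exact: measurable_funS mh. Qed.

(** Starting at -1 leaves room for differentiating on a neighbourhood of [[0, 1]]. *)
Let F x := oint h (- 1) x.

Let bound x y : x <= y -> `|oint h x y| <= M * (y - x).
Proof.
move=> xy; apply: (le_trans (norm_oint (lexx x) (lexx y) (hi x y))).
rewrite -oint_cst//; apply: (@le_oint _ x y) => //; [exact: cint_norm|exact: cint_cst].
Qed.

Let F_lip x y : x <= y -> `|F y - F x| <= M * (y - x).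
Proof.
move=> xy; have F0 t : t <= -1 -> F t = 0.
  by move=> t1; rewrite /F /oint set_itv_ge ?bnd_simp -?leNgt// Rintegral_set0.
have [x1|x1] := leP x (-1); last first.
  by rewrite /F (oint_cat (hi (-1) y) (lexx _) (ltW x1) xy (lexx _)) addrAC subrr add0r bound.
rewrite (F0 x x1) subr0; have [y1|y1] := leP y (-1).
  by rewrite F0// normr0 mulr_ge0 ?subr_ge0.
by apply: (le_trans (bound (ltW y1))); apply: ler_wpM2l => //; rewrite lerD2l lerN2.
Qed.

Let F_lip' x y : `|F y - F x| <= M * `|y - x|.
Proof.
have [xy|yx] := leP x y; first by rewrite [X in M * X]ger0_norm ?subr_ge0// F_lip.
by rewrite distrC [X in M * X]distrC [X in M * X]gtr0_norm ?subr_gt0// F_lip// ltW.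
Qed.

Lemma F_continuous : continuous F.
Proof.
move=> x; apply/cvgrPdist_le => e e0; near=> y.
apply: (le_trans (F_lip' _ _)).
apply: (@le_trans _ _ ((M + 1) * `|x - y|)); first by apply: ler_wpM2r => //; rewrite lerDl.
rewrite mulrC -ler_pdivlMr ?ltr_wpDl//.
near: y; apply/nbhs_ballP; exists (e / (M + 1)) => /=; first by rewrite divr_gt0// ltr_wpDl.
by move=> z; rewrite /ball/= => /ltW.
Unshelve. all: by end_near.
Qed.

(** The Steklov average over [[x, x + 1 / (n + 1)]] when [x >= -1]. One averaging makes a bounded
    function continuous, and a second one makes it continuously differentiable near [[0, 1]]. *)
Definition average (n : nat) x := n.+1%:R * (F (x + n.+1%:R^-1) - F x).

Lemma average_continuous n : continuous (average n).
Proof.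
move=> x; apply: cvgM; first exact: cvg_cst.
apply: cvgB; last exact: F_continuous.
apply: (@continuous_comp _ _ _ (fun x => x + n.+1%:R^-1) F); last exact: F_continuous.
by apply: cvgD; [exact: cvg_id|exact: cvg_cst].
Qed.

Lemma average_bounded n x : `|average n x| <= M.
Proof.
rewrite /average normrM ger0_norm//; apply: (@le_trans _ _ (n.+1%:R * (M * n.+1%:R^-1))).
  apply: ler_wpM2l => //; apply: (le_trans (F_lip' _ _)).
  by rewrite [x + _]addrC addrK ger0_norm ?invr_ge0.
by rewrite mulrCA divff ?mulr1// pnatr_eq0.
Qed.

Lemma average_cvg : (fun n => oint (fun x => (average n x - h x) ^+ 2) 0 1) @ \oo --> (0 : R).
Proof.
apply: (@oint_cvg0 _ (fun=> (M + M) ^+ 2)); first last.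
- have := oint_derive (hi (-1) 3); apply: aeS => x hx x01.
  rewrite -[X in _ --> X](expr0n _ 2); apply: cvg_exp.
  apply/cvgrPdist_le => e e0; rewrite in_itv/= in x01; have /andP[x0 x1] := x01.
  have [|d d0 hd] := hx _ e e0; first by rewrite in_itv/=; apply/andP; split; lra.
  exists (Num.truncn d^-1) => // n /= hn.
  have nd : n.+1%:R^-1 < d.
    by rewrite invf_plt ?posrE//; apply: (lt_le_trans (truncnS_gt _)); rewrite ler_nat ltnS.
  have ni : 0 < n.+1%:R^-1 :> R by rewrite invr_gt0.
  have [|+ _] := hd (x + n.+1%:R^-1); first by rewrite [x + _]addrC addrK gtr0_norm.
  move=> /(_ _); rewrite lerDl ltW// => /(_ isT).
  have x_1 : -1 <= x by lra.
  have e1 : oint h x (x + n.+1%:R^-1) = F (x + n.+1%:R^-1) - F x.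
    by rewrite /F (oint_cat (hi (-1) (x + n.+1%:R^-1)) (lexx _) x_1 _ (lexx _)) ?lerDl ?ltW// addrAC subrr add0r.
  rewrite e1 [x + _ - x]addrAC subrr add0r sub0r normrN => h1.
  have -> : average n x - h x = n.+1%:R * (F (x + n.+1%:R^-1) - F x - h x / n.+1%:R).
    by rewrite /average [RHS]mulrBr [X in _ = _ - X]mulrCA divff ?mulr1// pnatr_eq0.
  by rewrite normrM gtr0_norm// mulrC -ler_pdivlMr.
- move=> n x _ _; rewrite normrX; apply: lerXn2r; rewrite ?nnegrE ?addr_ge0//.
  by apply: (le_trans (ler_normB _ _)); rewrite lerD ?average_bounded.
- exact: cint_cst.
- move=> n; apply: measurable_funX; apply: measurable_funB; last exact: measurable_funS mh.
  have H := continuous_measurable_fun (@average_continuous n). exact: measurable_funTS H.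
Qed.

Lemma average_prim n : continuous h ->
  prim 0 1 (average n) (fun x => n.+1%:R * (h (x + n.+1%:R^-1) - h x)).
Proof.
move=> ch; set D := (fun x => _).
have cD : continuous D.
  move=> x; apply: cvgM; first exact: cvg_cst.
  apply: cvgB; last exact: ch.
  apply: (@continuous_comp _ _ _ (fun x => x + n.+1%:R^-1) h); last exact: ch.
  by apply: cvgD; [exact: cvg_id|exact: cvg_cst].
have dF x : -1 < x -> is_derive x 1 F (h x).
  move=> x1; have x2 : x < x + 1 by rewrite ltrDl.
  have ib : mu.-integrable [set` Interval (BRight (-1 : R)) (BRight (x + 1))] (EFin \o h).
    exact: cint_oc (hi (-1) (x + 1)) (lexx _) (lexx _).
  have [|d1 d2] := continuous_FTC1 x2 ib _ (ch x); first exact: x1.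
  have {}d1 : derivable F x 1 := d1; have {}d2 : derive1 F x = h x := d2.
  by rewrite derive1E in d2; exact: DeriveDef d1 d2.
have dA x : -1 < x -> is_derive x 1 (average n) (D x).
  move=> x1; have ni : 0 < n.+1%:R^-1 :> R by rewrite invr_gt0.
  have xn : -1 < x + n.+1%:R^-1 by rewrite (lt_trans x1)// ltrDl.
  have i1 := dF x x1; have i2 := dF _ xn.
  have i3 : is_derive x 1 (fun y => F (y + n.+1%:R^-1)) (h (x + n.+1%:R^-1)).
    have := @is_derive1_comp R F (shift n.+1%:R^-1) x _ _ i2 (is_derive_shift x 1 _).
    rewrite mulr1; exact.
  have i4 := is_deriveB i3 i1.
  exact: (@is_deriveZ _ _ _ _ n.+1%:R _ _ _ i4).
move=> x y x0 xy y1; case: (ltgtP x y) xy => // [xy _|-> _]; last by rewrite subrr oint_nil.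
have := @continuous_FTC2 R D (average n) x y xy.
rewrite /oint Rintegral_itv_obnd_cbnd; last first.
  apply: (@cint_oc _ x y) => //; apply: continuous_compact_integrable; first exact: segment_compact.
  exact: continuous_subspaceT.
rewrite /Rintegral => ->; [by []|exact: continuous_subspaceT| |].
- split => [z zxy| |].
  + move: zxy; rewrite in_itv/= => /andP[zx _]; have z1 : -1 < z by lra.
    by have [] := dA z z1.
  + by apply: cvg_at_right_filter; exact: average_continuous.
  + by apply: cvg_at_left_filter; exact: average_continuous.
- move=> z; rewrite in_itv/= => /andP[zx _]; rewrite derive1E.
  have z1 : -1 < z by lra.
  by have [_ ->] := dA z z1.
Qed.

End Average.

Let sq2 (a b : R) : (a + b) ^+ 2 <= 2 * a ^+ 2 + 2 * b ^+ 2.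
Proof.
rewrite -subr_ge0 (_ : _ - _ = (a - b) ^+ 2); [exact: sqr_ge0|ring].
Qed.

Lemma sq_intB f g : cint 0 1 f -> cint 0 1 g -> cint 0 1 (fun x => f x ^+ 2) -> cint 0 1 (fun x => g x ^+ 2) ->
  cint 0 1 (fun x => (f x - g x) ^+ 2).
Proof.
move=> fi gi f2 g2; have mf := cint_meas fi; have mg := cint_meas gi.
have := cintD f2 (cintD g2 (cintZ (-2) (cint_mul2 mf mg f2 g2))).
by rewrite (_ : (fun _ => _) = (fun x => (f x - g x) ^+ 2))//; apply/funext => x; ring.
Qed.

Lemma oint_sq_triangle f g H e1 e2 : cint 0 1 f -> cint 0 1 g -> cint 0 1 H ->
  cint 0 1 (fun x => f x ^+ 2) -> cint 0 1 (fun x => g x ^+ 2) -> cint 0 1 (fun x => H x ^+ 2) ->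
  oint (fun x => (f x - g x) ^+ 2) 0 1 <= e1 -> oint (fun x => (g x - H x) ^+ 2) 0 1 <= e2 ->
  oint (fun x => (f x - H x) ^+ 2) 0 1 <= 2 * e1 + 2 * e2.
Proof.
move=> fi gi Hi f2 g2 H2 h1 h2.
have i1 := sq_intB fi gi f2 g2; have i2 := sq_intB gi Hi g2 H2; have i3 := sq_intB fi Hi f2 H2.
apply: (@le_trans _ _ (oint (fun x => 2 * (f x - g x) ^+ 2 + 2 * (g x - H x) ^+ 2) 0 1)).
  apply: (@le_oint _ 0 1) => //; first by apply: cintD; exact: cintZ.
  by move=> t _ _; have -> : f t - H t = (f t - g t) + (g t - H t) by [ring]; exact: sq2.
rewrite (@ointD _ 0 1)//; [|exact: cintZ|exact: cintZ].
by rewrite (@ointZ _ 0 1)// (@ointZ _ 0 1)// lerD// ler_pM2l.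
Qed.

Lemma cont_cint f : continuous f -> cint 0 1 f /\ cint 0 1 (fun x => f x ^+ 2).
Proof. by move=> cf; apply: L2_cint; apply: L2_cont; exact: continuous_subspaceT. Qed.

Let sixteenths e : 0 < e -> 2 * (e / 16) + 2 * (2 * (e / 16) + 2 * (e / 16)) <= e.
Proof. by move=> e0; lra. Qed.

Let quarters e : 2 * (e / 4) + 2 * (e / 4) = e.
Proof. by field. Qed.

(** Truncation followed by two averagings: the first gives continuity, the second a continuous
    derivative. *)
Lemma AC_dense g e : cint 0 1 g -> cint 0 1 (fun x => g x ^+ 2) -> 0 < e ->
  exists G (D : R -> R), [/\ continuous G, continuous D, prim 0 1 G D & oint (fun x => (G x - g x) ^+ 2) 0 1 <= e].
Proof.
move=> gi g2 e0; have e8 : 0 < e / 16 by rewrite divr_gt0.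
have [M [h [M0 mh hM hg]]] := truncation gi g2 e8.
have FF : Filter \oo by exact: _.
have [n [_]] := @filter_ex _ \oo _ _ (cvg_close (FF := FF) (average_cvg mh hM) e8).
rewrite add0r; set H := average h n => hn.
have cH : continuous H by exact: average_continuous.
have HM x : `|H x| <= M by exact: average_bounded.
have mH := continuous_measurable_fun cH.
have [m [_]] := @filter_ex _ \oo _ _ (cvg_close (FF := FF) (average_cvg mH HM) e8).
rewrite add0r; set G := average H m => hm.
have cG : continuous G by exact: average_continuous.
exists G, (fun x => m.+1%:R * (H (x + m.+1%:R^-1) - H x)); split => //.
- move=> x; apply: cvgM; first exact: cvg_cst.
  apply: cvgB; last exact: cH.
  apply: (@continuous_comp _ _ _ (fun x => x + m.+1%:R^-1) H); last exact: cH.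
  by apply: cvgD; [exact: cvg_id|exact: cvg_cst].
- exact: average_prim.
- have [iH H2] := cont_cint cH; have [iG G2] := cont_cint cG.
  have ih : cint 0 1 h by apply: (@cint_bounded _ _ _ _ M) => //; exact: measurable_funS mh.
  have h2 : cint 0 1 (fun x => h x ^+ 2).
    apply: (@cint_bounded _ _ _ _ (M ^+ 2)); first by apply: measurable_funX; exact: measurable_funS mh.
    by move=> x _ _; rewrite normrX lerXn2r ?nnegrE.
  have t1 := oint_sq_triangle iH ih gi H2 h2 g2 (ltW hn) hg.
  apply: (le_trans (oint_sq_triangle iG iH gi G2 H2 g2 (ltW hm) t1)); exact: sixteenths.
Qed.

(** The induction approximates the derivative of a function [G] close to [g] and integrates back: on
    an interval of length 1 the primitive is uniformly at least as close to [G] as the derivatives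
    are in L^2. *)
Theorem rep_dense j g e : cint 0 1 g -> cint 0 1 (fun x => g x ^+ 2) -> 0 < e ->
  exists w, rep 0 1 j w /\ oint (fun x => (w 0%N x - g x) ^+ 2) 0 1 <= e.
Proof.
elim: j g e => [|j IH] g e gi g2 e0.
  exists (fun=> g); split; first by split.
  by rewrite (@eq_oint _ 0 1 _ (fun=> 0)) ?oint_cst ?ler01 ?mul0r ?ltW// => t _ _; rewrite subrr expr0n.
have e4 : 0 < e / 4 by rewrite divr_gt0.
have [G [D [cG cD GD hG]]] := AC_dense gi g2 e4.
have [iG G2] := cont_cint cG; have [iD D2] := cont_cint cD.
have [w [[w1 w2 w3] hw]] := IH D (e / 4) iD D2 e4.
have iw := w2 0%N isT.
have [_ iw2] : cint 0 1 (w 0%N) /\ cint 0 1 (fun x => w 0%N x ^+ 2).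
  by apply: L2_cint; apply: (@rep_L2 _ _ _ j).
pose W l := if l is l'.+1 then w l' else fun x => G 0 + oint (w 0%N) 0 x.
have pW : prim 0 1 (W 0%N) (W 1%N) by exact: oint_prim.
have [iW W2] : cint 0 1 (W 0%N) /\ cint 0 1 (fun x => W 0%N x ^+ 2).
  by apply: L2_cint; apply: L2_cont; exact: prim_cont pW.
exists W; split; first by split => // -[|l] // lj; [exact: w1|exact: w2].
have iwD := sq_intB iw iD iw2 D2.
suff h : oint (fun x => (W 0%N x - G x) ^+ 2) 0 1 <= e / 4.
  by rewrite -(quarters e); exact: oint_sq_triangle iW iG gi W2 G2 g2 h hG.
have iWG := sq_intB iW iG W2 G2.
apply: (@le_trans _ _ (oint (fun=> e / 4) 0 1)); last by rewrite oint_cst// subr0 mulr1.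
apply: (@le_oint _ 0 1) => //; first exact: cint_cst.
move=> x /ltW x0 x1.
have -> : W 0%N x - G x = oint (fun t => w 0%N t - D t) 0 x.
  by rewrite (@ointB _ 0 1)// -(GD 0 x)// /W; ring.
apply: le_trans hw; have sub : cint 0 x (fun t => (w 0%N t - D t) ^+ 2) by exact: cintS iwD _ _.
apply: (@le_trans _ _ ((x - 0) * oint (fun t => (w 0%N t - D t) ^+ 2) 0 x)).
  by apply: oint_CS1 => //; apply: measurable_funB; apply: cint_meas; [exact: cintS iw _ _|exact: cintS iD _ _].
have p0 a b : 0 <= oint (fun t => (w 0%N t - D t) ^+ 2) a b by apply: oint_ge0 => t _ _; exact: sqr_ge0.
rewrite subr0 (oint_cat iwD (lexx 0) x0 x1 (lexx 1)); have := p0 x 1; have := p0 0 x.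
move=> q1 q2; apply: (@le_trans _ _ (1 * oint (fun t => (w 0%N t - D t) ^+ 2) 0 x)); first exact: ler_wpM2r.
by rewrite mul1r lerDl.
Qed.

End Density.


(** * Jump decomposition of SBV2 functions *)

Section Decomposition.
Context {R : realType}.
Implicit Types (a b c d e h r s t x y M : R) (f g u z : R -> R).

Lemma cumulative_cint (nu : {finite_measure set (measurableTypeR R) -> \bar R}) :
  cint 0 1 (fun x => fine (nu [set` `]0, x]])).
Proof.
have mI t : measurable ([set` `]0, t]] : set (measurableTypeR R)) by exact: measurable_itv.
apply: (@cint_bounded _ _ _ _ (fine (nu setT))).
  apply: nondecreasing_measurable => // x y xy; apply: fine_le => //.
  by move=> t /=; rewrite !in_itv/= => /andP[-> /le_trans->].
move=> x _ _; rewrite ger0_norm; last by apply: fine_ge0; exact: measure_ge0.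
exact: fine_le.
Qed.

(** Converse of [profile_SBV2]. The difference between [u] and the cumulative function of its
    derivative is orthogonal to all derivatives of test functions, hence constant. The exponent [q]
    is left free to carry the sum of powers of jumps over to [z]. *)
Lemma SBV2_profile q u : SBV2 u -> q != 0 -> exists g z c, [/\ cint 0 1 g /\ cint 0 1 (fun x => g x ^+ 2),
  forall t, ~~ ((0 < t) && (t < 1)) -> z t = 0,
  atoms z [set` `]0, 1[] \is a fin_num /\ atoms (fun t => - z t) [set` `]0, 1[] \is a fin_num,
  (\esum_(t in [set` `]0%R, 1%R[]) (`|z t| `^ q)%:E = \esum_(t in jump_set u) (`|jump u t| `^ q)%:E)%E &
  aeq 0 1 u (fun x => c + profile_of g z x)].
Proof.
move=> [u1 [nu [[nu_p [nu_n [nuE du]]] ag g2 sj nuA]]] q0.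
set g := approx_gradient u in ag g2 nuA.
have [gi g2i] := L2_cint g2.
pose z t := if t \in jump_set u then jump u t else 0.
have js : jump_set u `<=` [set` `]0, 1[] by move=> t [].
have z0 t : ~~ ((0 < t) && (t < 1)) -> z t = 0.
  move=> t01; rewrite /z; case: ifPn => // /set_mem/js; rewrite /= in_itv/= => h.
  by rewrite h in t01.
have m01 : measurable ([set` `]0, 1[] : set (measurableTypeR R)) by exact: measurable_itv.
have esumE (F : R -> R) A : F 0 = 0 ->
    (\esum_(t in A) (F (z t))%:E = \esum_(t in jump_set u `&` A) (F (jump u t))%:E)%E.
  move=> F0; rewrite esum_mkcond [RHS]esum_mkcond; apply: eq_esum => t _.
  rewrite /z; case: (boolP (t \in jump_set u)) => jt.
    by rewrite in_setI jt.
  by rewrite in_setI (negbTE jt)/= F0; case: ifP.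
have fin w : (forall t, `|w t| <= `|z t|) -> atoms w [set` `]0, 1[] \is a fin_num.
  move=> wz; rewrite ge0_fin_numE ?measure_ge0//; apply: le_lt_trans sj.
  have -> : (\esum_(x in jump_set u) `|(jump u x)%:E| = \esum_(x in [set` `]0%R, 1%R[]) (`|z x|)%:E)%E.
    by rewrite (esumE (fun x => `|x|)) ?normr0// (setIidl js).
  apply: le_esum => t _; rewrite lee_fin ge_max normr_ge0 andbT.
  exact: le_trans (ler_norm _) (wz t).
have zp := fin z (fun=> lexx _).
have zn : atoms (fun t => - z t) [set` `]0, 1[] \is a fin_num by apply: fin => t; rewrite normrN.
have [ip iN] := (cumulative_cint nu_p, cumulative_cint nu_n).
pose w x := fine (nu_p [set` `]0, x]]) - fine (nu_n [set` `]0, x]]).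
have iw : cint 0 1 w by exact: cintB.
have ui : cint 0 1 u by apply/cint_oo.
have [c hc] : exists c, {ae mu, forall x, x \in `]0, 1[ -> u x - w x = c}.
  apply: du_bois_reymond => //; first exact: cintB.
  move=> phi tphi; have [ci pp] := test_prim tphi.
  have [jp ep] := dist_deriv nu_p tphi; have [jN eN] := dist_deriv nu_n tphi.
  have cphi : {within `[0, 1], continuous (derive1 phi)} by apply: continuous_subspaceT; case: tphi.
  have i1 : mu.-integrable `]0, 1[ (EFin \o (fun x => u x * derive1 phi x)).
    by apply/cint_oo; exact: cint_cM.
  have iu : cint 0 1 (fun x => u x * derive1 phi x) by exact: cint_cM.
  have iwp : cint 0 1 (fun x => fine (nu_p [set` `]0, x]]) * derive1 phi x) by exact: cint_cM.
  have iwn : cint 0 1 (fun x => fine (nu_n [set` `]0, x]]) * derive1 phi x) by exact: cint_cM.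
  have e : (fun x => (u x - w x) * derive1 phi x) = (fun x => u x * derive1 phi x - (fine (nu_p [set` `]0, x]]) * derive1 phi x - fine (nu_n [set` `]0, x]]) * derive1 phi x)).
    by apply/funext => x; rewrite /w; ring.
  have iww := cintB iwp iwn.
  rewrite e -oint_oo; last exact: cintB.
  rewrite (@ointB _ 0 1)// (@ointB _ 0 1)// !oint_oo// du// ep eN; ring.
exists g, z, c; split => //.
- by rewrite (esumE (fun x => `|x| `^ q)) ?normr0 ?powR0// (setIidl js).
- apply: aeS hc => x hx x01; have {hx} := hx x01.
  move: (x01); rewrite in_itv/= => /andP[x0 x1].
  have mx : measurable ([set` `]0, x]] : set (measurableTypeR R)) by exact: measurable_itv.
  have sub : ([set` `]0, x]] : set (measurableTypeR R)) `<=` [set` `]0, 1[].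
    by move=> t; rewrite /= !in_itv/= => /andP[-> /le_lt_trans ->].
  have -> : w x = profile_of g z x.
    have := nuA _ mx sub; rewrite nuE// => e.
    have {e} := congr1 fine e; rewrite fineB ?finite_fin// -/(w x) => ->.
    rewrite -(esumE (fun x => Num.max x 0)) ?maxxx// -(esumE (fun x => Num.max (- x) 0)) ?oppr0 ?maxxx//.
    rewrite -[X in (_ + (X - _))%E]/(atoms z [set` `]0, x]]) -[X in (_ + (_ - X))%E]/(atoms (fun t => (- z t)%R) [set` `]0, x]]).
    have fa v : (forall t, ~~ ((0 < t) && (t < 1)) -> v t = 0) -> atoms v [set` `]0, 1[] \is a fin_num -> atoms v [set` `]0, x]] \is a fin_num.
      move=> v0 vf; rewrite ge0_fin_numE ?measure_ge0//.
      apply: (@le_lt_trans _ _ (atoms v [set` `]0, 1[])); last by rewrite -ge0_fin_numE ?measure_ge0.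
      by apply: le_measure; [exact: mem_set|exact: mem_set|].
    have f1 := fa z z0 zp.
    have f2 : atoms (fun t => - z t) [set` `]0, x]] \is a fin_num by apply: fa => // t /z0 ->; rewrite oppr0.
    have f3 : (\int[mu]_(y in [set` `]0%R, x]]) (g y)%:E)%E \is a fin_num.
      by apply: integrable_fin_num => //; apply: (cint_oc gi) => //; exact: ltW.
    have f4 : (atoms z [set` `]0%R, x]] - atoms (fun t => (- z t)%R) [set` `]0%R, x]])%E \is a fin_num by rewrite fin_numB f1.
    by rewrite (fineD f3 f4) (fineB f1 f2).
  by move=> <-; rewrite subrK.
Qed.

Lemma finite_tail (q : R -> R) e : (forall t, 0 <= q t) -> (\esum_(t in setT) (q t)%:E < +oo)%E -> 0 < e ->
  exists s : seq R, uniq s /\ (\esum_(t in ~` [set` s]) (q t)%:E <= e%:E)%E.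
Proof.
move=> q0 qfin e0; set S := (\esum_(t in setT) (q t)%:E)%E in qfin.
have Sf : S \is a fin_num by rewrite ge0_fin_numE// esum_ge0// => t _; rewrite lee_fin.
have [_ [X [fX _] <-] hX] := ub_ereal_sup_adherent e0 Sf.
have /finite_seqP[s0 sX] := fX.
exists (undup s0); split; first exact: undup_uniq.
have -> : [set` undup s0] = X by rewrite sX; apply/seteqP; split => t /=; rewrite mem_undup.
have pos (A : set R) : (0 <= \esum_(t in A) (q t)%:E)%E by apply: esum_ge0 => t _; rewrite lee_fin.
have SE : S = (\esum_(t in X) (q t)%:E + \esum_(t in ~` X) (q t)%:E)%E.
  by rewrite /S (esumID X setT) ?setTI// => t _; rewrite lee_fin.
have XE : (\esum_(t in X) (q t)%:E = \sum_(i \in X) (q i)%:E)%E.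
  by rewrite esum_fset// => t _; rewrite lee_fin.
have le1 A : (\esum_(t in A) (q t)%:E <= S)%E.
  by rewrite /S; apply: esum_sub.
have f1 : (\esum_(t in X) (q t)%:E)%E \is a fin_num by rewrite ge0_fin_numE//; exact: le_lt_trans (le1 _) qfin.
have f2 : (\esum_(t in ~` X) (q t)%:E)%E \is a fin_num by rewrite ge0_fin_numE//; exact: le_lt_trans (le1 _) qfin.
move: hX; rewrite -XE [ereal_sup _](_ : _ = S)// SE -(fineK f1) -(fineK f2) -!EFinD lte_fin lee_fin; lra.
Qed.

Lemma atoms_truncated (w q : R -> R) (s : seq R) e A : (forall t, Num.max (w t) 0 <= q t) -> uniq s ->
  (\esum_(t in ~` [set` s]) (q t)%:E <= e%:E)%E ->
  (\sum_(t <- s) (if t \in A then Num.max (w t) 0 else 0) <= fine (atoms w A)) /\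
  (fine (atoms w A) <= \sum_(t <- s) (if t \in A then Num.max (w t) 0 else 0) + e).
Proof.
move=> wq us tail.
have p0 t : 0 <= Num.max (w t) 0 by rewrite le_max lexx orbT.
have E1 : (\esum_(t in A `&` [set` s]) (Num.max (w t) 0)%:E = (\sum_(t <- s) (if t \in A then Num.max (w t) 0 else 0))%:E)%E.
  rewrite setIC esum_mkcondr esum_fset; [|exact: finite_seq|by move=> t _; case: ifP => // _; rewrite lee_fin].
  by rewrite -fsbig_seq// -sumEFin; apply: eq_bigr => t _; case: ifP.
have E2 : (\esum_(t in A `&` ~` [set` s]) (Num.max (w t) 0)%:E <= e%:E)%E.
  apply: le_trans tail; apply: (@le_trans _ _ (\esum_(t in ~` [set` s]) (Num.max (w t) 0)%:E)%E).
    by apply: esum_sub => // t [].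
  by apply: le_esum => t _; rewrite lee_fin.
have E20 : (0 <= \esum_(t in A `&` ~` [set` s]) (Num.max (w t) 0)%:E)%E by apply: esum_ge0 => t _; rewrite lee_fin.
have f2 : (\esum_(t in A `&` ~` [set` s]) (Num.max (w t) 0)%:E)%E \is a fin_num.
  by rewrite ge0_fin_numE//; exact: le_lt_trans E2 (ltry _).
rewrite /atoms (esumID [set` s] A); last by move=> t _; rewrite lee_fin.
rewrite E1; rewrite -(fineK f2) in E2 E20 *; rewrite -EFinD /=.
by rewrite !lee_fin in E2 E20; rewrite lerDl lerD2l.
Qed.

(** The jumps left out contribute at most the tail of the sum of [|z t|], whatever [x] is; this
    makes the error uniform. *)
Lemma finite_jumps (z : R -> R) e : (forall t, ~~ ((0 < t) && (t < 1)) -> z t = 0) ->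
  atoms z [set` `]0, 1[] \is a fin_num -> atoms (fun t => - z t) [set` `]0, 1[] \is a fin_num -> 0 < e ->
  exists s : seq R, [/\ uniq s, {in s, forall t, z t != 0 /\ (0 < t < 1)} &
    forall x, 0 <= x -> `|(fine (atoms z [set` `]0, x]]) - fine (atoms (fun t => - z t) [set` `]0, x]]))
       - \sum_(t <- s) z t * (t <= x)%R%:R| <= e].
Proof.
move=> z0 zp zn e0.
have zn0 t : ~~ ((0 < t) && (t < 1)) -> - z t = 0 by move=> /z0 ->; rewrite oppr0.
have absE t : `|z t| = Num.max (z t) 0 + Num.max (- z t) 0.
  have [h|h] := leP 0 (z t); first by rewrite ger0_norm// [X in _ + X]max_r ?oppr_le0// addr0.
  by rewrite ltr0_norm// max_l ?oppr_ge0 ?(ltW h)// add0r.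
have fin : (\esum_(t in setT) (`|z t|)%:E < +oo)%E.
  have -> : (\esum_(t in setT) (`|z t|)%:E = atoms z setT + atoms (fun t => (- z t)%R) setT)%E.
    rewrite /atoms -esumD; last 2 first.
    - by move=> t _; rewrite lee_fin le_max lexx orbT.
    - by move=> t _; rewrite lee_fin le_max lexx orbT.
    by apply: eq_esum => t _; rewrite -EFinD absE.
  rewrite (atoms_01 setT z0) (atoms_01 setT zn0) !setTI.
  by rewrite -ge0_fin_numE ?adde_ge0 ?measure_ge0// fin_numD zp zn.
have [s [us tail]] := finite_tail (fun t => normr_ge0 (z t)) fin e0.
exists [seq t <- s | z t != 0]; split.
- exact: filter_uniq.
- move=> t; rewrite mem_filter => /andP[zt _]; split => //.
  by apply/negPn/negP => /z0 h; rewrite h eqxx in zt.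
- move=> x x0.
  have w1 t : Num.max (z t) 0 <= `|z t| by rewrite ge_max ler_norm normr_ge0.
  have w2 t : Num.max (- z t) 0 <= `|z t| by rewrite ge_max -normrN ler_norm normr_ge0.
  have [a1 a2] := atoms_truncated [set` `]0, x]] w1 us tail.
  have [b1 b2] := atoms_truncated [set` `]0, x]] w2 us tail.
  have E : \sum_(t <- [seq t <- s | z t != 0]) z t * (t <= x)%R%:R =
     \sum_(t <- s) (if t \in [set` `]0, x]] then Num.max (z t) 0 else 0) -
     \sum_(t <- s) (if t \in [set` `]0, x]] then Num.max (- z t) 0 else 0).
    rewrite big_filter big_mkcond -sumrB; apply: eq_bigr => t _.
    have mx : Num.max (z t) 0 - Num.max (- z t) 0 = z t.
      have [h|h] := leP 0 (z t); first by rewrite [X in _ - X]max_r ?oppr_le0// subr0.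
      by rewrite max_l ?oppr_ge0 ?(ltW h)// opprK add0r.
    case: eqVneq => [zt|zt] /=; first by rewrite zt oppr0 maxxx; case: ifP; rewrite subrr.
    have t0 : 0 < t by have /andP[] : 0 < t < 1 by apply/negPn/negP => /z0 h; rewrite h eqxx in zt.
    have -> : (t \in [set` `]0, x]]) = (t <= x) by apply/idP/idP => [/set_mem/=|h]; [rewrite in_itv/= => /andP[]|apply/mem_set; rewrite /= in_itv/= t0].
    by case: ifP => _; rewrite ?mulr1 ?mx// mulr0 subrr.
  rewrite E; move: a1 a2 b1 b2.
  move: (\sum_(t <- s) _) (\sum_(t <- s) _) (fine _) (fine _) => p q y y' *.
  by rewrite ler_norml; apply/andP; split; lra.
Qed.

End Decomposition.


(** * Recovery sequences *)

Section Step.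
Context {R : realType} (n : nat) (p : {poly R}).
Implicit Types (a b c d e h r s t x y M : R) (f g u z : R -> R).
Let k := n.+2.
Hypothesis tp : transition k p.

Definition clip t h x := Num.max t (Num.min x (t + h)).

(* The [l]-th derivative of the transition from 0 to 1 on [[t, t + h]]. *)
Definition step t h l x : R :=
  if l == k then (if (t < x) && (x <= t + h) then (stretch t (t + h) p)^`(k).[x] else 0)
  else (stretch t (t + h) p)^`(l).[clip t h x].

Lemma clip_le t h x y : x <= y -> clip t h x <= clip t h y.
Proof. by move=> xy; rewrite /clip le_max2// le_min2. Qed.

Lemma clip_in t h x : 0 < h -> t <= clip t h x <= t + h.
Proof. by move=> h0; rewrite /clip le_max lexx/= ge_max lerDl (ltW h0)/= ge_min lexx orbT. Qed.

Lemma oint_window f t h x y : 0 < h ->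
  oint (fun s => if (t < s) && (s <= t + h) then f s else 0) x y = oint f (clip t h x) (clip t h y).
Proof.
move=> h0; rewrite /oint /Rintegral; congr fine.
have -> : [set` `]clip t h x, clip t h y]] = [set` `]x, y]] `&` [set` `]t, t + h]].
  apply/seteqP; split => s /=; rewrite !in_itv/= /clip.
    rewrite gt_max gt_min => /andP[/andP[ts +] sy].
    move: sy; rewrite le_max leNgt ts/= le_min => /andP[sy sh].
    by rewrite sh sy !andbT => /orP[->//|]; rewrite ltNge sh.
  move=> [/andP[xs sy] /andP[ts sh]].
  by rewrite gt_max ts gt_min xs/= le_max le_min sy sh orbT.
rewrite integral_mkcondr; apply: eq_integral => s _.
rewrite patchE; case: ifPn => [/andP[h1 h2]|/negP hn].
  by rewrite mem_set//= in_itv/= h1.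
by rewrite memNset//= in_itv.
Qed.

Let out_zero t h l x : 0 < h -> (0 < l)%N -> (l < k)%N -> ~~ ((t < x) && (x <= t + h)) ->
  (stretch t (t + h) p)^`(l).[clip t h x] = 0.
Proof.
move=> h0 l0 lk; rewrite negb_and -leNgt -ltNge => /orP[xt|hx].
  rewrite /clip max_l; last by rewrite ge_min xt.
  by rewrite stretch_l; have [_ _ _ /(_ l)[|-> _]] := tp; rewrite ?l0 ?mulr0.
rewrite /clip min_r ?(ltW hx)// max_r ?lerDl ?(ltW h0)// stretch_r ?ltrDl//.
by have [_ _ _ /(_ l)[|_ ->]] := tp; rewrite ?l0 ?mulr0.
Qed.

(** For [0 < l < k] clipping the argument already gives 0 outside the window, as these derivatives
    vanish at both ends. The derivative of order [k] need not vanish there, which is why [step] cuts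
    it off explicitly. *)
Lemma step_window t h l x : 0 < h -> (0 < l)%N -> (l <= k)%N ->
  step t h l x = if (t < x) && (x <= t + h) then (stretch t (t + h) p)^`(l).[x] else 0.
Proof.
move=> h0 l0; rewrite leq_eqVlt /step => /predU1P[->|lk]; first by rewrite eqxx.
rewrite (ltn_eqF lk); case: ifPn => [/andP[tx xh]|xo]; last exact: out_zero.
by rewrite /clip min_l// max_r// ltW.
Qed.

Lemma step_out t h l x : 0 < h -> (0 < l)%N -> (l <= k)%N -> ~~ ((t < x) && (x <= t + h)) -> step t h l x = 0.
Proof. by move=> h0 l0 lk xo; rewrite step_window// (negbTE xo). Qed.

Lemma step_before t h x : x <= t -> step t h 0 x = 0.
Proof.
move=> xt; rewrite /step/= /clip max_l; last by rewrite ge_min xt.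
by have := stretch_l t (t + h) p 0; rewrite derivn0 => ->; have [-> _ _ _] := tp; rewrite mulr0.
Qed.

Lemma step_after t h x : 0 < h -> t + h <= x -> step t h 0 x = 1.
Proof.
move=> h0 hx; rewrite /step/= /clip min_r// max_r ?lerDl ?ltW//.
have th : t < t + h by rewrite ltrDl.
by have := stretch_r p 0 th; rewrite derivn0 => ->; have [_ -> _ _] := tp; rewrite mulr1 expr0.
Qed.

Lemma step_bounded : exists2 M : R, 0 <= M & forall t h x, 0 < h -> `|step t h 0 x| <= M.
Proof.
have [M [_ hM]] := compact_bounded (continuous_compact (@horner_within R p 0 1) (@segment_compact R 0 1)).
exists (`|M + 1|) => // t h x h0; apply: (@le_trans _ _ (M + 1)); last exact: ler_norm.
apply: hM; first by rewrite ltrDl.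
have /andP[c1 c2] := clip_in t x h0.
exists (h^-1 * (clip t h x - t)) => /=.
  rewrite in_itv/= mulr_ge0 ?invr_ge0 ?(ltW h0) ?subr_ge0//= mulrC ler_pdivrMr// mul1r lerBlDl.
  by [].
rewrite /step/=; have := stretch_derivn t (t + h) p 0 (clip t h x).
by rewrite !derivn0 expr0 mul1r [t + h - t]addrAC subrr add0r => ->.
Qed.

Let step_prim t h l : 0 < h -> (l < k)%N -> prim 0 1 (step t h l) (step t h l.+1).
Proof.
move=> h0 lk x y _ xy _; rewrite {1 2}/step (ltn_eqF lk).
set q := stretch t (t + h) p.
have := @horner_prim R q^`(l) t (t + h) _ _ (proj1 (andP (clip_in t x h0))) (clip_le t h xy) (proj2 (andP (clip_in t y h0))).
move=> ->; rewrite -derivnS -oint_window//; apply: eq_oint => s _ _.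
by rewrite step_window.
Qed.

Let step_cint t h l : 0 < h -> (l <= k)%N -> cint 0 1 (step t h l) /\ cint 0 1 (fun x => step t h l x ^+ 2).
Proof.
move=> h0 lk; apply: L2_cint.
have cc : continuous (clip t h).
  move=> x; apply: (@continuous_comp _ _ _ (fun x => Num.min x (t + h)) (fun y => Num.max t y)).
    by apply: continuous_min; [exact: cvg_id|exact: cvg_cst].
  by apply: continuous_max; [exact: cvg_cst|exact: cvg_id].
have [->|l0] := posnP l.
  apply: L2_cont; apply: continuous_subspaceT => x.
  apply: (@continuous_comp _ _ _ (clip t h) (horner (stretch t (t + h) p))); first exact: cc.
  exact: continuous_horner.
set q := (stretch t (t + h) p)^`(l).
have [iq q2] := L2_cint (L2_cont (@horner_within R q 0 1)).
have mw : measurable_fun (`[0, 1] : set R) (step t h l).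
  rewrite (_ : step t h l = fun x => if (t < x) && (x <= t + h) then q.[x] else 0); last by apply/funext => x; exact: step_window.
  apply: measurable_fun_if => //.
    by apply: measurable_and; [exact: measurable_fun_ltr|exact: measurable_fun_ler].
  by apply: measurable_funS (cint_meas iq) => // x [].
apply: cint_L2; first by apply: measurable_funS mw => //; exact: subset_itv_oo_cc.
apply: (@cint_le _ _ _ _ (fun x => q.[x] ^+ 2)) => //; first exact: measurable_funX.
move=> x _ _; rewrite step_window//; case: ifP => // _.
by rewrite expr0n normr0.
Qed.

Lemma step_rep t h : 0 < h -> rep 0 1 k (step t h).
Proof.
move=> h0; split; [by move=> l lk; exact: step_prim|by move=> l lk; case: (step_cint t h0 lk)|].
by case: (step_cint t h0 (leqnn k)).
Qed.

(** Only an inequality, because the window may extend beyond 1. *)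
Lemma step_energy t h : 0 < h -> 0 <= t -> oint (fun x => step t h k x ^+ 2) 0 1 <= h^-1 ^+ (2 * k) * h * alpha k p.
Proof.
move=> h0 t0; have th : t < t + h by rewrite ltrDl.
have := stretch_energy p k th; rewrite [t + h - t]addrAC subrr add0r => <-.
set q := (stretch t (t + h) p)^`(k).
have -> : oint (fun x => step t h k x ^+ 2) 0 1 = oint (fun x => q.[x] ^+ 2) (clip t h 0) (clip t h 1).
  rewrite -oint_window//; apply: eq_oint => s _ _; rewrite step_window//; case: ifP => // _.
  by rewrite expr0n.
have /andP[a1 a2] := clip_in t 0 h0; have /andP[b1 b2] := clip_in t 1 h0.
have ab := clip_le t h (@ler01 R).
have [_ iq2] := L2_cint (L2_cont (@horner_within R q t (t + h))).
rewrite (oint_cat iq2 (lexx t) a1 (le_trans ab b2) (lexx _)) (oint_cat iq2 a1 ab b2 (lexx _)).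
have p0 x y : 0 <= oint (fun x => q.[x] ^+ 2) x y by apply: oint_ge0 => s _ _; exact: sqr_ge0.
by rewrite addrCA lerDl addr_ge0.
Qed.

Lemma window_size t h : 0 < h -> cint 0 1 (fun x => if (t < x) && (x <= t + h) then 1 else 0 : R) /\
  oint (fun x => if (t < x) && (x <= t + h) then 1 else 0) 0 1 <= h.
Proof.
move=> h0; split.
  apply: (@cint_bounded _ _ _ _ 1).
    apply: measurable_fun_if => //.
    by apply: measurable_and; [exact: measurable_fun_ltr|exact: measurable_fun_ler].
  by move=> x _ _; case: ifP => _; rewrite ?normr1// normr0.
rewrite (oint_window (fun=> 1))// oint_cst; last exact: clip_le.
have /andP[a1 a2] := clip_in t 0 h0; have /andP[b1 b2] := clip_in t 1 h0.
by rewrite mul1r lerBlDr; apply: (le_trans b2); rewrite addrC lerD2l.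
Qed.

End Step.


(** * Superposition of transition layers on a smooth function *)

Section Combination.
Context {R : realType} (n : nat) (p : {poly R}).
Implicit Types (a b c d e h r t x y M : R) (f g u z : R -> R) (S : seq R).
Let k := n.+2.
Hypothesis tp : transition k p.

Lemma oint_sum S (F : R -> R -> R) : {in S, forall t, cint 0 1 (F t)} ->
  cint 0 1 (fun x => \sum_(t <- S) F t x) /\ oint (fun x => \sum_(t <- S) F t x) 0 1 = \sum_(t <- S) oint (F t) 0 1.
Proof.
elim: S => [|t S IH] hF.
  rewrite (_ : (fun x => _) = fun=> 0); last by apply/funext => x; rewrite big_nil.
  by split; [exact: cint_cst|rewrite oint_cst// mul0r big_nil].
have [i1 e1] : cint 0 1 (fun x => \sum_(t <- S) F t x) /\ oint (fun x => \sum_(t <- S) F t x) 0 1 = \sum_(t <- S) oint (F t) 0 1.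
  by apply: IH => r rS; apply: hF; rewrite inE rS orbT.
have i2 : cint 0 1 (F t) by apply: hF; exact: mem_head.
rewrite (_ : (fun x => _) = fun x => F t x + \sum_(t <- S) F t x); last by apply/funext => x; rewrite big_cons.
by split; [exact: cintD|rewrite (@ointD _ 0 1)// e1 big_cons].
Qed.

Lemma ler_sum_in S (F G : R -> R) : {in S, forall t, F t <= G t} -> \sum_(t <- S) F t <= \sum_(t <- S) G t.
Proof. by move=> h; rewrite big_seq [leRHS]big_seq; exact: ler_sum. Qed.

Lemma rep_add w w' c : rep 0 1 k w -> rep 0 1 k w' -> rep 0 1 k (fun l x => w l x + c * w' l x).
Proof.
move=> [h1 h2 h3] [h1' h2' h3']; split.
- move=> l lk x y x0 xy y1; rewrite (@ointD _ 0 1)//; [|by apply: h2|by apply: cintZ; apply: h2'].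
  by rewrite (@ointZ _ 0 1)//; [rewrite -h1// -h1'//; ring|apply: h2'].
- by move=> l lk; apply: cintD; [exact: h2|apply: cintZ; exact: h2'].
- have i1 := h2 k (leqnn k); have i2 := h2' k (leqnn k).
  have := cintD h3 (cintD (cintZ (2 * c) (cint_mul2 (cint_meas i1) (cint_meas i2) h3 h3')) (cintZ (c ^+ 2) h3')).
  by rewrite (_ : (fun _ => _) = (fun x => (w k x + c * w' k x) ^+ 2))//; apply/funext => x; ring.
Qed.

Definition combine (W : nat -> R -> R) S z (h : R -> R) (l : nat) x := W l x + \sum_(t <- S) z t * step n p t (h t) l x.

Lemma combine_rep W S z (h : R -> R) : rep 0 1 k W -> {in S, forall t, 0 < h t} -> rep 0 1 k (combine W S z h).
Proof.
move=> rW; elim: S => [|t S IH] h0.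
  by rewrite (_ : combine W [::] z h = W)//; apply/funext => l; apply/funext => x; rewrite /combine big_nil addr0.
rewrite (_ : combine W (t :: S) z h = fun l x => combine W S z h l x + z t * step n p t (h t) l x).
  apply: rep_add; first by apply: IH => r rS; apply: h0; rewrite inE rS orbT.
  by apply: step_rep => //; apply: h0; exact: mem_head.
by apply/funext => l; apply/funext => x; rewrite /combine big_cons; ring.
Qed.

Lemma sum_sq_disjoint S (F : R -> R) : uniq S -> {in S &, forall t r, t != r -> F t * F r = 0} ->
  (\sum_(t <- S) F t) ^+ 2 = \sum_(t <- S) F t ^+ 2.
Proof.
elim: S => [|t S IH] /= => [_ _|/andP[tS uS] hF]; first by rewrite !big_nil expr0n.
rewrite !big_cons sqrrD IH//; last by move=> r q rS qS; apply: hF; rewrite inE ?rS ?qS orbT.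
have -> : F t * \sum_(r <- S) F r = 0; last by rewrite mul0rn addr0.
rewrite mulr_sumr big1_seq// => r /andP[_ rS]; apply: hF; rewrite ?mem_head ?inE ?rS ?orbT//.
by apply: contra tS => /eqP ->.
Qed.

(** The left side is [f_eps] for [eps = s^2]. The bound by the square is used between the transition
    layers, the bound by [1 / s^2] inside them. *)
Lemma flat_steep_le f s x : 0 < s ->
  flat f s x ^+ 2 + (s ^+ 2)^-1 * steep f s x <= f x ^+ 2 /\ flat f s x ^+ 2 + (s ^+ 2)^-1 * steep f s x <= (s ^+ 2)^-1.
Proof.
move=> s0; rewrite /flat /steep -(real_normK (num_real (f x))).
have si0 : 0 <= s^-1 by rewrite invr_ge0 ltW.
case: ltP => h; rewrite ?subrr ?mulr0 ?expr0n/= ?add0r ?mulr1 ?subr0 ?addr0; split => //.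
- by rewrite -exprVn; apply: lerXn2r; rewrite ?nnegrE// ltW.
- by rewrite mulr1 real_normK ?num_real.
- rewrite mulr1 -(real_normK (num_real (f x))) -exprVn; apply: lerXn2r; rewrite ?nnegrE//.
Qed.

Let young (a b d : R) : 0 < d -> (a + b) ^+ 2 <= (1 + d^-1) * a ^+ 2 + (1 + d) * b ^+ 2.
Proof.
move=> d0; rewrite -subr_ge0.
have -> : (1 + d^-1) * a ^+ 2 + (1 + d) * b ^+ 2 - (a + b) ^+ 2 = d^-1 * (a - d * b) ^+ 2.
  by field; rewrite gt_eqF.
by rewrite mulr_ge0 ?invr_ge0 ?sqr_ge0// ltW.
Qed.

Let kE : (2 * k).-1 = n.*2.+3.
Proof. by rewrite /k mul2n. Qed.

Let scale_power (s a : R) : 0 < s -> 0 < a ->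
  (s ^+ 2) ^+ (2 * k).-1 * ((s ^+ 2 * a)^-1 ^+ (2 * k) * (s ^+ 2 * a)) = a^-1 ^+ (2 * k) * a.
Proof.
move=> s0 a0; have q0 : 0 < s ^+ 2 by rewrite exprn_gt0.
have -> : (2 * k = (2 * k).-1.+1)%N by rewrite /k; lia.
move: (_.-1) q0 => m; move: (s ^+ 2) => q q0; rewrite /= !exprVn exprMn.
by rewrite !exprS; field; rewrite !gt_eqF// exprn_gt0.
Qed.

(* The transition layers are disjoint, so their energies add up exactly; the
   interaction with the smooth part is absorbed by Young's inequality. *)
Lemma combine_energy W S z (a : R -> R) (s d : R) : rep 0 1 k W -> 0 < s -> s <= 1 -> 0 < d -> uniq S ->
  {in S, forall t, 0 <= t /\ 0 < a t} -> {in S &, forall t r, t != r -> s ^+ 2 * a t <= `|t - r|} ->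
  total_energy n (combine W S z (fun t => s ^+ 2 * a t)) s <= oint (fun x => W 1%N x ^+ 2) 0 1 +
    \sum_(t <- S) (a t + (1 + d) * (z t ^+ 2 * (a t)^-1 ^+ (2 * k) * a t * alpha k p)) +
    s ^+ 2 * ((1 + d^-1) * oint (fun x => W k x ^+ 2) 0 1).
Proof.
move=> rW s0 s1 d0 uS hS sep.
pose h t := s ^+ 2 * a t; have q0 : 0 < s ^+ 2 by rewrite exprn_gt0.
have h0 : {in S, forall t, 0 < h t} by move=> t /hS[_ a0]; exact: mulr_gt0.
pose v := combine W S z h; have rv : rep 0 1 k v by exact: combine_rep.
have [_ hv2 hv3] := rv; have [_ hW2 hW3] := rW.
have [_ W12] : cint 0 1 (W 1%N) /\ cint 0 1 (fun x => W 1%N x ^+ 2) by apply: L2_cint; exact: (rep_L2 rW).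
pose J t x : R := if (t < x) && (x <= t + h t) then 1 else 0.
have iJ t : t \in S -> cint 0 1 (J t) /\ oint (J t) 0 1 <= h t by move=> tS; apply: window_size; exact: h0.
have [iSJ eSJ] := @oint_sum S J (fun t tS => (iJ t tS).1).
have v1 := hv2 1%N isT.
have i1 := flat_sq_int s0 v1; have i2 := steep_cint s (cint_meas v1).
(* Inside a layer the integrand is at most [1 / s^2], which integrates to at most [a t]; outside all
   layers the derivative is that of [W]. *)
have part1 : oint (fun x => flat (v 1%N) s x ^+ 2) 0 1 + steep_size (v 1%N) s 0 1 / s ^+ 2 <=
    oint (fun x => W 1%N x ^+ 2) 0 1 + \sum_(t <- S) a t.
  rewrite /steep_size mulrC -(@ointZ _ 0 1)// -(@ointD _ 0 1)//; last exact: cintZ.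
  apply: (@le_trans _ _ (oint (fun x => W 1%N x ^+ 2 + (s ^+ 2)^-1 * \sum_(t <- S) J t x) 0 1)); last first.
    rewrite (@ointD _ 0 1)//; last exact: cintZ.
    rewrite (@ointZ _ 0 1)// eSJ lerD2l mulrC ler_pdivrMr// mulr_suml; apply: ler_sum_in => t tS.
    by rewrite mulrC; exact: (iJ t tS).2.
  apply: (@le_oint _ 0 1) => //; [by apply: cintD => //; exact: cintZ|by apply: cintD => //; exact: cintZ|].
  move=> x _ _; have [b1 b2] := flat_steep_le (v 1%N) x s0.
  have J0 t : 0 <= J t x by rewrite /J; case: ifP.
  have [/hasP[t tS tJ]|/hasPn nJ] := boolP (has (fun t => (t < x) && (x <= t + h t)) S).
    apply: (le_trans b2); apply: ler_wpDl; first exact: sqr_ge0.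
    rewrite -[leLHS]mulr1 ler_pM2l ?invr_gt0// (bigD1_seq t)//= {1}/J tJ lerDl.
    exact: sumr_ge0.
  rewrite big1_seq ?mulr0 ?addr0; last by move=> t /andP[_ /nJ]; rewrite /J => /negbTE ->.
  apply: (le_trans b1); rewrite /v /combine big1_seq ?addr0// => t /andP[_ tS].
  by rewrite step_out ?mulr0//; [exact: h0|exact: nJ].
pose Q t x := z t ^+ 2 * step n p t (h t) k x ^+ 2.
have iQ t : t \in S -> cint 0 1 (Q t).
  by move=> tS; apply: cintZ; have [_ _ h3] := step_rep tp t (h0 t tS); exact: h3.
have [iSQ eSQ] := oint_sum iQ.
have part2 : oint (fun x => v k x ^+ 2) 0 1 <= (1 + d^-1) * oint (fun x => W k x ^+ 2) 0 1 +
    (1 + d) * \sum_(t <- S) (z t ^+ 2 * ((h t)^-1 ^+ (2 * k) * h t * alpha k p)).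
  apply: (@le_trans _ _ (oint (fun x => (1 + d^-1) * W k x ^+ 2 + (1 + d) * \sum_(t <- S) Q t x) 0 1)); last first.
    rewrite (@ointD _ 0 1)//; [|exact: cintZ|exact: cintZ].
    rewrite (@ointZ _ 0 1)// (@ointZ _ 0 1)// eSQ lerD2l ler_pM2l; last by rewrite addr_gt0.
    apply: ler_sum_in => t tS; have [_ _ h3] := step_rep tp t (h0 t tS).
    rewrite /Q (@ointZ _ 0 1)//; apply: ler_wpM2l; first exact: sqr_ge0.
    by apply: step_energy => //; [exact: h0|have [] := hS t tS].
  apply: (@le_oint _ 0 1) => //; first by apply: cintD; exact: cintZ.
  move=> x _ _; rewrite /v /combine; apply: (le_trans (young _ _ d0)).
  rewrite lerD2l ler_pM2l ?addr_gt0// sum_sq_disjoint//.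
    by apply: ler_sum => t _; rewrite exprMn.
  move=> t r tS rS tr; case: (boolP ((t < x) && (x <= t + h t))) => [/andP[tx xt]|out]; last first.
    by rewrite (step_out tp) ?mulr0 ?mul0r//; exact: h0.
  rewrite [X in _ * X](_ : _ = 0) ?mulr0//; rewrite (step_out tp) ?mulr0//; first exact: h0.
  apply/negP => /andP[rx xr].
  have g1 := sep t r tS rS tr; have g2 := sep r t rS tS; rewrite eq_sym distrC in g2.
  have {}g2 := g2 tr; rewrite -/(h t) in g1; rewrite -/(h r) in g2.
  by move: tr; rewrite neq_lt => /orP[lt|lt]; move: g1 g2; [rewrite ltr0_norm ?subr_lt0//|rewrite gtr0_norm ?subr_gt0//]; move: (h t) (h r) tx xt rx xr lt => *; lra.
rewrite /total_energy /steep_energy -/k -/v big_split.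
have A0 : 0 <= oint (fun x => W k x ^+ 2) 0 1 by apply: oint_ge0 => t _ _; exact: sqr_ge0.
have q1 : (s ^+ 2) ^+ (2 * k).-1 <= s ^+ 2.
  by rewrite kE exprS ler_piMr ?(ltW q0)// exprn_ile1 ?(ltW q0)// exprn_ile1// ltW.
have part3 : (s ^+ 2) ^+ (2 * k).-1 * oint (fun x => v k x ^+ 2) 0 1 <=
   \sum_(t <- S) (1 + d) * (z t ^+ 2 * (a t)^-1 ^+ (2 * k) * a t * alpha k p) + s ^+ 2 * ((1 + d^-1) * oint (fun x => W k x ^+ 2) 0 1).
  apply: (@le_trans _ _ ((s ^+ 2) ^+ (2 * k).-1 * ((1 + d^-1) * oint (fun x => W k x ^+ 2) 0 1 +
    (1 + d) * \sum_(t <- S) (z t ^+ 2 * ((h t)^-1 ^+ (2 * k) * h t * alpha k p))))).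
    by apply: ler_wpM2l => //; rewrite exprn_ge0// ltW.
  rewrite mulrDr addrC; apply: lerD; last first.
    by apply: ler_wpM2r => //; rewrite mulr_ge0// addr_ge0// invr_ge0 ltW.
  rewrite mulr_sumr mulr_sumr le_eqVlt; apply/orP; left; apply/eqP; apply: eq_big_seq => t /hS[_ a0].
  rewrite -[in RHS](mulrA (z t ^+ 2)) -(scale_power s0 a0) /h; ring.
by have := lerD part1 part3; rewrite !addrA.
Qed.

End Combination.


(** * Choice of constants and finite sums *)

Section Arithmetic.
Context {R : realType}.
Implicit Types (a b c d e m L l s t x y : R) (S : seq R).

(** Absorbs two losses of the construction at once: the factor [1 + d] of the Young inequality, and
    the excess [d] over [m_k] of a nearly optimal length [T]. *)
Lemma perturbation m L e : 0 < m -> 0 <= L -> 0 < e ->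
  exists2 d : R, 0 < d & forall l, 0 <= l -> l <= L -> (1 + d) * ((m + d) * l) <= m * L + e.
Proof.
move=> m0 L0 e0; pose d := Num.min 1 (e / ((2 + m) * (L + 1))).
have c0 : 0 < (2 + m) * (L + 1) by apply: mulr_gt0; lra.
have d0 : 0 < d by rewrite lt_min ltr01 divr_gt0.
exists d => // l l0 lL; have d1 : d <= 1 by rewrite ge_min lexx.
have dc : d * ((2 + m) * (L + 1)) <= e.
  by rewrite -ler_pdivlMr// ge_min lexx orbT.
apply: (@le_trans _ _ ((1 + d) * ((m + d) * L))).
  by apply: ler_wpM2l; [rewrite addr_ge0// ltW|apply: ler_wpM2l => //; rewrite addr_ge0// ltW].
have h1 : d * d * L <= d * L by rewrite ler_wpM2r// ler_piMr// ltW.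
have h2 : 0 <= d * (2 + m) by rewrite mulr_ge0 ?ltW//; lra.
have -> : (1 + d) * ((m + d) * L) = m * L + (d * L + d * m * L + d * d * L) by ring.
rewrite lerD2l; apply: le_trans dc.
have -> : d * ((2 + m) * (L + 1)) = d * L + d * m * L + d * L + d * (2 + m) by ring.
move: (d * L) (d * m * L) (d * d * L) (d * (2 + m)) h1 h2 => *; lra.
Qed.

Lemma sq_close (g : R -> R) e : cint 0 1 g -> cint 0 1 (fun x => g x ^+ 2) -> 0 < e ->
  exists2 d : R, 0 < d & forall w, cint 0 1 w -> cint 0 1 (fun x => w x ^+ 2) ->
    oint (fun x => (w x - g x) ^+ 2) 0 1 <= d -> oint (fun x => w x ^+ 2) 0 1 <= oint (fun x => g x ^+ 2) 0 1 + e.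
Proof.
move=> gi g2 e0; pose G := oint (fun x => g x ^+ 2) 0 1.
have G0 : 0 <= G by apply: oint_ge0 => t _ _; exact: sqr_ge0.
pose q := e / 2 / (G + 1); have G1 : 0 < G + 1 by lra.
have q0 : 0 < q by rewrite !divr_gt0.
have q1 : 0 < 1 + q^-1 by rewrite addr_gt0// invr_gt0.
exists (e / 2 / (1 + q^-1)); first by rewrite !divr_gt0.
move=> v vi v2 h; have iB := sq_intB vi gi v2 g2.
apply: (@le_trans _ _ (oint (fun x => (1 + q) * g x ^+ 2 + (1 + q^-1) * (v x - g x) ^+ 2) 0 1)).
  apply: (@le_oint _ 0 1) => //; first by apply: cintD; exact: cintZ.
  move=> x _ _; rewrite -subr_ge0.
  have -> : (1 + q) * g x ^+ 2 + (1 + q^-1) * (v x - g x) ^+ 2 - v x ^+ 2 = q^-1 * (v x - g x - q * g x) ^+ 2.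
    by field; rewrite gt_eqF.
  by rewrite mulr_ge0 ?invr_ge0 ?sqr_ge0// ltW.
rewrite (@ointD _ 0 1)//; [|exact: cintZ|exact: cintZ].
rewrite (@ointZ _ 0 1)// (@ointZ _ 0 1)// -/G.
have h1 : q * G <= e / 2.
  apply: (@le_trans _ _ (q * (G + 1))); first by rewrite ler_pM2l// lerDl.
  by rewrite /q -mulrA mulVf ?mulr1// gt_eqF.
have h2 : (1 + q^-1) * oint (fun x => (v x - g x) ^+ 2) 0 1 <= e / 2.
  by rewrite mulrC -ler_pdivlMr.
rewrite mulrDl mul1r; move: h1 h2; move: (_ * G) (_ * oint _ _ _) => x y *; lra.
Qed.

Lemma separation S : exists2 d : R, 0 < d & {in S &, forall t r, t != r -> d <= `|t - r|}.
Proof.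
elim: S => [|t S [d d0 hd]]; first by exists 1.
have [e e0 he] : exists2 e : R, 0 < e & {in S, forall r, t != r -> e <= `|t - r|}.
  elim: S {hd} => [|r S [e e0 he]]; first by exists 1.
  have [tr|tr] := eqVneq t r.
    by exists e => // q; rewrite inE => /predU1P[->|qS]; [rewrite tr eqxx|exact: he].
  exists (Num.min e `|t - r|); first by rewrite lt_min e0 normr_gt0 subr_eq0.
  move=> q; rewrite inE => /predU1P[->|qS] tq; first by rewrite ge_min lexx orbT.
  by rewrite ge_min he.
exists (Num.min d e); first by rewrite lt_min d0.
move=> x y; rewrite !inE => /predU1P[->|xS] /predU1P[->|yS] xy; rewrite ge_min.
- by rewrite eqxx in xy.
- by rewrite he ?orbT.
- by rewrite distrC he ?orbT// eq_sym.
- by rewrite hd.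
Qed.

Lemma seq_le_esum S (q : R -> R) (A : set R) : uniq S -> (forall t, 0 <= q t) -> {in S, forall t, A t} ->
  ((\sum_(t <- S) q t)%:E <= \esum_(t in A) (q t)%:E)%E.
Proof.
move=> uS q0 SA; rewrite -sumEFin fsbig_seq//; apply: ereal_sup_ubound; exists [set` S] => //; split.
  exact: finite_seq.
by move=> t /SA.
Qed.

Lemma term_le_sum S (q : R -> R) t : (forall t, t \in S -> 0 <= q t) -> t \in S -> q t <= \sum_(t <- S) q t.
Proof.
move=> q0 tS; rewrite (big_rem t)//= lerDl big_seq; apply: sumr_ge0 => r /mem_rem; exact: q0.
Qed.

End Arithmetic.

(** * The recovery sequence *)

Section Recovery.
Context {R : realType} (n : nat).
Implicit Types (a b c d e eta eps h s t x y : R) (f g u z : R -> R) (S : seq R).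
Let k := n.+2.

(** Homogeneity of the cell problem: a transition of height [l^k] over the length [l T] costs [l]
    times a unit transition over the length [T]. *)
Let jump_cost (l T A z : R) : 0 < l -> 0 < T -> `|z| = l ^+ k ->
  l * T + z ^+ 2 * (l * T)^-1 ^+ (2 * k) * (l * T) * A = l * (T + T^-1 ^+ (2 * k) * T * A).
Proof.
move=> l0 T0 zl; rewrite -(real_normK (num_real z)) zl -exprM [(k * 2)%N]mulnC.
rewrite invfM exprMn; have h : l ^+ (2 * k) * l^-1 ^+ (2 * k) = 1.
  by rewrite -exprMn mulfV ?gt_eqF// expr1n.
have -> : l ^+ (2 * k) * (l^-1 ^+ (2 * k) * T^-1 ^+ (2 * k)) * (l * T) * A =
   (l ^+ (2 * k) * l^-1 ^+ (2 * k)) * (l * (T^-1 ^+ (2 * k) * T * A)) by ring.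
by rewrite h mul1r mulrDr.
Qed.

Let four (x1 x2 x3 e : R) : x1 <= e / 4 -> x2 <= e / 4 -> x3 <= e / 2 -> x1 + x2 + x3 <= e.
Proof. by move=> *; lra. Qed.

Let energies (x x1 x2 x3 G M e : R) : 0 < e -> x <= x1 + x2 + x3 -> x1 <= G + e / 4 -> x2 <= M + e / 4 -> x3 <= e / 4 -> x <= G + M + e.
Proof. by move=> *; lra. Qed.

Let twice (y e : R) : y <= e / 4 -> 2 * y <= e / 2. Proof. by move=> *; lra. Qed.

Let window_mem (t x y : R) : 0 < y -> t <= x -> x < t + y -> (t - y < x) && (x <= t - y + 2 * y).
Proof. by move=> *; apply/andP; split; lra. Qed.

Let four0 e : 0 < e -> 0 < e / 4. Proof. by move=> *; rewrite divr_gt0. Qed.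

(** The density and the set of jumps are approximated independently; leaving out jumps can only
    lower the sum that has to be matched. Each remaining jump [t] becomes a layer of length
    [eps * l t * T], with one nearly optimal [T] for all jumps. *)
Theorem recovery u eta : SBV2 u -> (F_lim k u < +oo)%E -> 0 < eta ->
  exists2 e0 : R, 0 < e0 & forall eps, 0 < eps -> eps < e0 -> exists v,
    [/\ L1 0 1 v, (F_eps k eps v <= F_lim k u + eta%:E)%E &
        (\int[mu]_(x in `]0%R, 1%R[) (`|v x - u x|)%:E <= eta%:E)%E].
Proof.
move=> su Fu eta0.
have kk : 1 / k%:R != 0 :> R by rewrite div1r invr_eq0 pnatr_eq0.
have [g [z [c [[gi g2] z0 [zp zn] zE ua]]]] := SBV2_profile su kk.
have m0 : 0 < m_ R k by exact: m_gt0.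
pose l t := `|z t| `^ (1 / k%:R).
have l0 t : 0 <= l t by exact: powR_ge0.
have pos : (0 <= \esum_(t in [set` `]0%R, 1%R[]) (l t)%:E)%E by apply: esum_ge0 => t _; rewrite lee_fin.
have zs : (\esum_(t in [set` `]0%R, 1%R[]) (l t)%:E < +oo)%E.
  move: Fu pos; rewrite /F_lim (asboolT su) -zE -/(\esum_(t in [set` `]0%R, 1%R[]) (l t)%:E)%E.
  have : (0 <= \int[mu]_(t in `]0%R, 1%R[) (approx_gradient u t ^+ 2)%:E)%E by apply: integral_ge0 => x _; rewrite lee_fin sqr_ge0.
  case: (\esum_(t in _) _)%E => [r _ _ _|I0|//]; first exact: ltry.
  by rewrite gt0_muley ?lte_fin// addey// -ltNye (lt_le_trans _ I0)// ltNy0.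
have mu_ : measurable_fun (`]0, 1[ : set R) u by have [/cint_oo/cint_moo] := su.
have [_ FE] := profile_SBV2 gi g2 z0 zp zn zs mu_ ua.
pose L := fine (\esum_(t in [set` `]0%R, 1%R[]) (l t)%:E)%E.
have LE : (\esum_(t in [set` `]0%R, 1%R[]) (l t)%:E = L%:E)%E by rewrite fineK// ge0_fin_numE.
have L0 : 0 <= L by rewrite fine_ge0.
rewrite -/(l _) LE -EFinM -EFinD in FE.
have eta4 := four0 eta0.
have [d d0 hd] := perturbation m0 L0 eta4.
have [p [tp _]] := @transition_exists R k isT.
have [T T0 cT] := m_approx (isT : (1 < k)%N) tp d0.
have [e1 e10 he1] := sq_close gi g2 eta4.
(* The first bound keeps the energy of the density within [eta / 4]; the second, through
   Cauchy-Schwarz, keeps its primitive within [eta / 4] at every point. *)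
have e20 : 0 < Num.min e1 ((eta / 4) ^+ 2) by rewrite lt_min e10 exprn_gt0.
have [w [rw hw]] := rep_dense n.+1 gi g2 e20.
move: hw; rewrite le_min => /andP[hw1 hw2].
have [w1 w2 w3] := rw; have iw := w2 0%N isT.
have [_ iw2] : cint 0 1 (w 0%N) /\ cint 0 1 (fun x => w 0%N x ^+ 2) by apply: L2_cint; exact: (rep_L2 rw).
pose W j := if j is j'.+1 then w j' else fun x => c + oint (w 0%N) 0 x.
have pW : prim 0 1 (W 0%N) (W 1%N) by exact: oint_prim.
have iW0 : cint 0 1 (W 0%N) by case: (L2_cint (L2_cont (prim_cont iw pW))).
have rW : rep 0 1 k W by split => // -[|j] // jk; [exact: w1|exact: w2].
have [S [uS Sz hS]] := finite_jumps z0 zp zn eta4.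
have lz t : `|z t| = l t ^+ k.
  by rewrite /l -powR_mulrn ?powR_ge0// -powRrM div1r mulVf ?pnatr_eq0// powRr1.
have lS t : t \in S -> 0 < l t.
  by move=> /Sz[zt _]; rewrite lt_def l0 andbT; apply: contra zt => /eqP e; rewrite -normr_eq0 lz e expr0n.
pose a t := l t * T.
have a0 t : t \in S -> 0 < a t by move=> /lS ?; exact: mulr_gt0.
have [M M0 hM] := step_bounded n p.
pose A := \sum_(t <- S) a t.
pose C := (1 + d^-1) * oint (fun x => W k x ^+ 2) 0 1.
pose B := \sum_(t <- S) `|z t| * (M + 1) * a t.
have A0 : 0 <= A by rewrite /A big_seq; apply: sumr_ge0 => t /a0/ltW.
have C0 : 0 <= C by rewrite mulr_ge0 ?addr_ge0 ?invr_ge0 ?(ltW d0)//; apply: oint_ge0 => t _ _; exact: sqr_ge0.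
have M1 : 0 <= M + 1 by rewrite addr_ge0.
have zM t : 0 <= `|z t| * (M + 1) by rewrite mulr_ge0.
have B0 : 0 <= B by rewrite /B big_seq; apply: sumr_ge0 => t /a0/ltW ?; exact: mulr_ge0.
have [D D0 hD] := separation S.
(* In order: [s <= 1]; the layers are disjoint; the [k]-th derivative of the smooth part costs at
   most [eta / 4]; and the layers change the function by at most [eta / 2] in L^1. *)
pose e0 := Num.min 1 (Num.min (D / (A + 1)) (Num.min (eta / 4 / (C + 1)) (eta / 4 / (B + 1)))).
have A1 : 0 < A + 1 by rewrite ltr_wpDl.
have B1 : 0 < B + 1 by rewrite ltr_wpDl.
have C1 : 0 < C + 1 by rewrite ltr_wpDl.
exists e0; first by rewrite !lt_min ltr01 !divr_gt0.
move=> eps eps0; rewrite !lt_min => /and4P[eps1 epsA epsC epsB].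
rewrite ltr_pdivlMr// in epsA; rewrite ltr_pdivlMr// in epsC; rewrite ltr_pdivlMr// in epsB.
pose s := Num.sqrt eps; have s0 : 0 < s by rewrite sqrtr_gt0.
have s2 : s ^+ 2 = eps by rewrite sqr_sqrtr// ltW.
have s1 : s <= 1 by rewrite -sqrtr1 ler_wsqrtr// ltW.
pose h t := s ^+ 2 * a t; have h0 : {in S, forall t, 0 < h t} by move=> t /a0 ?; rewrite mulr_gt0 ?exprn_gt0.
pose v := combine n p W S z h; have rv : rep 0 1 k v by exact: combine_rep.
have iv : cint 0 1 (v 0%N) by have [_ hv _] := rv; exact: hv.
have mv : measurable_fun (`]0, 1[ : set R) (v 0%N) by exact: cint_moo iv.
exists (v 0%N); split; first by apply/cint_oo.
- rewrite -s2 (F_eps_rep s0 rv mv (aeq_refl _ _ _)) FE -EFinD lee_fin.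
  have sep : {in S &, forall t r, t != r -> s ^+ 2 * a t <= `|t - r|}.
    move=> t r tS rS tr; apply: le_trans (hD t r tS rS tr); rewrite s2; apply: le_trans (ltW epsA).
    rewrite ler_pM2l//; apply: (@le_trans _ _ A); last by rewrite lerDl.
    by apply: term_le_sum => // q /a0/ltW.
  have hS' : {in S, forall t, 0 <= t /\ 0 < a t} by move=> t tS; split; [have [_ /andP[/ltW]] := Sz t tS|exact: a0].
  have E := combine_energy tp z rW s0 s1 d0 uS hS' sep.
  apply: (energies eta0 E).
  + exact: he1.
  + apply: (@le_trans _ _ (\sum_(t <- S) (1 + d) * ((m_ R k + d) * l t))).
      apply: ler_sum_in => t tS.
      apply: (@le_trans _ _ ((1 + d) * (a t + z t ^+ 2 * (a t)^-1 ^+ (2 * k) * a t * alpha k p))).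
        by rewrite [leRHS]mulrDr lerD2r ler_peMl ?(ltW (a0 t tS))// lerDl ltW.
      rewrite /a (jump_cost _ (lS t tS) T0 (lz t)); apply: ler_wpM2l; first by rewrite addr_ge0// ltW.
      by rewrite mulrC; apply: ler_wpM2r => //; exact: ltW.
    rewrite -mulr_sumr -mulr_sumr; apply: hd; first exact: sumr_ge0.
    rewrite -lee_fin -LE; apply: seq_le_esum => // t tS.
    by have [_ t01] := Sz t tS; rewrite /= in_itv.
  + rewrite s2 -/C; apply: le_trans (ltW epsC); by rewrite ler_pM2l// lerDl.
- have hs : forall t, t \in S -> 0 < 2 * h t by move=> t /h0 ?; exact: mulr_gt0.
  (* The window is doubled to the left so that it contains the point [t] itself, where the jump is
     already counted but the layer still has the value 0. *)
  pose J t x : R := if (t - h t < x) && (x <= t - h t + 2 * h t) then 1 else 0.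
  have iJ t : t \in S -> cint 0 1 (J t) /\ oint (J t) 0 1 <= 2 * h t by move=> tS; apply: window_size; exact: hs.
  pose K t x := `|z t| * (M + 1) * J t x.
  have iK t : t \in S -> cint 0 1 (K t) by move=> tS; apply: cintZ; have [] := iJ t tS.
  have [iSK eSK] := oint_sum iK.
  pose F x := eta / 4 + eta / 4 + \sum_(t <- S) K t x.
  have iF : cint 0 1 F by apply: cintD => //; exact: cint_cst.
  have Fle : oint F 0 1 <= eta.
    rewrite /F (@ointD _ 0 1)//; last exact: cint_cst.
    rewrite oint_cst// subr0 mulr1; apply: four => //.
    rewrite eSK; apply: (@le_trans _ _ (\sum_(t <- S) `|z t| * (M + 1) * (2 * h t))).
      apply: ler_sum_in => t tS; have [i1 i2] := iJ t tS; rewrite /K (@ointZ _ 0 1)//.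
      by exact: ler_wpM2l.
    have -> : \sum_(t <- S) `|z t| * (M + 1) * (2 * h t) = 2 * (eps * B).
      by rewrite /B !mulr_sumr; apply: eq_bigr => t _; rewrite /h s2; ring.
    have eB : eps * B <= eta / 4 by apply: le_trans (ltW epsB); rewrite ler_pM2l// lerDl.
    exact: twice eB.
  apply: (@le_trans _ _ (\int[mu]_(x in `]0%R, 1%R[) (F x)%:E)%E); last first.
    have : (oint F 0 1)%:E = (\int[mu]_(x in `]0%R, 1%R[) (F x)%:E)%E.
      by rewrite oint_oo// /Rintegral fineK//; apply: integrable_fin_num => //; apply/cint_oo.
    by move=> <-; rewrite lee_fin.
  apply: ae_ge0_le_integral => //.
  + by apply/measurable_EFinP; apply: measurableT_comp => //; exact: measurable_funB.
  + move=> x _; rewrite lee_fin /F !addr_ge0 ?(ltW eta4)// sumr_ge0// => t _.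
    by rewrite /K mulr_ge0// /J; case: ifP.
  + by apply/measurable_EFinP; exact: cint_moo.
  apply: aeS ua => x ux x01; rewrite lee_fin ux//; move: x01; rewrite /= in_itv/= => /andP[x0 x1].
  rewrite /v /combine /profile_of /F.
  set Q := fine _ - fine _.
  have b1 : `|oint (w 0%N) 0 x - oint g 0 x| <= eta / 4.
    rewrite -(@ointB _ 0 1)//; last exact: ltW.
    rewrite -(ler_pXn2r (isT : (0 < 2)%N)) ?nnegrE ?(ltW eta4)// real_normK ?num_real//.
    apply: le_trans hw2; have iB := sq_intB iw gi iw2 g2.
    have sub : cint 0 x (fun t => (w 0%N t - g t) ^+ 2) by apply: cintS iB _ _ => //; exact: ltW.
    apply: (@le_trans _ _ ((x - 0) * oint (fun t => (w 0%N t - g t) ^+ 2) 0 x)).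
      apply: oint_CS1 => //; first exact: ltW.
      by apply: measurable_funB; apply: cint_meas; [apply: (cintS iw)|apply: (cintS gi)] => //; exact: ltW.
    have p0 y y' : 0 <= oint (fun t => (w 0%N t - g t) ^+ 2) y y' by apply: oint_ge0 => t _ _; exact: sqr_ge0.
    rewrite subr0 (oint_cat iB (lexx 0) (ltW x0) (ltW x1) (lexx 1)).
    apply: (@le_trans _ _ (1 * oint (fun t => (w 0%N t - g t) ^+ 2) 0 x)); first by apply: ler_wpM2r => //; exact: ltW.
    by rewrite mul1r lerDl.
  have b2 : `|Q - \sum_(t <- S) z t * (t <= x)%R%:R| <= eta / 4 by apply: hS; exact: ltW.
  have b3 : `|\sum_(t <- S) z t * step n p t (h t) 0 x - \sum_(t <- S) z t * (t <= x)%R%:R| <= \sum_(t <- S) K t x.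
    rewrite -sumrB; apply: (le_trans (ler_norm_sum _ _ _)); apply: ler_sum_in => t tS.
    have ht := h0 t tS.
    rewrite -mulrBr normrM /K -[leRHS]mulrA; apply: ler_wpM2l => //; rewrite /J.
    have [xt|tx] := ltP x (t - h t + (h t)); last have [xh|hx] := ltP x (t + h t).
    - rewrite subrK in xt; rewrite (step_before tp _ (ltW xt)) [t <= x]leNgt xt/= subrr normr0.
      by rewrite mulr_ge0//; case: ifP.
    - rewrite subrK in tx; rewrite tx; have -> : (t - h t < x) && (x <= t - h t + 2 * h t).
        exact: window_mem.
      rewrite mulr1; apply: (le_trans (ler_normB _ _)); rewrite normr1 lerD2r; exact: hM.
    - rewrite subrK in tx; rewrite (step_after tp ht hx) tx subrr normr0.
      by rewrite mulr_ge0//; case: ifP.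
  rewrite -/(step n p) (_ : _ - _ = (oint (w 0%N) 0 x - oint g 0 x) - (Q - \sum_(t <- S) z t * (t <= x)%R%:R) +
     (\sum_(t <- S) z t * step n p t (h t) 0 x - \sum_(t <- S) z t * (t <= x)%R%:R)); last by rewrite /W; ring.
  apply: (le_trans (ler_normD _ _)); apply: lerD => //.
  by apply: (le_trans (ler_normB _ _)); exact: lerD.
Qed.

End Recovery.


(** * Gamma-convergence *)

Section Gamma.
Context {R : realType} (n : nat).
Implicit Types (e eta x y : R) (u : R -> R) (v : nat -> R -> R) (eps : nat -> R).
Let k := n.+2.

(* [v i] is chosen good for every tolerance [m <= i] that is attainable at [i]. *)
Lemma diagonal (T : Type) (X : T) (G : nat -> T -> nat -> Prop) :
  (forall i w m m', (m <= m')%N -> G i w m' -> G i w m) ->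
  (forall m, \forall i \near \oo, exists w, G i w m) ->
  exists v : nat -> T, forall m, \forall i \near \oo, G i (v i) m.
Proof.
move=> mono ex.
have /choice[v hv] : forall i, exists w : T, forall m, (m <= i)%N -> (exists w', G i w' m) -> G i w m.
  move=> i; suff H j : exists w : T, forall m, (m <= j)%N -> (exists w', G i w' m) -> G i w m by exact: H.
  elim: j => [|j [w hw]].
    have [[w hw]|h] := pselect (exists w', G i w' 0%N).
      by exists w => m; rewrite leqn0 => /eqP ->.
    by exists X => m; rewrite leqn0 => /eqP -> /h.
  have [[w' hw']|h] := pselect (exists w', G i w' j.+1).
    by exists w' => m mj _; exact: mono mj hw'.
  by exists w => m; rewrite leq_eqVlt => /predU1P[-> /h//|]; exact: hw.
exists v => m; have FF : Filter \oo by exact: _.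
have := @filterI _ \oo FF _ _ (nbhs_infty_ge m) (ex m); apply: filterS => i [mi h].
exact: hv.
Qed.

Let step_small e : 0 < e -> exists m : nat, m.+1%:R^-1 < e.
Proof. by move=> e0; exists (Num.truncn e^-1); rewrite invf_plt ?posrE// truncnS_gt. Qed.

Lemma L1_cvg_refl u : cvg_in_L1 (fun=> u) u.
Proof.
rewrite /cvg_in_L1 (_ : (fun=> _) = fun=> 0%E); first exact: cvg_cst.
by apply/funext => i; apply: integral0_eq => x _; rewrite subrr normr0.
Qed.

Theorem limsup_L1 eps u : (forall i, 0 < eps i) -> eps @ \oo --> (0 : R) -> SBV2 u -> (F_lim k u < +oo)%E ->
  exists v, [/\ forall i, L1 0 1 (v i), cvg_in_L1 v u &
    (limn_esup (fun i => F_eps k (eps i) (v i)) <= F_lim k u)%E].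
Proof.
move=> e0 ec su Fu.
pose G i (w : R -> R) (m : nat) := [/\ L1 0 1 w, (F_eps k (eps i) w <= F_lim k u + (m.+1%:R^-1)%:E)%E &
  (\int[mu]_(x in `]0%R, 1%R[) (`|w x - u x|)%:E <= (m.+1%:R^-1)%:E)%E].
have mono i w m m' : (m <= m')%N -> G i w m' -> G i w m.
  move=> mm [h1 h2 h3]; have le : (m'.+1%:R^-1 : R) <= m.+1%:R^-1.
    by rewrite lef_pV2 ?posrE// ler_nat ltnS.
  split => //; first by apply: (le_trans h2); rewrite leeD2l// lee_fin.
  by apply: (le_trans h3); rewrite lee_fin.
have ex m : \forall i \near \oo, exists w, G i w m.
  have p0 : 0 < m.+1%:R^-1 :> R by rewrite invr_gt0.
  have [d d0 hd] := recovery su Fu p0.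
  have FF : Filter \oo by exact: _.
  have := cvg_close (FF := FF) ec d0; apply: filterS => i [_]; rewrite add0r => hi.
  by have [w [h1 h2 h3]] := hd (eps i) (e0 i) hi; exists w.
have [v0 hv0] := diagonal (fun=> 0) mono ex.
(* Only finitely many [v0 i] can fail to be integrable; the value 0 replaces them. *)
pose v i := if `[< L1 0 1 (v0 i) >] then v0 i else fun=> 0.
have L1v i : L1 0 1 (v i).
  rewrite /v; case: asboolP => // _; by apply/cint_oo; exact: cint_cst.
have hv m : \forall i \near \oo, G i (v i) m.
  have := hv0 m; apply: filterS => i [h1 h2 h3]; rewrite /v; case: asboolP => //.
exists v; split => //.
- have I0 i : (0 <= \int[mu]_(x in `]0%R, 1%R[) (`|v i x - u x|)%:E)%E by apply: integral_ge0 => x _; rewrite lee_fin.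
  have fin : \forall i \near \oo, (\int[mu]_(x in `]0%R, 1%R[) (`|v i x - u x|)%:E)%E \is a fin_num.
    have := hv 0%N; apply: filterS => i [_ _ h].
    by rewrite ge0_fin_numE//; exact: le_lt_trans h (ltry _).
  apply/fine_cvgP; split; first exact: fin.
  apply/cvgrPdist_le => e e1; have [m hm] := step_small e1.
  have FF : Filter \oo by exact: _.
  have := @filterI _ \oo FF _ _ fin (hv m); apply: filterS => i [f [_ _ h]].
  rewrite sub0r normrN /= ger0_norm ?fine_ge0// -lee_fin fineK//.
  by apply: (le_trans h); rewrite lee_fin ltW.
- apply/lee_addgt0Pr => e e1; have [m hm] := step_small e1.
  have [N _ hN] := hv m.
  rewrite limn_esup_lim (cvg_lim _ (@cvg_esups_inf _ _))//.
  apply: (@le_trans _ _ (esups (fun i => F_eps k (eps i) (v i)) N)).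
    by apply: ereal_inf_lbound; exists N.
  apply: ub_ereal_sup => _ [i /= Ni <-]; have [_ h _] := hN i Ni.
  by apply: (le_trans h); rewrite leeD2l// lee_fin ltW.
Qed.

Lemma F_lim_pinfty u : ~ (SBV2 u /\ (F_lim k u < +oo)%E) -> F_lim k u = +oo%E.
Proof.
move=> h; have [su|nsu] := pselect (SBV2 u); last by rewrite /F_lim asboolF.
by apply/eqP; rewrite -leye_eq leNgt; apply/negP => lt; apply: h.
Qed.

Theorem gamma_L1 : gamma_converges [set u : R -> R | L1 0 1 u] (@cvg_in_L1 R) (F_eps k) (F_lim k).
Proof.
move=> eps e0 ec u Xu; split.
  move=> v Xv vu; apply: liminf_measure => //; first by move/cint_oo/cint_moo: Xu.
  exact: L1_measure.
have [[su Fu]|h] := pselect (SBV2 u /\ (F_lim k u < +oo)%E); first exact: limsup_L1.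
(* The limit functional is infinite at [u], so any admissible sequence converging to [u] will do. *)
exists (fun=> u); rewrite (F_lim_pinfty h); split => //; [exact: L1_cvg_refl|exact: leey].
Qed.

Theorem gamma_measure : gamma_converges [set u : R -> R | measurable_fun (`]0, 1[ : set R) u]
  (@cvg_in_measure R) (F_eps k) (F_lim k).
Proof.
move=> eps e0 ec u Xu; split; first by move=> v Xv vu; exact: liminf_measure.
have [[su Fu]|h] := pselect (SBV2 u /\ (F_lim k u < +oo)%E).
  have [v [v1 v2 v3]] := limsup_L1 e0 ec su Fu; exists v; split => //.
    by move=> i; have /cint_oo/cint_moo := v1 i.
  by apply: L1_measure => //; case: su.
exists (fun=> u); rewrite (F_lim_pinfty h); split => //; last exact: leey.
move=> d d0; rewrite (_ : (fun=> _) = fun=> 0%E); first exact: cvg_cst.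
apply/funext => i; rewrite (_ : _ `&` _ = set0) ?measure0//.
by apply/seteqP; split => // x [_ /=]; rewrite subrr normr0 ltNge ltW.
Qed.

End Gamma.


Unset Implicit Arguments.

Theorem theorem1 (R : realType) (k : nat) (k_ge2 : (2 <= k)%N) :
  [/\ (* the minimum in the definition of m_k is attained for every T *)
      forall T : R, 0 < T ->
        exists2 v, cell_admissible k T v & cell_energy k T v = cell_min k T,
      0 < m_ R k,
      gamma_converges [set u : R -> R | measurable_fun (`]0, 1[ : set R) u]
        (@cvg_in_measure R) (F_eps k) (F_lim k),
      gamma_converges [set u : R -> R | L1 0 1 u]
        (@cvg_in_L1 R) (F_eps k) (F_lim k) &
      equicoercive (@F_eps R k)].
Proof.
case: k k_ge2 => [//|[//|n]] _; split.
- by move=> T; exact: cell_attained.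
- exact: m_gt0.
- exact: gamma_measure.
- exact: gamma_L1.
- exact: F_eps_equicoercive.
Qed.
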